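(* Let $q$ be a prime power, $n\ge 2$, and let $\mathcal{L}$ be a non-empty set of lines of $\mathrm{PG}(n,q)$. Then $\mathcal{L}$ is the line set of a naturally embedded split Cayley hexagon $\mathbf{H}(q)$ in $\mathrm{PG}(6,q)$ if and only if $\mathcal{L}$ satisfies all of the following: (Pt) every point of $\mathrm{PG}(n,q)$ is incident with either $0$ or $q+1$ elements of $\mathcal{L}$; (Pl) every plane of $\mathrm{PG}(n,q)$ contains either $0$, $1$ or $q+1$ elements of $\mathcal{L}$; (Sd) every solid ($3$-dimensional subspace) of $\mathrm{PG}(n,q)$ contains either $0$, $1$, $q+1$ or $2q+1$ elements of $\mathcal{L}$; (Hp') every $5$-dimensional subspace of $\mathrm{PG}(n,q)$ contains at most $q^4-q^3+3q^2+2q$ elements of $\mathcal{L}$; (To) $|\mathcal{L}|\le q^5+q^4+q^3+q^2+q+1$.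
   Context: A line is said to be contained in (incident with) a subspace if it is a subset of it. The natural embedding of the split Cayley hexagon $\mathbf{H}(q)$ in $\mathrm{PG}(6,q)$ with homogeneous coordinates $(x_0,\dots,x_6)$: its points are the points of the parabolic quadric $\mathbf{Q}(6,q)$ given by $x_0x_4+x_1x_5+x_2x_6=x_3^2$, and its lines are those lines of $\mathbf{Q}(6,q)$ whose Grassmann coordinates $p_{ij}=x_iy_j-x_jy_i$ (for a line spanned by points $x,y$) satisfy $p_{12}=p_{34}$, $p_{54}=p_{32}$, $p_{20}=p_{35}$, $p_{65}=p_{30}$, $p_{01}=p_{36}$, $p_{46}=p_{31}$. ''$\mathcal{L}$ is the line set of a naturally embedded split Cayley hexagon in $\mathrm{PG}(6,q)$'' means that $\mathcal{L}$ spans a $6$-dimensional subspace of $\mathrm{PG}(n,q)$ and, up to a projectivity, $\mathcal{L}$ is exactly the line set of this natural embedding of $\mathbf{H}(q)$. *)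

(* Defs.v *)
(* PG(n,q) = projective geometry of the vector space 'rV[F]_(n.+1)
   over a finite field F with #|F| = q. A projective k-dimensional subspace is
   represented canonically by the square matrix <<A>>%MS of rank k+1. *)
From HB Require Import structures.
From mathcomp Require Import all_boot all_order all_algebra.
Set Implicit Arguments. Unset Strict Implicit. Unset Printing Implicit Defensive.
Import Order.TTheory GRing.Theory Num.Theory.
Local Open Scope ring_scope.

Definition proj_sub (F : fieldType) (m k : nat) (A : 'M[F]_m) : bool :=
  (\rank A == k.+1)%N && (<<A>>%MS == A).

Definition cd (F : fieldType) (v : 'rV[F]_7) (i : nat) : F := v 0 (inord i).

Definition Q6 (F : fieldType) (v : 'rV[F]_7) : F :=
  cd v 0%N * cd v 4%N + cd v 1%N * cd v 5%N + cd v 2%N * cd v 6%N - cd v 3%N ^+ 2.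

Definition pg (F : fieldType) (x y : 'rV[F]_7) (i j : nat) : F :=
  cd x i * cd y j - cd x j * cd y i.

Definition hex_grassmann (F : fieldType) (x y : 'rV[F]_7) : Prop :=
  pg x y 1%N 2%N = pg x y 3%N 4%N /\ pg x y 5%N 4%N = pg x y 3%N 2%N /\ pg x y 2%N 0%N = pg x y 3%N 5%N /\
  pg x y 6%N 5%N = pg x y 3%N 0%N /\ pg x y 0%N 1%N = pg x y 3%N 6%N /\ pg x y 4%N 6%N = pg x y 3%N 1%N.

Definition hex_line (F : fieldType) (l : 'M[F]_7) : Prop :=
  [/\ proj_sub 1 l,
      (forall v : 'rV[F]_7, (v <= l)%MS -> Q6 v = 0) &
      (exists x y : 'rV[F]_7, (col_mx x y == l)%MS /\ hex_grassmann x y)].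

(* L is the line set of a naturally embedded split Cayley hexagon in a PG(6,q)
   inside PG(n,q): L spans a 6-dimensional subspace and, up to a projectivity
   (injective linear map F^7 -> F^(n+1)), equals the line set of H(q). *)
Definition is_hexagon_lineset (F : finFieldType) (n : nat) (L : {set 'M[F]_n.+1}) : Prop :=
  \rank (\sum_(l in L) l)%MS = 7%N /\
  exists M : 'M[F]_(7, n.+1), row_free M /\
    (forall l : 'M[F]_n.+1, l \in L <->
       exists h : 'M[F]_7, hex_line h /\ l = <<h *m M>>%MS).

Definition nb_in (F : finFieldType) (m : nat) (L : {set 'M[F]_m}) (S : 'M[F]_m) : nat :=
  #|[set l in L | (l <= S)%MS]|.

(* Main.v *)
(** Points are nonzero vectors up to scalars. By (Pt), (Pl) and (Sd), the lines of
L through a covered point x fill a plane [pl x], a solid contains at most two such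
planes, and there are no triangles or quadrangles. Fix l in L. The cosets y + l of
points y far from l are analysed through the solids spanned by l, y and a line
through y; if y has two distinct points of l at distance two (a pentagon), then all
of y + l is covered and the planes at its points lie in one common 5-space H. By (To),
double counting the paths from l to far points then yields a coset with so many
directions that H contains more lines than (Hp') allows. Hence there are no
pentagons, and L is the line set of a generalized hexagon of order q.

The points at distance at most two from w span a hyperplane T w of the 6-space
spanned by L. An apartment a1, b2, a3, b1, a2, b3 together with a point e of the six
hyperplanes T a_i, T b_i is a basis in which (0, 0, b) lies in [pl (a, 0, 0)] iff
a.b = 0; writing pl (a, 0, b) = <(a, 0, 0), (0, 0, b), (c, 1, d)> one gets a x c = k1 b
and b x d = k2 a with constants k1, k2, and rescaling the basis turns these into
the Grassmann equations of H(q). Equality follows since |L| is at least the number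
of lines of H(q).

Conversely, two points of H(q) are collinear iff their product as traceless split
octonions vanishes. A chart of [pl x] gives (Pt) and (Pl); totally singular subspaces
have rank at most 3 and alternativity makes two opposite lines span a regulus of
lines, which gives (Sd); a point whose plane lies in a hyperplane is an eigenvector
of left multiplication by a fixed octonion, with at most two eigenvalues, which
bounds the lines in that hyperplane. *)
Require Import Defs.
From HB Require Import structures.
From mathcomp Require Import all_boot all_order all_algebra.
From mathcomp Require Import zify ring.
Set Implicit Arguments. Unset Strict Implicit. Unset Printing Implicit Defensive.
Import Order.TTheory GRing.Theory Num.Theory.

(** * Row spaces over a finite field *)

(** All counts are of nonzero vectors, so each point is counted q - 1 times. Each z on l is a
    direction of at least q^4 (q - 1) far vectors, while (To) leaves at most q^6 - q^4 far vectors: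
    on average a far point has at least one direction on l. A single pentagon does not contradict
    this, which is the obstacle. In a coset y + l a given direction serves at most q far vectors,
    and a coset with two directions consists of q^2 far vectors; with fewer than q directions its
    average is below one, and with a single direction it is at most one. So a pentagon forces some
    coset to have at least q directions. The q solids obtained from these, all through l + y, yield
    q^4 + q^2 + q + 1 points whose planes lie in H, hence at least as many lines in H, and (Hp')
    fails as soon as q > 2. For q = 2 the bound is 24, and one pentagon already gives 30 such
    points: the nonzero vectors of its span other than the sum of the five vertices.

    Once pentagons are excluded, the main tool is that the only points of a far coset y + l are
    those of y + <z>, where z is the direction of y. *)

Ltac smx :=
  first [ done | exact: submx_refl | exact: sub0mx
  | lazymatch goal with
    | |- is_true (@submx _ _ _ _ (@addsmx _ _ _ _ _ _) _) =>
        rewrite addsmx_sub; apply/andP; split; smx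
    end
  | lazymatch goal with
    | |- is_true (@submx _ _ _ _ ?X (@addsmx _ _ _ _ ?A ?B)) =>
        (* The summands on the right are tried from last to first with backtracking; what cannot be
           closed is left as a goal. *)
        first [ solve [apply: (@submx_trans _ _ _ _ _ X B _ _ (addsmxSr A B)); smx]
              | solve [apply: (@submx_trans _ _ _ _ _ X A _ _ (addsmxSl A B)); smx] ]
    end
  | lazymatch goal with
    | |- is_true (@submx _ _ _ _ (GRing.add _ _) _) => apply: addmx_sub; smx
    | |- is_true (@submx _ _ _ _ (GRing.scale _ _) _) => apply: scalemx_sub; smx
    | |- is_true (@submx _ _ _ _ (GRing.opp _) _) => rewrite eqmx_opp; smx
    end
  | idtac ].

Section RowSpaces.
Local Open Scope ring_scope.
Variables (F : fieldType) (N : nat).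
Implicit Types (u v w : 'rV[F]_N).

Lemma rank_vec v : v != 0 -> \rank v = 1%N.
Proof. by move=> v0; rewrite rank_rV v0. Qed.

Lemma sub_rank_sup m1 m2 (A : 'M[F]_(m1, N)) (B : 'M_(m2, N)) :
  (A <= B)%MS -> (\rank B <= \rank A)%N -> (B <= A)%MS.
Proof. by move=> sAB rBA; have [_ <-] := mxrank_leqif_sup sAB; rewrite eqn_leq mxrankS. Qed.

Lemma rank_addv m (A : 'M[F]_(m, N)) v :
  ~~ (v <= A)%MS -> \rank (A + v)%MS = (\rank A).+1.
Proof.
move=> vA; have v0 : v != 0 by apply: contraNneq vA => ->; rewrite sub0mx.
have := mxrank_sum_cap A v; rewrite [in RHS](rank_vec v0).
suff -> : \rank (A :&: v)%MS = 0%N by rewrite addn0 addn1.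
apply/eqP; rewrite -leqn0 leqNgt; apply: contra vA => r.
apply: submx_trans (capmxSl A v); apply: sub_rank_sup (capmxSr A v) _.
by rewrite rank_vec.
Qed.

Lemma rank_addv_le m (A : 'M[F]_(m, N)) v : (\rank (A + v)%MS <= (\rank A).+1)%N.
Proof.
apply: leq_trans (mxrank_adds_leqif A v).1 _.
by rewrite -[X in (_ <= X)%N]addn1 leq_add2l rank_leq_row.
Qed.

Lemma rank_span2 u v : u != 0 -> ~~ (v <= u)%MS -> \rank (u + v)%MS = 2%N.
Proof. by move=> u0 vu; rewrite rank_addv // rank_vec. Qed.

Lemma sub_vecP v u : reflect (exists c, v = c *: u) (v <= u)%MS.
Proof. exact: sub_rVP. Qed.

Lemma sub_addsP m1 m2 (A : 'M[F]_(m1, N)) (B : 'M_(m2, N)) v :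
  (v <= A + B)%MS -> exists a b, [/\ (a <= A)%MS, (b <= B)%MS & v = a + b].
Proof.
case/sub_addsmxP => -[a b] /= ->.
by exists (a *m A), (b *m B); rewrite !submxMl.
Qed.

Lemma sub_addvP m (A : 'M[F]_(m, N)) u v :
  (v <= A + u)%MS -> exists a c, (a <= A)%MS /\ v = a + c *: u.
Proof. by case/sub_addsP => a [b [aA /sub_vecP[c ->] ->]]; exists a, c. Qed.

Lemma sub_span2P u w v :
  (v <= u + w)%MS -> exists c d, v = c *: u + d *: w.
Proof. by case/sub_addvP => a [d [/sub_vecP[c ->] ->]]; exists c, d. Qed.

Lemma sub_span3P u w t v :
  (v <= u + w + t)%MS -> exists c d e, v = c *: u + d *: w + e *: t.
Proof. by case/sub_addvP => a [e [/sub_span2P[c [d ->]] ->]]; exists c, d, e. Qed.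

Lemma ex_cap m1 m2 m3 (A : 'M[F]_(m1, N)) (B : 'M_(m2, N)) (C : 'M_(m3, N)) :
  (A <= C)%MS -> (B <= C)%MS -> (\rank C < \rank A + \rank B)%N ->
  exists v : 'rV_N, [/\ v != 0, (v <= A)%MS & (v <= B)%MS].
Proof.
move=> AC BC r.
have : (0 < \rank (A :&: B)%MS)%N.
  have := mxrank_sum_cap A B.
  have : (\rank (A + B)%MS <= \rank C)%N by apply: mxrankS; smx.
  lia.
rewrite lt0n mxrank_eq0 => /rowV0Pn[v vAB v0].
by exists v; split=> //; rewrite (submx_trans vAB) ?capmxSl ?capmxSr.
Qed.

Lemma rank_cap_ge m1 m2 m3 (A : 'M[F]_(m1, N)) (B : 'M_(m2, N)) (C : 'M_(m3, N)) :
  (A <= C)%MS -> (B <= C)%MS -> (\rank A + \rank B <= \rank C + \rank (A :&: B)%MS)%N.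
Proof.
move=> AC BC; have := mxrank_sum_cap A B.
have : (\rank (A + B)%MS <= \rank C)%N by apply: mxrankS; smx.
lia.
Qed.

Lemma ex_outside m1 m2 (A : 'M[F]_(m1, N)) (B : 'M_(m2, N)) :
  (\rank A < \rank B)%N -> exists v : 'rV_N, (v <= B)%MS /\ ~~ (v <= A)%MS.
Proof.
move=> r; have : ~~ (B <= A)%MS by apply: contraL r => /mxrankS; rewrite -leqNgt.
by case/row_subPn => i ni; exists (row i B); rewrite row_sub.
Qed.

Lemma addv_sub_eq u v m (A : 'M[F]_(m, N)) : (u <= A)%MS -> ((u + v)%R <= A)%MS = (v <= A)%MS.
Proof.
move=> uA; apply/idP/idP => h; last exact: addmx_sub.
rewrite (_ : v = (u + v) - u); last by rewrite addrAC subrr add0r.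
by smx.
Qed.

Lemma scale_sub_eq c v m (A : 'M[F]_(m, N)) : c != 0 -> (c *: v <= A)%MS = (v <= A)%MS.
Proof. by move=> c0; rewrite (eqmx_scale _ c0). Qed.

Lemma opp_sub_eq v m (A : 'M[F]_(m, N)) : (- v <= A)%MS = (v <= A)%MS.
Proof. by rewrite eqmx_opp. Qed.

Lemma notsub_nz v m (A : 'M[F]_(m, N)) : ~~ (v <= A)%MS -> v != 0.
Proof. by apply: contraNneq => ->; rewrite sub0mx. Qed.

Lemma sub_vec_sym u v : u != 0 -> (u <= v)%MS -> (v <= u)%MS.
Proof.
by move=> u0 uv; apply: sub_rank_sup uv _; rewrite (rank_vec u0) rank_leq_row.
Qed.

End RowSpaces.

Section CardSpaces.
Local Open Scope ring_scope.
Variables (F : finFieldType) (N : nat).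
Implicit Types (u v w : 'rV[F]_N).
Local Notation q := #|F|.

Definition vset m (A : 'M[F]_(m, N)) := [set v : 'rV[F]_N | (v <= A)%MS].

Lemma card_vset m (A : 'M[F]_(m, N)) : #|vset A| = (q ^ \rank A)%N.
Proof.
have -> : vset A = [set u *m row_base A | u : 'rV[F]_(\rank A)].
  apply/setP => v; rewrite inE -(eq_row_base A).
  by apply/submxP/imsetP => [[u ->]|[u _ ->]]; exists u.
rewrite card_imset ?card_mx ?mul1n //.
exact: row_free_inj (row_base_free A).
Qed.

Lemma card_vsetD m1 m2 (A : 'M[F]_(m1, N)) (B : 'M[F]_(m2, N)) : (A <= B)%MS ->
  #|vset B :\: vset A| = (q ^ \rank B - q ^ \rank A)%N.
Proof.
move=> AB; rewrite cardsD (setIidPr _) ?card_vset //.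
by apply/subsetP => v; rewrite !inE => /submx_trans->.
Qed.

Lemma q_gt1 : (1 < q)%N.
Proof. by rewrite (cardD1 0) (cardD1 1) !inE oner_neq0. Qed.

End CardSpaces.

(** * The plane of lines through a point *)

(** The count to be played against (Sd): three families of q + 1 lines that pairwise share at most
    one line have at least 3q members, more than 2q + 1 since q > 1. *)
Lemma card_union3 (T : finType) (A B C D : {set T}) :
  A \subset D -> B \subset D -> C \subset D ->
  #|A :&: B| <= 1 -> #|A :&: C| <= 1 -> #|B :&: C| <= 1 ->
  #|A| + #|B| + #|C| <= #|D| + 3.
Proof.
move=> AD BD CD AB AC BC.
have /subset_leq_card : (A :|: B :|: C) \subset D by rewrite !subUset AD BD CD.
have := cardsUI (A :|: B) C; have := cardsUI A B; rewrite setIUl.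
have := cardsUI (A :&: C) (B :&: C); lia.
Qed.

Section FlatGeometry.
Local Open Scope ring_scope.
Variables (F : finFieldType) (N : nat) (L : {set 'M[F]_N}).
Local Notation q := #|F|.

Definition lthru (x : 'rV[F]_N) := [set l in L | (x <= l)%MS].
Definition hpoint (x : 'rV[F]_N) := (x != 0) && (lthru x != set0).
Definition tplane (x : 'rV[F]_N) : 'M[F]_N := (\sum_(l in lthru x) l)%MS.

(** The conditions (Pt), (Pl) and (Sd) for arbitrary matrices of the right rank instead of canonical
    ones, with points given by vectors. *)
Record flat : Prop := Flat {
  fl_rank : forall l, l \in L -> \rank l = 2%N;
  fl_can : forall l, l \in L -> <<l>>%MS = l;
  fl_pt : forall x, hpoint x -> #|lthru x| = q.+1;
  fl_pl : forall S : 'M[F]_N, \rank S = 3%N -> nb_in L S \in [:: 0%N; 1%N; q.+1];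
  fl_sd : forall S : 'M[F]_N, \rank S = 4%N ->
            nb_in L S \in [:: 0%N; 1%N; q.+1; (2 * q).+1] }.

Hypothesis G : flat.
Implicit Types (x y z a b c u v w : 'rV[F]_N) (l m : 'M[F]_N).
Local Notation PP := hpoint.
Local Notation pl := tplane.

Lemma line_inj l1 l2 : l1 \in L -> l2 \in L -> (l1 <= l2)%MS -> l1 = l2.
Proof.
move=> L1 L2 s12; rewrite -(fl_can G L1) -(fl_can G L2); apply/genmxP.
by rewrite s12 sub_rank_sup // (fl_rank G L1) (fl_rank G L2).
Qed.

Lemma rank_lines l1 l2 x : l1 \in L -> l2 \in L -> l1 != l2 -> x != 0 ->
  (x <= l1)%MS -> (x <= l2)%MS -> \rank (l1 + l2)%MS = 3%N.
Proof.
move=> L1 L2 n12 x0 x1 x2; have := mxrank_sum_cap l1 l2.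
rewrite (fl_rank G L1) (fl_rank G L2).
have : (1 <= \rank (l1 :&: l2)%MS)%N.
  by rewrite -(rank_vec x0) mxrankS // sub_capmx x1 x2.
have : (\rank (l1 :&: l2)%MS < 2)%N.
  rewrite ltnNge; apply: contra n12 => r; apply/eqP/line_inj => //.
  apply: submx_trans (capmxSr l1 l2); apply: sub_rank_sup (capmxSl _ _) _.
  by rewrite (fl_rank G L1).
lia.
Qed.

(** If two planes through l1 shared more than l1 they would coincide, and l3 would lie in the
    first. *)
Lemma cap_lines l1 l2 l3 x : l1 \in L -> l2 \in L -> l3 \in L -> x != 0 ->
  (x <= l1)%MS -> (x <= l2)%MS -> (x <= l3)%MS -> l2 != l3 -> l1 != l2 -> l1 != l3 ->
  ~~ (l3 <= l1 + l2)%MS -> ((l1 + l2) :&: (l1 + l3) <= l1)%MS.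
Proof.
move=> L1 L2 L3 x0 x1 x2 x3 n23 n12 n13 n3.
have r12 := rank_lines L1 L2 n12 x0 x1 x2.
have r13 := rank_lines L1 L3 n13 x0 x1 x3.
apply: sub_rank_sup; first by rewrite sub_capmx !addsmxSl.
rewrite (fl_rank G L1) leqNgt; apply: contra n3 => r.
apply: submx_trans (addsmxSr l1 l3) _.
apply: submx_trans (capmxSl _ _); apply: sub_rank_sup (capmxSr _ _) _.
by rewrite r13.
Qed.

Lemma nb_in_plane (S : 'M[F]_N) l1 l2 : \rank S = 3%N -> l1 \in L -> l2 \in L ->
  l1 != l2 -> (l1 <= S)%MS -> (l2 <= S)%MS -> nb_in L S = q.+1.
Proof.
move=> rS L1 L2 n12 s1 s2; have := fl_pl G rS.
have : (2 <= nb_in L S)%N.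
  have <- : #|[set l1; l2]| = 2%N by rewrite cards2 n12.
  by apply: subset_leq_card; apply/subsetP => l; rewrite !inE => /orP[]/eqP->; rewrite ?L1 ?L2.
by rewrite !inE => h /or3P[]/eqP e; rewrite e in h *.
Qed.

Lemma nb_in_solid (S : 'M[F]_N) : \rank S = 4%N -> (nb_in L S <= (2 * q).+1)%N.
Proof.
move=> rS; have := fl_sd G rS; have := q_gt1 F.
by rewrite !inE => ? /or4P[]/eqP->; lia.
Qed.

(** Three lines through x that are not coplanar span a solid. Each of the three planes they span
    contains q + 1 lines by (Pl), and two of these planes share one line, so the solid would have at
    least 3q lines. *)
Lemma coplanar l1 l2 x l : x != 0 -> l1 \in lthru x -> l2 \in lthru x ->
  l1 != l2 -> l \in lthru x -> (l <= l1 + l2)%MS.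
Proof.
move=> x0; rewrite !inE => /andP[L1 x1] /andP[L2 x2] n12 /andP[L3 x3].
apply: contraT => n3.
have n13 : l1 != l by apply: contraNneq n3 => <-; exact: addsmxSl.
have n23 : l2 != l by apply: contraNneq n3 => <-; exact: addsmxSr.
have r12 := rank_lines L1 L2 n12 x0 x1 x2.
have r13 := rank_lines L1 L3 n13 x0 x1 x3.
have r23 := rank_lines L2 L3 n23 x0 x2 x3.
have rS : \rank (l1 + l2 + l)%MS = 4%N.
  have := mxrank_sum_cap (l1 + l2)%MS l; rewrite r12 (fl_rank G L3).
  have : (1 <= \rank ((l1 + l2) :&: l)%MS)%N.
    by rewrite -(rank_vec x0) mxrankS // sub_capmx x3 (submx_trans x1) ?addsmxSl.
  have : (\rank ((l1 + l2) :&: l)%MS < 2)%N.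
    rewrite ltnNge; apply: contra n3 => r; apply: submx_trans (capmxSl _ l).
    by apply: sub_rank_sup (capmxSr _ _) _; rewrite (fl_rank G L3).
  by move: (\rank _) (\rank _) => i k; clear; lia.
have one (A B : 'M[F]_N) m : m \in L -> (A :&: B <= m)%MS ->
   (#|[set l in L | (l <= A)%MS] :&: [set l in L | (l <= B)%MS]| <= 1)%N.
  move=> Lm ABm; rewrite -(cards1 m); apply: subset_leq_card; apply/subsetP => k.
  rewrite !inE => /andP[/andP[Lk kA] /andP[_ kB]]; apply/eqP/line_inj => //.
  by apply: submx_trans ABm; rewrite sub_capmx kA.
have sub (A : 'M[F]_N) : (A <= l1 + l2 + l)%MS ->
  [set l in L | (l <= A)%MS] \subset [set k in L | (k <= l1 + l2 + l)%MS].
  by move=> AS; apply/subsetP => k; rewrite !inE => /andP[-> /submx_trans->].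
have := card_union3 (sub (l1 + l2)%MS _) (sub (l1 + l)%MS _) (sub (l2 + l)%MS _)
  (one _ _ l1 L1 _) (one _ _ l2 L2 _) (one _ _ l L3 _).
have := nb_in_solid rS.
have := nb_in_plane r12 L1 L2 n12; have := nb_in_plane r13 L1 L3 n13.
have := nb_in_plane r23 L2 L3 n23; rewrite /nb_in !addsmxSl !addsmxSr.
move=> /(_ isT isT)-> /(_ isT isT)-> /(_ isT isT)-> le h.
have n31 : l != l1 by rewrite eq_sym.
have n32 : l != l2 by rewrite eq_sym.
have n21 : l2 != l1 by rewrite eq_sym.
have n1 : ~~ (l1 <= l + l2)%MS.
  apply: contra n3 => s1; apply: submx_trans (addsmxSl l l2) _.
  apply: sub_rank_sup; first by smx.
  by rewrite r12 addsmxC r23.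
have : (q.+1 + q.+1 + q.+1 <= #|[set k in L | (k <= l1 + l2 + l)%MS]| + 3)%N.
  apply: h; [by smx | by smx | by smx | | |].
  - exact: cap_lines L1 L2 L3 x0 x1 x2 x3 n23 n12 n13 n3.
  - rewrite addsmxC; apply: cap_lines L2 L1 L3 x0 x2 x1 x3 n13 n21 n23 _.
    by rewrite addsmxC.
  - rewrite [(l1 + l)%MS]addsmxC [(l2 + l)%MS]addsmxC.
    apply: cap_lines L3 L1 L2 x0 x3 x1 x2 n12 n31 n32 _.
    apply: contra n3 => s1; apply: submx_trans (addsmxSl l l1) _.
    by apply: sub_rank_sup; [smx | rewrite r12 addsmxC r13].
have := q_gt1 F; move: le; rewrite /nb_in; clear; lia.
Qed.

Lemma lthru2 x : PP x -> exists l1 l2, [/\ l1 \in lthru x, l2 \in lthru x & l1 != l2].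
Proof.
move=> Px; have : (1 < #|lthru x|)%N by rewrite (fl_pt G Px) ltnS; have := q_gt1 F; lia.
by case/card_gt1P => l1 [l2 [h1 h2 n]]; exists l1, l2.
Qed.

Lemma pl_span x l1 l2 : PP x -> l1 \in lthru x -> l2 \in lthru x -> l1 != l2 ->
  (pl x :=: l1 + l2)%MS.
Proof.
move=> /andP[x0 _] h1 h2 n; apply/eqmxP/andP; split.
  by apply/sumsmx_subP => l hl; apply: coplanar h1 h2 n hl.
by rewrite addsmx_sub /tplane (sumsmx_sup l1) // (sumsmx_sup l2).
Qed.

Lemma rank_pl x : PP x -> \rank (pl x) = 3%N.
Proof.
move=> Px; have [l1 [l2 [h1 h2 n]]] := lthru2 Px.
rewrite (pl_span Px h1 h2 n); case/andP: (Px) => x0 _.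
move: h1 h2; rewrite !inE => /andP[L1 x1] /andP[L2 x2].
exact: rank_lines L1 L2 n x0 x1 x2.
Qed.

Lemma lthru_pl x l : PP x -> l \in lthru x -> (l <= pl x)%MS.
Proof. by move=> Px h; rewrite /tplane (sumsmx_sup l). Qed.

(** By (Pl) the plane contains exactly q + 1 lines, and the lines through x are already that
    many. *)
Lemma line_pl x l : PP x -> l \in L -> (l <= pl x)%MS -> l \in lthru x.
Proof.
move=> Px Ll lx; have [l1 [l2 [h1 h2 n]]] := lthru2 Px.
have : lthru x \subset [set l in L | (l <= pl x)%MS].
  by apply/subsetP => k hk; rewrite inE lthru_pl // andbT; move: hk; rewrite inE => /andP[].
have := nb_in_plane (rank_pl Px) (l1 := l1) (l2 := l2).
have [L1 L2] : l1 \in L /\ l2 \in L.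
  by move: h1 h2; rewrite !inE => /andP[? _] /andP[? _].
move=> /(_ L1 L2 n (lthru_pl Px h1) (lthru_pl Px h2)); rewrite /nb_in => c s.
have /eqP e : lthru x == [set l in L | (l <= pl x)%MS].
  by rewrite eqEcard s c (fl_pt G Px) leqnn.
by rewrite e inE Ll.
Qed.

Lemma mem_pl x : PP x -> (x <= pl x)%MS.
Proof.
move=> Px; have [l1 [l2 [h1 _ _]]] := lthru2 Px; apply: submx_trans (lthru_pl Px h1).
by move: h1; rewrite inE => /andP[].
Qed.

Lemma PP_nz x : PP x -> x != 0. Proof. by case/andP. Qed.

Lemma line_PP l x : l \in L -> (x <= l)%MS -> x != 0 -> PP x.
Proof.
move=> Ll xl x0; rewrite /hpoint x0; apply/set0Pn; exists l.
by rewrite inE Ll.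
Qed.

(* The q + 1 lines of L through x cover q^3 - q vectors of [pl x] off x, that is, all of them. *)
Lemma pl_line x y : PP x -> (y <= pl x)%MS -> ~~ (y <= x)%MS -> <<(x + y)%MS>>%MS \in L.
Proof.
move=> Px yx nyx; have x0 := PP_nz Px.
suff [l lx yl] : exists2 l, l \in lthru x & (y <= l)%MS.
  move: lx; rewrite inE => /andP[Ll xl].
  suff -> : <<(x + y)%MS>>%MS = l by [].
  rewrite -[RHS](fl_can G Ll); apply/genmxP.
  have s : (x + y <= l)%MS by smx.
  by rewrite s sub_rank_sup // (fl_rank G Ll) rank_span2.
apply/exists_inP; apply: contraT; rewrite negb_exists_in => /forall_inP no.
pose A := vset (pl x) :\: vset x.
have cA : #|A| = (q ^ 3 - q)%N by rewrite card_vsetD ?mem_pl // rank_pl // rank_vec // expn1.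
have cl l : l \in lthru x -> #|A :&: vset l| = (q ^ 2 - q)%N.
  move=> lx; move: (lx); rewrite inE => /andP[Ll xl].
  have -> : A :&: vset l = vset l :\: vset x.
    apply/setP => v; rewrite !inE; have [vl|nvl] := boolP (v <= l)%MS; last by rewrite !andbF.
    by rewrite (submx_trans vl (lthru_pl Px lx)) !andbT.
  by rewrite card_vsetD // (fl_rank G Ll) rank_vec.
have : (\sum_(l in lthru x) #|A :&: vset l| <= #|A :\ y|)%N.
  under eq_bigr => l _ do rewrite -sum1_card big_mkcond /=.
  rewrite exchange_big -sum1_card [X in (_ <= X)%N]big_mkcond /=.
  apply: leq_sum => v _; rewrite !inE.
  case vA: (v \in A); last by rewrite big1 // => l _; rewrite inE vA.
  move: (vA); rewrite !inE => /andP[nvx vpx]; rewrite nvx vpx andbT.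
  have -> : (\sum_(l in lthru x) (if v \in A :&: vset l then 1 else 0))%N
          = #|[set l in lthru x | (v <= l)%MS]|.
    rewrite -sum1_card big_mkcond [RHS]big_mkcond; apply: eq_bigr => l _.
    by rewrite !inE nvx vpx /=; case: (l \in L); case: (x <= l)%MS; case: (v <= l)%MS.
  case: eqP => [->|_] /=.
    rewrite leqn0 cards_eq0; apply/eqP/setP => l; rewrite in_set0.
    by rewrite inE; apply/negP => /andP[/no/negP].
  apply/card_le1_eqP => l1 l2; rewrite !inE => /andP[/andP[L1 x1] v1] /andP[/andP[L2 x2] v2].
  have s k : k \in L -> (x <= k)%MS -> (v <= k)%MS -> k = <<(x + v)%MS>>%MS.
    move=> Lk xk vk; rewrite -[LHS](fl_can G Lk); apply/genmxP.
    have s : (x + v <= k)%MS by smx.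
    by rewrite s sub_rank_sup // (fl_rank G Lk) rank_span2.
  by rewrite (s _ L1) // (s _ L2).
under eq_bigr => l lx do rewrite cl //.
have yA : y \in A by rewrite !inE nyx.
rewrite sum_nat_const (fl_pt G Px); move: cA; rewrite (cardsD1 y A) yA.
have := q_gt1 F; move: #|F| #|A :\ y| => k m; clear => h.
have -> : (k.+1 * (k ^ 2 - k) = k ^ 3 - k)%N by rewrite mulnBr !expnS expn0; nia.
lia.
Qed.

Lemma pl_PP x y : PP x -> (y <= pl x)%MS -> y != 0 -> PP y.
Proof.
move=> Px yx y0; have x0 := PP_nz Px.
have [/sub_vecP[c e]|nyx] := boolP (y <= x)%MS.
  case: (lthru2 Px) => l [_ [+ _ _]]; rewrite inE => /andP[Ll xl].
  by apply: line_PP Ll _ y0; rewrite e; smx.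
by apply: line_PP (pl_line Px yx nyx) _ y0; rewrite genmxE addsmxSr.
Qed.

Lemma pl_sym x y : PP x -> (y <= pl x)%MS -> y != 0 -> (x <= pl y)%MS.
Proof.
move=> Px yx y0; have Py := pl_PP Px yx y0; have x0 := PP_nz Px.
have [/(sub_vec_sym y0) xy|nyx] := boolP (y <= x)%MS.
  by apply: submx_trans xy (mem_pl Py).
have h : <<(x + y)%MS>>%MS \in lthru y by rewrite inE (pl_line Px) //= genmxE addsmxSr.
by apply: submx_trans (lthru_pl Py h); rewrite genmxE addsmxSl.
Qed.

(** There are no triangles: the line of y and z would lie in [pl x], so by [line_pl] it passes
    through x. *)
Lemma pl_notri x y z : PP x -> (y <= pl x)%MS -> (z <= pl x)%MS -> y != 0 ->
  (z <= pl y)%MS -> (\rank (x + y + z)%MS <= 2)%N.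
Proof.
move=> Px yx zx y0 zy; have x0 := PP_nz Px; have Py := pl_PP Px yx y0.
have [zly|nzy] := boolP (z <= y)%MS.
  have s : (x + y + z <= x + y)%MS by smx.
  apply: leq_trans (mxrankS s) _; apply: leq_trans (rank_addv_le _ _) _.
  by rewrite rank_vec.
have h := line_pl Px (pl_line Py zy nzy).
have : (<<(y + z)%MS>> <= pl x)%MS by rewrite genmxE; smx.
move=> /h; rewrite inE genmxE => /andP[_ xyz].
have s : (x + y + z <= y + z)%MS by smx.
apply: leq_trans (mxrankS s) _; by rewrite rank_span2.
Qed.

Lemma pl_eqmx x y : (x :=: y)%MS -> pl x = pl y.
Proof.
move=> e; rewrite /tplane; apply: eq_bigl => l; rewrite !inE.
by rewrite e.
Qed.

Lemma pl_scale (c : F) x : c != 0 -> pl (c *: x) = pl x.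
Proof. by move=> c0; apply: pl_eqmx; apply: eqmx_scale. Qed.

Lemma PP_scale (c : F) x : c != 0 -> PP (c *: x) = PP x.
Proof.
move=> c0; rewrite /hpoint scaler_eq0 (negbTE c0) /=; congr (_ && (_ != _)).
by apply/setP => l; rewrite !inE scale_sub_eq.
Qed.

(** The pencils at two different points share at most the joining line, so three such planes would
    put at least 3q lines into the solid. *)
Lemma solid3 (S : 'M[F]_N) a b c : \rank S = 4%N -> PP a -> PP b -> PP c ->
  (pl a <= S)%MS -> (pl b <= S)%MS -> (pl c <= S)%MS ->
  [|| (a <= b)%MS, (a <= c)%MS | (b <= c)%MS].
Proof.
move=> rS Pa Pb Pc aS bS cS; apply: contraT; rewrite !negb_or => /and3P[nab nac nbc].
have sub x : PP x -> (pl x <= S)%MS -> lthru x \subset [set l in L | (l <= S)%MS].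
  move=> Px xS; apply/subsetP => l hl; rewrite inE (submx_trans (lthru_pl Px hl)) // andbT.
  by move: hl; rewrite inE => /andP[].
have one x y : PP x -> PP y -> ~~ (x <= y)%MS -> (#|lthru x :&: lthru y| <= 1)%N.
  move=> Px Py nxy; apply/card_le1_eqP => l1 l2.
  rewrite !inE => /andP[/andP[L1 x1] /andP[_ y1]] /andP[/andP[L2 x2] /andP[_ y2]].
  have s k : k \in L -> (x <= k)%MS -> (y <= k)%MS -> k = <<(y + x)%MS>>%MS.
    move=> Lk xk yk; rewrite -[LHS](fl_can G Lk); apply/genmxP.
    have s : (y + x <= k)%MS by smx.
    by rewrite s sub_rank_sup // (fl_rank G Lk) rank_span2 // PP_nz.
  by rewrite (s _ L1) // (s _ L2).
have := card_union3 (sub a Pa aS) (sub b Pb bS) (sub c Pc cS)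
  (one _ _ Pa Pb nab) (one _ _ Pa Pc nac) (one _ _ Pb Pc nbc).
rewrite !(fl_pt G) //; have := nb_in_solid rS; rewrite /nb_in; have := q_gt1 F; clear; lia.
Qed.

End FlatGeometry.

(** * Points far from a line *)

Section Far.
Local Open Scope ring_scope.
Variables (F : finFieldType) (N : nat) (L : {set 'M[F]_N}).
Hypothesis G : flat L.
Local Notation q := #|F|.
Local Notation PP := (hpoint L).
Local Notation pl := (tplane L).
Implicit Types (x y z a b c d u v w t s : 'rV[F]_N) (l m n S : 'M[F]_N).

Lemma vs_eq k1 k2 (A : 'M[F]_(k1, N)) (B : 'M[F]_(k2, N)) :
  (A <= B)%MS -> \rank A = \rank B -> (B <= A)%MS.
Proof. by move=> AB e; rewrite sub_rank_sup ?e. Qed.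

Lemma sub_lin (c : F) x r d k (A : 'M[F]_(k, N)) : c != 0 -> d = c *: x + r ->
  (d <= A)%MS -> (r <= A)%MS -> (x <= A)%MS.
Proof.
move=> c0 e dA rA; rewrite -(scale_sub_eq x _ c0) (_ : c *: x = d - r); first by smx.
by rewrite e addrK.
Qed.

Lemma PP0 x : PP x -> x != 0. Proof. exact: PP_nz. Qed.

Lemma pl3 x y z : PP x -> (y <= pl x)%MS -> (z <= pl x)%MS ->
  ~~ (y <= x)%MS -> ~~ (z <= x + y)%MS -> (pl x <= x + y + z)%MS.
Proof.
move=> Px yx zx ny nz; have := mem_pl G Px => xx.
apply: vs_eq; first by smx.
by rewrite (rank_pl G Px) rank_addv // rank_addv // rank_vec ?PP0.
Qed.

Lemma full2 x y z k (S : 'M[F]_(k, N)) : PP x -> (y <= pl x)%MS -> (z <= pl x)%MS ->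
  ~~ (y <= x)%MS -> ~~ (z <= x + y)%MS -> (x <= S)%MS -> (y <= S)%MS -> (z <= S)%MS ->
  (pl x <= S)%MS.
Proof. by move=> Px yx zx ny nz xS yS zS; apply: submx_trans (pl3 Px yx zx ny nz) _; smx. Qed.

(** There are no quadrangles: if b and d were different, the solid spanned by a, b, d and c would
    contain the three planes [pl a], [pl b] and [pl c], against [solid3]. *)
Lemma mid_uniq a c b d : PP a -> PP c -> ~~ (c <= pl a)%MS ->
  b != 0 -> d != 0 -> (b <= pl a)%MS -> (b <= pl c)%MS -> (d <= pl a)%MS ->
  (d <= pl c)%MS -> (b <= d)%MS.
Proof.
move=> Pa Pc nca b0 d0 ba bc da dc; apply: contraT => nbd.
have nac : ~~ (a <= pl c)%MS by apply: contra nca => h; apply: pl_sym h _; rewrite ?PP0.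
have Pb := pl_PP G Pa ba b0.
have ab := pl_sym G Pa ba b0; have cb := pl_sym G Pc bc b0.
have indep x : (PP x) -> ~~ (x <= b + d)%MS -> ~~ (b <= x)%MS.
  by move=> Px; apply: contra => h; have := sub_vec_sym b0 h => xb; smx.
have na : ~~ (a <= b + d)%MS.
  by apply: contra nac => h; apply: submx_trans h _; smx.
have nc : ~~ (c <= b + d)%MS.
  by apply: contra nca => h; apply: submx_trans h _; smx.
have ind3 x : ~~ (x <= b + d)%MS -> ~~ (d <= x + b)%MS.
  move=> nx; apply: contra nx => /sub_span2P[e [f E]].
  have e0 : e != 0.
    apply: contraNneq nbd => e0; move: E; rewrite e0 scale0r add0r => E.
    by apply: sub_vec_sym d0 _; rewrite E; smx.
  by apply: (sub_lin e0 E); smx.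
have rabd : \rank (a + b + d)%MS = 3%N.
  by rewrite (rank_addv (ind3 _ na)) (rank_addv (indep _ Pa na)) rank_vec ?PP0.
have s1 : (pl a <= a + b + d)%MS by apply: pl3 => //; [apply: indep | apply: ind3].
have ncS : ~~ (c <= a + b + d)%MS.
  by apply: contra nca => h; apply: submx_trans h _; have := mem_pl G Pa => aa; smx.
have rS : \rank (a + b + d + c)%MS = 4%N by rewrite rank_addv // rabd.
have nba : ~~ (a <= b)%MS by apply: contra na => h; smx.
have nbc : ~~ (c <= b)%MS by apply: contra nc => h; smx.
have s2 : (pl b <= a + b + d + c)%MS.
  apply: (full2 Pb ab cb) => //; try by smx.
  by apply: contra ncS => h; apply: submx_trans h _; smx.
have s3 : (pl c <= a + b + d + c)%MS.
  by apply: (full2 Pc bc dc); rewrite ?indep ?ind3 //; smx.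
have s1' : (pl a <= a + b + d + c)%MS by smx.
case/or3P: (solid3 G rS Pa Pb Pc s1' s2 s3).
- by rewrite (negbTE nba).
- by move=> /(submx_trans)/(_ (mem_pl G Pc)); rewrite (negbTE nac).
- by move=> h; have := sub_vec_sym b0 h; rewrite (negbTE nbc).
Qed.

(* In the hexagon, [far l y] says that y is at incidence distance at least 5 from l, and [dist2 z y] that y is at incidence distance at most 4 from z. *)
Definition far l y := PP y && ((pl y :&: l)%MS == 0).
Definition dist2 z y := [exists w, [&& w != 0, (w <= pl z)%MS & (y <= pl w)%MS]].

Lemma far_PP l y : far l y -> PP y. Proof. by case/andP. Qed.

Lemma far_no l y z : far l y -> z != 0 -> (z <= l)%MS -> ~~ (z <= pl y)%MS.
Proof.
case/andP => _ /eqP c0 z0 zl; apply: contra z0 => zy.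
by rewrite -submx0 -c0 sub_capmx zy.
Qed.

Lemma farI l y : PP y -> (forall z, z != 0 -> (z <= l)%MS -> ~~ (z <= pl y)%MS) -> far l y.
Proof.
move=> Py h; rewrite /far Py; apply/rowV0P => z; rewrite sub_capmx => /andP[zy zl].
by apply/eqP; apply: contraT => z0; move: (h z z0 zl); rewrite zy.
Qed.

Section Line.
Variables (l : 'M[F]_N) (Ll : l \in L).
Let rl : \rank l = 2%N := fl_rank G Ll.

Lemma l_pl z : z != 0 -> (z <= l)%MS -> (l <= pl z)%MS.
Proof.
move=> z0 zl; apply: lthru_pl; first exact: line_PP Ll zl z0.
by rewrite inE Ll.
Qed.

Lemma l_PP z : z != 0 -> (z <= l)%MS -> PP z.
Proof. by move=> z0 zl; apply: line_PP Ll zl z0. Qed.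

Lemma far_no2 y z : far l y -> z != 0 -> (z <= l)%MS -> ~~ (y <= pl z)%MS.
Proof.
move=> fy z0 zl; apply: contra (far_no fy z0 zl) => h.
exact: (pl_sym G (l_PP z0 zl) h (PP0 (far_PP fy))).
Qed.

Lemma far_notin y : far l y -> ~~ (y <= l)%MS.
Proof.
move=> fy; apply/negP => yl; have Py := far_PP fy.
by have := far_no fy (PP0 Py) yl; rewrite mem_pl.
Qed.

Lemma far_rankE y : far l y -> \rank (l + y)%MS = 3%N.
Proof. by move=> fy; rewrite rank_addv ?far_notin // rl. Qed.

Lemma far_rankU y : far l y -> \rank (l + pl y)%MS = 5%N.
Proof.
move=> fy; have := mxrank_sum_cap l (pl y).
have -> : \rank (l :&: pl y)%MS = 0%N.
  by rewrite capmxC; case/andP: fy => _ /eqP->; rewrite mxrank0.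
by rewrite rl (rank_pl G (far_PP fy)) addn0.
Qed.

Lemma far_shift y v : far l y -> (v <= l)%MS -> PP (y + v) -> far l (y + v).
Proof.
move=> fy vl P'; apply: farI => // z z0 zl; apply: contra (far_no2 fy z0 zl) => h.
have h2 := pl_sym G P' h z0; rewrite -(addrK v y).
by have lz := l_pl z0 zl; have vz := submx_trans vl lz; smx.
Qed.

Lemma far_capE y : far l y -> (\rank (pl y :&: (l + y))%MS <= 1)%N.
Proof.
move=> fy; have := mxrank_sum_cap (pl y) (l + y)%MS.
rewrite (rank_pl G (far_PP fy)) (far_rankE fy).
have : (\rank (l + pl y)%MS <= \rank (pl y + (l + y))%MS)%N by apply: mxrankS; smx.
rewrite far_rankU //; lia.
Qed.

Lemma far_solid y S : far l y -> \rank S = 4%N -> (l <= S)%MS ->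
  (\rank (pl y :&: S)%MS <= 2)%N.
Proof.
move=> fy rS lS; rewrite leqNgt; apply/negP => r.
have pS : (pl y <= S)%MS.
  apply: submx_trans (capmxSr (pl y) S); apply: sub_rank_sup (capmxSl _ _) _.
  by rewrite (rank_pl G (far_PP fy)).
case: (ex_cap lS pS); first by rewrite rS rl (rank_pl G (far_PP fy)).
by move=> v [v0 vl vy]; move: (far_no fy v0 vl); rewrite vy.
Qed.

Definition coset y := [set y' | ((y' - y)%R <= l)%MS].

Lemma card_coset y : #|coset y| = (q ^ 2)%N.
Proof.
rewrite -rl -card_vset -(card_imset _ (addrI y)); congr #|pred_of_set _|.
apply/setP => t; rewrite inE; apply/idP/imsetP => [h|[v + ->]].
  by exists (t - y); rewrite ?inE // addrC subrK.
by rewrite inE addrC addKr.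
Qed.

Definition Yset y m :=
  [set y' in coset y | PP y' && (1 < \rank (pl y' :&: (l + m))%MS)%N].

(** The solid S spanned by l, y and w contains [pl z] and [pl w]. A line at y + v inside S meets
    [pl z] in a point w' whose plane also lies in S, so w' = w by [solid3]. Then v lies in [pl w],
    and v outside <z> would force l to pass through w. *)
Lemma typeA y z w v : far l y -> z != 0 -> (z <= l)%MS -> w != 0 ->
  (w <= pl z)%MS -> (y <= pl w)%MS -> (v <= l)%MS -> PP (y + v) ->
  (1 < \rank (pl (y + v) :&: (l + y + w))%MS)%N -> (v <= z)%MS.
Proof.
move=> fy z0 zl w0 wz yw vl P' r.
have Pz := l_PP z0 zl; have Pw := pl_PP G Pz wz w0; have Py := far_PP fy.
have wy := pl_sym G Pw yw (PP0 Py); have zw := pl_sym G Pz wz w0.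
have f' := far_shift fy vl P'.
have nwl : ~~ (w <= l)%MS.
  by apply/negP => wl; move: (far_no fy w0 wl); rewrite wy.
have nyw : ~~ (w <= y)%MS.
  apply: contra (far_no2 fy z0 zl) => h; apply: submx_trans wz.
  exact: sub_vec_sym.
have nwE : ~~ (w <= l + y)%MS.
  apply/negP => /sub_addvP[a [c [al e]]].
  have [a0|a0] := eqVneq a 0.
    by move: nyw; rewrite e a0 add0r; case/negP; smx.
  move: (far_no fy a0 al); case/negP; have yy := mem_pl G Py.
  by apply: (@sub_lin 1 a (c *: y) w); rewrite ?scale1r ?oner_neq0 //; smx.
have rS : \rank (l + y + w)%MS = 4%N by rewrite rank_addv // far_rankE.
have pzS : (pl z <= l + y + w)%MS.
  apply: (@submx_trans _ _ _ _ _ _ (l + w)%MS); last by smx.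
  apply: vs_eq; first by have := l_pl z0 zl => lz; smx.
  by rewrite rank_addv // rl (rank_pl G Pz).
have nzw : ~~ (w <= z)%MS by apply: contra nwl => h; apply: submx_trans h zl.
have nzw' : ~~ (z <= w)%MS by apply: contra nzw; apply: sub_vec_sym.
have zS : (z <= l + y + w)%MS by apply: submx_trans zl _; smx.
have nywz : ~~ (y <= w + z)%MS.
  apply: contra (far_no2 fy z0 zl) => h; apply: submx_trans h _.
  by have zz := mem_pl G Pz; smx.
have pwS : (pl w <= l + y + w)%MS by apply: (full2 Pw zw yw) => //; smx.
have [w' [w'0 w'n w'z]] : exists w', [/\ w' != 0, (w' <= pl (y + v)%R :&: (l + y + w))%MS & (w' <= pl z)%MS].
  by apply: ex_cap (capmxSr _ _) pzS _; rewrite rS (rank_pl G Pz) addn3 !ltnS.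
move: w'n; rewrite sub_capmx => /andP[w'y' w'S].
have Pw' := pl_PP G Pz w'z w'0.
have zw' := pl_sym G Pz w'z w'0; have y'w' := pl_sym G P' w'y' w'0.
have n1 : ~~ (z <= w')%MS.
  apply/negP => h; have h2 := submx_trans h w'y'.
  by move: (far_no f' z0 zl); rewrite h2.
have n2 : ~~ ((y + v)%R <= w' + z)%MS.
  apply/negP => h; have zz := mem_pl G Pz.
  have : ((y + v)%R <= pl z)%MS by apply: submx_trans h _; smx.
  by rewrite (negbTE (far_no2 f' z0 zl)).
have y'S' : ((y + v)%R <= l + y + w)%MS by smx.
have pw'S : (pl w' <= l + y + w)%MS by apply: (full2 Pw' zw' y'w').
have := solid3 G rS Pz Pw Pw' pzS pwS pw'S.
rewrite (negbTE nzw') (negbTE n1) /= => ww'.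
have w'w := sub_vec_sym w0 ww'.
have e : pl w = pl w' by apply: pl_eqmx; apply/eqmxP; rewrite ww'.
have vw : (v <= pl w)%MS.
  by rewrite -(addv_sub_eq v yw) e.
apply: contraT => nvz; case/negP: nwl.
suff : l \in lthru L w by rewrite inE => /andP[].
apply: (line_pl G Pw Ll); apply: (@submx_trans _ _ _ _ _ _ (z + v)%MS); last by smx.
by apply: vs_eq; [smx | rewrite rank_span2].
Qed.

(** Either the solid S = l + m contains the plane of a point z of l, and then the q vectors y + c z
    work; or no other line of L in S meets l, and each of them meets the plane l + y in a vector of
    the coset. *)
Lemma Yset_ge y m : far l y -> m \in lthru L y -> (q <= #|Yset y m|)%N.
Proof.
move=> fy; rewrite inE => /andP[Lm ym]; have Py := far_PP fy.
have mpl : (m <= pl y)%MS by apply: lthru_pl => //; rewrite inE Lm.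
have lm0 v : v != 0 -> (v <= l)%MS -> ~~ (v <= m)%MS.
  by move=> v0 vl; apply: contra (far_no fy v0 vl) => /submx_trans->.
have rS : \rank (l + m)%MS = 4%N.
  have := mxrank_sum_cap l m; rewrite rl (fl_rank G Lm).
  suff -> : \rank (l :&: m)%MS = 0%N by rewrite addn0.
  apply/eqP; rewrite mxrank_eq0; apply/rowV0P => v; rewrite sub_capmx => /andP[vl vm].
  by apply/eqP; apply: contraT => v0; move: (lm0 v v0 vl); rewrite vm.
have ySm : (y <= l + m)%MS by apply: submx_trans ym _; smx.
(* In the first case m meets [pl z] in a point w, and the whole line y + <z> consists of neighbours
   of w. *)
have [/existsP[z /and3P[z0 zl pzS]]|noA] :=
   boolP [exists z, [&& z != 0, (z <= l)%MS & (pl z <= l + m)%MS]].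
  have Pz := l_PP z0 zl.
  have [w [w0 wm wz]] : exists w, [/\ w != 0, (w <= m)%MS & (w <= pl z)%MS].
    apply: ex_cap (addsmxSr l m) pzS _.
    by rewrite rS (rank_pl G Pz) (fl_rank G Lm).
  have Pw := pl_PP G Pz wz w0.
  have yw : (y <= pl w)%MS.
    by apply: submx_trans ym _; apply: lthru_pl => //; rewrite inE Lm.
  have zw := pl_sym G Pz wz w0.
  have inj : injective (fun c : F => y + c *: z).
    by move=> c d /addrI/eqP; rewrite -subr_eq0 -scalerBl scaler_eq0 (negbTE z0) orbF subr_eq0 => /eqP.
  rewrite -(card_imset _ inj); apply: subset_leq_card; apply/subsetP => t /imsetP[c _ ->].
  have tw : ((y + c *: z)%R <= pl w)%MS by smx.
  have zz := mem_pl G Pz.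
  have nyz := far_no2 fy z0 zl.
  have tz : ~~ ((y + c *: z)%R <= pl z)%MS.
    by rewrite addrC addv_sub_eq //; smx.
  have t0 := notsub_nz tz.
  have Pt := pl_PP G Pw tw t0.
  rewrite !inE; apply/and3P; split=> //.
    by rewrite addrC addKr; smx.
  have nwt : ~~ (w <= (y + c *: z)%R)%MS.
    by apply: contra tz => h; apply: submx_trans wz; apply: sub_vec_sym h.
  rewrite -(rank_span2 t0 nwt) mxrankS // sub_capmx.
  have wt := pl_sym G Pw tw t0; have tt := mem_pl G Pt.
  have zS : (z <= l + m)%MS by apply: submx_trans zl _; smx.
  have wS : (w <= l + m)%MS by apply: submx_trans wm _; smx.
  by apply/andP; split; smx.
have noA' z : z != 0 -> (z <= l)%MS -> ~~ (pl z <= l + m)%MS.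
  move=> z0 zl; move: noA; rewrite negb_exists => /forallP/(_ z).
  by rewrite z0 zl.
pose X := [set n in L | (n <= l + m)%MS] :\ l.
have lX : l \in [set n in L | (n <= l + m)%MS] by rewrite inE Ll addsmxSl.
have nlm : l != m.
  by apply: contraTneq ym => <-; exact: far_notin.
(* As l and m are two lines in the solid, (Sd) leaves only q + 1 or 2q + 1. *)
have cX : (q <= #|X|)%N.
  have X0 : (0 < #|X|)%N.
    by apply/card_gt0P; exists m; rewrite !inE Lm addsmxSr eq_sym nlm.
  move: (fl_sd G rS) X0; rewrite /nb_in (cardsD1 l) lX -/X add1n.
  move: #|X| #|F| => k j; rewrite !inE; clear; case/or4P => /eqP; lia.
apply: leq_trans cX _.
have nX n : n \in X -> exists2 y', y' \in coset y & (y' <= n)%MS.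
  rewrite !inE => /and3P[nl Ln nS].
  have nl0 v : v != 0 -> (v <= l)%MS -> ~~ (v <= n)%MS.
    move=> v0 vl; apply: contra (noA' v v0 vl) => vn.
    have -> // := pl_span G (l_PP v0 vl) (l1 := l) (l2 := n).
    - by smx.
    - by rewrite inE Ll.
    - by rewrite inE Ln.
    - by rewrite eq_sym.
  have [t [t0 tn tE]] : exists t, [/\ t != 0, (t <= n)%MS & (t <= l + y)%MS].
    apply: (ex_cap nS (B := (l + y)%MS)); first by smx.
    by rewrite rS (fl_rank G Ln) far_rankE.
  case/sub_addvP: tE => a [c [al e]].
  have c0 : c != 0.
    apply: contraL tn => /eqP c0; apply: nl0 => //; by rewrite e c0 scale0r addr0.
  exists (c^-1 *: t); last by smx.
  by rewrite inE e scalerDr scalerA mulVf // scale1r addrK; smx.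
(* The default 0 is never taken on X, by [nX]. Two lines with the same value would put the plane of
   a far point into a solid through l, so f is injective. *)
pose f n := odflt 0 [pick y' | (y' \in coset y) && (y' <= n)%MS].
have fP n : n \in X -> (f n \in coset y) && (f n <= n)%MS.
  move=> /nX[y' h1 h2]; rewrite /f; case: pickP => [t //|/(_ y')].
  by rewrite h1 h2.
have fY n : n \in X -> PP (f n) /\ far l (f n).
  move=> hn; case/andP: (fP n hn) => fc fn; move: (hn); rewrite !inE => /and3P[_ Ln _].
  have e : f n = y + (f n - y) by rewrite addrC subrK.
  have f0 : f n != 0.
    apply: contraNneq (far_notin fy) => f0; move: fc; rewrite inE f0 sub0r opp_sub_eq //.
  have Pf := line_PP Ln fn f0; split=> //.
  by rewrite e; apply: far_shift; rewrite -?e //; move: fc; rewrite inE.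
have finj : {in X &, injective f}.
  move=> n1 n2 h1 h2 e; have [P1 f1] := fY _ h1.
  case/andP: (fP _ h1) => _ fn1; case/andP: (fP _ h2) => _; rewrite -e => fn2.
  move: (h1) (h2); rewrite !inE => /and3P[_ L1 S1] /and3P[_ L2 S2].
  apply: contraTeq (far_solid f1 rS (addsmxSl _ _)) => n12; rewrite -ltnNge.
  have : (pl (f n1) <= pl (f n1) :&: (l + m))%MS.
    have h1' : n1 \in lthru L (f n1) by rewrite inE L1.
    have h2' : n2 \in lthru L (f n1) by rewrite inE L2.
    by rewrite sub_capmx submx_refl (pl_span G P1 h1' h2' n12) /=; smx.
  by move=> /mxrankS; rewrite (rank_pl G P1).
rewrite -(card_in_imset finj); apply: subset_leq_card; apply/subsetP => t /imsetP[n hn ->].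
have [Pf ff] := fY _ hn; case/andP: (fP _ hn) => fc fn.
rewrite inE fc Pf /=; move: (hn); rewrite !inE => /and3P[_ Ln nS].
rewrite -(fl_rank G Ln) mxrankS // sub_capmx nS andbT.
by apply: lthru_pl => //; rewrite inE Ln.
Qed.

End Line.
End Far.

(** * Lone points of a coset *)

Section Lone.
Local Open Scope ring_scope.
Variables (F : finFieldType) (N : nat) (L : {set 'M[F]_N}).
Hypothesis G : flat L.
Local Notation q := #|F|.
Local Notation PP := (hpoint L).
Local Notation pl := (tplane L).
Implicit Types (x y z a b u v w t s : 'rV[F]_N) (l m n S E U : 'M[F]_N).

(** The planes at two collinear points share only the joining line, since a further common point
    would close a triangle. *)
Lemma rank_pl2 z u : PP z -> (u <= pl z)%MS -> ~~ (u <= z)%MS ->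
  \rank (pl z + pl u)%MS = 4%N.
Proof.
move=> Pz uz nuz; have u0 := notsub_nz nuz; have Pu := pl_PP G Pz uz u0.
have zu := pl_sym G Pz uz u0.
have := mxrank_sum_cap (pl z) (pl u); rewrite (rank_pl G Pz) (rank_pl G Pu).
have r2 := rank_span2 (PP0 Pz) nuz.
have : (2 <= \rank (pl z :&: pl u)%MS)%N.
  by have zz := mem_pl G Pz; have uu := mem_pl G Pu; rewrite -r2 mxrankS // sub_capmx; apply/andP; split; smx.
suff : (\rank (pl z :&: pl u)%MS < 3)%N by clear; lia.
rewrite ltnNge; apply/negP => r.
have [s [sz ns]] : exists s, (s <= pl z)%MS /\ ~~ (s <= z + u)%MS.
  by apply: ex_outside; rewrite r2 (rank_pl G Pz).
have su : (s <= pl u)%MS.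
  apply: submx_trans (capmxSr (pl z) (pl u)); apply: submx_trans sz _.
  by apply: sub_rank_sup (capmxSl _ _) _; rewrite (rank_pl G Pz).
by have := pl_notri G Pz uz sz u0 su; rewrite rank_addv // r2.
Qed.

(** Labels the subspaces one dimension above E inside E + d1 + d2, other than those through d1 and
    d2, by a nonzero scalar. There are q - 1 labels, which is what the collision arguments need. *)
Lemma solid_param E U S (d1 d2 : 'rV[F]_N) : (U <= E + d1 + d2)%MS -> (S <= U)%MS -> (E <= S)%MS ->
  (\rank E < \rank S)%N -> ~~ (d1 <= S)%MS -> ~~ (d2 <= S)%MS ->
  exists2 t : F, t != 0 & ((d1 + t *: d2)%R <= S)%MS.
Proof.
move=> UE SU ES rS n1 n2; have [s [sS nsE]] := ex_outside rS.
have := submx_trans (submx_trans sS SU) UE.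
case/sub_addvP => a [be [/sub_addvP[e [al [eE ->]]] es]].
have eS := submx_trans eE ES.
have al0 : al != 0.
  apply: contraNneq n2 => al0; move: es; rewrite al0 scale0r addr0 => es.
  have be0 : be != 0.
    by apply: contraNneq nsE => be0; rewrite es be0 scale0r addr0.
  by apply: (@sub_lin _ _ be d2 e s); rewrite // es addrC.
have be0 : be != 0.
  apply: contraNneq n1 => be0; move: es; rewrite be0 scale0r addr0 => es.
  by apply: (@sub_lin _ _ al d1 e s); rewrite // es addrC.
exists (be / al); first by rewrite mulf_neq0 // invr_eq0.
rewrite -(scale_sub_eq _ _ al0) scalerDr scalerA mulrCA divff // mulr1.
rewrite (_ : _ + _ = s - e); first by smx.
by rewrite es -[e + _ + _]addrA [e + _]addrC addrK.
Qed.

(** The q + 2 points f c, u1 and u2 of [pl z] give solids [pl z + pl u] inside U. By [solid3] these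
    are pairwise different, but only q + 1 solids lie between [pl z] and U. Taking d1 and d2 from
    the solids of u1 and u2 leaves q - 1 labels for the q points f c. *)
Lemma dlemma U z (f : F -> 'rV[F]_N) u1 u2 : \rank U = 5%N -> PP z -> (pl z <= U)%MS ->
  (forall c, [/\ (f c <= pl z)%MS, ~~ (f c <= z)%MS & (pl (f c) <= U)%MS]) ->
  (u1 <= pl z)%MS -> ~~ (u1 <= z)%MS -> (pl u1 <= U)%MS ->
  (u2 <= pl z)%MS -> ~~ (u2 <= z)%MS -> (pl u2 <= U)%MS ->
  (forall c d, c != d -> ~~ (f c <= f d)%MS) ->
  (forall c, ~~ (f c <= u1)%MS) -> (forall c, ~~ (f c <= u2)%MS) -> ~~ (u1 <= u2)%MS ->
  False.
Proof.
move=> rU Pz zU hf u1z n1 u1U u2z n2 u2U ff f1 f2 n12.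
have P u : (u <= pl z)%MS -> ~~ (u <= z)%MS -> PP u.
  by move=> uz /notsub_nz u0; apply: pl_PP uz u0.
have three u w S : (u <= pl z)%MS -> ~~ (u <= z)%MS -> (w <= pl z)%MS -> ~~ (w <= z)%MS ->
    ~~ (u <= w)%MS -> \rank S = 4%N -> (pl z <= S)%MS -> (pl u <= S)%MS -> (pl w <= S)%MS -> False.
  move=> uz nu wz nw nuw rS zS uS wS.
  have := solid3 G rS (P u uz nu) (P w wz nw) Pz uS wS zS.
  by rewrite (negbTE nuw) (negbTE nu) (negbTE nw).
have pick1 u : (u <= pl z)%MS -> ~~ (u <= z)%MS ->
   exists d : 'rV[F]_N, [/\ (d <= pl u)%MS, ~~ (d <= pl z)%MS & (pl z + pl u <= pl z + d)%MS].
  move=> uz nu; have r4 := rank_pl2 Pz uz nu.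
  have [d [du nd]] : exists d : 'rV[F]_N, (d <= pl u)%MS /\ ~~ (d <= pl z)%MS.
    have : ~~ (pl u <= pl z)%MS.
      apply/negP => s; have : (pl z + pl u <= pl z)%MS by smx.
      by move/mxrankS; rewrite r4 (rank_pl G Pz).
    by case/row_subPn => i ni; exists (row i (pl u)); rewrite row_sub.
  exists d; split=> //; apply: vs_eq; first by smx.
  by rewrite rank_addv // r4 (rank_pl G Pz).
have [d1 [d1u nd1 s1]] := pick1 _ u1z n1; have [d2 [d2u nd2 s2]] := pick1 _ u2z n2.
have nd21 : ~~ (d2 <= pl z + pl u1)%MS.
  apply/negP => h; apply: (three u1 u2 (pl z + pl u1)%MS) => //; try by smx.
    exact: rank_pl2.
  apply: (@submx_trans _ _ _ _ _ _ (pl z + pl u2)%MS); first by smx.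
  by apply: submx_trans s2 _; smx.
have nd21' : ~~ (d2 <= pl z + d1)%MS by apply: contra nd21 => h; apply: submx_trans h _; smx.
have UE : (U <= pl z + d1 + d2)%MS.
  apply: vs_eq.
    have a1 := submx_trans d1u u1U; have a2 := submx_trans d2u u2U; by smx.
  by rewrite rank_addv // rank_addv // (rank_pl G Pz) rU.
have ex c : exists2 t : F, t != 0 & ((d1 + t *: d2)%R <= pl z + pl (f c))%MS.
  have [fz nf fU] := hf c.
  apply: (solid_param UE) => //; try by smx.
  - by rewrite (rank_pl2 Pz fz nf) (rank_pl G Pz).
  - apply/negP => h; apply: (three (f c) u1 (pl z + pl (f c))%MS) => //; try by smx.
      exact: rank_pl2.
    apply: (@submx_trans _ _ _ _ _ _ (pl z + pl u1)%MS); first by smx.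
    by apply: submx_trans s1 _; smx.
  - apply/negP => h; apply: (three (f c) u2 (pl z + pl (f c))%MS) => //; try by smx.
      exact: rank_pl2.
    apply: (@submx_trans _ _ _ _ _ _ (pl z + pl u2)%MS); first by smx.
    by apply: submx_trans s2 _; smx.
pose tau c := odflt 0 [pick t : F | (t != 0) && ((d1 + t *: d2)%R <= pl z + pl (f c))%MS].
have tauP c : (tau c != 0) && ((d1 + tau c *: d2)%R <= pl z + pl (f c))%MS.
  rewrite /tau; case: pickP => // no; have [t t0 ht] := ex c.
  by move: (no t); rewrite t0 ht.
have inj : injective tau.
  move=> c d e; apply/eqP; apply: contraT => ncd.
  case/andP: (tauP c) => _ hc; case/andP: (tauP d) => t0; rewrite -e => hd.
  set g := (d1 + tau c *: d2) in hc hd.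
  have [fz nf fU] := hf c; have [gz ng gU] := hf d.
  have ngz : ~~ (g <= pl z)%MS.
    apply/negP => h; case/negP: nd21'.
    apply: (@sub_lin _ _ (tau c) d2 d1 g); last by smx.
    - by rewrite e.
    - by rewrite /g addrC.
    - by smx.
  have eqS u : (u <= pl z)%MS -> ~~ (u <= z)%MS -> (g <= pl z + pl u)%MS -> (pl z + pl u <= pl z + g)%MS.
    move=> uz nu gu; apply: vs_eq; first by smx.
    by rewrite rank_addv // (rank_pl2 Pz uz nu) (rank_pl G Pz).
  case: (three (f c) (f d) (pl z + g)%MS) => //; first exact: ff.
  - by rewrite rank_addv // (rank_pl G Pz).
  - by smx.
  - by apply: submx_trans (eqS _ fz nf hc); smx.
  - by apply: submx_trans (eqS _ gz ng hd); smx.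
have : (#|[set tau c | c : F]| <= #|[set~ (0%R : F)]|)%N.
  apply: subset_leq_card; apply/subsetP => t /imsetP[c _ ->].
  by rewrite !inE; case/andP: (tauP c).
by rewrite (card_imset _ inj) cardsC1 -ltnS prednK ?ltnn // ltnW // q_gt1.
Qed.

Section Line.
Variables (l : 'M[F]_N) (Ll : l \in L).
Let rl : \rank l = 2%N := fl_rank G Ll.

(** No other point of the coset has its plane in the rank-five space spanned by l and the plane at
    y. It says that this space belongs to y alone. *)
Definition lone y := [forall v, [==> (v <= l)%MS, v != 0, PP (y + v) =>
   ~~ (pl (y + v)%R <= l + pl y)%MS]].

(** Two planes in a space of rank five meet, here in a common neighbour t of y and y + v; then t is
    a neighbour of the difference v as well, so v is a direction of y. *)
Lemma fullpair y v : far L l y -> (v <= l)%MS -> v != 0 -> PP (y + v) ->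
  (pl (y + v)%R <= l + pl y)%MS -> dist2 L v y.
Proof.
move=> fy vl v0 P' s; have Py := far_PP fy; have f' := far_shift G Ll fy vl P'.
have [t [t0 t1 t2]] : exists t, [/\ t != 0, (t <= pl (y + v)%R)%MS & (t <= pl y)%MS].
  apply: ex_cap s _ _; first by smx.
  by rewrite (far_rankU G Ll fy) !(rank_pl G).
have Pt := pl_PP G Py t2 t0.
have yt := pl_sym G Py t2 t0; have y't := pl_sym G P' t1 t0.
have vt : (v <= pl t)%MS by rewrite -(addv_sub_eq v yt).
by apply/existsP; exists t; rewrite t0 yt (pl_sym G Pt vt v0).
Qed.

Lemma loneI y : (forall v, (v <= l)%MS -> v != 0 -> PP (y + v) ->
  (pl (y + v)%R <= l + pl y)%MS -> False) -> lone y.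
Proof.
move=> h; apply/forallP => v; apply/implyP => h1; apply/implyP => h2; apply/implyP => h3.
by apply/negP; apply: h.
Qed.

Lemma loneP y v : lone y -> (v <= l)%MS -> v != 0 -> PP (y + v) ->
  ~~ (pl (y + v)%R <= l + pl y)%MS.
Proof. by move=> /forallP/(_ v) h h1 h2 h3; move: h; rewrite h1 h2 h3. Qed.

Lemma not_lone y : ~~ lone y -> exists v,
  [/\ (v <= l)%MS, v != 0, PP (y + v) & (pl (y + v)%R <= l + pl y)%MS].
Proof.
rewrite negb_forall => /existsP[v]; rewrite negb_imply => /andP[h1].
rewrite negb_imply => /andP[h2]; rewrite negb_imply => /andP[h3 /negPn h4].
by exists v.
Qed.

Lemma lone_none y : far L l y ->
  (forall z, z != 0 -> (z <= l)%MS -> ~~ dist2 L z y) -> lone y.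
Proof.
move=> fy no; apply: loneI => v vl v0 P' s.
by move: (no v v0 vl); rewrite (fullpair fy).
Qed.

(* Each of the directions z1, z2 forces v to be a multiple of it. *)
Lemma lone_two y z1 z2 : far L l y -> z1 != 0 -> z2 != 0 -> (z1 <= l)%MS -> (z2 <= l)%MS ->
  ~~ (z1 <= z2)%MS -> dist2 L z1 y -> dist2 L z2 y -> lone y.
Proof.
move=> fy z10 z20 z1l z2l n12 /existsP[w1 /and3P[w10 w1z yw1]] /existsP[w2 /and3P[w20 w2z yw2]].
apply: loneI => v vl v0 P' s; have Py := far_PP fy.
suff key z w : z != 0 -> (z <= l)%MS -> w != 0 -> (w <= pl z)%MS -> (y <= pl w)%MS -> (v <= z)%MS.
  have v1 := key _ _ z10 z1l w10 w1z yw1; have v2 := key _ _ z20 z2l w20 w2z yw2.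
  by case/negP: n12; apply: submx_trans v2; apply: sub_vec_sym.
move=> z0 zl w0 wz yw; apply: (typeA G Ll fy z0 zl w0 wz yw vl P').
have Pw := pl_PP G (l_PP Ll z0 zl) wz w0; have wy := pl_sym G Pw yw (PP0 Py).
have yy := mem_pl G Py.
have SU : (l + y + w <= l + pl y)%MS by smx.
have := rank_cap_ge s SU; rewrite (rank_pl G P') (far_rankU G Ll fy).
suff -> : \rank (l + y + w)%MS = 4%N by clear; lia.
rewrite rank_addv ?(far_rankE G Ll fy) //; apply/negP => /sub_addvP[a [c [al e]]].
have [a0|a0] := eqVneq a 0.
  case/negP: (far_no2 G Ll fy z0 zl); apply: submx_trans wz; apply: sub_vec_sym => //.
  by rewrite e a0 add0r; smx.
case/negP: (far_no fy a0 al).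
by apply: (@sub_lin _ _ 1 a (c *: y) w); rewrite ?scale1r ?oner_neq0 //; smx.
Qed.

Lemma YsetE y m y' : (y' \in Yset L l y m) =
  [&& y' \in coset l y, PP y' & (1 < \rank (pl y' :&: (l + m))%MS)%N].
Proof. by rewrite inE. Qed.

(** The sum of the sizes of the sets [Yset y m] over the q + 1 lines m through y is at least q (q +
    1) by [Yset_ge]. It is also at most (q + 1) + (q^2 - 1): y is counted once for each m, and any
    other member of the coset at most once. Equality therefore holds everywhere. *)
Lemma lone_count y : far L l y -> lone y ->
  [/\ forall v, (v <= l)%MS -> PP (y + v),
      forall v, (v <= l)%MS -> v != 0 -> \rank (pl (y + v)%R :&: (l + pl y))%MS = 2%N &
      forall m, m \in lthru L y -> #|Yset L l y m| = q].
Proof.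
move=> fy lo; have Py := far_PP fy; have q1 := q_gt1 F.
pose cnt y' := (\sum_(m in lthru L y) (y' \in Yset L l y m))%N.
have tot : (\sum_(m in lthru L y) #|Yset L l y m| = \sum_(y' in coset l y) cnt y')%N.
  rewrite /cnt exchange_big; apply: eq_bigr => m _ /=.
  rewrite -sum1_card big_mkcond [RHS]big_mkcond; apply: eq_bigr => y' _ /=.
  by rewrite /Yset inE; case: (y' \in coset l y).
have cnty : (cnt y <= q.+1)%N.
  by rewrite -(fl_pt G Py) -sum1_card; apply: leq_sum => m _; case: (_ \in _).
have yc : y \in coset l y by rewrite inE subrr sub0mx.
have cosE y' : y' \in coset l y -> ((y' - y)%R <= l)%MS /\ y' = y + (y' - y).
  by rewrite inE => ->; rewrite addrC subrK.
have cntPP y' : y' \in coset l y -> (0 < cnt y')%N -> exists2 m, m \in lthru L y & y' \in Yset L l y m.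
  move=> yc' h; apply/exists_inP; apply: contraTT h; rewrite negb_exists_in => /forall_inP no.
  by rewrite -eqn0Ngt /cnt big1 // => m hm; rewrite (negbTE (no m hm)).
have mpl m : m \in lthru L y -> (m <= pl y)%MS by apply: lthru_pl.
have rS m : m \in lthru L y -> \rank (l + m)%MS = 4%N.
  move=> hm; have := mxrank_sum_cap l m; rewrite rl.
  have -> : \rank m = 2%N by move: hm; rewrite inE => /andP[/(fl_rank G)].
  suff -> : \rank (l :&: m)%MS = 0%N by rewrite addn0.
  apply/eqP; rewrite mxrank_eq0; apply/rowV0P => v; rewrite sub_capmx => /andP[vl vm].
  apply/eqP; apply: contraT => v0; move: (far_no fy v0 vl); rewrite (submx_trans vm) //.
  exact: mpl.
have cnt1 y' : y' \in coset l y -> y' != y -> (cnt y' <= 1)%N.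
  move=> /cosE[vl e] ny.
  have -> : cnt y' = #|[set m in lthru L y | y' \in Yset L l y m]|.
    by rewrite /cnt -sum1_card big_mkcond [RHS]big_mkcond; apply: eq_bigr => m _; rewrite inE; case: (m \in _); case: (_ \in _).
  apply/card_le1_eqP => m2 m1.
  rewrite [m2 \in _]in_set => /andP[h2]; rewrite YsetE => /and3P[_ P' r2].
  rewrite [m1 \in _]in_set => /andP[h1]; rewrite YsetE => /and3P[_ _ r1].
  apply/eqP; apply: contraT => n12.
  have f' : far L l y' by rewrite e; apply: far_shift => //; rewrite -e.
  have v0 : y' - y != 0 by rewrite subr_eq0.
  move: (loneP lo vl v0); rewrite -e => /(_ P'); case/negP.
  have SU m : m \in lthru L y -> (l + m <= l + pl y)%MS by move=> /mpl h; smx.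
  (* The solids l + m1 and l + m2 meet in the plane l + y' only, which [pl y'] meets in a single
     point. So lines of [pl y'] in both solids would span [pl y'] inside l + pl y, against
     loneness. *)
  have capr : (\rank ((l + m1) :&: (l + m2))%MS <= 3)%N.
    have := mxrank_sum_cap (l + m1)%MS (l + m2)%MS; rewrite !rS //.
    have : (5 <= \rank (l + m1 + (l + m2))%MS)%N.
      rewrite -(far_rankU G Ll fy) mxrankS // addsmx_sub; apply/andP; split; first by smx.
      by rewrite (pl_span G Py h1 h2 n12); smx.
    by clear; lia.
  have yS m : m \in lthru L y -> (y <= l + m)%MS.
    by rewrite inE => /andP[_ ym]; smx.
  have capE : ((l + m1) :&: (l + m2) <= l + y')%MS.
    apply: sub_rank_sup; last by rewrite (far_rankE G Ll f').
    have y'S m : m \in lthru L y -> (y' <= l + m)%MS by move=> /yS ?; rewrite e; smx.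
    by rewrite sub_capmx; have a1 := y'S _ h1; have a2 := y'S _ h2; apply/andP; split; smx.
  pose A := (pl y' :&: (l + m1))%MS; pose B := (pl y' :&: (l + m2))%MS.
  have := mxrank_sum_cap A B.
  have : (\rank (A :&: B)%MS <= 1)%N.
    apply: leq_trans (far_capE G Ll f'); apply: mxrankS; rewrite sub_capmx; apply/andP; split.
      by apply: submx_trans (capmxSl _ _) (capmxSl _ _).
    apply: submx_trans capE; rewrite sub_capmx; apply/andP; split.
      by apply: submx_trans (capmxSl _ _) (capmxSr _ _).
    by apply: submx_trans (capmxSr _ _) (capmxSr _ _).
  move=> c1 c2.
  have r3 : (3 <= \rank (A + B)%MS)%N by move: c1 c2 r1 r2; rewrite /A /B; clear; lia.
  apply: (@submx_trans _ _ _ _ _ _ (A + B)%MS).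
    apply: sub_rank_sup; last by rewrite (rank_pl G P').
    by rewrite addsmx_sub !capmxSl.
  rewrite addsmx_sub; apply/andP; split; apply: submx_trans (capmxSr _ _) (SU _ _) => //.
have tot2 : (\sum_(y' in coset l y) cnt y' = cnt y + \sum_(y' in coset l y | y' != y) cnt y')%N.
  by rewrite (bigD1 y).
have card1 : #|[pred y' in coset l y | y' != y]| = (q ^ 2 - 1)%N.
  have := card_coset G Ll y; rewrite (cardD1 y) yc => <-; rewrite add1n subn1 /=.
  by apply: eq_card => t; rewrite !inE andbC.
have lowm m : m \in lthru L y -> (q <= #|Yset L l y m|)%N by move=> hm; apply: Yset_ge.
have up2 : (\sum_(y' in coset l y | y' != y) cnt y' <= q ^ 2 - 1)%N.
  rewrite -card1 -sum1_card; apply: leq_sum => t /andP[h1 h2]; exact: cnt1.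
have low : (q.+1 * q <= \sum_(m in lthru L y) #|Yset L l y m|)%N.
  rewrite -(fl_pt G Py) -sum_nat_const; apply: leq_sum => m hm; exact: lowm.
(* A member counted zero times would leave a total of at most q^2 + q - 1. *)
have c1 y' : y' \in coset l y -> y' != y -> (0 < cnt y')%N.
  move=> h1 h2; rewrite lt0n; apply/eqP => c0.
  have sp : (\sum_(t in coset l y | t != y) cnt t
     = cnt y' + \sum_(t | (t \in coset l y) && (t != y) && (t != y')) cnt t)%N.
    by rewrite (bigD1 y') //= h1.
  have : (\sum_(t | (t \in coset l y) && (t != y) && (t != y')) cnt t <= q ^ 2 - 2)%N.
    have cd : #|[pred t in coset l y | (t != y) && (t != y')]| = (q ^ 2 - 2)%N.
      have yin : y' \in [pred t in coset l y | t != y] by rewrite unfold_in /= h1 h2.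
      move: card1; rewrite (cardD1 y') yin add1n => c.
      have -> : #|[pred t in coset l y | (t != y) && (t != y')]|
              = #|[predD1 [pred t in coset l y | t != y] & y']|.
        by apply: eq_card => t; rewrite !inE; case: (_ <= _)%MS; case: (t == y); case: (t == y').
      apply/eqP; rewrite -eqSS c; move: (q_gt1 F); clear; rewrite expnS expn1 => h.
      by apply/eqP; nia.
    rewrite -cd -sum1_card (eq_bigl (fun t => (t \in coset l y) && ((t != y) && (t != y')))).
      by apply: leq_sum => t /and3P[h3 h4 _]; exact: cnt1.
    by move=> t; rewrite andbA.
  move: low; rewrite tot tot2 sp c0 add0n; move: cnty q1.
  move: (\sum_(t | _) _)%N (cnt y) #|F|; clear => A B k; rewrite !expnS expn0; nia.
split.
- move=> v vl; have [->|v0] := eqVneq v 0; first by rewrite addr0.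
  have h1 : y + v \in coset l y by rewrite inE addrC addKr.
  have h2 : y + v != y by rewrite -subr_eq0 addrC addKr.
  by have [m hm] := cntPP _ h1 (c1 _ h1 h2); rewrite YsetE => /and3P[].
- move=> v vl v0.
  have h1 : y + v \in coset l y by rewrite inE addrC addKr.
  have h2 : y + v != y by rewrite -subr_eq0 addrC addKr.
  have [m hm] := cntPP _ h1 (c1 _ h1 h2); rewrite YsetE => /and3P[_ P' r].
  apply/eqP; rewrite eqn_leq; apply/andP; split.
    rewrite leqNgt; apply: contra (loneP lo vl v0 P') => r3.
    apply: submx_trans (capmxSr (pl (y + v)) _); apply: sub_rank_sup (capmxSl _ _) _.
    by rewrite (rank_pl G P').
  apply: leq_trans r _; apply: mxrankS; apply: capmxS => //.
  by have := mpl _ hm => h; smx.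
move=> m hm; apply/eqP; rewrite eqn_leq lowm // andbT leqNgt; apply/negP => gt.
have : (q.+1 * q < \sum_(m in lthru L y) #|Yset L l y m|)%N.
  rewrite (bigD1 m) //= -(fl_pt G Py) -sum_nat_const (bigD1 m) //=.
  rewrite -addSn leq_add // leq_sum // => m' /andP[hm' _]; exact: lowm.
rewrite tot tot2; move: cnty up2 q1; clear; rewrite expnS expn1; nia.
Qed.

End Line.
End Lone.

(** * A hyperplane from two lone points *)

Section Hyper.
Local Open Scope ring_scope.
Variables (F : finFieldType) (N : nat) (L : {set 'M[F]_N}).
Hypothesis G : flat L.
Local Notation q := #|F|.
Local Notation PP := (hpoint L).
Local Notation pl := (tplane L).
Implicit Types (x y z u v w t s : 'rV[F]_N) (l m n S E U : 'M[F]_N).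

Lemma line_of x (A : 'M[F]_N) : PP x -> (A <= pl x)%MS -> \rank A = 2%N -> (x <= A)%MS ->
  <<A>>%MS \in lthru L x.
Proof.
move=> Px Ax rA xA; have [s [sA ns]] : exists s, (s <= A)%MS /\ ~~ (s <= x)%MS.
  by apply: ex_outside; rewrite rA rank_vec ?(PP0 Px).
have -> : <<A>>%MS = <<(x + s)%MS>>%MS.
  have s' : (x + s <= A)%MS by smx.
  by apply/genmxP; rewrite s' andbT vs_eq // (rank_span2 (PP0 Px) ns) rA.
by rewrite inE (pl_line G Px (submx_trans sA Ax) ns) /= genmxE addsmxSl.
Qed.

Lemma dist2P z y w : w != 0 -> (w <= pl z)%MS -> (y <= pl w)%MS -> dist2 L z y.
Proof. by move=> w0 wz yw; apply/existsP; exists w; rewrite w0 wz yw. Qed.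

Lemma dist2_shift z y (c : F) : PP z -> dist2 L z y -> dist2 L z (y + c *: z).
Proof.
move=> Pz /existsP[w /and3P[w0 wz yw]]; apply: (dist2P w0 wz).
by have := pl_sym G Pz wz w0 => zw; smx.
Qed.

Lemma dist2_par z z' y : z' != 0 -> (z' <= z)%MS -> dist2 L z' y -> dist2 L z y.
Proof.
move=> z0 h; rewrite /dist2; suff -> : pl z' = pl z by [].
by apply: pl_eqmx; apply/eqmxP; rewrite h sub_vec_sym.
Qed.

Section Line.
Variables (l : 'M[F]_N) (Ll : l \in L).
Let rl : \rank l = 2%N := fl_rank G Ll.

Lemma span_l z z' : z != 0 -> (z <= l)%MS -> (z' <= l)%MS -> ~~ (z' <= z)%MS -> (l <= z + z')%MS.
Proof. by move=> z0 zl zl' n; apply: vs_eq; [smx | rewrite rank_span2]. Qed.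

Lemma l_other z : z != 0 -> exists v, (v <= l)%MS /\ ~~ (v <= z)%MS.
Proof. by move=> z0; apply: ex_outside; rewrite rl rank_vec. Qed.

Lemma dist2_notl z y w : far L l y -> z != 0 -> (z <= l)%MS -> (y <= pl w)%MS -> w != 0 ->
  (w <= pl z)%MS -> ~~ (w <= l)%MS.
Proof.
move=> fy z0 zl yw w0 wz; apply/negP => wl.
by have := far_no2 G Ll fy w0 wl; rewrite yw.
Qed.

Lemma pl_zw z w : z != 0 -> (z <= l)%MS -> (w <= pl z)%MS -> ~~ (w <= l)%MS -> (pl z <= l + w)%MS.
Proof.
move=> z0 zl wz nw; apply: vs_eq; first by have := l_pl Ll z0 zl => lz; smx.
by rewrite rank_addv // rl (rank_pl G (l_PP Ll z0 zl)).
Qed.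

(** All points of the coset with direction z lie on one line y + <z>, by [typeA]. *)
Lemma dist2_coset z y v : far L l y -> z != 0 -> (z <= l)%MS -> (v <= l)%MS -> PP (y + v) ->
  dist2 L z y -> dist2 L z (y + v) -> (v <= z)%MS.
Proof.
move=> fy z0 zl vl P' /existsP[w /and3P[w0 wz yw]] /existsP[w' /and3P[w'0 w'z yw']].
have f' := far_shift G Ll fy vl P'.
apply: (typeA G Ll fy z0 zl w0 wz yw vl P').
have nwl := dist2_notl fy z0 zl yw w0 wz.
have Pz := l_PP Ll z0 zl; have Pw' := pl_PP G Pz w'z w'0.
have nw' : ~~ (w' <= (y + v)%R)%MS.
  apply: contra (far_no2 G Ll f' z0 zl) => h; apply: submx_trans w'z; exact: sub_vec_sym.
rewrite -(rank_span2 (PP0 P') nw') mxrankS // sub_capmx.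
have a1 := mem_pl G P'; have a2 := pl_sym G Pw' yw' (PP0 P').
have a3 : (w' <= l + y + w)%MS.
  by apply: submx_trans w'z _; apply: submx_trans (pl_zw z0 zl wz nwl) _; smx.
by apply/andP; split; smx.
Qed.

(** In the affine plane y + l the lines y + <z> and y + v + <z'> are not parallel; their common
    point inherits both directions. *)
Lemma dist2_meet y z z' v : (v <= l)%MS -> z != 0 -> (z <= l)%MS -> z' != 0 -> (z' <= l)%MS ->
  ~~ (z' <= z)%MS -> dist2 L z y -> dist2 L z' (y + v) ->
  exists c : F, dist2 L z (y + c *: z) /\ dist2 L z' (y + c *: z).
Proof.
move=> vl z0 zl z'0 z'l n h h'.
have [c [d e]] := sub_span2P (submx_trans vl (span_l z0 zl z'l n)).
exists c; split; first by apply: dist2_shift (l_PP Ll z0 zl) h.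
rewrite (_ : y + c *: z = y + v + (- d) *: z'); first by apply: dist2_shift (l_PP Ll z'0 z'l) h'.
by rewrite e scaleNr -addrA addrK.
Qed.

(** H = l + pl x + pl y1 has rank 5 + 3 - 2. The plane of a coset point y outside H meets H in a
    line that lies in both l + pl x and l + pl y1. These meet in a solid l + mx with mx a line
    through x, so y belongs to [Yset x mx], a set of only q elements including x. *)
Lemma lone_pair x v1 : far L l x -> lone L l x -> (v1 <= l)%MS -> v1 != 0 -> lone L l (x + v1) ->
  exists H : 'M[F]_N, [/\ \rank H = 6%N, (l + pl x <= H)%MS &
     forall v, (v <= l)%MS -> (pl (x + v)%R <= H)%MS].
Proof.
move=> fx lx v1l v10 ly; have [PPx one cntx] := lone_count G Ll fx lx.
have Px := far_PP fx; set y1 := x + v1 in ly.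
have Py1 : PP y1 by apply: PPx.
have fy1 : far L l y1 by apply: far_shift.
have [_ oney _] := lone_count G Ll fy1 ly.
pose H := (l + pl x + pl y1)%MS; exists H.
have rH : \rank H = 6%N.
  have := mxrank_sum_cap (l + pl x)%MS (pl y1); rewrite (far_rankU G Ll fx) (rank_pl G Py1).
  by rewrite capmxC one // -/H; clear; lia.
have xH : (pl x <= H)%MS by rewrite /H; smx.
have lH : (l <= H)%MS by rewrite /H; smx.
have xxH := submx_trans (mem_pl G Px) xH.
split=> //; first by smx.
pose S0 := ((l + pl x) :&: (l + pl y1))%MS.
have rS0 : \rank S0 = 4%N.
  have := mxrank_sum_cap (l + pl x)%MS (l + pl y1)%MS.
  rewrite (far_rankU G Ll fx) (far_rankU G Ll fy1) -/S0.
  have -> : \rank (l + pl x + (l + pl y1))%MS = \rank H.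
    by apply/eqmx_rank/andP; split; rewrite /H; smx.
  by rewrite rH; clear; lia.
have claim v : (v <= l)%MS -> ~~ (pl (x + v)%R <= H)%MS -> (1 < \rank (pl (x + v)%R :&: S0)%MS)%N.
  move=> vl nH; have P' := PPx v vl.
  have v0 : v != 0 by apply: contraNneq nH => ->; rewrite addr0.
  have vv1 : v - v1 != 0.
    rewrite subr_eq0; apply: contraNneq nH => ->; rewrite -/y1 /H; smx.
  have e : x + v = y1 + (v - v1) by rewrite /y1 addrACA subrr addr0.
  have r1 := one v vl v0.
  have r2 : \rank (pl (x + v)%R :&: (l + pl y1))%MS = 2%N.
    by rewrite e; apply: oney => //; smx.
  have rc : (\rank (pl (x + v)%R :&: H)%MS <= 2)%N.
    rewrite leqNgt; apply: contra nH => r.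
    apply: submx_trans (capmxSr (pl (x + v)) H); apply: sub_rank_sup (capmxSl _ _) _.
    by rewrite (rank_pl G P').
  have s1 : (pl (x + v)%R :&: H <= pl (x + v)%R :&: (l + pl x))%MS.
    by apply: sub_rank_sup; rewrite ?r1 //; apply: capmxS; rewrite ?submx_refl // /H; smx.
  have s2 : (pl (x + v)%R :&: H <= pl (x + v)%R :&: (l + pl y1))%MS.
    by apply: sub_rank_sup; rewrite ?r2 //; apply: capmxS; rewrite ?submx_refl // /H; smx.
  rewrite -r1; apply: mxrankS; rewrite sub_capmx capmxSl /= /S0 sub_capmx capmxSr /=.
  apply: submx_trans (capmxSr (pl (x + v)) _); apply: submx_trans s2.
  by apply: capmxS; rewrite ?submx_refl // /H; smx.
have x_y1 : x = y1 - v1 by rewrite /y1 addrK.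
have xU2 : (x <= l + pl y1)%MS.
  by rewrite x_y1; have := mem_pl G Py1 => yy; smx.
have rmx : \rank (pl x :&: (l + pl y1))%MS = 2%N.
  by rewrite {1}x_y1; apply: oney; rewrite ?oppr_eq0 ?opp_sub_eq.
pose mx := <<(pl x :&: (l + pl y1))%MS>>%MS.
have hmx : mx \in lthru L x.
  by apply: line_of => //; rewrite ?capmxSl // sub_capmx mem_pl.
have S0m : (S0 <= l + mx)%MS.
  apply: vs_eq.
    rewrite addsmx_sub /S0 !sub_capmx !addsmxSl /= /mx !genmxE capmxSr andbT.
    by apply: submx_trans (capmxSl _ _) _; smx.
  have := mxrank_sum_cap l mx; rewrite rl rS0 genmxE rmx.
  suff -> : \rank (l :&: mx)%MS = 0%N by rewrite addn0.
  apply/eqP; rewrite mxrank_eq0; apply/rowV0P => v; rewrite sub_capmx genmxE sub_capmx.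
  case/and3P => vl vx _; apply/eqP; apply: contraT => v0.
  by move: (far_no fx v0 vl); rewrite vx.
move=> v vl; apply: contraT => nH; set y := x + v in nH.
have Py : PP y by apply: PPx.
have fy : far L l y by apply: far_shift.
have [m hm nm] : exists2 m, m \in lthru L y & ~~ (m <= H)%MS.
  apply/exists_inP; apply: contraNT nH; rewrite negb_exists_in => /forall_inP h.
  by apply/sumsmx_subP => m hm; move: (h m hm); rewrite negbK.
have mpl := lthru_pl Py hm.
have [Lm ym] : m \in L /\ (y <= m)%MS by apply/andP; move: hm; rewrite inE.
have rSm : \rank (l + m)%MS = 4%N.
  have := mxrank_sum_cap l m; rewrite rl (fl_rank G Lm).
  suff -> : \rank (l :&: m)%MS = 0%N by rewrite addn0.
  apply/eqP; rewrite mxrank_eq0; apply/rowV0P => t; rewrite sub_capmx => /andP[tl tm].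
  apply/eqP; apply: contraT => t0.
  by move: (far_no fy t0 tl); rewrite (submx_trans tm).
have sub : Yset L l y m \subset Yset L l x mx :\ x.
  apply/subsetP => y'; rewrite YsetE => /and3P[yc P' r'].
  have vl' : ((y' - x)%R <= l)%MS.
    rewrite (_ : y' - x = (y' - y) + v); last by rewrite /y opprD addrA subrK.
    by move: yc; rewrite inE => ?; smx.
  have e : y' = x + (y' - x) by rewrite addrC subrK.
  have f' : far L l y' by rewrite e; apply: far_shift => //; rewrite -e.
  have n' : ~~ (pl y' <= H)%MS.
    apply/negP => s'.
    have rc : (\rank (H :&: (l + m))%MS <= 3)%N.
      rewrite leqNgt; apply: contra nm => r; apply: submx_trans (addsmxSr l m) _.
      apply: submx_trans (capmxSl H (l + m)%MS); apply: sub_rank_sup (capmxSr _ _) _.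
      by rewrite rSm.
    have y'S : (y' <= l + m)%MS.
      rewrite (_ : y' = (y' - y) + y); last by rewrite subrK.
      by move: yc; rewrite inE => ?; smx.
    have y'H : (y' <= H)%MS by have h := submx_trans vl' lH; rewrite e; smx.
    have cE : (H :&: (l + m) <= l + y')%MS.
      apply: sub_rank_sup; last by rewrite (far_rankE G Ll f').
      by rewrite sub_capmx; apply/andP; split; smx.
    have : (\rank (pl y' :&: (l + m))%MS <= 1)%N.
      apply: leq_trans (far_capE G Ll f'); apply: mxrankS; rewrite sub_capmx capmxSl /=.
      apply: submx_trans cE; rewrite sub_capmx capmxSr andbT.
      exact: submx_trans (capmxSl _ _) s'.
    by rewrite leqNgt r'.
  rewrite !inE; apply/andP; split.
    by apply: contraNneq n' => ->.
  rewrite vl' P' /=; move: (claim _ vl'); rewrite -e => /(_ n') r.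
  apply: leq_trans r _; apply: mxrankS; exact: capmxS.
have := subset_leq_card sub; have := Yset_ge G Ll fy hm.
have := cntx _ hmx; rewrite (cardsD1 x) YsetE Px inE subrr sub0mx /=.
have -> : (1 < \rank (pl x :&: (l + mx))%MS)%N.
  apply: (@leq_trans (\rank mx)); first by rewrite genmxE rmx.
  apply: mxrankS; rewrite sub_capmx addsmxSr andbT; exact: lthru_pl.
rewrite add1n; move=> e a b; move: (leq_trans a b); rewrite -e ltnn //.
Qed.

End Line.
End Hyper.

(** Supplies the q points of a line other than z, the family that [dlemma] is applied to. *)
Lemma affine_nonpar (F : fieldType) N (v z : 'rV[F]_N) (c d : F) :
  z != 0%R -> ~~ (v <= z)%MS -> c != d ->
  ~~ ((v + c *: z)%R <= (v + d *: z)%R)%MS.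
Proof.
move=> z0 nv ncd; apply/negP => /sub_vecP[e he].
have [e1|e1] := eqVneq e 1%R.
  move: he; rewrite e1 scale1r => /addrI/eqP; rewrite -subr_eq0 -scalerBl scaler_eq0.
  by rewrite (negbTE z0) orbF subr_eq0 (negbTE ncd).
have ve : v = (e *: v + (e * d) *: z - c *: z)%R by rewrite -scalerA -scalerDr -he addrK.
case/negP: nv; rewrite -(@scale_sub_eq _ _ (1 - e)%R) ?subr_eq0 1?eq_sym //.
have -> : ((1 - e) *: v = (e * d) *: z - c *: z)%R.
  by apply: (addIr (e *: v)%R); rewrite scalerBl scale1r subrK [RHS]addrC addrA -ve.
by smx.
Qed.

(** * Far points with every direction *)

Section Exceptional.
Local Open Scope ring_scope.
Variables (F : finFieldType) (N : nat) (L : {set 'M[F]_N}).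
Hypothesis G : flat L.
Local Notation q := #|F|.
Local Notation PP := (hpoint L).
Local Notation pl := (tplane L).
Implicit Types (x y z u v w t s r : 'rV[F]_N) (l m n S E U : 'M[F]_N).
Variables (l : 'M[F]_N) (Ll : l \in L).
Let rl : \rank l = 2%N := fl_rank G Ll.

Section AllDirections.
Variables (x : 'rV[F]_N).
Hypothesis fx : far L l x.
Hypothesis lx : lone L l x.
Hypothesis all2 : forall z, z != 0 -> (z <= l)%MS -> dist2 L z x.
Local Notation U := (l + pl x)%MS.
Let Px := far_PP fx.

Lemma midw z : z != 0 -> (z <= l)%MS ->
  exists w, [/\ w != 0, (w <= pl z)%MS, (x <= pl w)%MS, ~~ (w <= l)%MS & (w <= pl x)%MS].
Proof.
move=> z0 zl; case/existsP: (all2 z0 zl) => w /and3P[w0 wz xw].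
exists w; split=> //; first exact: (dist2_notl G Ll fx z0 zl xw w0 wz).
exact: (pl_sym G (pl_PP G (l_PP Ll z0 zl) wz w0) xw (PP0 Px)).
Qed.

Lemma plzU z : z != 0 -> (z <= l)%MS -> (pl z <= U)%MS.
Proof.
move=> z0 zl; have [w [w0 wz xw nwl wx]] := midw z0 zl.
by apply: submx_trans (pl_zw G Ll z0 zl wz nwl) _; smx.
Qed.

Variables (z w : 'rV[F]_N).
Hypotheses (z0 : z != 0) (zl : (z <= l)%MS) (w0 : w != 0) (wz : (w <= pl z)%MS).
Hypotheses (xw : (x <= pl w)%MS).
Local Notation r := (x + w).
Let Pz := l_PP Ll z0 zl.
Let Pw := pl_PP G Pz wz w0.
Let nwl : ~~ (w <= l)%MS := dist2_notl G Ll fx z0 zl xw w0 wz.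
Let wx : (w <= pl x)%MS := pl_sym G Pw xw (PP0 Px).
Let zw : (z <= pl w)%MS := pl_sym G Pz wz w0.
Let nxz : ~~ (x <= pl z)%MS := far_no2 G Ll fx z0 zl.

Lemma l_notin_plw v : (v <= l)%MS -> ~~ (v <= z)%MS -> ~~ (v <= pl w)%MS.
Proof.
move=> vl nv; apply: contra nwl => vw.
have : l \in lthru L w.
  by apply: (line_pl G Pw Ll); apply: submx_trans (span_l G Ll z0 zl vl nv) _; smx.
by rewrite inE => /andP[].
Qed.

Lemma nrz : ~~ (r <= pl z)%MS.
Proof. by rewrite addrC addv_sub_eq. Qed.

Lemma far_r : far L l r.
Proof.
have rw : (r <= pl w)%MS by have ww := mem_pl G Pw; smx.
have r0 := notsub_nz nrz; have Pr := pl_PP G Pw rw r0.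
apply: farI => // v v0 vl; apply/negP => vr.
have rv := pl_sym G Pr vr v0.
have [vz|nvz] := boolP (v <= z)%MS.
  case/negP: nrz; suff <- : pl v = pl z by [].
  by apply: pl_eqmx; apply/eqmxP; rewrite vz sub_vec_sym.
have lz := l_pl Ll z0 zl.
have := mid_uniq G Pz Pr nrz w0 v0 wz (pl_sym G Pw rw r0) (submx_trans vl lz) vr.
by move=> wv; case/negP: nwl; apply: submx_trans vl.
Qed.

(** The roles of point and line are exchanged: u is far from the line l3 through w and x, and it has
    the two directions x and w on l3, so it is lone for l3. Since l3 + pl u = U, [lone_count] for
    the coset u + l3 gives the claim at r. *)
Lemma claimA u : (u <= l)%MS -> ~~ (u <= z)%MS ->
  PP (r + u) /\ \rank (pl (r + u)%R :&: U)%MS = 2%N.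
Proof.
move=> ul nuz; have u0 := notsub_nz nuz; have Pu := l_PP Ll u0 ul.
have nxw : ~~ (x <= w)%MS.
  by apply: contra nxz => h; apply: submx_trans wz.
pose l3 := <<(w + x)%MS>>%MS.
have L3 : l3 \in L by apply: pl_line.
have zu : (z <= pl u)%MS by apply: submx_trans zl (l_pl Ll u0 ul).
have uz : (u <= pl z)%MS by apply: submx_trans ul (l_pl Ll z0 zl).
have f3 : far L l3 u.
  apply: farI => // v v0; rewrite genmxE => v3; apply/negP => vu.
  have vw : (v <= pl w)%MS by apply: submx_trans v3 _; have ww := mem_pl G Pw; smx.
  have Pv := pl_PP G Pw vw v0.
  have [vz|nvz] := boolP (v <= pl z)%MS.
    have [a [b e]] := sub_span2P v3.
    have b0 : b = 0.
      apply/eqP; apply: contraNT nxz => b0.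
      have e' : v = b *: x + a *: w by rewrite e addrC.
      by apply: (sub_lin b0 e' vz); smx.
    have a0 : a != 0 by apply: contraNneq v0 => a0; rewrite e a0 b0 !scale0r addr0.
    move: vu; rewrite e b0 scale0r addr0 scale_sub_eq // => wu.
    by case/negP: (l_notin_plw ul nuz); exact: (pl_sym G Pu wu w0).
  have := mid_uniq G Pz Pv nvz w0 u0 wz (pl_sym G Pw vw v0) uz (pl_sym G Pu vu v0).
  by move=> wu; case/negP: nwl; apply: submx_trans ul.
have [wu [wu0 wuu xwu _ wux]] := midw u0 ul.
have lo : lone L l3 u.
  apply: (lone_two G L3 f3 (z1 := x) (z2 := w)) => //.
  - exact: (PP0 Px).
  - by rewrite genmxE; smx.
  - by rewrite genmxE; smx.
  - by apply: (dist2P wu0 wux); exact: (pl_sym G Pu wuu wu0).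
  - by apply: (dist2P z0 zw).
have [h1 h2 _] := lone_count G L3 f3 lo.
have r3 : (r <= l3)%MS by rewrite genmxE; smx.
have r0 := notsub_nz nrz.
rewrite addrC; split; first exact: h1.
rewrite -(h2 _ r3 r0).
have e1 : (l3 + pl u <= U)%MS.
  by rewrite addsmx_sub plzU // andbT genmxE; have xx := mem_pl G Px; smx.
have e2 : (U <= l3 + pl u)%MS.
  by apply: vs_eq => //; rewrite (far_rankU G Ll fx) (far_rankU G L3 f3).
by apply/eqmx_rank/andP; split; apply: capmxS => //.
Qed.

(** Let w' join z' to r + u and let w2 join z' to x. If w2 and w' agree, then w + u is a neighbour
    of w2, which makes l pass through w or closes a quadrangle. If they differ, too many planes at
    points of [pl z'] lie in U. *)
Lemma claimB u z' : (u <= l)%MS -> ~~ (u <= z)%MS -> z' != 0 -> (z' <= l)%MS ->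
  ~~ dist2 L z' (r + u).
Proof.
move=> ul nuz z'0 z'l; apply/negP => /existsP[w' /and3P[w'0 w'z yw']].
have [Py _] := claimA ul nuz.
have fy : far L l (r + u) by apply: far_shift => //; exact: far_r.
have Pz' := l_PP Ll z'0 z'l; have Pw' := pl_PP G Pz' w'z w'0.
have nw'l := dist2_notl G Ll fy z'0 z'l yw' w'0 w'z.
have z'w' := pl_sym G Pz' w'z w'0.
have [w2 [w20 w2z xw2 nw2l w2x]] := midw z'0 z'l.
have Pw2 := pl_PP G Pz' w2z w20.
have xU : (x <= U)%MS by have := mem_pl G Px => xx; smx.
have wU : (w <= U)%MS by smx.
have lU : (l <= U)%MS by smx.
have uU := submx_trans ul lU.
have plwU t s : (s <= pl z')%MS -> s != 0 -> (t <= pl s)%MS -> (t <= U)%MS -> ~~ (t <= pl z')%MS ->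
    ~~ (s <= l)%MS -> (pl s <= U)%MS.
  move=> sz s0 ts tU nt nsl.
  have Ps := pl_PP G Pz' sz s0; have z's := pl_sym G Pz' sz s0.
  have sU : (s <= U)%MS by apply: submx_trans sz (plzU z'0 z'l).
  apply: (full2 G Ps z's ts) => //.
  - by apply: contra nsl => h; apply: submx_trans z'l; apply: sub_vec_sym h.
  - by apply: contra nt => h; apply: submx_trans h _; have zz := mem_pl G Pz'; smx.
  - exact: submx_trans z'l lU.
have [w2w'|n22] := boolP (w2 <= w')%MS.
  have e : pl w2 = pl w' by apply: pl_eqmx; apply/eqmxP; rewrite w2w' sub_vec_sym.
  have wu2 : ((w + u)%R <= pl w2)%MS.
    rewrite (_ : w + u = (x + w + u) - x); first by rewrite -e in yw'; smx.
    by rewrite -[x + w + u]addrA [x + _]addrC addrK.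
  have [z'z|nz'] := boolP (z' <= z)%MS.
    have ez : pl z' = pl z by apply: pl_eqmx; apply/eqmxP; rewrite z'z sub_vec_sym.
    have nzx : ~~ (x <= pl z)%MS by [].
    have w2w : (w2 <= w)%MS.
      by apply: (mid_uniq G Pz Px nzx w20 w0); rewrite // -ez.
    have e2 : pl w2 = pl w by apply: pl_eqmx; apply/eqmxP; rewrite w2w sub_vec_sym.
    case/negP: (l_notin_plw ul nuz); rewrite -(addv_sub_eq u (mem_pl G Pw)).
    by rewrite -e2.
  have wuz : ((w + u)%R <= pl z)%MS.
    by have := submx_trans ul (l_pl Ll z0 zl) => h; smx.
  have nw2z : ~~ (w2 <= pl z)%MS.
    apply: contra nw2l => h; have z'w2 := pl_sym G Pz' w2z w20; have zw2 := pl_sym G Pz h w20.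
    suff : l \in lthru L w2 by rewrite inE => /andP[].
    by apply: (line_pl G Pw2 Ll); apply: submx_trans (span_l G Ll z0 zl z'l nz') _; smx.
  have wu0 : w + u != 0.
    apply: contraNneq nwl => /eqP; rewrite addr_eq0 => /eqP->; by smx.
  have z'z : (z' <= pl z)%MS by apply: submx_trans z'l (l_pl Ll z0 zl).
  have := mid_uniq G Pz Pw2 nw2z wu0 z'0 wuz wu2 z'z (pl_sym G Pz' w2z w20).
  move=> h; case/negP: nwl; rewrite -(addv_sub_eq w ul) addrC.
  exact: submx_trans h z'l.
have [v0 [v0l nv0]] := l_other G Ll z'0.
have f1 c : ((v0 + c *: z')%R <= l)%MS by smx.
have f2 c : ~~ ((v0 + c *: z')%R <= z')%MS by rewrite addrC addv_sub_eq //; smx.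
have nsf c s : ~~ (s <= l)%MS -> s != 0 -> ~~ ((v0 + c *: z')%R <= s)%MS.
  move=> ns s0; apply: contra ns => h; apply: submx_trans (f1 c); apply: sub_vec_sym h.
  exact: notsub_nz (f2 c).
have rU : (r + u <= U)%MS by smx.
(* The q + 2 points are the q points of l other than z', together with w2 and w'. *)
apply: (@dlemma _ _ _ G U z' (fun c => v0 + c *: z') w2 w') => //.
- exact: far_rankU fx.
- exact: plzU.
- move=> c; split=> //; first exact: submx_trans (f1 c) (l_pl Ll z'0 z'l).
  apply: plzU => //; exact: notsub_nz (f2 c).
- by apply: contra nw2l => h; apply: submx_trans z'l.
- by apply: (plwU x) => //; exact: far_no2 fx z'0 z'l.
- by apply: contra nw'l => h; apply: submx_trans z'l.
- apply: (plwU (r + u)) => //; last exact: far_no2 fy z'0 z'l.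
  by smx.
- by move=> c d ncd; apply: affine_nonpar.
- by move=> c; apply: nsf.
- by move=> c; apply: nsf.
Qed.

End AllDirections.
End Exceptional.

(** * The common hyperplane of a coset with a lone point *)

Section Exceptional2.
Local Open Scope ring_scope.
Variables (F : finFieldType) (N : nat) (L : {set 'M[F]_N}).
Hypothesis G : flat L.
Local Notation q := #|F|.
Local Notation PP := (hpoint L).
Local Notation pl := (tplane L).
Implicit Types (x y z u v w t s r : 'rV[F]_N) (l m n S E U : 'M[F]_N).
Variables (l : 'M[F]_N) (Ll : l \in L).
Let rl : \rank l = 2%N := fl_rank G Ll.

(** For u on l outside <z> the point r + u is lone, and the solid S u spanned by l and its line in U
    contains no plane at a point of l. If the planes at z1 and z2 gave different solids through l +
    r, the solids S u would be confined to q - 2 of the q + 1 solids of U through l + r, each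
    serving at most q of the q^2 - q vectors u. So the planes at all points of l except z lie in one
    solid; for q > 2 there are three of them. *)
Lemma all_directions_false x : (2 < q)%N -> far L l x ->
  (forall z, z != 0 -> (z <= l)%MS -> dist2 L z x) -> False.
Proof.
move=> q2 fx all2; have Px := far_PP fx.
have [z [zl nz]] : exists z, (z <= l)%MS /\ ~~ (z <= (0 : 'rV[F]_N))%MS.
  by apply: ex_outside; rewrite rl mxrank0.
have z0 := notsub_nz nz.
have [w [w0 wz xw nwl wx]] := midw G Ll fx all2 z0 zl.
have Pz := l_PP Ll z0 zl; have Pw := pl_PP G Pz wz w0.
pose U := (l + pl x)%MS; pose r := x + w.
have rU : \rank U = 5%N by apply: far_rankU.
have fr : far L l r := far_r G Ll fx z0 zl w0 wz xw.
have Pr := far_PP fr.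
have A u (ul : (u <= l)%MS) (nu : ~~ (u <= z)%MS) := claimA G Ll fx all2 z0 zl w0 wz xw ul nu.
have B u z' (ul : (u <= l)%MS) (nu : ~~ (u <= z)%MS) :=
  @claimB _ _ _ G _ Ll _ fx all2 _ _ z0 zl w0 wz xw u z' ul nu.
have far_u u : (u <= l)%MS -> ~~ (u <= z)%MS -> far L l (r + u).
  by move=> ul nu; apply: far_shift => //; have [] := A u ul nu.
have lone_u u : (u <= l)%MS -> ~~ (u <= z)%MS -> lone L l (r + u).
  by move=> ul nu; apply: (lone_none G Ll (far_u u ul nu)) => z'; apply: B.
have xU : (x <= U)%MS by have := mem_pl G Px => xx; rewrite /U; smx.
have wU : (w <= U)%MS by rewrite /U; smx.
have lU : (l <= U)%MS by rewrite /U; smx.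
have rrU : (r <= U)%MS by rewrite /r; smx.
pose n u := (pl (r + u)%R :&: U)%MS; pose S u := (l + n u)%MS.
have nmem u : (u <= l)%MS -> ~~ (u <= z)%MS -> ((r + u)%R <= n u)%MS.
  by move=> ul nu; rewrite sub_capmx mem_pl ?(A u ul nu).1 //=; have := submx_trans ul lU => ?; smx.
have rS u : (u <= l)%MS -> ~~ (u <= z)%MS -> \rank (S u) = 4%N.
  move=> ul nu; have := mxrank_sum_cap l (n u); rewrite rl (A u ul nu).2.
  suff -> : \rank (l :&: n u)%MS = 0%N by rewrite addn0.
  apply/eqP; rewrite mxrank_eq0; apply/rowV0P => t; rewrite !sub_capmx => /and3P[tl tm _].
  by apply/eqP; apply: contraT => t0; move: (far_no (far_u u ul nu) t0 tl); rewrite tm.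
have SU u : (S u <= U)%MS by rewrite addsmx_sub lU capmxSr.
have ES u : (u <= l)%MS -> ~~ (u <= z)%MS -> (l + r <= S u)%MS.
  move=> ul nu; rewrite addsmx_sub addsmxSl /=.
  have h := nmem u ul nu; have e : r + u = 1 *: r + u by rewrite scale1r.
  by apply: (sub_lin (oner_neq0 F) e); rewrite /S; smx.
have C u z' : (u <= l)%MS -> ~~ (u <= z)%MS -> z' != 0 -> (z' <= l)%MS -> ~~ (pl z' <= S u)%MS.
  move=> ul nu z'0 z'l; apply: contra (B u z' ul nu z'0 z'l) => s.
  have Pz' := l_PP Ll z'0 z'l; have [Py ry] := A u ul nu.
  have [t [t0 tn tz]] : exists t, [/\ t != 0, (t <= n u)%MS & (t <= pl z')%MS].
    by apply: ex_cap (addsmxSr _ _) s _; rewrite -/(S u) rS // ry (rank_pl G Pz').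
  apply: (dist2P t0 tz); apply: (pl_sym G Py _ t0).
  by apply: submx_trans tn (capmxSl _ _).
have rE := far_rankE G Ll fr.
pose D z' := (pl z' + r)%MS.
have rD z' : z' != 0 -> (z' <= l)%MS -> \rank (D z') = 4%N.
  by move=> z'0 z'l; rewrite rank_addv ?(rank_pl G (l_PP Ll z'0 z'l)) // (far_no2 G Ll fr).
have key z1 z2 : (z1 <= l)%MS -> ~~ (z1 <= z)%MS -> (z2 <= l)%MS -> ~~ (z2 <= z)%MS ->
   (pl z2 <= D z1)%MS.
  move=> z1l n1 z2l n2; apply: contraT => nD.
  have z10 := notsub_nz n1; have z20 := notsub_nz n2.
  have [w1 [w10 w1z _ nw1 w1x]] := midw G Ll fx all2 z10 z1l.
  have [w2 [w20 w2z _ nw2 w2x]] := midw G Ll fx all2 z20 z2l.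
  have p1 := pl_zw G Ll z10 z1l w1z nw1; have p2 := pl_zw G Ll z20 z2l w2z nw2.
  have l1 := l_pl Ll z10 z1l.
  have D1 : (D z1 <= l + r + w1)%MS.
    by rewrite addsmx_sub; apply/andP; split; last smx; apply: submx_trans p1 _; smx.
  have nw1E : ~~ (w1 <= l + r)%MS.
    apply/negP => h; have s : (D z1 <= l + r)%MS by apply: submx_trans D1 _; smx.
    by have := mxrankS s; rewrite rD // rE.
  have nw2E : ~~ (w2 <= l + r + w1)%MS.
    apply/negP => h; case/negP: nD; apply: submx_trans p2 _; rewrite /D.
    have h1 : (l + r + w1 <= pl z1 + r)%MS by smx.
    by have h2 := submx_trans h h1; smx.
  have UE : (U <= l + r + w1 + w2)%MS.
    apply: vs_eq; last by rewrite rank_addv // rank_addv // rE rU.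
    have a1 : (w1 <= U)%MS by rewrite /U; smx.
    have a2 : (w2 <= U)%MS by rewrite /U; smx.
    by smx.
  pose Sz := (l + r + w)%MS.
  have pzS : (pl z <= Sz)%MS by apply: submx_trans (pl_zw G Ll z0 zl wz nwl) _; rewrite /Sz; smx.
  have nwE : ~~ (w <= l + r)%MS.
    apply/negP => h; have : (l + w <= l + r)%MS by smx.
    move=> /(submx_trans (pl_zw G Ll z0 zl wz nwl)) s.
    have := vs_eq s; rewrite rE (rank_pl G Pz) => /(_ erefl) s2.
    case/negP: (far_no2 G Ll fr z0 zl); apply: submx_trans s2; smx.
  have rSz : \rank Sz = 4%N by rewrite rank_addv // rE.
  have xSz : (x <= Sz)%MS by rewrite -(addrK w x) -/r /Sz; smx.
  have nzw : ~~ (z <= w)%MS by apply: contra nwl => h; apply: submx_trans zl; apply: sub_vec_sym h.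
  have pwS : (pl w <= Sz)%MS.
    apply: (full2 G Pw (pl_sym G Pz wz w0) xw) => //.
    - apply: contra (far_no2 G Ll fx z0 zl) => h; apply: submx_trans h _.
      by have zz := mem_pl G Pz; smx.
    - by rewrite /Sz; smx.
    - by rewrite /Sz; smx.
  have noSz z' w' : z' != 0 -> (z' <= l)%MS -> ~~ (z' <= z)%MS -> (w' <= pl z')%MS -> ~~ (w' <= l)%MS ->
      ~~ (w' <= Sz)%MS.
    move=> z'0 z'l nz' w'z nw'; apply/negP => h.
    have s : (pl z' <= Sz)%MS.
      have lS : (l <= Sz)%MS by rewrite /Sz; smx.
      by apply: submx_trans (pl_zw G Ll z'0 z'l w'z nw') _; smx.
    have := solid3 G rSz (l_PP Ll z'0 z'l) Pz Pw s pzS pwS.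
    rewrite (negbTE nz') (negbTE nzw) orbF /= => h'.
    by case/negP: nwl; apply: submx_trans z'l; apply: sub_vec_sym h'.
  have SzU : (Sz <= U)%MS by rewrite /Sz; smx.
  have [tz tz0 htz] : exists2 t : F, t != 0 & ((w1 + t *: w2)%R <= Sz)%MS.
    apply: (solid_param UE SzU); rewrite ?rE ?rSz //; first exact: addsmxSl.
      by apply: (noSz z1).
    by apply: (noSz z2).
  have nSu z' w' u : (u <= l)%MS -> ~~ (u <= z)%MS -> z' != 0 -> (z' <= l)%MS ->
      (w' <= pl z')%MS -> ~~ (w' <= l)%MS -> ~~ (w' <= S u)%MS.
    move=> ul nu z'0 z'l w'z nw'; apply: contra (C u z' ul nu z'0 z'l) => h.
    by apply: submx_trans (pl_zw G Ll z'0 z'l w'z nw') _; rewrite addsmx_sub h andbT addsmxSl.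
  have ex u : (u <= l)%MS -> ~~ (u <= z)%MS ->
      exists2 t : F, t != 0 & ((w1 + t *: w2)%R <= S u)%MS.
    move=> ul nu; apply: (solid_param UE (SU u) (ES u ul nu)); first by rewrite rE rS.
      exact: (nSu z1).
    exact: (nSu z2).
  have gE (t : F) : t != 0 -> ~~ ((w1 + t *: w2)%R <= l + r)%MS.
    move=> t0; apply: contra nw2E => h.
    have e : w1 + t *: w2 = t *: w2 + w1 by rewrite addrC.
    by apply: (sub_lin t0 e); smx.
  pose tau u := odflt 0 [pick t : F | (t != 0) && ((w1 + t *: w2)%R <= S u)%MS].
  have tauP u : (u <= l)%MS -> ~~ (u <= z)%MS -> (tau u != 0) && ((w1 + tau u *: w2)%R <= S u)%MS.
    move=> ul nu; rewrite /tau; case: pickP => // no; have [t t0 ht] := ex u ul nu.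
    by move: (no t); rewrite t0 ht.
  have eqS u u' : (u <= l)%MS -> ~~ (u <= z)%MS -> (u' <= l)%MS -> ~~ (u' <= z)%MS -> tau u = tau u' ->
     (S u <= S u')%MS.
    move=> ul nu ul' nu' e; case/andP: (tauP u ul nu) => t0 h; case/andP: (tauP u' ul' nu') => _.
    rewrite -e => h'; have Eu := ES u ul nu; have Eu' := ES u' ul' nu'.
    apply: (@submx_trans _ _ _ _ _ _ (l + r + (w1 + tau u *: w2)%R)%MS); last by smx.
    apply: vs_eq; first by smx.
    by rewrite rank_addv ?gE // rE rS.
  have tauz u : (u <= l)%MS -> ~~ (u <= z)%MS -> tau u != tz.
    move=> ul nu; apply/eqP => e; case/andP: (tauP u ul nu) => t0; rewrite e => h.
    case/negP: (C u z ul nu z0 zl); apply: submx_trans pzS _.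
    have Eu := ES u ul nu.
    apply: (@submx_trans _ _ _ _ _ _ (l + r + (w1 + tz *: w2)%R)%MS); last by smx.
    have ls : (l + r <= Sz)%MS by rewrite /Sz; smx.
    apply: vs_eq; first by smx.
    by rewrite rank_addv ?gE // rE rSz.
  pose As := vset l :\: vset z.
  have inA u : u \in As -> (u <= l)%MS /\ ~~ (u <= z)%MS by rewrite !inE => /andP[].
  have cA : #|As| = (q ^ 2 - q)%N by rewrite card_vsetD // rl rank_vec.
  (* Vectors u with the same label share the solid S u, so all points r + u lie in one [Yset] of a
     lone point, which has q elements. *)
  have fib (t : F) : (#|[set u in As | tau u == t]| <= q)%N.
    have [->|[u0]] := set_0Vmem [set u in As | tau u == t]; first by rewrite cards0.
    rewrite inE => /andP[/inA[u0l nu0] /eqP t0].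
    have [P0 r0] := A u0 u0l nu0; have [_ _ cnt] := lone_count G Ll (far_u _ u0l nu0) (lone_u _ u0l nu0).
    have hm : <<n u0>>%MS \in lthru L (r + u0).
      by apply: line_of => //; rewrite ?capmxSl //; apply: nmem.
    rewrite -(cnt _ hm) -(card_imset _ (addrI r)); apply: subset_leq_card.
    apply/subsetP => y /imsetP[u]; rewrite inE => /andP[/inA[ul nu] /eqP tu] ->.
    have [Pu ru] := A u ul nu.
    rewrite YsetE Pu inE; apply/andP; split.
      by rewrite opprD addrACA subrr add0r; smx.
    rewrite /= -{1}ru; apply: mxrankS; rewrite sub_capmx capmxSl /=.
    apply: submx_trans (addsmxSr l (n u)) _.
    have := eqS u u0 ul nu u0l nu0; rewrite tu t0 => /(_ erefl) h; apply: submx_trans h _.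
    by rewrite addsmx_sub addsmxSl; apply: submx_trans (addsmxSr _ _); rewrite genmxE.
  have : (#|As| <= \sum_(t in [set~ (0%R : F)] :\ tz) q)%N.
    rewrite -sum1_card (partition_big tau [in [set~ (0%R : F)] :\ tz]).
      apply: leq_sum => t _; by rewrite sum1_card; have := fib t; rewrite cardsE.
    move=> u /inA[ul nu]; rewrite !inE tauz //=; by case/andP: (tauP u ul nu).
  rewrite sum_nat_const cA; have := cardsC1 (0%R : F).
  rewrite (cardsD1 tz) !inE tz0 /= add1n; set k := #|_ :\ tz|.
  move=> e; have : k.+2 = q by rewrite e prednK // ltnW // q_gt1.
  move=> <-; clear; rewrite expnS expn1; nia.
have [v [vl nv]] := l_other G Ll z0.
(* A third scalar exists because q > 2; it gives the third plane in the solid. *)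
have [c c0 c1] : exists2 c : F, c != 0 & c != 1.
  apply/exists_inP; apply: contraTT q2; rewrite negb_exists_in => /forall_inP no.
  rewrite -leqNgt; have <- : #|[set (0 : F); 1]| = 2%N by rewrite cards2 eq_sym oner_neq0.
  apply: subset_leq_card; apply/subsetP => c _; rewrite !inE.
  by have [//|c0] := eqVneq c 0; move: (no c c0); rewrite negbK.
have f1 d : ((v + d *: z)%R <= l)%MS by smx.
have f2 d : ~~ ((v + d *: z)%R <= z)%MS by rewrite addrC addv_sub_eq //; smx.
have f3 d : v + d *: z != 0 := notsub_nz (f2 d).
have rD0 := rD _ (f3 0) (f1 0).
have := solid3 G rD0 (l_PP Ll (f3 0) (f1 0)) (l_PP Ll (f3 1) (f1 1)) (l_PP Ll (f3 c) (f1 c))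
  (key _ _ (f1 0) (f2 0) (f1 0) (f2 0)) (key _ _ (f1 0) (f2 0) (f1 1) (f2 1))
  (key _ _ (f1 0) (f2 0) (f1 c) (f2 c)).
have an d e : d != e -> ~~ ((v + d *: z)%R <= (v + e *: z)%R)%MS by apply: affine_nonpar.
by rewrite !(negbTE (an _ _ _)) // eq_sym ?oner_neq0.
Qed.

(** Suppose no other point of the coset is lone. Then every x + z has a direction z'; unless z' is
    parallel to z, some x + a zi with zi one of z1, z2 has two directions and is lone. So x has
    every direction, which is excluded for q > 2. *)
Lemma lone_other x z1 z2 : far L l x -> z1 != 0 -> z2 != 0 -> (z1 <= l)%MS -> (z2 <= l)%MS ->
  ~~ (z1 <= z2)%MS -> dist2 L z1 x -> dist2 L z2 x ->
  exists v, [/\ (v <= l)%MS, v != 0 & lone L l (x + v)].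
Proof.
move=> fx z10 z20 z1l z2l n12 d1 d2.
have lx := lone_two G Ll fx z10 z20 z1l z2l n12 d1 d2.
have [PPx one cntx] := lone_count G Ll fx lx.
have [/existsP[v /and3P[]]|no] := boolP [exists v, [&& (v <= l)%MS, v != 0 & lone L l (x + v)]].
  by exists v.
have {}no v : (v <= l)%MS -> v != 0 -> ~~ lone L l (x + v).
  by move=> vl v0; move: no; rewrite negb_exists => /forallP/(_ v); rewrite vl v0.
have farv v : (v <= l)%MS -> far L l (x + v) by move=> vl; apply: far_shift => //; apply: PPx.
have all2 z : z != 0 -> (z <= l)%MS -> dist2 L z x.
  move=> z0 zl.
  have [z' [z'0 z'l dz']] : exists z', [/\ z' != 0, (z' <= l)%MS & dist2 L z' (x + z)].
    have [/existsP[z' /and3P[]]|nz'] := boolP [exists z', [&& z' != 0, (z' <= l)%MS & dist2 L z' (x + z)]].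
      by exists z'.
    case/negP: (no z zl z0); apply: (lone_none G Ll (farv z zl)) => z' z'0 z'l.
    by move: nz'; rewrite negb_exists => /forallP/(_ z'); rewrite z'0 z'l.
  have [zz|nzz] := boolP (z' <= z)%MS.
    have := dist2_shift G (-1) (l_PP Ll z0 zl) (dist2_par z'0 zz dz').
    by rewrite scaleN1r addrK.
  have [zi [zi0 zil ni di]] : exists zi, [/\ zi != 0, (zi <= l)%MS, ~~ (zi <= z')%MS & dist2 L zi x].
    have [h1|n1] := boolP (z1 <= z')%MS; last by exists z1.
    exists z2; split=> //; apply: contra n12 => h2.
    by apply: submx_trans h1 _; apply: sub_vec_sym h2.
  have niz : ~~ (z' <= zi)%MS by apply: contra ni; apply: sub_vec_sym.
  have [a [b e]] := sub_span2P (submx_trans zl (span_l G Ll zi0 zil z'l niz)).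
  have da : dist2 L zi (x + a *: zi) by apply: dist2_shift (l_PP Ll zi0 zil) di.
  have db : dist2 L z' (x + a *: zi).
    have := dist2_shift G (- b) (l_PP Ll z'0 z'l) dz'.
    by rewrite e scaleNr addrA addrK.
  have [a0|a0] := eqVneq a 0.
    case/negP: nzz; apply: (sub_vec_sym z0); rewrite e a0 scale0r add0r; smx.
  have ail : (a *: zi <= l)%MS by smx.
  have ai0 : a *: zi != 0 by rewrite scaler_eq0 negb_or a0.
  case/negP: (no _ ail ai0); apply: (lone_two G Ll (farv _ ail) zi0 z'0 zil z'l) => //.
(* For q = 2 the only direction of x + z1 is z1, so the point that spoils its loneness is x itself;
   then x is not lone either. *)
have [q2|q2] := ltnP 2 q; first by case: (all_directions_false q2 fx all2).
have [v [vl v0 P' s]] := not_lone (no z1 z1l z10).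
have dv := fullpair G Ll (farv _ z1l) vl v0 P' s.
have d1' : dist2 L z1 (x + z1).
  by have := dist2_shift G 1 (l_PP Ll z10 z1l) d1; rewrite scale1r.
have /sub_vecP[c ev] : (v <= z1)%MS.
  apply: contraT => nv; case/negP: (no z1 z1l z10).
  exact: (lone_two G Ll (farv _ z1l) v0 z10 vl z1l nv dv d1').
have c0 : c != 0 by apply: contraNneq v0 => c0; rewrite ev c0 scale0r.
have c1 : c = -1.
  apply/eqP; apply: contraTT q2 => c1; rewrite -ltnNge.
  by rewrite (cardD1 0) (cardD1 (-1)) (cardD1 c) !inE oppr_eq0 oner_eq0 c0 c1.
move: s; rewrite ev c1 scaleN1r addrK => s.
have lP := loneP lx z1l z10 (PPx _ z1l); case/negP: lP.
have P1 := PPx _ z1l.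
apply: (@submx_trans _ _ _ _ _ _ (l + pl (x + z1)%R)%MS); first by smx.
by apply: vs_eq; [smx | rewrite (far_rankU G Ll fx) (far_rankU G Ll (farv _ z1l))].
Qed.

(** By [lone_pair] two lone points in the coset suffice. A point with two directions has a lone
    companion by [lone_other]. Otherwise, if some point has a direction z, all points off its line
    in direction z have none and are lone; and if no point has a direction, all are lone. *)
Lemma lone_hyper x : far L l x -> lone L l x ->
  exists H : 'M[F]_N, [/\ \rank H = 6%N, (l + pl x <= H)%MS &
     forall v, (v <= l)%MS -> PP (x + v) /\ (pl (x + v)%R <= H)%MS].
Proof.
move=> fx lx; have [PPx _ _] := lone_count G Ll fx lx.
have farv v : (v <= l)%MS -> far L l (x + v) by move=> vl; apply: far_shift => //; apply: PPx.
suff [a [v [al vl v0 la lv]]] : exists a v, [/\ (a <= l)%MS, (v <= l)%MS, v != 0, lone L l (x + a) &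
    lone L l (x + a + v)].
  have [H [rH aH vH]] := lone_pair G Ll (farv a al) la vl v0 lv.
  have all v' : (v' <= l)%MS -> (pl (x + v')%R <= H)%MS.
    move=> v'l; rewrite (_ : x + v' = x + a + (v' - a)); first by apply: vH; smx.
    by rewrite addrACA subrr addr0.
  exists H; split=> // [|v' v'l]; last by split; [apply: PPx | apply: all].
  have := all 0 (sub0mx _ _); rewrite addr0 => xH.
  by have lH : (l <= H)%MS; [apply: submx_trans aH; smx | smx].
have [/existsP[a /existsP[z1 /existsP[z2 /and5P[al z10 z20 z1l]]]]|no] :=
  boolP [exists a, exists z1, exists z2, [&& (a <= l)%MS, z1 != 0, z2 != 0, (z1 <= l)%MS &
     [&& (z2 <= l)%MS, ~~ (z1 <= z2)%MS, dist2 L z1 (x + a) & dist2 L z2 (x + a)]]].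
  case/and4P => z2l n12 d1 d2.
  have [v [vl v0 lv]] := lone_other (farv a al) z10 z20 z1l z2l n12 d1 d2.
  by exists a, v; split=> //; apply: (lone_two G Ll (farv a al) z10 z20).
have {}no a z1 z2 : (a <= l)%MS -> z1 != 0 -> z2 != 0 -> (z1 <= l)%MS -> (z2 <= l)%MS ->
    dist2 L z1 (x + a) -> dist2 L z2 (x + a) -> (z1 <= z2)%MS.
  move=> al z10 z20 z1l z2l d1 d2; apply: contraT => n12; move: no.
  rewrite negb_exists => /forallP/(_ a); rewrite negb_exists => /forallP/(_ z1).
  rewrite negb_exists => /forallP/(_ z2).
  by rewrite al z10 z20 z1l z2l n12 d1 d2.
have [/existsP[a /existsP[z /and4P[al z0 zl dz]]]|none] :=
  boolP [exists a, exists z, [&& (a <= l)%MS, z != 0, (z <= l)%MS & dist2 L z (x + a)]].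
  have [v [vl nv]] := l_other G Ll z0.
  have lo t : (t <= l)%MS -> ~~ (t <= z)%MS -> lone L l (x + a + t).
    move=> tl nt; have fa : far L l (x + a + t) by rewrite -addrA; apply: farv; smx.
    apply: (lone_none G Ll fa) => z' z'0 z'l; apply/negP => dz'.
    have [zz|nzz] := boolP (z' <= z)%MS.
      case/negP: nt; apply: (dist2_coset G Ll (farv a al) z0 zl tl (far_PP fa) dz).
      exact: dist2_par zz dz'.
    have [c [h1 h2]] := dist2_meet G Ll tl z0 zl z'0 z'l nzz dz dz'.
    case/negP: nzz; apply: (no (a + c *: z)) => //; [smx | by rewrite addrA | by rewrite addrA].
  exists (a + v), z; split=> //; first by smx.
    by rewrite addrA; apply: lo.
  rewrite addrA -(addrA _ v); apply: lo; first by smx.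
  by rewrite addrC addv_sub_eq.
have lo t : (t <= l)%MS -> lone L l (x + t).
  move=> tl; apply: (lone_none G Ll (farv t tl)) => z' z'0 z'l; apply/negP => dz'.
  move: none; rewrite negb_exists => /forallP/(_ t); rewrite negb_exists => /forallP/(_ z').
  by rewrite tl z'0 z'l dz'.
have [v [vl nv]] : exists v, (v <= l)%MS /\ ~~ (v <= (0 : 'rV[F]_N))%MS.
  by apply: ex_outside; rewrite rl mxrank0.
exists 0, v; rewrite sub0mx addr0; split=> //; [exact: notsub_nz nv | exact: lo].
Qed.

End Exceptional2.

(** * Pentagons *)

Section Pentagon.
Local Open Scope ring_scope.
Variables (F : finFieldType) (N : nat) (L : {set 'M[F]_N}).
Hypothesis G : flat L.
Local Notation q := #|F|.
Local Notation PP := (hpoint L).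
Local Notation pl := (tplane L).
Implicit Types (x y z u v w t s r e : 'rV[F]_N) (l m n S E U : 'M[F]_N).

Definition pent e1 e2 e3 e4 e5 := [/\ [/\ PP e1, PP e2, PP e3, PP e4 & PP e5],
  [/\ (e2 <= pl e1)%MS, (e3 <= pl e2)%MS, (e4 <= pl e3)%MS, (e5 <= pl e4)%MS & (e1 <= pl e5)%MS] &
  \rank (e1 + e2 + e3 + e4 + e5)%MS = 5%N].

Lemma pent_rot e1 e2 e3 e4 e5 : pent e1 e2 e3 e4 e5 -> pent e2 e3 e4 e5 e1.
Proof.
case=> -[P1 P2 P3 P4 P5] [h1 h2 h3 h4 h5] r; split=> //.
by rewrite -r; apply/eqmx_rank/andP; split; smx.
Qed.

Lemma pent_ref e1 e2 e3 e4 e5 : pent e1 e2 e3 e4 e5 -> pent e5 e4 e3 e2 e1.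
Proof.
case=> -[P1 P2 P3 P4 P5] [h1 h2 h3 h4 h5] r; split=> //.
  by split; apply: (pl_sym G) => //; apply: PP0; eassumption.
by rewrite -r; apply/eqmx_rank/andP; split; smx.
Qed.

Lemma pent_indep e1 e2 e3 e4 e5 : pent e1 e2 e3 e4 e5 ->
  [/\ ~~ (e2 <= e1)%MS, ~~ (e3 <= e1 + e2)%MS, ~~ (e4 <= e1 + e2 + e3)%MS &
      ~~ (e5 <= e1 + e2 + e3 + e4)%MS].
Proof.
case=> -[P1 P2 P3 P4 P5] _ r.
have r1 := rank_vec (PP0 P1).
have r2 := rank_addv_le e1 e2; have r3 := rank_addv_le (e1 + e2)%MS e3.
have r4 := rank_addv_le (e1 + e2 + e3)%MS e4.
have r5 := rank_addv_le (e1 + e2 + e3 + e4)%MS e5.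
have key k (A : 'M[F]_(k, N)) v : (\rank A < \rank (A + v)%MS)%N -> ~~ (v <= A)%MS.
  apply: contraL => vA; rewrite -leqNgt; apply: mxrankS; smx.
split; apply: key; move: r r1 r2 r3 r4 r5; clear; lia.
Qed.

Section OnePent.
Variables e1 e2 e3 e4 e5 : 'rV[F]_N.
Hypothesis pe : pent e1 e2 e3 e4 e5.
Local Notation U := (e1 + e2 + e3 + e4 + e5)%MS.
Local Notation l := (<<(e1 + e2)%MS>>%MS).

Lemma pent_l : l \in L.
Proof.
case: pe => -[P1 P2 P3 P4 P5] [h1 h2 h3 h4 h5] _; case: (pent_indep pe) => n1 _ _ _.
exact: pl_line.
Qed.

Lemma pent_pl4 : (pl e4 <= e3 + e4 + e5)%MS.
Proof.
have pe' := pent_rot (pent_rot pe).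
case: pe => -[P1 P2 P3 P4 P5] [h1 h2 h3 h4 h5] _; case: (pent_indep pe') => n1 n2 _ _.
have h3' := pl_sym G P3 h3 (PP0 P4).
apply: (full2 G P4 h3' h4); try by smx.
  by apply: contra n1; apply: sub_vec_sym; apply: PP0 P3.
by rewrite addsmxC.
Qed.

Lemma pent_U : (l + pl e4 :=: U)%MS.
Proof.
have p4 := pent_pl4; have pe' := pent_rot (pent_rot pe).
case: pe => -[P1 P2 P3 P4 P5] [h1 h2 h3 h4 h5] _.
have a3 := pl_sym G P3 h3 (PP0 P4); have a4 := mem_pl G P4.
apply/eqmxP/andP; split.
  rewrite addsmx_sub genmxE; apply/andP; split; first by smx.
  by apply: submx_trans p4 _; smx.
have : (e1 + e2 <= l + pl e4)%MS by apply: submx_trans (addsmxSl _ _); rewrite genmxE.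
by rewrite addsmx_sub => /andP[? ?]; smx.
Qed.

Lemma pent_far : far L l e4.
Proof.
case: (pe) => -[P1 P2 P3 P4 P5] [h1 h2 h3 h4 h5] r.
apply: farI => // v v0; rewrite genmxE => v12; apply/negP => v4.
have v345 := submx_trans v4 pent_pl4.
have := mxrank_sum_cap (e1 + e2)%MS (e3 + e4 + e5)%MS.
have -> : \rank (e1 + e2 + (e3 + e4 + e5))%MS = 5%N.
  by rewrite -r; apply/eqmx_rank/andP; split; smx.
have : (1 <= \rank ((e1 + e2) :&: (e3 + e4 + e5))%MS)%N.
  by rewrite -[X in (X <= _)%N](rank_vec v0) mxrankS // sub_capmx v12.
have := rank_addv_le e1 e2; have := rank_addv_le e3 e4; have := rank_addv_le (e3 + e4)%MS e5.
rewrite (rank_vec (PP0 P1)) (rank_vec (PP0 P3)); clear; lia.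
Qed.

Lemma pent_lone : lone L l e4.
Proof.
case: (pe) => -[P1 P2 P3 P4 P5] [h1 h2 h3 h4 h5] r; case: (pent_indep pe) => n1 _ _ _.
apply: (lone_two G pent_l pent_far (z1 := e2) (z2 := e1)); rewrite ?genmxE ?(PP0 P1) ?(PP0 P2) //; try by smx.
  by apply: (dist2P (PP0 P3)).
by apply: (dist2P (PP0 P5)); apply: (pl_sym G) => //; [exact: PP0 P1 | exact: PP0 P5].
Qed.

(** The vertex e4 has the directions e1 and e2 on their line, so it is lone and [lone_hyper]
    provides a hyperplane. The plane at e4 + e1 meets U in a line, so U and this plane already span
    it, as 5 + 3 - 2 = 6. *)
Lemma pentH : let H := (U + pl (e4 + e1)%R)%MS in \rank H = 6%N /\
   forall v, (v <= e1 + e2)%MS -> PP (e4 + v) /\ (pl (e4 + v)%R <= H)%MS.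
Proof.
case: (pe) => -[P1 P2 P3 P4 P5] [h1 h2 h3 h4 h5] r H.
have e1l : (e1 <= l)%MS by rewrite genmxE; smx.
have [PPx one _] := lone_count G pent_l pent_far pent_lone.
have [H' [rH' UH' hv]] := lone_hyper G pent_l pent_far pent_lone.
have [Q1 H1] := hv _ e1l.
have HH' : (H <= H')%MS by rewrite addsmx_sub H1 andbT -pent_U.
have rH : \rank H = 6%N.
  have := mxrank_sum_cap (pl (e4 + e1)%R) (l + pl e4)%MS.
  rewrite (one _ e1l (PP0 P1)) (rank_pl G Q1) (far_rankU G pent_l pent_far).
  have -> : \rank (pl (e4 + e1)%R + (l + pl e4))%MS = \rank H.
    apply/eqmx_rank/andP; rewrite /H; split; rewrite addsmx_sub; apply/andP; split; try by smx.
      by rewrite pent_U; smx.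
    by rewrite -pent_U; smx.
  clear; lia.
split=> // v v12; have vl : (v <= l)%MS by rewrite genmxE.
have [Q Hv] := hv _ vl; split=> //; apply: submx_trans Hv _.
by apply: vs_eq => //; rewrite rH rH'.
Qed.

End OnePent.

Lemma pent_next e1 e2 e3 e4 e5 : pent e1 e2 e3 e4 e5 ->
  (e1 + e2 + e3 + e4 + e5 + pl (e4 + e2)%R <= e1 + e2 + e3 + e4 + e5 + pl (e4 + e1)%R)%MS.
Proof.
move=> pe; have [_ h] := pentH pe; have e2s : (e2 <= e1 + e2)%MS by smx.
by have [_ ?] := h _ e2s; smx.
Qed.

(* Going round the diagonals of the pentagon shows that they all give the same hyperplane. *)
Lemma pent_diag e1 e2 e3 e4 e5 : pent e1 e2 e3 e4 e5 ->
  (e1 + e2 + e3 + e4 + e5 + pl (e4 + e1)%R <= e1 + e2 + e3 + e4 + e5 + pl (e1 + e3)%R)%MS.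
Proof.
move=> p1; have p2 := pent_rot p1; have p3 := pent_rot p2.
have := pent_next p3; rewrite [(e1 + e4)%R]addrC => h.
rewrite addsmx_sub addsmxSl /=; apply: submx_trans (addsmxSr _ _) (submx_trans h _).
by smx.
Qed.

Lemma pent_rotH e1 e2 e3 e4 e5 : pent e1 e2 e3 e4 e5 ->
  (e2 + e3 + e4 + e5 + e1 + pl (e5 + e2)%R <= e1 + e2 + e3 + e4 + e5 + pl (e4 + e1)%R)%MS.
Proof.
move=> p1; have p2 := pent_rot p1; have p3 := pent_rot p2; have p4 := pent_rot p3.
have p5 := pent_rot p4.
have s1 := pent_next p1; rewrite [(e4 + e2)%R]addrC in s1.
have s2 := pent_diag p2.
have : (e2 + e3 + e4 + e5 + e1 + pl (e2 + e4)%R <= e1 + e2 + e3 + e4 + e5 + pl (e4 + e1)%R)%MS.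
  rewrite addsmx_sub; apply/andP; split; first by smx.
  by apply: submx_trans (addsmxSr _ _) s1.
exact: submx_trans s2.
Qed.

Lemma pent_refH e1 e2 e3 e4 e5 : pent e1 e2 e3 e4 e5 ->
  (e5 + e4 + e3 + e2 + e1 + pl (e2 + e5)%R <= e1 + e2 + e3 + e4 + e5 + pl (e4 + e1)%R)%MS.
Proof.
move=> p1; have := pent_rotH p1; rewrite [(e2 + e5)%R]addrC => h.
rewrite addsmx_sub; apply/andP; split; first by smx.
by apply: submx_trans (addsmxSr _ _) h.
Qed.

(** Up to a scalar u = r + v with r = e4 + mu e3 and v on the line of e1 and e2. The point r is far
    from that line with direction e2, and its coset contains a lone point, so all planes of the
    coset lie in one hyperplane H'. It remains to see that H' is H. *)
Lemma pent_solid e1 e2 e3 e4 e5 u : pent e1 e2 e3 e4 e5 ->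
  (u <= e1 + e2 + e3 + e4)%MS -> ~~ (u <= e1 + e2 + e3)%MS ->
  PP u /\ (pl u <= e1 + e2 + e3 + e4 + e5 + pl (e4 + e1)%R)%MS.
Proof.
move=> pe /sub_addvP[b [c [bb eu]]] nu.
have c0 : c != 0 by apply: contraNneq nu => c0; rewrite eu c0 scale0r addr0.
have [a [d [aa eb]]] := sub_addvP bb.
have eu' : u = c *: (e4 + (d / c) *: e3 + c^-1 *: a).
  by rewrite !scalerDr !scalerA mulrCA divff // mulr1 scale1r eu eb addrC addrA addrAC.
rewrite eu' PP_scale // pl_scale //.
have : (c^-1 *: a <= e1 + e2)%MS by smx.
move: (d / c) (c^-1 *: a) => mu v v12 {eu eu' nu a aa eb b bb c c0 d u}.
set H := (_ + pl _)%MS.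
have [rH hv] := pentH pe.
case: (pe) => -[P1 P2 P3 P4 P5] [h1 h2 h3 h4 h5] rU.
case: (pent_indep pe) => n2 n3 n4 n5.
have [->|mu0] := eqVneq mu 0; first by rewrite scale0r addr0; apply: hv.
pose l := <<(e1 + e2)%MS>>%MS; have Ll : l \in L := pent_l pe.
have fx : far L l e4 := pent_far pe.
have e1l : (e1 <= l)%MS by rewrite genmxE; smx.
have e2l : (e2 <= l)%MS by rewrite genmxE; smx.
have vl : (v <= l)%MS by rewrite genmxE.
pose r := e4 + mu *: e3.
have e4r : e4 = r - mu *: e3 by rewrite addrK.
have e3e3 := mem_pl G P3.
have e3e2 := pl_sym G P2 h2 (PP0 P3).
have re3 : (r <= pl e3)%MS by rewrite /r; smx.
have nr : ~~ (r <= pl e2)%MS.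
  rewrite /r addrC addv_sub_eq; last by smx.
  exact: (far_no2 G Ll fx (PP0 P2) e2l).
have r0 := notsub_nz nr; have Pr := pl_PP G P3 re3 r0.
have e3r := pl_sym G P3 re3 r0.
have fr : far L l r.
  apply: farI => // t t0 tl; apply/negP => tr.
  have [te|nte] := boolP (t <= e2)%MS.
    case/negP: nr; suff <- : pl t = pl e2 by apply: pl_sym tr t0.
    by apply: pl_eqmx; apply/eqmxP; rewrite te sub_vec_sym.
  have te2 := submx_trans tl (l_pl Ll (PP0 P2) e2l).
  have := mid_uniq G P2 Pr nr (PP0 P3) t0 h2 e3r te2 tr => h.
  case/negP: n3; apply: submx_trans h _; by move: tl; rewrite genmxE.
have d2r : dist2 L e2 r by apply: (dist2P (PP0 P3)).
have rot := pent_rot (pent_rot pe).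
have [_ hy] := pentH rot.
have [Py yH] : PP (r + e1) /\ (pl (r + e1)%R <= H)%MS.
  rewrite addrC; have rs : (r <= e3 + e4)%MS by rewrite /r; smx.
  have [Q s] := hy _ rs; split=> //; apply: submx_trans s _.
  have := submx_trans (pent_rotH (pent_rot pe)) (pent_rotH pe); exact: id.
have fy : far L l (r + e1) by apply: far_shift.
have ne12 : ~~ (e1 <= e2)%MS by apply: contra n2; apply: sub_vec_sym; exact: PP0 P1.
(* If r + e1 has a direction z', the lines r + <e2> and r + e1 + <z'> meet in a point with two
   directions, which is lone; otherwise r + e1 itself is lone. *)
have [a [al fa loa]] : exists a, [/\ (a <= l)%MS, far L l (r + a) & lone L l (r + a)].
  have [/existsP[z' /and3P[z'0 z'l dz']]|none] :=
    boolP [exists z', [&& z' != 0, (z' <= l)%MS & dist2 L z' (r + e1)]].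
    have nz' : ~~ (z' <= e2)%MS.
      apply/negP => h; case/negP: ne12.
      exact: (dist2_coset G Ll fr (PP0 P2) e2l e1l Py d2r (dist2_par z'0 h dz')).
    have [c [c1 c2]] := dist2_meet G Ll e1l (PP0 P2) e2l z'0 z'l nz' d2r dz'.
    have cl : (c *: e2 <= l)%MS by smx.
    have s3 : ((r + c *: e2)%R <= pl e3)%MS by smx.
    have nz3 : r + c *: e2 != 0.
      apply: (@notsub_nz _ _ _ _ (pl e2)); rewrite addrC addv_sub_eq //.
      by have := mem_pl G P2 => ?; smx.
    have fc := far_shift G Ll fr cl (pl_PP G P3 s3 nz3).
    exists (c *: e2); split=> //.
    apply: (lone_two G Ll fc (PP0 P2) z'0 e2l z'l _ c1 c2).
    by apply: contra nz'; apply: sub_vec_sym; exact: PP0 P2.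
  exists e1; split=> //; apply: (lone_none G Ll fy) => z' z'0 z'l.
  by move: none; rewrite negb_exists => /forallP/(_ z'); rewrite z'0 z'l.
have [H' [rH' lH' hv']] := lone_hyper G Ll fa loa.
have hr t : (t <= l)%MS -> PP (r + t) /\ (pl (r + t)%R <= H')%MS.
  move=> tl; rewrite (_ : r + t = r + a + (t - a)); first by apply: hv'; smx.
  by rewrite addrACA subrr addr0.
have [Q s] := hr _ vl; rewrite -/r; split=> //; apply: submx_trans s _.
have rH1 : \rank H = 6%N by [].
have lH1 : (l <= H')%MS by apply: submx_trans lH'; smx.
have [_ rH2] := hr 0 (sub0mx _ _); rewrite addr0 in rH2.
have [_ yH2] := hr _ e1l.
have e3H := submx_trans e3r rH2; have rrH := submx_trans (mem_pl G Pr) rH2.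
pose S := (l + r + e3)%MS.
have SU : (S <= e1 + e2 + e3 + e4 + e5)%MS.
  by rewrite /S addsmx_sub addsmx_sub genmxE /r; apply/andP; split; [apply/andP; split|]; smx.
have rS : \rank S = 4%N.
  rewrite rank_addv ?(far_rankE G Ll fr) //; apply/negP => /sub_addvP[t [c [tl e]]].
  have : (e3 - c *: r <= pl r)%MS by have := mem_pl G Pr => ?; smx.
  have te : t = e3 - c *: r by rewrite e addrK.
  have [t0|t0] := eqVneq t 0.
    case/negP: nr; move: te; rewrite t0 => /esym/eqP; rewrite subr_eq0 => /eqP e3c.
    apply: submx_trans h2; apply: (sub_vec_sym (PP0 P3)); rewrite e3c; smx.
  move=> _; case/negP: (far_no fr t0 tl); rewrite te; have := mem_pl G Pr => ?; smx.
(* By [typeA] the solid S sticks out of l + pl (r + e1). Together they span H' and both lie in H. *)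
have nSU : ~~ (S <= l + pl (r + e1)%R)%MS.
  apply/negP => s; case/negP: ne12.
  apply: (typeA G Ll fr (PP0 P2) e2l (PP0 P3) h2 re3 e1l Py); rewrite -/S.
  have := rank_cap_ge (addsmxSr l (pl (r + e1)%R)) s.
  by rewrite (rank_pl G Py) rS (far_rankU G Ll fy); clear; lia.
have [t [tS nt]] : exists t, (t <= S)%MS /\ ~~ (t <= l + pl (r + e1)%R)%MS.
  by case/row_subPn: nSU => i ni; exists (row i S); rewrite row_sub.
have tH : (t <= H)%MS by rewrite /H; have := submx_trans tS SU => ?; smx.
have tH' : (t <= H')%MS by apply: submx_trans tS _; rewrite /S; smx.
have lH : (l <= H)%MS by rewrite genmxE /H; smx.
apply: (@submx_trans _ _ _ _ _ _ (l + pl (r + e1)%R + t)%MS); last by smx.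
by apply: vs_eq; [smx | rewrite rank_addv // (far_rankU G Ll fy) rH'].
Qed.

(** Vectors without e4-component are handled by reflected and rotated pentagons, which all have the
    same hyperplane. The point e2 is left over, and its plane lies in U. *)
Lemma pent_full e1 e2 e3 e4 e5 u : pent e1 e2 e3 e4 e5 -> u != 0 ->
  (u <= e1 + e2 + e3 + e4)%MS ->
  PP u /\ (pl u <= e1 + e2 + e3 + e4 + e5 + pl (e4 + e1)%R)%MS.
Proof.
move=> pe u0 us.
have [u1|n1] := boolP (u <= e1 + e2 + e3)%MS; last exact: pent_solid.
have refp := pent_rot (pent_ref pe).
have refH := submx_trans (pent_rotH (pent_ref pe)) (pent_refH pe).
have [u2|n2] := boolP (u <= e4 + e3 + e2)%MS; last first.
  have us' : (u <= e4 + e3 + e2 + e1)%MS by apply: submx_trans us _; smx.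
  by have [Q s] := pent_solid refp us' n2; split=> //; apply: submx_trans s _.
have [[P1 P2 P3 P4 P5] [h1 h2 h3 h4 h5] _] := pe.
have [_ _ n4 _] := pent_indep pe.
have u3 : (u <= e2 + e3)%MS.
  have u2' : (u <= e2 + e3 + e4)%MS by apply: submx_trans u2 _; smx.
  have [a [c [aa e]]] := sub_addvP u2'.
  have [c0|c0] := eqVneq c 0; first by rewrite e c0 scale0r addr0.
  case/negP: n4; apply: (sub_lin c0 (r := a) (d := u)) => //; first by rewrite e addrC.
  by apply: submx_trans aa _; smx.
have [/sub_vecP[c e]|n3] := boolP (u <= e2)%MS.
  have c0 : c != 0 by apply: contraNneq u0 => c0; rewrite e c0 scale0r.
  rewrite e PP_scale // pl_scale //; split=> //.
  have := pent_pl4 (pent_rot (pent_rot (pent_rot pe))) => s; apply: submx_trans s _; smx.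
have p5 := pent_rot (pent_rot (pent_rot (pent_rot pe))).
have us5 : (u <= e5 + e1 + e2 + e3)%MS by apply: submx_trans u3 _; smx.
have n5 : ~~ (u <= e5 + e1 + e2)%MS.
  have [c [d e]] := sub_span2P u3.
  have d0 : d != 0 by apply: contraNneq n3 => d0; rewrite e d0 scale0r addr0; smx.
  have [_ _ nn _] := pent_indep p5.
  apply: contra nn => h; apply: (sub_lin d0 (r := c *: e2) (d := u)) => //; first by rewrite e addrC.
  by smx.
have [Q s] := pent_solid p5 us5 n5; split=> //; apply: submx_trans s _.
have R1 := pent_rotH pe; have R2 := pent_rotH (pent_rot pe).
have R3 := pent_rotH (pent_rot (pent_rot pe)); have R4 := pent_rotH (pent_rot (pent_rot (pent_rot pe))).
exact: submx_trans R4 (submx_trans R3 (submx_trans R2 R1)).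
Qed.

End Pentagon.

(** * Counting directions *)

Lemma double_count (T1 T2 : finType) (A : {set T1}) (B : {set T2}) (r : T1 -> T2 -> bool) :
  \sum_(x in A) #|[set y in B | r x y]| = \sum_(y in B) #|[set x in A | r x y]|.
Proof.
have h (S1 S2 : finType) (C : {set S1}) (D : {set S2}) (p : S1 -> S2 -> bool) :
  \sum_(x in C) #|[set y in D | p x y]| = \sum_(x in C) \sum_(y in D) p x y.
  apply: eq_bigr => x _; rewrite -sum1_card big_mkcond [RHS]big_mkcond.
  by apply: eq_bigr => y _; rewrite inE; case: (y \in D); case: (p x y).
rewrite h exchange_big /=; apply: eq_bigr => y _.
rewrite -sum1_card big_mkcond [RHS]big_mkcond.
by apply: eq_bigr => x _; rewrite inE; case: (x \in A); case: (r x y).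
Qed.

Lemma card_nz (F : finFieldType) N m (A : 'M[F]_(m, N)) :
  #|[set x : 'rV[F]_N | (x <= A)%MS && (x != 0%R)]| = #|F| ^ \rank A - 1.
Proof.
rewrite -card_vset (cardsD1 0%R (vset A)) inE sub0mx add1n subn1 /=.
by apply: eq_card => x; rewrite !inE andbC.
Qed.

Section Counting.
Local Open Scope ring_scope.
Variables (F : finFieldType) (N : nat) (L : {set 'M[F]_N}).
Hypothesis G : flat L.
Local Notation q := #|F|.
Local Notation PP := (hpoint L).
Local Notation pl := (tplane L).
Implicit Types (x y z u v w t s r e : 'rV[F]_N) (l m n S E U H : 'M[F]_N).

Lemma card_PP : (#|[set x | PP x]| = #|L| * q.-1)%N.
Proof.
have q1 := q_gt1 F.
have := double_count [set x | PP x] L (fun x l => (x <= l)%MS).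
rewrite (eq_bigr (fun=> q.+1)) => [|x]; last by rewrite inE => /(fl_pt G).
rewrite sum_nat_const.
rewrite (eq_bigr (fun=> (q ^ 2 - 1)%N)) => [|l Ll]; last first.
  rewrite -(fl_rank G Ll) -card_nz; apply: eq_card => x; rewrite !inE andbC.
  have [xl|//] := boolP (x <= l)%MS; have [->|x0] := eqVneq x 0; first by rewrite /hpoint eqxx.
  by rewrite (line_PP Ll xl).
rewrite sum_nat_const; have -> : (q ^ 2 - 1 = q.-1 * q.+1)%N.
  by move: q1; clear; case: #|F| => // k _; rewrite expnS expn1; nia.
by rewrite mulnA => /eqP; rewrite eqn_pmul2r // => /eqP.
Qed.

(** A point whose plane lies in H has all its q + 1 lines in H, and each line has (q - 1)(q + 1)
    nonzero vectors; the factor q + 1 cancels. *)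
Lemma card_full H : (#|[set x | PP x && (pl x <= H)%MS]| <= nb_in L H * q.-1)%N.
Proof.
have q1 := q_gt1 F.
have := double_count [set x | PP x && (pl x <= H)%MS] [set l in L | (l <= H)%MS] (fun x l => (x <= l)%MS).
rewrite (eq_bigr (fun=> q.+1)) => [|x]; last first.
  rewrite inE => /andP[Px xH]; rewrite -(fl_pt G Px); apply: eq_card => l; rewrite !inE -andbA.
  have [Ll|//] := boolP (l \in L); have [xl|] := boolP (x <= l)%MS; last by rewrite andbF.
  by rewrite andbT /= (submx_trans _ xH) // lthru_pl // inE Ll.
rewrite sum_nat_const => e.
have : (\sum_(y in [set l in L | (l <= H)%MS])
    #|[set x in [set x | PP x && (pl x <= H)%MS] | (x <= y)%MS]| <= \sum_(y in [set l in L | (l <= H)%MS]) (q.-1 * q.+1))%N.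
  apply: leq_sum => l; rewrite inE => /andP[Ll lH].
  have -> : (q.-1 * q.+1 = q ^ 2 - 1)%N.
    by move: q1; clear; case: #|F| => // k _; rewrite expnS expn1; nia.
  rewrite -(fl_rank G Ll) -card_nz; apply: subset_leq_card; apply/subsetP => x.
  by rewrite !inE => /andP[/andP[/PP0 -> _] ->].
rewrite -e sum_nat_const mulnA leq_pmul2r //.
Qed.

(** The rank is five because l and [pl x] are complementary and w1, x, w2 span [pl x]: otherwise w1
    and z2 would be two common neighbours of z1 and w2. *)
Lemma pent_of l x z1 z2 w1 w2 : l \in L -> far L l x -> z1 != 0 -> z2 != 0 ->
  (z1 <= l)%MS -> (z2 <= l)%MS -> ~~ (z1 <= z2)%MS ->
  w1 != 0 -> (w1 <= pl z1)%MS -> (x <= pl w1)%MS ->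
  w2 != 0 -> (w2 <= pl z2)%MS -> (x <= pl w2)%MS ->
  pent L z2 z1 w1 x w2.
Proof.
move=> Ll fx z10 z20 z1l z2l n12 w10 w1z xw1 w20 w2z xw2.
have Px := far_PP fx; have P1 := l_PP Ll z10 z1l; have P2 := l_PP Ll z20 z2l.
have Q1 := pl_PP G P1 w1z w10; have Q2 := pl_PP G P2 w2z w20.
have w1x := pl_sym G Q1 xw1 (PP0 Px); have w2x := pl_sym G Q2 xw2 (PP0 Px).
have nl1 := dist2_notl G Ll fx z10 z1l xw1 w10 w1z.
have nl2 := dist2_notl G Ll fx z20 z2l xw2 w20 w2z.
have lz2 := l_pl Ll z20 z2l; have lz1 := l_pl Ll z10 z1l.
split; first by split.
  by split=> //; [exact: submx_trans z1l lz2 | exact: pl_sym w2z w20].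
have nz1w2 : ~~ (z1 <= pl w2)%MS.
  apply: contra nl2 => h; suff : l \in lthru L w2 by rewrite inE => /andP[].
  apply: (line_pl G Q2 Ll); apply: submx_trans (span_l G Ll z20 z2l z1l n12) _.
  by have := pl_sym G P2 w2z w20 => ?; smx.
have pxs : (pl x <= x + w1 + w2)%MS.
  apply: (full2 G Px w1x w2x); try by smx.
    apply: contra (far_no2 G Ll fx z10 z1l) => h.
    by apply: submx_trans w1z; apply: sub_vec_sym h.
  apply/negP => h; case/negP: nl1; apply: (submx_trans _ (z2l)).
  apply: (mid_uniq G Q2 P1 nz1w2 w10 z20) => //.
  - apply: (pl_sym G Q1 _ w20); apply: submx_trans h _; have := mem_pl G Q1 => ?; smx.
  - exact: pl_sym w2z w20.
  - exact: (submx_trans z2l lz1).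
rewrite -(far_rankU G Ll fx); apply/eqmx_rank/andP; split.
  by have := mem_pl G Px => ?; smx.
rewrite addsmx_sub; apply/andP; split.
  by apply: submx_trans (span_l G Ll z20 z2l z1l n12) _; smx.
by apply: submx_trans pxs _; smx.
Qed.

Section Line.
Variables (l : 'M[F]_N) (Ll : l \in L).
Let rl : \rank l = 2%N := fl_rank G Ll.
Let q1 := q_gt1 F.

Definition lnz := [set z : 'rV[F]_N | (z <= l)%MS && (z != 0)].
Definition Fa := [set y | far L l y].
Definition bdir y := [set z in lnz | dist2 L z y].

Lemma card_lnz : #|lnz| = (q ^ 2 - 1)%N.
Proof.
by rewrite card_nz rl.
Qed.

Lemma card_par z : z != 0 -> #|[set t : 'rV[F]_N | (t <= z)%MS && (t != 0)]| = q.-1.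
Proof.
by move=> z0; rewrite card_nz rank_vec // expn1 subn1.
Qed.

(** A neighbour of y on l would close a triangle or a quadrangle with z and w. *)
Lemma far_path z w y : z \in lnz -> (w <= pl z)%MS -> ~~ (w <= l)%MS -> (y <= pl w)%MS ->
  ~~ (y <= z + w)%MS -> far L l y.
Proof.
rewrite inE => /andP[zl z0] wz nwl yw ny; have w0 := notsub_nz nwl.
have Pz := l_PP Ll z0 zl; have Pw := pl_PP G Pz wz w0; have y0 := notsub_nz ny.
have Py := pl_PP G Pw yw y0; have zw := pl_sym G Pz wz w0.
have nzw : ~~ (z <= w)%MS by apply: contra nwl => h; apply: submx_trans zl; apply: sub_vec_sym h.
have nyz : ~~ (y <= pl z)%MS.
  apply: contra ny => h; have := pl_notri G Pw zw yw z0 h; rewrite leqNgt; apply: contraNT => ny.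
  by rewrite rank_addv ?rank_span2 // 1?addsmxC.
apply: farI => // v v0 vl; apply/negP => vy.
have [vz|nv] := boolP (v <= z)%MS.
  case/negP: nyz; suff <- : pl v = pl z by apply: pl_sym vy v0.
  by apply: pl_eqmx; apply/eqmxP; rewrite vz sub_vec_sym.
have lz := l_pl Ll z0 zl; case/negP: nwl; apply: (submx_trans _ (vl)).
exact: (mid_uniq G Pz Py nyz w0 v0 wz (pl_sym G Pw yw y0) (submx_trans vl lz) vy).
Qed.

(** There are q^3 - q^2 vectors w in [pl z] off l, each with q^3 - q^2 vectors y off the line of z
    and w. By [mid_uniq] each y is reached from at most q - 1 vectors w. *)
Lemma card_dist2 z : z \in lnz -> (q ^ 4 * q.-1 <= #|[set y in Fa | dist2 L z y]|)%N.
Proof.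
move=> zin; move: (zin); rewrite inE => /andP[zl z0]; have Pz := l_PP Ll z0 zl.
have lz := l_pl Ll z0 zl.
pose W := vset (pl z) :\: vset l.
have cW : #|W| = (q ^ 3 - q ^ 2)%N by rewrite card_vsetD // rl (rank_pl G Pz).
have inW w : w \in W -> [/\ (w <= pl z)%MS, ~~ (w <= l)%MS, w != 0, PP w & (z <= pl w)%MS].
  rewrite !inE => /andP[nw wz]; have w0 := notsub_nz nw.
  by split=> //; [apply: pl_PP wz w0 | apply: pl_sym wz w0].
have := double_count W [set y in Fa | dist2 L z y] (fun w y => (y <= pl w)%MS).
have lo w : w \in W -> (q ^ 3 - q ^ 2 <= #|[set y in [set y in Fa | dist2 L z y] | (y <= pl w)%MS]|)%N.
  case/inW => wz nw w0 Pw zw.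
  have nzw : ~~ (w <= z)%MS by apply: contra nw => h; apply: submx_trans zl.
  have s : (z + w <= pl w)%MS by have := mem_pl G Pw => ?; smx.
  have := card_vsetD s; rewrite (rank_pl G Pw) rank_span2 // => <-.
  apply: subset_leq_card; apply/subsetP => y; rewrite !inE => /andP[ny yw].
  rewrite yw andbT (dist2P w0 wz yw) andbT; exact: (far_path zin wz nw yw ny).
have hi y : y \in [set y in Fa | dist2 L z y] -> (#|[set w in W | (y <= pl w)%MS]| <= q.-1)%N.
  rewrite !inE => /andP[fy /existsP[w /and3P[w0 wz yw]]].
  have Py := far_PP fy; have Pw := pl_PP G Pz wz w0.
  rewrite -(card_par w0); apply: subset_leq_card; apply/subsetP => w'; rewrite inE => /andP[/inW[w'z _ w'0 Pw' _] yw'].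
  rewrite inE w'0 andbT.
  apply: (mid_uniq G Pz Py (far_no2 G Ll fy z0 zl) w'0 w0 w'z (pl_sym G Pw' yw' (PP0 Py)) wz).
  exact: (pl_sym G Pw yw (PP0 Py)).
move=> e.
have h1 : (#|W| * (q ^ 3 - q ^ 2) <= \sum_(w in W) #|[set y in [set y in Fa | dist2 L z y] | (y <= pl w)%MS]|)%N.
  by rewrite -sum_nat_const; apply: leq_sum.
have h2 : (\sum_(y in [set y in Fa | dist2 L z y]) #|[set w in W | (y <= pl w)%MS]| <=
    #|[set y in Fa | dist2 L z y]| * q.-1)%N.
  by rewrite -sum_nat_const; apply: leq_sum.
have := leq_trans h1; rewrite e => /(_ _ h2); rewrite cW.
move: #|[set y in Fa | dist2 L z y]| => k; have -> : (q ^ 3 - q ^ 2 = q ^ 2 * q.-1)%N.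
  by move: q1; clear; case: #|F| => // j _; rewrite !expnS expn0; nia.
have : (0 < q.-1)%N by move: q1; clear; case: #|F|.
move: q.-1 => p p0; rewrite mulnA leq_pmul2r //; rewrite mulnAC -expnD.
by [].
Qed.

End Line.
End Counting.

(** * Directions averaged over the cosets of a line *)

Section Cosets.
Local Open Scope ring_scope.
Variables (F : finFieldType) (N : nat) (L : {set 'M[F]_N}).
Hypothesis G : flat L.
Local Notation q := #|F|.
Local Notation PP := (hpoint L).
Local Notation pl := (tplane L).
Implicit Types (x y z u v w t s r e : 'rV[F]_N) (m n S E U H : 'M[F]_N).
Variables (l : 'M[F]_N) (Ll : l \in L).
Let rl : \rank l = 2%N := fl_rank G Ll.
Let q1 := q_gt1 F.
Local Notation lnz := (lnz l).
Local Notation Fa := (Fa L l).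
Local Notation bdir := (bdir L l).

Lemma lnzP z : reflect ((z <= l)%MS /\ z != 0) (z \in lnz).
Proof. by rewrite inE; apply: andP. Qed.

(** Each of the q + 1 points of l sees q^3 - q^2 vectors off l, and a point off l is seen from one
    point of l only, as otherwise l would pass through it. *)
Lemma card_near : (q ^ 2 - 1 + q.+1 * (q ^ 3 - q ^ 2) <= #|[set y | PP y && ~~ far L l y]|)%N.
Proof.
pose Yn := [set y : 'rV[F]_N | ~~ (y <= l)%MS && [exists z in lnz, (y <= pl z)%MS]].
have h z : z \in lnz -> #|[set y in Yn | (y <= pl z)%MS]| = (q ^ 3 - q ^ 2)%N.
  move=> zin; have [zl z0] := lnzP _ zin; have lz := l_pl Ll z0 zl.
  have := card_vsetD lz; rewrite rl (rank_pl G (l_PP Ll z0 zl)) => <-.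
  apply: eq_card => y; rewrite !inE; have [yl|nyl] //= := boolP (y <= l)%MS.
  have [yz|_] := boolP (y <= pl z)%MS; last by rewrite andbF.
  by rewrite andbT; apply/exists_inP; exists z.
have hi y : y \in Yn -> (#|[set z in lnz | (y <= pl z)%MS]| <= q.-1)%N.
  rewrite inE => /andP[nyl /exists_inP[z zin yz]]; have [zl z0] := lnzP _ zin.
  have Pz := l_PP Ll z0 zl; have y0 := notsub_nz nyl; have Py := pl_PP G Pz yz y0.
  rewrite -(card_par z0); apply: subset_leq_card; apply/subsetP => z'; rewrite inE => /andP[/lnzP[z'l z'0] yz'].
  rewrite inE z'0 andbT; apply: contraT => nz; case/negP: nyl.
  suff : l \in lthru L y by rewrite inE => /andP[].
  apply: (line_pl G Py Ll); apply: submx_trans (span_l G Ll z0 zl z'l nz) _.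
  have a1 := pl_sym G Pz yz y0; have a2 := pl_sym G (l_PP Ll z'0 z'l) yz' y0; smx.
have := double_count lnz Yn (fun z y => (y <= pl z)%MS).
rewrite (eq_bigr _ h) sum_nat_const (card_lnz G Ll) => e.
have h2 : (\sum_(y in Yn) #|[set z in lnz | (y <= pl z)%MS]| <= #|Yn| * q.-1)%N.
  by rewrite -sum_nat_const; apply: leq_sum.
rewrite -e in h2.
have h3 : (q.+1 * (q ^ 3 - q ^ 2) <= #|Yn|)%N.
  have p0 : (0 < q.-1)%N by move: q1; clear; case: #|F|.
  rewrite -(leq_pmul2r p0); apply: leq_trans h2; rewrite mulnAC leq_mul //.
  by move: q1; clear; case: #|F| => // k _; rewrite expnS expn1; nia.
rewrite -(card_lnz G Ll); apply: leq_trans (leq_add (leqnn _) h3) _.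
have dis : [disjoint lnz & Yn].
  by rewrite disjoint_subset; apply/subsetP => z; rewrite !inE => /andP[->].
move: dis; rewrite -(leq_card_setU lnz Yn) => /eqP <-; apply: subset_leq_card.
apply/subsetP => y; rewrite !inE => /orP[/andP[yl y0]|/andP[nyl /exists_inP[z /lnzP[zl z0] yz]]].
  by rewrite (l_PP Ll y0 yl) /=; apply: contraTN yl => /(far_notin G); apply.
rewrite (pl_PP G (l_PP Ll z0 zl) yz (notsub_nz nyl)) /=.
by apply: contraTN yz => fy; apply: far_no2 fy z0 zl.
Qed.

Lemma card_PPsplit : (#|L| * q.-1 = #|Fa| + #|[set y | PP y && ~~ far L l y]|)%N.
Proof.
rewrite -(card_PP G) -(cardsID Fa); congr (_ + _)%N; apply: eq_card => y; rewrite !inE.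
  by have [/far_PP->|] := boolP (far L l y); rewrite ?andbF.
by rewrite andbC.
Qed.

Lemma sum_bdir : (q.-1 * (q ^ 6 - q ^ 4) <= \sum_(y in Fa) #|bdir y|)%N.
Proof.
rewrite (double_count Fa lnz (fun y z => dist2 L z y)).
apply: (@leq_trans (\sum_(z in lnz) (q ^ 4 * q.-1))%N).
  rewrite sum_nat_const (card_lnz G Ll); move: q1; clear; case: #|F| => // k _.
  by rewrite !expnS expn0; apply: eq_leq; nia.
by apply: leq_sum => z zin; apply: (card_dist2 G Ll zin).
Qed.

Definition cof y := y *m cokermx l.

Lemma cofE y y' : (cof y == cof y') = ((y - y')%R <= l)%MS.
Proof. by rewrite submxE mulmxBl subr_eq0. Qed.

Definition Yc y0 := [set y in Fa | cof y == cof y0].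
Definition Dirs y0 := [set z in lnz | [exists y in Yc y0, dist2 L z y]].

Lemma YcP y0 y : reflect (far L l y /\ ((y - y0)%R <= l)%MS) (y \in Yc y0).
Proof. by rewrite !inE cofE; apply: andP. Qed.

Lemma DirsP y0 z : z \in Dirs y0 -> [/\ (z <= l)%MS, z != 0 & exists2 y, y \in Yc y0 & dist2 L z y].
Proof. by rewrite inE => /andP[/lnzP[zl z0] /exists_inP[y h1 h2]]; split=> //; exists y. Qed.

Lemma Yc_line y0 y z (c : F) : y \in Yc y0 -> z != 0 -> (z <= l)%MS -> dist2 L z y ->
  y + c *: z \in Yc y0.
Proof.
move=> /YcP[fy yl] z0 zl /existsP[w /and3P[w0 wz yw]].
have Pz := l_PP Ll z0 zl; have Pw := pl_PP G Pz wz w0; have zw := pl_sym G Pz wz w0.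
have czl : (c *: z <= l)%MS by smx.
have nz : y + c *: z != 0.
  apply: (@notsub_nz _ _ _ _ l); rewrite addrC addv_sub_eq //; exact: far_notin fy.
have s : ((y + c *: z)%R <= pl w)%MS by smx.
apply/YcP; split; first exact: (far_shift G Ll fy czl (pl_PP G Pw s nz)).
by rewrite addrAC; smx.
Qed.

Lemma card_line_inj z : z != 0 -> injective (fun c : F => c *: z).
Proof.
move=> z0 c d /eqP; rewrite -subr_eq0 -scalerBl scaler_eq0 (negbTE z0) orbF subr_eq0.
by move/eqP.
Qed.

(** By [dist2_coset] the points of the coset with a given direction z lie on one line y + <z>, hence
    are at most q. *)
Lemma sum_coset y0 : (\sum_(y in Yc y0) #|bdir y| <= q * #|Dirs y0|)%N.
Proof.
rewrite (double_count (Yc y0) lnz (fun y z => dist2 L z y)).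
rewrite mulnC -sum_nat_const [X in (_ <= X)%N](eq_bigl (fun z => (z \in lnz) && (z \in Dirs y0))); last first.
  by move=> z; rewrite [z \in Dirs _]inE andbA andbb.
rewrite (bigID (fun z => z \in Dirs y0)) /= [X in (_ + X)%N]big1 ?addn0 => [|z /andP[zin nz]]; last first.
  apply/eqP; rewrite cards_eq0; apply/eqP/setP => y; rewrite in_set0 inE.
  apply/negP => /andP[yY dz]; case/negP: nz; rewrite inE zin; apply/exists_inP; by exists y.
apply: leq_sum => z /andP[_ /DirsP[zl z0 [y yY dz]]].
have inj : injective (fun c : F => y + c *: z) by move=> c d /addrI; apply: card_line_inj.
rewrite -(card_imset _ inj); apply: subset_leq_card; apply/subsetP => y'; rewrite inE => /andP[yY' dz'].
have [fy yl] := YcP _ _ yY; have [fy' yl'] := YcP _ _ yY'.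
have vl : ((y' - y)%R <= l)%MS.
  rewrite (_ : y' - y = (y' - y0) - (y - y0)); first by smx.
  by rewrite opprB addrA subrK.
have e : y' = y + (y' - y) by rewrite addrC subrK.
have /sub_vecP[c ec] : ((y' - y)%R <= z)%MS.
  by apply: (dist2_coset G Ll fy z0 zl vl _ dz); rewrite -e //; exact: far_PP fy'.
by apply/imsetP; exists c => //; rewrite -ec.
Qed.

Lemma Yc_ge y0 : (0 < #|Dirs y0|)%N -> (q <= #|Yc y0|)%N.
Proof.
case/card_gt0P => z /DirsP[zl z0 [y yY dz]].
have inj : injective (fun c : F => y + c *: z) by move=> c d /addrI; apply: card_line_inj.
rewrite -(card_imset _ inj); apply: subset_leq_card; apply/subsetP => y' /imsetP[c _ ->].
exact: Yc_line.
Qed.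

Lemma Dirs_two y0 z : z != 0 -> (q.-1 < #|Dirs y0|)%N -> exists2 z', z' \in Dirs y0 & ~~ (z' <= z)%MS.
Proof.
move=> z0 c; apply/exists_inP; apply: contraTT c; rewrite negb_exists_in => /forall_inP h.
rewrite -leqNgt -(card_par z0); apply: subset_leq_card; apply/subsetP => z' hz'.
by move: (h z' hz'); rewrite negbK inE => ->; have [] := DirsP hz'.
Qed.

Lemma Dirs_meet y0 z1 z2 : z1 \in Dirs y0 -> z2 \in Dirs y0 -> ~~ (z2 <= z1)%MS ->
  exists x, [/\ x \in Yc y0, dist2 L z1 x & dist2 L z2 x].
Proof.
move=> /DirsP[z1l z10 [y1 yY1 d1]] /DirsP[z2l z20 [y2 yY2 d2]] n12.
have [f1 e1] := YcP _ _ yY1; have [f2 e2] := YcP _ _ yY2.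
have vl : ((y2 - y1)%R <= l)%MS.
  rewrite (_ : y2 - y1 = (y2 - y0) - (y1 - y0)); first by smx.
  by rewrite opprB addrA subrK.
have d2' : dist2 L z2 (y1 + (y2 - y1)) by rewrite addrC subrK.
have [c [h1 h2]] := dist2_meet G Ll vl z10 z1l z20 z2l n12 d1 d2'.
by exists (y1 + c *: z1); split=> //; apply: Yc_line.
Qed.

Lemma Yc_full y0 x z1 z2 : x \in Yc y0 -> z1 != 0 -> z2 != 0 -> (z1 <= l)%MS -> (z2 <= l)%MS ->
  ~~ (z2 <= z1)%MS -> dist2 L z1 x -> dist2 L z2 x -> (q ^ 2 <= #|Yc y0|)%N.
Proof.
move=> xY z10 z20 z1l z2l n12 d1 d2; have [fx xl] := YcP _ _ xY.
have lx := lone_two G Ll fx z20 z10 z2l z1l n12 d2 d1.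
have [PPx _ _] := lone_count G Ll fx lx.
rewrite -(card_coset G Ll x); apply: subset_leq_card; apply/subsetP => y; rewrite inE => yx.
have e : y = x + (y - x) by rewrite addrC subrK.
apply/YcP; split; first by rewrite e; apply: far_shift => //; exact: PPx.
by rewrite (_ : y - y0 = (y - x) + (x - y0)); [smx | rewrite addrA subrK].
Qed.

Hypothesis To : (#|L| <= q ^ 5 + q ^ 4 + q ^ 3 + q ^ 2 + q + 1)%N.

(** By (To) at most q^6 - 1 nonzero vectors are covered, and at least q^4 - 1 of them are near l. *)
Lemma card_Fa : (#|Fa| <= q ^ 6 - q ^ 4)%N.
Proof.
have := card_near; have := card_PPsplit; move: To q1.
move: #|Fa| #|L| #|[set y | _]| => f k n; clear; case: #|F| => // j.
rewrite /= => h1 _ h2 h3.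
have : (k * j <= (j.+1 ^ 5 + j.+1 ^ 4 + j.+1 ^ 3 + j.+1 ^ 2 + j.+1 + 1) * j)%N by rewrite leq_mul.
rewrite h2; move: h3; clear; rewrite !expnS expn0; nia.
Qed.

(** Otherwise no coset has more than q - 1 direction vectors per far vector on average. The coset of
    x has strictly fewer, which contradicts the lower bound [sum_bdir]. *)
Lemma ex_many_dirs x z1 z2 : far L l x -> z1 != 0 -> z2 != 0 -> (z1 <= l)%MS -> (z2 <= l)%MS ->
  ~~ (z2 <= z1)%MS -> dist2 L z1 x -> dist2 L z2 x ->
  exists2 y0, y0 \in Fa & (q * q.-1 <= #|Dirs y0|)%N.
Proof.
move=> fx z10 z20 z1l z2l n12 d1 d2; apply/exists_inP; apply: contraT.
rewrite negb_exists_in => /forall_inP no.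
have {}no y : y \in Fa -> (#|Dirs y| < q * q.-1)%N by move=> /no; rewrite -ltnNge.
have p0 : (0 < q.-1)%N by move: q1; clear; case: #|F|.
have big y : (q.-1 < #|Dirs y|)%N -> (q ^ 2 <= #|Yc y|)%N.
  move=> h; case/card_gt0P: (leq_trans p0 (ltnW h)) => z hz.
  have [zl z0 _] := DirsP hz; have [z' hz' n] := Dirs_two z0 h; have [z'l z'0 _] := DirsP hz'.
  have [t [tY t1 t2]] := Dirs_meet hz hz' n.
  exact: Yc_full tY z0 z'0 zl z'l n t1 t2.
have le y : (\sum_(t in Yc y) #|bdir t| <= #|Yc y| * q.-1)%N.
  apply: leq_trans (sum_coset y) _.
  have [h|h] := ltnP q.-1 #|Dirs y|.
    case/card_gt0P: (leq_trans p0 (ltnW h)) => z hz; have [_ _ [t tY _]] := DirsP hz.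
    have e : Yc y = Yc t.
      have [_ tl] := YcP _ _ tY; apply/setP => s; rewrite !inE; congr (_ && _).
      by have /eqP <- : cof t == cof y by rewrite cofE.
    have tF : t \in Fa by move: tY; rewrite inE => /andP[].
    have eD : Dirs y = Dirs t by rewrite /Dirs e.
    have := no t tF; rewrite -eD => h2; have := big y h.
    move: h2; move: #|Dirs y| #|Yc y| #|F|; clear => a b k h1 h2; rewrite expnS expn1 in h2.
    by apply: leq_trans (leq_mul (leqnn k) (ltnW h1)) _; rewrite mulnA leq_mul.
  have [->|d0] := posnP #|Dirs y|; first by rewrite muln0.
  by apply: leq_mul (Yc_ge d0) h.
(* The coset of x has two directions, hence all its q^2 vectors are far, while at most q times fewer
   than q (q - 1) incidences occur. *)
have lt : (\sum_(t in Yc x) #|bdir t| < #|Yc x| * q.-1)%N.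
  apply: leq_ltn_trans (sum_coset x) _.
  have xF : x \in Fa by rewrite inE.
  have xY : x \in Yc x by apply/YcP; rewrite subrr sub0mx.
  apply: (@leq_trans (q * (q * q.-1))%N); first by rewrite ltn_pmul2l ?no // ltnW.
  by rewrite mulnA mulnn leq_mul // (Yc_full xY z10 z20 z1l z2l n12 d1 d2).
have part (f : 'rV[F]_N -> nat) : (\sum_(y in Fa) f y = \sum_(c : 'rV[F]_N) \sum_(y in Fa | cof y == c) f y)%N.
  by rewrite (partition_big cof predT).
have coseq (f : 'rV[F]_N -> nat) y : (\sum_(t in Fa | cof t == cof y) f t = \sum_(t in Yc y) f t)%N.
  by apply: eq_bigl => t; rewrite [t \in Yc y]inE.
have : (\sum_(y in Fa) #|bdir y| < \sum_(y in Fa) q.-1)%N.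
  rewrite !part (bigD1 (cof x)) //= [X in (_ < X)%N](bigD1 (cof x)) //= !coseq.
  rewrite -addSn leq_add //; first by rewrite sum_nat_const.
  apply: leq_sum => c _.
  have [/exists_inP[y yF /eqP <-]|none] := boolP [exists y in Fa, cof y == c].
    by rewrite !coseq sum_nat_const.
  rewrite big1 // => t /andP[tF tc]; case/negP: none; apply/exists_inP; by exists t.
have := sum_bdir; rewrite sum_nat_const => h1 h2; have := leq_ltn_trans h1 h2.
by rewrite mulnC ltn_pmul2r // ltnNge card_Fa.
Qed.

End Cosets.

(** * Excluding pentagons by (Hp') *)

Section NoPentagon.
Local Open Scope ring_scope.
Variables (F : finFieldType) (N : nat) (L : {set 'M[F]_N}).
Hypothesis G : flat L.
Local Notation q := #|F|.
Local Notation PP := (hpoint L).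
Local Notation pl := (tplane L).
Implicit Types (x y z u v w t s r e : 'rV[F]_N) (l m n S E U H : 'M[F]_N).
Hypothesis Hp : forall H, \rank H = 6%N -> (nb_in L H <= q ^ 4 - q ^ 3 + 3 * q ^ 2 + 2 * q)%N.
Let q1 := q_gt1 F.

(** The vanishing product says that some coordinate of u is zero, so u lies in one of the five
    solids spanned by four vertices, all of which have the same hyperplane. *)
Lemma pent_subfull e1 e2 e3 e4 e5 (c1 c2 c3 c4 c5 : F) u : pent L e1 e2 e3 e4 e5 ->
  c1 * c2 * c3 * c4 * c5 = 0 -> u != 0 ->
  u = c1 *: e1 + c2 *: e2 + c3 *: e3 + c4 *: e4 + c5 *: e5 ->
  PP u && (pl u <= e1 + e2 + e3 + e4 + e5 + pl (e4 + e1)%R)%MS.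
Proof.
move=> pe /eqP c0 u0 eu.
have p2 := pent_rot pe; have p3 := pent_rot p2; have p4 := pent_rot p3; have p5 := pent_rot p4.
have H1 := pent_rotH G pe; have H2 := submx_trans (pent_rotH G p2) H1.
have H3 := submx_trans (pent_rotH G p3) H2; have H4 := submx_trans (pent_rotH G p4) H3.
move: c0; rewrite !mulf_eq0 -!orbA => /or4P[/eqP z|/eqP z|/eqP z|/orP[]/eqP z].
- have [|-> h] := pent_full G p2 u0; first by rewrite eu z scale0r add0r; smx.
  exact: submx_trans h H1.
- have [|-> h] := pent_full G p3 u0; first by rewrite eu z scale0r addr0; smx.
  exact: submx_trans h H2.
- have [|-> h] := pent_full G p4 u0; first by rewrite eu z scale0r addr0; smx.
  exact: submx_trans h H3.
- have [|-> h] := pent_full G p5 u0; first by rewrite eu z scale0r addr0; smx.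
  exact: submx_trans h H4.
- by have [|-> h] := pent_full G pe u0; first by rewrite eu z scale0r addr0; smx.
Qed.

(** Over the field of two elements the only vector without a zero coordinate is the sum of the
    vertices; the other 30 nonzero vectors of the span exceed the bound 24. *)
Lemma pent_q2 e1 e2 e3 e4 e5 : q = 2%N -> pent L e1 e2 e3 e4 e5 -> False.
Proof.
move=> q2 pe.
have two (c : F) : c = 0 \/ c = 1.
  have : [set: F] = [set 0; 1].
    by apply/eqP; rewrite eq_sym eqEcard subsetT cards2 eq_sym oner_eq0 cardsT q2.
  by move/setP/(_ c); rewrite !inE => /esym/orP[]/eqP; [left|right].
have [rH _] := pentH G pe.
have := leq_trans (card_full G _) (leq_mul (Hp rH) (leqnn q.-1)).
rewrite q2 /= leqNgt => /negP; apply.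
case: (pe) => _ _ rU.
have cU : #|vset (e1 + e2 + e3 + e4 + e5)%MS| = 32 by rewrite card_vset rU q2.
rewrite (cardsD1 0) (cardsD1 (e1 + e2 + e3 + e4 + e5)) in cU.
suff : (#|(vset (e1 + e2 + e3 + e4 + e5)%MS :\ 0%R) :\ (e1 + e2 + e3 + e4 + e5)%R| <=
    #|[set x | PP x && (pl x <= e1 + e2 + e3 + e4 + e5 + pl (e4 + e1)%R)%MS]|)%N.
  move: cU; move: #|_ :\ _| => k; do 2!case: (_ \in _) => /=; clear; lia.
apply: subset_leq_card; apply/subsetP => u; rewrite !inE => /and3P[ns u0 uU].
have [a [c5 [/sub_addvP[b [c4 [/sub_span3P[c1 [c2 [c3 eb]]] ea]]] eu]]] := sub_addvP uU.
rewrite ea eb in eu; apply: (pent_subfull pe _ u0 eu).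
move: ns; rewrite {u0 uU}eu {ea eb}; case: (two c1) => ->; rewrite ?mul0r //; case: (two c2) => ->; rewrite ?(mulr0, mul0r) //.
case: (two c3) => ->; rewrite ?(mulr0, mul0r) //; case: (two c4) => ->; rewrite ?(mulr0, mul0r) //.
by case: (two c5) => ->; rewrite ?(mulr0, mul0r) // !scale1r eqxx.
Qed.

Hypothesis To : (#|L| <= q ^ 5 + q ^ 4 + q ^ 3 + q ^ 2 + q + 1)%N.

(** Any two non-parallel directions z, z' of the coset come from a pentagon with vertices z, z', so
    by [pent_full] all vectors of the solid S z = E + pl z have their planes in H. Solids of
    different directions meet in E only, which makes their vectors easy to count. *)
Lemma no_pent_big l x z1 z2 : (2 < q)%N -> l \in L -> far L l x -> z1 != 0 -> z2 != 0 ->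
  (z1 <= l)%MS -> (z2 <= l)%MS -> ~~ (z2 <= z1)%MS -> dist2 L z1 x -> dist2 L z2 x -> False.
Proof.
move=> q3 Ll fx z10 z20 z1l z2l n12 d1 d2.
have [y0 yF cD] := ex_many_dirs G Ll To fx z10 z20 z1l z2l n12 d1 d2.
move: {x z1 z2 fx z10 z20 z1l z2l n12 d1 d2} yF; rewrite inE => fy0.
have p0 : (0 < q.-1)%N by move: q1; clear; case: #|F|.
have many : (q.-1 < #|Dirs L l y0|)%N.
  by apply: leq_trans cD; rewrite -[X in (X < _)%N]mul1n ltn_pmul2r.
(* One H serves for all pentagons of the coset: it comes from a lone point of the coset and contains
   the planes of every coset point. *)
have [H [rH lH plH]] : exists H : 'M[F]_N, [/\ \rank H = 6%N, (l <= H)%MS &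
    forall y, y \in Yc L l y0 -> forall v, (v <= l)%MS -> (pl (y + v)%R <= H)%MS].
  case/card_gt0P: (leq_trans p0 (ltnW many)) => z hz.
  have [zl z0 _] := DirsP hz; have [z' hz' n] := Dirs_two z0 many.
  have [z'l z'0 _] := DirsP hz'.
  have [t [tY t1 t2]] := Dirs_meet G Ll hz hz' n.
  have [ft tl] := YcP _ _ _ _ tY.
  have lt := lone_two G Ll ft z'0 z0 z'l zl n t2 t1.
  have [H [rH sH h]] := lone_hyper G Ll ft lt; exists H; split=> //.
    by apply: submx_trans sH; smx.
  move=> y yY v vl; have [fy yl] := YcP _ _ _ _ yY.
  have [|_] := h (y - y0 - (t - y0) + v); first by smx.
  by rewrite addrA opprB (addrA (y - y0)) subrK [t + _]addrC subrK.
pose E := (l + y0)%MS; pose S z := (E + pl z)%MS.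
have rE : \rank E = 3%N := far_rankE G Ll fy0.
have key z z' : z \in Dirs L l y0 -> z' \in Dirs L l y0 -> ~~ (z' <= z)%MS ->
  exists x w w', [/\ pent L z' z w x w', (E :=: z' + z + x)%MS, (S z :=: z' + z + w + x)%MS,
    (S z' :=: z' + z + w' + x)%MS & x \in Yc L l y0].
  move=> hz hz' n; have [zl z0 _] := DirsP hz; have [z'l z'0 _] := DirsP hz'.
  have [x [xY /existsP[w /and3P[w0 wz xw]] /existsP[w' /and3P[w'0 w'z' xw']]]] := Dirs_meet G Ll hz hz' n.
  have [fx xl] := YcP _ _ _ _ xY.
  have n' : ~~ (z <= z')%MS by apply: contra n; apply: sub_vec_sym.
  have pe := pent_of G Ll fx z0 z'0 zl z'l n' w0 wz xw w'0 w'z' xw'.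
  have sl := span_l G Ll z0 zl z'l n.
  have xE : (x <= E)%MS.
    by rewrite -(subrK y0 x) /E; smx.
  have zE : (z <= E)%MS by rewrite /E; smx.
  have z'E : (z' <= E)%MS by rewrite /E; smx.
  have y0E : (y0 <= z' + z + x)%MS.
    rewrite -(subKr x y0); apply: addmx_sub; first by smx.
    by rewrite eqmx_opp; apply: submx_trans xl (submx_trans sl _); smx.
  have eE : (E :=: z' + z + x)%MS.
    apply/eqmxP/andP; split; last by rewrite /E; smx.
    by rewrite /E addsmx_sub y0E andbT; apply: submx_trans sl _; smx.
  have nw := dist2_notl G Ll fx z0 zl xw w0 wz.
  have nw' := dist2_notl G Ll fx z'0 z'l xw' w'0 w'z'.
  exists x, w, w'; split=> //.
    apply/eqmxP/andP; split; rewrite /S.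
      rewrite addsmx_sub eE; apply/andP; split; first by smx.
      by apply: submx_trans (pl_zw G Ll z0 zl wz nw) _; smx; apply: submx_trans sl _; smx.
    by smx.
  apply/eqmxP/andP; split; rewrite /S.
    rewrite addsmx_sub eE; apply/andP; split; first by smx.
    by apply: submx_trans (pl_zw G Ll z'0 z'l w'z' nw') _; smx; apply: submx_trans sl _; smx.
  by smx.
have full z u : z \in Dirs L l y0 -> (u <= S z)%MS -> u != 0 -> PP u && (pl u <= H)%MS.
  move=> hz uS u0; have [zl z0 _] := DirsP hz; have [z' hz' n] := Dirs_two z0 many.
  have [z'l z'0 _] := DirsP hz'.
  have [x [w [w' [pe _ eS _ xY]]]] := key z z' hz hz' n.
  have [|-> h] := pent_full G pe u0; first by rewrite -eS.
  apply: submx_trans h _; rewrite addsmx_sub plH // andbT.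
  rewrite -(pent_U G pe) addsmx_sub genmxE -{1}(addr0 x) plH ?sub0mx // andbT; smx.
    exact: submx_trans lH.
  exact: submx_trans lH.
have rS z : z \in Dirs L l y0 -> \rank (S z) = 4%N.
  move=> hz; have [zl z0 _] := DirsP hz; have [z' hz' n] := Dirs_two z0 many.
  have [x [w [w' [pe _ -> _ xY]]]] := key z z' hz hz' n.
  have [n1 n2 n3 n4] := pent_indep pe; do 3!rewrite rank_addv //; rewrite rank_vec //.
  by case: pe => -[/PP0].
pose Fl := [set x | PP x && (pl x <= H)%MS].
pose B := Fl :\: vset E.
have sub1 z : z \in Dirs L l y0 -> #|[set u in B | (u <= S z)%MS]| = (q ^ 4 - q ^ 3)%N.
  move=> hz; rewrite -(rS z hz) -rE -card_vsetD; last by rewrite /S; smx.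
  apply: eq_card => u; rewrite !inE; have [//|nE] := boolP (u <= E)%MS.
  have [uS|] := boolP (u <= S z)%MS; last by rewrite andbF.
  by rewrite (full z u hz uS (notsub_nz nE)).
(* Parallel directions have the same solid, so a vector off E is counted at most q - 1 times. *)
have sub2 u : u \in B -> (#|[set z in Dirs L l y0 | (u <= S z)%MS]| <= q.-1)%N.
  rewrite !inE => /andP[nuE _].
  have [e|[z]] := set_0Vmem [set z in Dirs L l y0 | (u <= S z)%MS]; first by rewrite e cards0.
  rewrite inE => /andP[hz uz]; have [zl z0 _] := DirsP hz.
  rewrite -(card_par z0); apply: subset_leq_card; apply/subsetP => z'; rewrite inE => /andP[hz' uz'].
  have [_ z'0 _] := DirsP hz'; rewrite inE z'0 andbT; apply: contraT => n.
  have [x [w [w' [pe eE eS eS' xY]]]] := key z z' hz hz' n; case/negP: nuE.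
  have rcap : (\rank (S z :&: S z')%MS <= \rank E)%N.
    have := mxrank_sum_cap (S z) (S z'); rewrite (rS _ hz) (rS _ hz') rE.
    have -> : \rank (S z + S z')%MS = 5%N.
      case: (pe) => _ _ <-; apply: eqmx_rank; apply/andP; split.
        by rewrite addsmx_sub eS eS'; apply/andP; split; smx.
      have h1 : (z' + z + w + x <= S z)%MS by rewrite eS.
      have h2 : (z' + z + w' + x <= S z')%MS by rewrite eS'.
      apply: submx_trans (addsmxS h1 h2); smx.
    move: (\rank _) => k; clear; lia.
  apply: submx_trans (_ : (S z :&: S z' <= _)%MS); first by rewrite sub_capmx uz.
  by apply: sub_rank_sup rcap; rewrite sub_capmx /S; apply/andP; split; smx.
have := double_count (Dirs L l y0) B (fun z u => (u <= S z)%MS).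
rewrite (eq_bigr _ sub1) sum_nat_const => e.
have : (\sum_(u in B) #|[set z in Dirs L l y0 | (u <= S z)%MS]| <= #|B| * q.-1)%N.
  by rewrite -sum_nat_const; apply: leq_sum.
rewrite -e => hB; have := leq_trans (leq_mul cD (leqnn _)) hB => {e sub1 sub2}hB.
have hE : (q ^ 3 - 1 <= #|Fl :&: vset E|)%N.
  rewrite -rE -card_nz; apply: subset_leq_card; apply/subsetP => u; rewrite !inE => /andP[uE u0].
  rewrite uE andbT; case/card_gt0P: (leq_trans p0 (ltnW many)) => z hz.
  by apply: (full z) => //; apply: submx_trans uE _; rewrite /S; smx.
have := cardsID (vset E) Fl; rewrite -/B => eF.
have := leq_trans (card_full G H) (leq_mul (Hp rH) (leqnn q.-1)).
rewrite -/Fl -eF; move: hB hE q3; move: #|B| #|_ :&: _|; clear => b e.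
case: #|F| => // k; rewrite /=; do 2!case: k => // k; move=> hB hE _.
have {}hB : (k.+3 ^ 4 * k.+2 <= b)%N.
  rewrite -(@leq_pmul2r k.+2) //; apply: leq_trans hB; apply: eq_leq.
  have -> : (k.+3 ^ 4 - k.+3 ^ 3 = k.+3 ^ 3 * k.+2)%N by rewrite [(k.+3 ^ 4)%N]expnS; move: (k.+3 ^ 3)%N => j; nia.
  by rewrite !expnS expn0; ring.
(* Here q = k + 3. The q^4 (q - 1) vectors off E and the q^3 - 1 in E exceed q - 1 times the bound
   of (Hp'); for q = 2 this inequality would be false. *)
apply/negP; rewrite -ltnNge.
apply: leq_trans (leq_add hE hB); clear.
have -> : (k.+3 ^ 4 - k.+3 ^ 3 = k.+3 ^ 3 * k.+2)%N by rewrite [(k.+3 ^ 4)%N]expnS; move: (k.+3 ^ 3)%N => j; nia.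
rewrite !expnS expn0; nia.
Qed.

Lemma no_pent l x z1 z2 : l \in L -> far L l x -> z1 != 0 -> z2 != 0 ->
  (z1 <= l)%MS -> (z2 <= l)%MS -> dist2 L z1 x -> dist2 L z2 x -> (z2 <= z1)%MS.
Proof.
move=> Ll fx z10 z20 z1l z2l d1 d2; apply: contraT => n.
have [q3|q2] := ltnP 2 q; first by case: (no_pent_big q3 Ll fx z10 z20 z1l z2l n d1 d2).
case/existsP: (d1) => w1 /and3P[w10 w1z xw1]; case/existsP: (d2) => w2 /and3P[w20 w2z xw2].
have n' : ~~ (z1 <= z2)%MS by apply: contra n; apply: sub_vec_sym.
have := pent_of G Ll fx z10 z20 z1l z2l n' w10 w1z xw1 w20 w2z xw2.
by case/(@pent_q2 _ _ _ _ _); apply/eqP; rewrite eqn_leq q2 q1.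
Qed.

Section Line.
Variables (l : 'M[F]_N) (Ll : l \in L).

Lemma card_bdir y : far L l y -> (#|bdir L l y| <= q.-1)%N.
Proof.
move=> fy; have [->|[z]] := set_0Vmem (bdir L l y); first by rewrite cards0.
rewrite inE => /andP[/lnzP[zl z0] dz]; rewrite -(card_par z0).
apply: subset_leq_card; apply/subsetP => z' /setIdP[/lnzP[z'l z'0] dz'].
by rewrite inE z'0 (no_pent Ll fy z0 z'0 zl z'l dz dz').
Qed.

Lemma card_Fa_ge : (q ^ 6 - q ^ 4 <= #|Fa L l|)%N.
Proof.
have p0 : (0 < q.-1)%N by move: q1; clear; case: #|F|.
rewrite -(leq_pmul2l p0); apply: leq_trans (sum_bdir G Ll) _.
rewrite mulnC -sum_nat_const; apply: leq_sum => y; rewrite inE; exact: card_bdir.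
Qed.

(** The average number of directions per far point is at least one and no far point has two, so none
    can have zero. *)
Lemma ex_dir y : far L l y -> exists z, [/\ z != 0, (z <= l)%MS & dist2 L z y].
Proof.
move=> fy; have [b0|[z]] := set_0Vmem (bdir L l y); last first.
  by rewrite inE => /andP[/lnzP[zl z0] dz]; exists z.
have := leq_trans (leq_mul (leqnn q.-1) (card_Fa G Ll To)) (sum_bdir G Ll).
have p0 : (0 < q.-1)%N by move: q1; clear; case: #|F|.
have yF : y \in Fa L l by rewrite inE.
rewrite (bigD1 y) //= b0 cards0 add0n => h.
have : (\sum_(i in Fa L l | i != y) #|bdir L l i| <= \sum_(i in Fa L l | i != y) q.-1)%N.
  by apply: leq_sum => t /andP[]; rewrite inE => /card_bdir.
move/(leq_trans h); rewrite leqNgt => /negP[].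
by rewrite mulnC -sum_nat_const [X in (_ < X)%N](bigD1 y) //= -[X in (X < _)%N]add0n ltn_add2r.
Qed.

(** The point y + v has some direction z'. If z' were not parallel to z, the lines in directions z
    and z' would meet in a point with two directions, a pentagon. *)
Lemma far_coset y z v : far L l y -> z != 0 -> (z <= l)%MS -> dist2 L z y -> (v <= l)%MS ->
  PP (y + v) -> (v <= z)%MS.
Proof.
move=> fy z0 zl dz vl Pv; have fyv := far_shift G Ll fy vl Pv.
have [z' [z'0 z'l dz']] := ex_dir fyv.
have [zz|n] := boolP (z' <= z)%MS.
  by apply: (dist2_coset G Ll fy z0 zl vl Pv dz); apply: dist2_par dz'.
have [c [h1 h2]] := dist2_meet G Ll vl z0 zl z'0 z'l n dz dz'.
case/negP: n; apply: (no_pent Ll _ z0 z'0 zl z'l h1 h2).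
have zY : y \in Yc L l y by apply/YcP; rewrite subrr sub0mx.
by have [] := YcP _ _ _ _ (Yc_line G Ll c zY z0 zl dz).
Qed.

(** The count behind [card_Fa] read backwards: there are at least q^6 - q^4 far and q^4 - 1 near
    vectors. *)
Lemma card_L_ge : (q ^ 5 + q ^ 4 + q ^ 3 + q ^ 2 + q + 1 <= #|L|)%N.
Proof.
have := card_near G Ll; have := card_PPsplit G l; have := card_Fa_ge; move: q1.
move: #|L| #|Fa L l| #|[set y | _]| => k f n; clear; case: #|F| => // j; rewrite /= ltnS => j0 h1 h2 h3.
rewrite -(leq_pmul2r j0) h2; apply: leq_trans (leq_add h1 h3); clear; rewrite !expnS expn0; nia.
Qed.

End Line.
End NoPentagon.

(** * Tangent hyperplanes of the hexagon *)

Section Hexagon.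
Local Open Scope ring_scope.
Variables (F : finFieldType) (N : nat) (L : {set 'M[F]_N}).
Hypothesis G : flat L.
Local Notation q := #|F|.
Local Notation PP := (hpoint L).
Local Notation pl := (tplane L).
Implicit Types (x y z a b d p u v w t s r e : 'rV[F]_N) (l m n S E U H Gs : 'M[F]_N).
Hypothesis Hp : forall H, \rank H = 6%N -> (nb_in L H <= q ^ 4 - q ^ 3 + 3 * q ^ 2 + 2 * q)%N.
Hypothesis To : (#|L| <= q ^ 5 + q ^ 4 + q ^ 3 + q ^ 2 + q + 1)%N.
Let q1 := q_gt1 F.

(** The point d is far from the line of a and b and already has the direction b there, through c; a
    second direction a would be a pentagon. *)
Lemma path3 a b c d : PP b -> (a <= pl b)%MS -> ~~ (a <= b)%MS -> (c <= pl b)%MS ->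
  ~~ (c <= a + b)%MS -> (d <= pl c)%MS -> ~~ (d <= b + c)%MS -> ~~ dist2 L a d.
Proof.
move=> Pb ab nab cb nc dc nd; apply/negP => da.
have Ll := pl_line G Pb ab nab; have b0 := PP0 Pb; have a0 := notsub_nz nab.
have bl : (b <= <<(b + a)%MS>>)%MS by rewrite genmxE; smx.
have al : (a <= <<(b + a)%MS>>)%MS by rewrite genmxE; smx.
have bin : b \in lnz <<(b + a)%MS>>%MS by apply/lnzP.
have nc' : ~~ (c <= <<(b + a)%MS>>)%MS by rewrite genmxE addsmxC.
have fd := far_path G Ll bin cb nc' dc nd.
by case/negP: nab; apply: (no_pent G Hp To Ll fd b0 a0 bl al (dist2P (notsub_nz nc) cb dc) da).
Qed.

Lemma dist2_sym x y : PP x -> y != 0 -> dist2 L x y -> dist2 L y x.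
Proof.
move=> Px y0 /existsP[w /and3P[w0 wx yw]]; have Pw := pl_PP G Px wx w0.
exact: (dist2P w0 (pl_sym G Pw yw y0) (pl_sym G Px wx w0)).
Qed.

Lemma adj_dist2 x y : PP x -> (y <= pl x)%MS -> dist2 L x y.
Proof. by move=> Px yx; apply: (dist2P (PP0 Px) (mem_pl G Px) yx). Qed.

Lemma opp_far w p p' : PP w -> PP p -> ~~ dist2 L w p -> (p' <= pl p)%MS -> ~~ (p' <= p)%MS ->
  far L <<(p + p')%MS>>%MS w.
Proof.
move=> Pw Pp nd p'p np'; apply: farI => // z z0; rewrite genmxE => zl; apply/negP => zw.
case/negP: nd; apply: (dist2P z0 zw); apply: (pl_sym G Pp _ z0).
by apply: submx_trans zl _; have := mem_pl G Pp => ?; smx.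
Qed.

(** The direction of w on the line of p and p'. It is not p itself, which is opposite to w, so it
    can be normalised to have p'-coordinate one. *)
Lemma proj_ex w p p' : PP w -> PP p -> ~~ dist2 L w p -> (p' <= pl p)%MS -> ~~ (p' <= p)%MS ->
  exists c : F, dist2 L w (p' + c *: p).
Proof.
move=> Pw Pp nd p'p np'; have fw := opp_far Pw Pp nd p'p np'.
have Ll := pl_line G Pp p'p np'.
have [z [z0 zl dz]] := ex_dir G Hp To Ll fw; rewrite genmxE in zl.
have Pz : PP z by apply: (pl_PP G Pp _ z0); apply: submx_trans zl _; have := mem_pl G Pp => ?; smx.
have := dist2_sym Pz (PP0 Pw) dz.
have [c [d ez]] := sub_span2P zl; have d0 : d != 0.
  apply: contraNneq nd => d0; rewrite ez d0 scale0r addr0 in z0 dz.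
  have c0 : c != 0 by apply: contraNneq z0 => ->; rewrite scale0r.
  case/existsP: dz => u /and3P[u0]; rewrite pl_scale // => up wu.
  apply: (dist2_sym Pp (PP0 Pw)); exact: (dist2P u0 up wu).
case/existsP => u /and3P[u0 uw zu]; exists (c / d); apply: (dist2P u0 uw).
rewrite (_ : p' + _ = d^-1 *: z); first by smx.
by rewrite ez scalerDr !scalerA mulVf // scale1r mulrC addrC.
Qed.

Lemma proj_uniq w p p' y z : PP w -> PP p -> ~~ dist2 L w p -> (p' <= pl p)%MS -> ~~ (p' <= p)%MS ->
  y != 0 -> z != 0 -> (y <= p + p')%MS -> (z <= p + p')%MS -> dist2 L w y -> dist2 L w z ->
  (z <= y)%MS.
Proof.
move=> Pw Pp nd p'p np' y0 z0 yl zl dy dz; have fw := opp_far Pw Pp nd p'p np'.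
have Ll := pl_line G Pp p'p np'.
by apply: (no_pent G Hp To Ll fw y0 z0); rewrite ?genmxE //; apply: dist2_sym.
Qed.

Definition tspace w : 'M[F]_N := (\sum_(p | (p <= pl w)%MS && (p != 0)) pl p)%MS.
Local Notation T := tspace.

Lemma pl_T w p : (p <= pl w)%MS -> p != 0 -> (pl p <= T w)%MS.
Proof. by move=> pw p0; apply: (@sumsmx_sup _ _ p) => //; rewrite pw. Qed.

Lemma dist2_T w p : dist2 L w p -> (p <= T w)%MS.
Proof. by case/existsP => u /and3P[u0 uw pu]; apply: submx_trans pu (pl_T uw u0). Qed.

Lemma pl_plane x : PP x -> exists y z, [/\ (y <= pl x)%MS, (z <= pl x)%MS, ~~ (y <= x)%MS & ~~ (z <= x + y)%MS].
Proof.
move=> Px.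
have [|y [yx ny]] := @ex_outside _ _ _ _ x (pl x); first by rewrite (rank_pl G Px) (rank_vec (PP0 Px)).
have [|z [zx nz]] := @ex_outside _ _ _ _ (x + y)%MS (pl x); last by exists y, z.
by rewrite (rank_pl G Px) (rank_span2 (PP0 Px) ny).
Qed.

(** * All points lie in the span of T w and one opposite point *)

Section Closure.
Variables (Gs : 'M[F]_N) (w : 'rV[F]_N).
Hypotheses (Pw : PP w) (TG : (T w <= Gs)%MS).

(** Every line through p has a second point at distance at most two from w, hence in T w. *)
Lemma opp_pl p : PP p -> ~~ dist2 L w p -> (p <= Gs)%MS -> (pl p <= Gs)%MS.
Proof.
move=> Pp nd pG.
have key y : (y <= pl p)%MS -> ~~ (y <= p)%MS -> (y <= Gs)%MS.
  move=> yp ny; have [c dc] := proj_ex Pw Pp nd yp ny.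
  have h := submx_trans (dist2_T dc) TG.
  by rewrite -(addrK (c *: p) y); smx.
have [y [z [yp zp ny nz]]] := pl_plane Pp.
apply: (full2 G Pp yp zp ny nz) => //; apply: key => //.
by apply: contra nz => h; smx.
Qed.

(** If s is not opposite to w, it has a common neighbour u with w, and [pl s] is spanned by s, p and
    u. *)
Lemma opp_pl2 p s : PP p -> ~~ dist2 L w p -> (p <= Gs)%MS -> (s <= pl p)%MS -> s != 0 ->
  (pl s <= Gs)%MS.
Proof.
move=> Pp nd pG sp s0; have Ps := pl_PP G Pp sp s0; have pG' := opp_pl Pp nd pG.
have sG := submx_trans sp pG'.
have [/existsP[u /and3P[u0 uw su]]|ns] := boolP (dist2 L w s); last exact: opp_pl.
have Pu := pl_PP G Pw uw u0; have us := pl_sym G Pu su s0; have ps := pl_sym G Pp sp s0.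
have n : ~~ (u <= s + p)%MS.
  apply: contra nd => h; apply: (dist2P u0 uw); apply: (pl_sym G Pp _ u0).
  by apply: submx_trans h _; have := mem_pl G Pp => ?; smx.
apply: (full2 G Ps ps us _ n) => //.
  apply: contra nd => h; apply: (dist2P u0 uw); exact: submx_trans h su.
exact: submx_trans (mem_pl G Pu) (submx_trans (pl_T uw u0) TG).
Qed.

Lemma opp_dist2 p x : PP p -> ~~ dist2 L w p -> (p <= Gs)%MS -> dist2 L p x -> (x <= Gs)%MS.
Proof.
move=> Pp nd pG /existsP[s /and3P[s0 sp xs]]; exact: submx_trans xs (opp_pl2 Pp nd pG sp s0).
Qed.

(** Both w and p project to the line of x and x1. If the projections differ, that line lies in Gs.
    If both are y, take s between y and p: when s is not on the line of u and y, it is opposite to w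
    by [path3], and x, a neighbour of y, lies in Gs. *)
Lemma closure_or p x (x1 : 'rV[F]_N) (c : F) u : PP p -> ~~ dist2 L w p -> (p <= Gs)%MS ->
  PP x -> ~~ dist2 L w x -> (x1 <= pl x)%MS -> ~~ (x1 <= x)%MS ->
  u != 0 -> (u <= pl w)%MS -> ((x1 + c *: x)%R <= pl u)%MS ->
  (x <= Gs)%MS \/ exists s, [/\ s != 0, (s <= u + (x1 + c *: x)%R)%MS & (s <= pl p)%MS].
Proof.
move=> Pp nd pG Px nx x1x nx1 u0 uw yu; set y := x1 + c *: x in yu *.
have Pu := pl_PP G Pw uw u0; have wu := pl_sym G Pw uw u0.
have [/opp_dist2 h|ndx] := boolP (dist2 L p x); first by left; apply: h.
have [c' dc'] := proj_ex Pp Px ndx x1x nx1.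
have yG' := opp_dist2 Pp nd pG dc'.
have yG : (y <= Gs)%MS by apply: submx_trans yu (submx_trans (pl_T uw u0) TG).
have [ec|nec] := eqVneq c c'; last first.
  left; rewrite -(@scale_sub_eq _ _ (c - c') x) ?subr_eq0 //.
  rewrite (_ : _ *: x = y - (x1 + c' *: x)); first by smx.
  by rewrite /y scalerBl opprD addrACA subrr add0r.
rewrite -ec -/y in dc'; case/existsP: dc' => s /and3P[s0 sp ys].
have Ps := pl_PP G Pp sp s0.
have y0 : y != 0.
  apply: contraNneq nx1 => e; rewrite -(addrK (c *: x) x1) -/y e add0r; smx.
have yx : (y <= pl x)%MS by have := mem_pl G Px => ?; rewrite /y; smx.
have Py := pl_PP G Px yx y0; have xy := pl_sym G Px yx y0; have sy := pl_sym G Ps ys y0.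
have nwy : ~~ (y <= pl w)%MS by apply: contra nx => h; apply: (dist2P y0 h xy).
have [h|n] := boolP (s <= u + y)%MS; [by right; exists s | left].
have so : ~~ dist2 L w s.
  apply: (path3 Pu wu _ yu _ sy n).
    apply: contra nwy => h; suff -> : pl w = pl u by [].
    by apply: pl_eqmx; apply/eqmxP; rewrite h sub_vec_sym // (PP0 Pw).
  by apply: contra nwy => h; apply: submx_trans h _; have := mem_pl G Pw => ?; smx.
have sG := submx_trans sp (opp_pl Pp nd pG).
exact: submx_trans xy (opp_pl2 Ps so sG ys y0).
Qed.

(** If x escapes, [closure_or] on two lines through x gives neighbours s and r of p on the lines
    joining w's middle points u1 and u2 to the projections. Applying it also to a second point p' of
    the line of p and s makes u2 a neighbour of s. Then u1 = u2, and u2 and x form a quadrangle with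
    the two projections. *)
Lemma closure_all p x : PP p -> ~~ dist2 L w p -> (p <= Gs)%MS -> PP x -> (x <= Gs)%MS.
Proof.
move=> Pp nd pG Px.
have [/dist2_T h|nx] := boolP (dist2 L w x); first exact: submx_trans h TG.
have [x1 [x2 [x1x x2x nx1 nx2]]] := pl_plane Px.
have nx2' : ~~ (x2 <= x)%MS by apply: contra nx2 => h; smx.
have [c1 /existsP[u1 /and3P[u10 u1w yu1]]] := proj_ex Pw Px nx x1x nx1.
have [c2 /existsP[u2 /and3P[u20 u2w yu2]]] := proj_ex Pw Px nx x2x nx2'.
have [//|[s [s0 sl sp]]] := closure_or Pp nd pG Px nx x1x nx1 u10 u1w yu1.
have [//|[r [r0 rl rp]]] := closure_or Pp nd pG Px nx x2x nx2' u20 u2w yu2.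
have Pu1 := pl_PP G Pw u1w u10; have Pu2 := pl_PP G Pw u2w u20.
have Ps := pl_PP G Pp sp s0; have Pr := pl_PP G Pp rp r0.
have su1 : (s <= pl u1)%MS by apply: submx_trans sl _; have := mem_pl G Pu1 => ?; smx.
have ru2 : (r <= pl u2)%MS by apply: submx_trans rl _; have := mem_pl G Pu2 => ?; smx.
have ds : dist2 L w s := dist2P u10 u1w su1.
have ps := pl_sym G Pp sp s0.
have nps : ~~ (p <= s)%MS by apply: contra nd => h; apply: dist2P u10 u1w _; apply: submx_trans h su1.
have nsp : ~~ (s <= p)%MS by apply: contra nps; apply: sub_vec_sym.
(* Another point of the line of p and s; it is opposite to w because s is the projection of w
   there. *)
pose p' := p + s.
have p's : (p' <= pl s)%MS by have := mem_pl G Ps => ?; rewrite /p'; smx.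
have np's : ~~ (p' <= s)%MS by rewrite /p' addrC addv_sub_eq.
have Pp' : PP p' := pl_PP G Ps p's (notsub_nz np's).
have nd' : ~~ dist2 L w p'.
  apply/negP => d'; case/negP: (np's); apply: (proj_uniq Pw Pp nd sp nsp s0 (notsub_nz np's) _ _ ds d'); rewrite /p'; smx.
have p'G : (p' <= Gs)%MS by have := submx_trans sp (opp_pl Pp nd pG) => ?; rewrite /p'; smx.
have [//|[r' [r'0 r'l r'p]]] := closure_or Pp' nd' p'G Px nx x2x nx2' u20 u2w yu2.
have r'u2 : (r' <= pl u2)%MS by apply: submx_trans r'l _; have := mem_pl G Pu2 => ?; smx.
have Pr' := pl_PP G Pp' r'p r'0.
have d1 : dist2 L u2 p := dist2P r0 ru2 (pl_sym G Pp rp r0).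
have d2 : dist2 L u2 p' := dist2P r'0 r'u2 (pl_sym G Pp' r'p r'0).
have Ll := pl_line G Ps ps nps.
have [f2|nf2] := boolP (far L <<(s + p)%MS>>%MS u2).
  have h1 : (p <= <<(s + p)%MS>>)%MS by rewrite genmxE; smx.
  have h2 : (p' <= <<(s + p)%MS>>)%MS by rewrite genmxE /p'; smx.
  have := no_pent G Hp To Ll f2 (PP0 Pp) (PP0 Pp') h1 h2 (dist2_sym Pu2 (PP0 Pp) d1) (dist2_sym Pu2 (PP0 Pp') d2).
  by rewrite /p' addv_sub_eq // (negbTE nsp).
have [g [g0 gl gu]] : exists g : 'rV[F]_N, [/\ g != 0, (g <= s + p)%MS & (g <= pl u2)%MS].
  move: nf2; rewrite /far Pu2 /= => /rowV0Pn[g gc g0]; exists g; split=> //.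
    by apply: submx_trans gc _; apply: submx_trans (capmxSr _ _) _; rewrite genmxE.
  by apply: submx_trans gc _; apply: capmxSl.
(* The neighbour g of u2 on this line is at distance two from w through u2, so it is the projection
   s. *)
have gs : (s <= g)%MS.
  apply: (proj_uniq Pw Pp nd sp nsp g0 s0 _ _ (dist2P u20 u2w gu) ds); last by smx.
  by rewrite addsmxC.
have su2 : (s <= pl u2)%MS := submx_trans gs gu.
have nws : ~~ (s <= pl w)%MS by apply: contra nd => h; apply: (dist2P s0 h ps).
have u12 : (u1 <= u2)%MS.
  by apply: (mid_uniq G Pw Ps nws u10 u20 u1w _ u2w); apply: (pl_sym G _ _ s0).
have nxu : ~~ (x <= pl u2)%MS by apply: contra nx => h; apply: (dist2P u20 u2w h).
have y10 : x1 + c1 *: x != 0.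
  by apply: (@notsub_nz _ _ _ _ x); rewrite addrC addv_sub_eq //; smx.
have y20 : x2 + c2 *: x != 0.
  by apply: (@notsub_nz _ _ _ _ x); rewrite addrC addv_sub_eq //; smx.
have y1u2 : ((x1 + c1 *: x)%R <= pl u2)%MS.
  suff <- : pl u1 = pl u2 by []; apply: pl_eqmx; apply/eqmxP; rewrite u12 /=; exact: sub_vec_sym u12.
have mx := mem_pl G Px.
have yy : ((x2 + c2 *: x)%R <= (x1 + c1 *: x)%R)%MS.
  by apply: (mid_uniq G Pu2 Px nxu y20 y10 yu2 _ y1u2); smx.
case/negP: nx2; rewrite -(addrK (c2 *: x) x2); apply: addmx_sub; last by smx.
by apply: submx_trans yy _; smx.
Qed.

End Closure.

(* The points y + c z all lie in the coset of y modulo the line l through z: by [far_coset] they are its only hexagon points, so every Yset is all of them. *)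
Lemma pl_comb w y z (c : F) : PP w -> (y <= pl w)%MS -> (z <= pl w)%MS -> ~~ (y <= w)%MS ->
  ~~ (z <= w + y)%MS -> (pl (y + c *: z)%R <= pl y + pl z)%MS.
Proof.
move=> Pw yw zw nyw nz; have z0 := notsub_nz nz; have y0 := notsub_nz nyw.
have Pz := pl_PP G Pw zw z0; have Py := pl_PP G Pw yw y0.
have wz := pl_sym G Pw zw z0; have wy := pl_sym G Pw yw y0.
have nwz : ~~ (w <= z)%MS.
  by apply: contra nz => h; apply: submx_trans (sub_vec_sym (PP0 Pw) h) _; smx.
have nyzw : ~~ (y <= z + w)%MS.
  apply: contra nz; rewrite addsmxC => /sub_span2P[a [b e]]; have b0 : b != 0.
    by apply: contraNneq nyw => b0; rewrite e b0 scale0r addr0; smx.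
  by apply: (@sub_lin _ _ b z (a *: w) y); [exact: b0 | by rewrite addrC | smx | smx].
have [u [uz nu]] : exists u, (u <= pl z)%MS /\ ~~ (u <= z + w)%MS.
  by apply: ex_outside; rewrite (rank_pl G Pz) rank_span2.
have nuz : ~~ (u <= z)%MS by apply: contra nu => h; smx.
have Ll := pl_line G Pz uz nuz; set l := <<(z + u)%MS>>%MS in Ll.
have zl : (z <= l)%MS by rewrite genmxE; smx.
have nwl : ~~ (w <= l)%MS.
  rewrite genmxE; apply: contra nu => /sub_span2P[a [b e]]; have b0 : b != 0.
    by apply: contraNneq nwz => b0; rewrite e b0 scale0r addr0; smx.
  by apply: (@sub_lin _ _ b u (a *: z) w); [exact: b0 | by rewrite addrC | smx | smx].
have zin : z \in lnz l by apply/lnzP.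
have fy : far L l y := far_path G Ll zin wz nwl yw nyzw.
have dzy : dist2 L z y := dist2P (PP0 Pw) wz yw.
have [t [ty nt]] : exists t, (t <= pl y)%MS /\ ~~ (t <= y + w)%MS.
  apply: ex_outside; rewrite (rank_pl G Py) rank_span2 //.
  by apply: contra nyw; apply: sub_vec_sym; exact: (PP0 Pw).
have nty : ~~ (t <= y)%MS by apply: contra nt => h; smx.
have Lm := pl_line G Py ty nty; set m := <<(y + t)%MS>>%MS in Lm.
have ym : (y <= m)%MS by rewrite genmxE; smx.
have mt : m \in lthru L y by rewrite inE Lm.
have inj : injective (fun c : F => y + c *: z) by move=> c1 c2 /addrI; apply: card_line_inj.
have eY : Yset L l y m = [set y + c *: z | c : F].
  apply/eqP; rewrite eqEcard (card_imset _ inj) (Yset_ge G Ll fy mt) andbT.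
  apply/subsetP => y'; rewrite YsetE inE => /and3P[yl' Py' _].
  have /sub_vecP[k e] : ((y' - y)%R <= z)%MS.
    by apply: (far_coset G Hp To Ll fy z0 zl dzy yl'); rewrite addrC subrK.
  by apply/imsetP; exists k => //; rewrite -e addrC subrK.
have : y + c *: z \in Yset L l y m by rewrite eY; apply/imsetP; exists c.
rewrite YsetE => /and3P[_ Py' r2].
have y'w : ((y + c *: z)%R <= pl w)%MS by smx.
have wy' := pl_sym G Pw y'w (PP0 Py').
have mly : (m <= pl y)%MS by rewrite genmxE; have := mem_pl G Py => ?; smx.
have rm : \rank m = 2%N := fl_rank G Lm.
have rS : \rank (l + m)%MS = 4%N.
  have := mxrank_sum_cap l m; rewrite (fl_rank G Ll) rm.
  have -> : \rank (l :&: m)%MS = 0%N; last by rewrite addn0.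
  apply/eqP; rewrite mxrank_eq0 -submx0; case/andP: fy => _ /eqP <-.
  by rewrite sub_capmx capmxSl andbT; apply: submx_trans (capmxSr _ _) mly.
have nwS : ~~ (w <= l + m)%MS.
  apply/negP => wS; have := far_solid G Ll fy rS (addsmxSl _ _); rewrite leqNgt => /negP; apply.
  apply: (@leq_trans (\rank (m + w)%MS)).
    rewrite rank_addv ?rm //; rewrite genmxE; apply: contra nt => /sub_span2P[a [b e]]; have b0 : b != 0.
      apply: contraNneq nyw => b0; rewrite e b0 scale0r addr0 in wS *.
      have a0 : a != 0 by apply: contraNneq (PP0 Pw) => a0; rewrite e b0 a0 !scale0r addr0.
      by apply/sub_vecP; exists a^-1; rewrite scalerA mulVf // scale1r.
    by apply: (@sub_lin _ _ b t (a *: y) w); [exact: b0 | by rewrite addrC | smx | smx].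
  by apply: mxrankS; rewrite sub_capmx; apply/andP; split; smx.
have [k [kc nk]] : exists k : 'rV[F]_N, (k <= pl (y + c *: z)%R :&: (l + m))%MS /\ ~~ (k <= (y + c *: z)%R)%MS.
  by apply: ex_outside; rewrite (rank_vec (PP0 Py')).
have ky' := submx_trans kc (capmxSl _ _); have kS := submx_trans kc (capmxSr _ _).
have lz : (l <= pl z)%MS by rewrite genmxE; have := mem_pl G Pz => ?; smx.
have zpz := mem_pl G Pz; have ypy := mem_pl G Py.
have lmU : (l + m <= pl y + pl z)%MS by smx.
have y'U : ((y + c *: z)%R <= pl y + pl z)%MS by smx.
have y'S : ((y + c *: z)%R <= l + m)%MS by smx.
apply: (full2 G Py' ky' wy' nk _ y'U (submx_trans kS lmU)); last by smx.
by apply: contra nwS => h; apply: submx_trans h _; smx.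
Qed.

End Hexagon.

Ltac vec := apply/rowP => ?; rewrite !mxE; ring.

Lemma indep3 (F : fieldType) N (w y z : 'rV[F]_N) (a b c : F) :
  w != 0%R -> ~~ (y <= w)%MS -> ~~ (z <= w + y)%MS -> (a *: w + b *: y + c *: z = 0)%R ->
  [/\ a = 0, b = 0 & c = 0]%R.
Proof.
move=> w0 ny nz e.
have c0 : c = 0%R.
  apply: contraNeq nz => c0; rewrite -(@scale_sub_eq _ _ c z) //.
  rewrite (_ : c *: z = - (a *: w + b *: y))%R; first by smx.
  by apply/eqP; rewrite -addr_eq0 addrC e.
rewrite c0 scale0r addr0 in e.
have b0 : b = 0%R.
  apply: contraNeq ny => b0; rewrite -(@scale_sub_eq _ _ b y) //.
  rewrite (_ : b *: y = - (a *: w))%R; first by smx.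
  by apply/eqP; rewrite -addr_eq0 addrC e.
rewrite b0 scale0r addr0 in e; split=> //.
by apply/eqP; move/eqP: e; rewrite scaler_eq0 (negbTE w0) orbF.
Qed.

Lemma indep_det (F : fieldType) N (w y z : 'rV[F]_N) (a1 b1 c1 a2 b2 c2 : F) :
  w != 0%R -> ~~ (y <= w)%MS -> ~~ (z <= w + y)%MS -> (b1 * c2 - b2 * c1 != 0)%R ->
  ~~ ((a1 *: w + b1 *: y + c1 *: z)%R <= w + (a2 *: w + b2 *: y + c2 *: z)%R)%MS.
Proof.
move=> w0 ny nz d0; apply/negP => /sub_span2P[s [m e]].
have [_ eb ec] : [/\ a1 - (s + m * a2) = 0, b1 - m * b2 = 0 & c1 - m * c2 = 0]%R.
  apply: (indep3 w0 ny nz); have : (a1 *: w + b1 *: y + c1 *: z - (s *: w + m *: (a2 *: w + b2 *: y + c2 *: z)) = 0)%R.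
    by rewrite -e subrr.
  by move=> <-; vec.
case/negP: d0; apply/eqP; move/subr0_eq: eb => ->; move/subr0_eq: ec => ->; ring.
Qed.

(** * The rank of T w *)

Section TSpace.
Local Open Scope ring_scope.
Variables (F : finFieldType) (N : nat) (L : {set 'M[F]_N}).
Hypothesis G : flat L.
Local Notation q := #|F|.
Local Notation PP := (hpoint L).
Local Notation pl := (tplane L).
Local Notation T := (tspace L).
Implicit Types (x y z a b d p u v w t s r e : 'rV[F]_N) (l m n S E U H Gs : 'M[F]_N).
Hypothesis Hp : forall H, \rank H = 6%N -> (nb_in L H <= q ^ 4 - q ^ 3 + 3 * q ^ 2 + 2 * q)%N.
Hypothesis To : (#|L| <= q ^ 5 + q ^ 4 + q ^ 3 + q ^ 2 + q + 1)%N.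
Let q1 := q_gt1 F.

Section OnePoint.
Variables (w y z : 'rV[F]_N).
Hypotheses (Pw : PP w) (yw : (y <= pl w)%MS) (zw : (z <= pl w)%MS).
Hypotheses (ny : ~~ (y <= w)%MS) (nz : ~~ (z <= w + y)%MS).
Let w0 := PP0 Pw.

(** A form of [pl_comb] in the basis w, y, z of [pl w]; the nonzero determinant says that the line
    of the two points misses w. *)
Let comb p (k m a1 b1 c1 a2 b2 c2 : F) : b1 * c2 - b2 * c1 != 0 -> p != 0 ->
  p = k *: (a1 *: w + b1 *: y + c1 *: z) + m *: (a2 *: w + b2 *: y + c2 *: z) ->
  (pl p <= pl (a1 *: w + b1 *: y + c1 *: z)%R + pl (a2 *: w + b2 *: y + c2 *: z)%R)%MS.
Proof.
move=> d0 p0 ep; have ww := mem_pl G Pw; have d0' : b2 * c1 - b1 * c2 != 0 by rewrite -opprB oppr_eq0.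
have [k0|nk] := eqVneq k 0.
  rewrite ep k0 scale0r add0r pl_scale; first by smx.
  by apply: contraNneq p0 => m0; rewrite ep k0 m0 !scale0r addr0.
have -> : p = k *: (a1 *: w + b1 *: y + c1 *: z + (m / k) *: (a2 *: w + b2 *: y + c2 *: z)).
  by rewrite ep [RHS]scalerDr scalerA [k * _]mulrC divfK.
rewrite pl_scale //; apply: (pl_comb G Hp To _ Pw); first by smx.
- by smx.
- have := indep_det a1 a2 w0 ny nz d0; apply: contra => h; smx.
- exact: (indep_det a2 a1 w0 ny nz d0').
Qed.

Let Ey : 0 *: w + 1 *: y + 0 *: z = y. Proof. by vec. Qed.
Let Ez : 0 *: w + 0 *: y + 1 *: z = z. Proof. by vec. Qed.
Let Es : 1 *: w + 1 *: y + 1 *: z = w + y + z. Proof. by vec. Qed.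

(** Starting from y, z and w + y + z, every point of [pl w] except w is reached by at most two joins
    along lines that miss w, and [pl_comb] carries the planes along. *)
Lemma T_span : (T w <= pl y + pl z + pl (w + y + z)%R)%MS.
Proof.
have pz : (pl z <= pl y + pl z + pl (w + y + z)%R)%MS by smx.
have py : (pl y <= pl y + pl z + pl (w + y + z)%R)%MS by smx.
have ps : (pl (w + y + z)%R <= pl y + pl z + pl (w + y + z)%R)%MS by smx.
set K := (pl y + pl z + pl (w + y + z)%R)%MS in pz py ps *.
apply/sumsmx_subP => p /andP[pw p0].
have : (p <= w + y + z)%MS by apply: submx_trans pw _; apply: (pl3 G Pw).
case/sub_span3P => a [b [c ep]].
have [a0|na] := eqVneq a 0.
  have d1 : 1 * 1 - 0 * 0 != 0 :> F by rewrite mul0r subr0 mulr1 oner_neq0.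
  have := @comb p b c 0 1 0 0 0 1 d1 p0; rewrite Ey Ez => h.
  by apply: (submx_trans (h _)); [rewrite ep a0; vec | smx].
have [c0|nc] := eqVneq c 0.
  have [b0|nb] := eqVneq b 0.
    have -> : pl p = pl w by rewrite ep b0 c0 !scale0r !addr0 pl_scale.
    have h1 := pl_sym G Pw yw (notsub_nz ny); have h2 := mem_pl G (pl_PP G Pw yw (notsub_nz ny)).
    have h3 := mem_pl G (pl_PP G Pw zw (notsub_nz nz)).
    apply: submx_trans (pl3 G Pw yw zw ny nz) _; smx.
    - exact: submx_trans h1 py.
    - exact: submx_trans h2 py.
    - exact: submx_trans h3 pz.
  have d1 : 1 * 0 - 1 * 1 != 0 :> F by rewrite mulr0 sub0r mulr1 oppr_eq0 oner_neq0.
  have d2 : b * 1 - 0 * a != 0 by rewrite mul0r subr0 mulr1.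
  have t0 : a *: w + b *: y + a *: z != 0.
    by apply: contraNneq nb => /(indep3 w0 ny nz)[_ ->].
  have := @comb (a *: w + b *: y + a *: z) a (b - a) 1 1 1 0 1 0 d1 t0; rewrite Ey Es => h1.
  have := @comb p 1 (- a) a b a 0 0 1 d2 p0; rewrite Ez => h2.
  apply: (submx_trans (h2 _)); first by rewrite ep c0; vec.
  rewrite addsmx_sub pz andbT; apply: (submx_trans (h1 _)); [by vec | smx].
have d1 : 1 * 1 - 0 * 1 != 0 :> F by rewrite mul0r subr0 mulr1 oner_neq0.
have d2 : a * 0 - 1 * c != 0 by rewrite mulr0 sub0r mul1r oppr_eq0.
have t0 : a *: w + a *: y + c *: z != 0.
  by apply: contraNneq na => /(indep3 w0 ny nz)[->].
have := @comb (a *: w + a *: y + c *: z) a (c - a) 1 1 1 0 0 1 d1 t0; rewrite Ez Es => h1.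
have := @comb p 1 (b - a) a a c 0 1 0 d2 p0; rewrite Ey => h2.
apply: (submx_trans (h2 _)); first by rewrite ep; vec.
rewrite addsmx_sub py andbT; apply: (submx_trans (h1 _)); [by vec | smx].
Qed.

(** The planes at y and z meet in w only and span rank five, and the plane at w + y + z adds at most
    one more dimension. If it added none, the planes at the q + 2 points y + c z, z and w + y + z
    would lie in rank five, against [dlemma]. *)
Lemma rank_T_aux : \rank (T w) = 6%N.
Proof.
have y0 := notsub_nz ny; have z0 := notsub_nz nz; have ww := mem_pl G Pw.
have Py := pl_PP G Pw yw y0; have Pz := pl_PP G Pw zw z0.
have wy := pl_sym G Pw yw y0; have wz := pl_sym G Pw zw z0.
have nzy : ~~ (z <= pl y)%MS.
  by apply/negP => h; have := pl_notri G Pw yw zw y0 h; rewrite rank_addv // rank_span2.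
have rc : (\rank (pl y :&: pl z)%MS <= 1)%N.
  rewrite -[X in (_ <= X)%N](rank_vec w0); apply: mxrankS; apply/row_subP => i.
  set v := row i _; have [->|v0] := eqVneq v 0; first exact: sub0mx.
  have : (v <= pl y :&: pl z)%MS by apply: row_sub.
  by rewrite sub_capmx => /andP[vy vz]; apply: (mid_uniq G Py Pz nzy v0 w0).
have r5 : (5 <= \rank (pl y + pl z)%MS)%N.
  have := mxrank_sum_cap (pl y) (pl z); rewrite (rank_pl G Py) (rank_pl G Pz).
  by move: rc; move: (\rank _) (\rank _) => i j; clear; lia.
have s0 : ~~ ((w + y + z)%R <= w + y)%MS by rewrite addv_sub_eq //; smx.
have sw : ((w + y + z)%R <= pl w)%MS by smx.
have Ps := pl_PP G Pw sw (notsub_nz s0).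
have yy := mem_pl G Py; have zz := mem_pl G Pz.
apply/eqP; rewrite eqn_leq; apply/andP; split.
  have [t [ts nt]] : exists t, (t <= pl (w + y + z)%R)%MS /\ ~~ (t <= (w + y + z)%R + w)%MS.
    apply: ex_outside; rewrite (rank_pl G Ps) rank_span2 ?(PP0 Ps) //.
    apply: contra nz => /(sub_vec_sym w0) h; rewrite (_ : z = (w + y + z) - (w + y)); last by vec.
    by apply: addmx_sub; [apply: submx_trans h _; smx | rewrite eqmx_opp; smx].
  have ws : (w <= pl (w + y + z)%R)%MS := pl_sym G Pw sw (notsub_nz s0).
  have nws : ~~ (w <= (w + y + z)%R)%MS.
    apply: contra nz => /(sub_vec_sym w0) h; rewrite (_ : z = (w + y + z) - (w + y)); last by vec.
    by apply: addmx_sub; [apply: submx_trans h _; smx | rewrite eqmx_opp; smx].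
  have h : (T w <= pl y + pl z + t)%MS.
    apply: submx_trans T_span _; rewrite addsmx_sub; apply/andP; split; first by smx.
    by apply: submx_trans (pl3 G Ps ws ts nws nt) _; smx.
  apply: leq_trans (mxrankS h) _; apply: leq_trans (rank_addv_le _ _) _; rewrite ltnS.
  have := mxrank_sum_cap (pl y) (pl z); rewrite (rank_pl G Py) (rank_pl G Pz).
  have : (0 < \rank (pl y :&: pl z)%MS)%N.
    rewrite -[X in (X <= _)%N](rank_vec w0); apply: mxrankS; by rewrite sub_capmx wy.
  by move: (\rank _) (\rank _) => i j; clear; lia.
rewrite ltnNge; apply/negP => r.
have hyz : (pl y + pl z <= T w)%MS by rewrite addsmx_sub !pl_T.
have rT : \rank (T w) = 5%N.
  by apply/eqP; rewrite eqn_leq r (leq_trans r5 (mxrankS hyz)).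
have nzw : ~~ (z <= w)%MS by apply: contra nz => h; smx.
have nzy2 : ~~ (z <= y)%MS by apply: contra nz => h; smx.
have nyz (c : F) : ~~ ((y + c *: z)%R <= w)%MS.
  apply/negP => /sub_vecP[k e]; have := @indep3 _ _ w y z (- k) 1 c w0 ny nz.
  case=> [|_ /eqP]; last by rewrite oner_eq0.
  by rewrite scale1r -addrA e; vec.
apply: (@dlemma _ _ _ G (T w) w (fun c : F => y + c *: z) z (w + y + z)) => //.
- by apply: submx_trans (pl3 G Pw yw zw ny nz) _; apply: submx_trans hyz; smx.
- move=> c; split=> //; first by smx.
  by apply: pl_T; [smx | apply: notsub_nz (nyz c)].
- exact: pl_T.
- by apply: contra s0 => h; smx.
- by apply: pl_T => //; apply: notsub_nz s0.
- move=> c d ncd; apply: affine_nonpar => //; by apply: contra nzy2; apply: sub_vec_sym.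
- move=> c; apply/negP => /sub_vecP[k e]; have := @indep3 _ _ w y z 0 1 (c - k) w0 ny nz.
  case=> [|_ /eqP]; last by rewrite oner_eq0.
  by rewrite scalerBl -e; vec.
- move=> c; apply/negP => /sub_vecP[k e]; have := @indep3 _ _ w y z (- k) (1 - k) (c - k) w0 ny nz.
  case=> [|/eqP k0 /eqP]; last by move: k0; rewrite oppr_eq0 => /eqP ->; rewrite subr0 oner_eq0.
  by transitivity ((y + c *: z) - k *: (w + y + z)); [vec | rewrite -e subrr].
- apply/negP => /sub_vecP[k e]; have := @indep3 _ _ w y z (- k) (- k) (1 - k) w0 ny nz.
  case=> [|/eqP k0 _ /eqP]; last by move: k0; rewrite oppr_eq0 => /eqP ->; rewrite subr0 oner_eq0.
  by transitivity (z - k *: (w + y + z)); [vec | rewrite -e subrr].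
Qed.

End OnePoint.

Lemma rank_T w : PP w -> \rank (T w) = 6%N.
Proof. by move=> Pw; have [y [z [yw zw ny nz]]] := pl_plane G Pw; apply: (rank_T_aux Pw yw zw). Qed.

Lemma all_sub (Gs : 'M[F]_N) : (forall x, PP x -> (x <= Gs)%MS) -> forall l, l \in L -> (l <= Gs)%MS.
Proof.
move=> h l Ll; apply/row_subP => i; have [->|r0] := eqVneq (row i l) 0; first exact: sub0mx.
by apply: h; apply: (l_PP Ll r0); apply: row_sub.
Qed.

(** A point of T w opposite to w would, by [closure_all], put all lines of L into the hyperplane T
    w, more than (Hp') allows. *)
Lemma T_iff w p : PP w -> PP p -> (p <= T w)%MS = dist2 L w p.
Proof.
move=> Pw Pp; apply/idP/idP => [pT|]; last exact: dist2_T.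
apply: contraT => nd; have := Hp (rank_T Pw).
have -> : nb_in L (T w) = #|L|.
  apply: eq_card => l; rewrite inE; have [Ll|//] := boolP (l \in L); rewrite /=.
  by apply: all_sub Ll => x Px; apply: (closure_all G Hp To Pw (submx_refl _) Pp nd pT).
have [l Ll] : exists l, l \in L.
  by case/andP: Pw => _ /set0Pn[l]; rewrite inE => /andP[Ll _]; exists l.
move/(leq_trans (card_L_ge G Hp To Ll)).
move: q1; clear; case: #|F| => // k _; rewrite !expnS expn0; nia.
Qed.

Lemma T_all w p x : PP w -> PP p -> ~~ dist2 L w p -> PP x -> (x <= T w + p)%MS.
Proof.
move=> Pw Pp nd Px; rewrite -(genmxE (T w + p)%MS).
by apply: (closure_all G Hp To Pw _ Pp nd _ Px); rewrite genmxE; smx.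
Qed.

End TSpace.

(** * Apartments and frames *)

Section Apartment.
Local Open Scope ring_scope.
Variables (F : finFieldType) (N : nat) (L : {set 'M[F]_N}).
Hypothesis G : flat L.
Local Notation q := #|F|.
Local Notation PP := (hpoint L).
Local Notation pl := (tplane L).
Local Notation T := (tspace L).
Implicit Types (x y z a b d p u v w t s r e : 'rV[F]_N) (l m n S E U H Gs : 'M[F]_N).
Hypothesis Hp : forall H, \rank H = 6%N -> (nb_in L H <= q ^ 4 - q ^ 3 + 3 * q ^ 2 + 2 * q)%N.
Hypothesis To : (#|L| <= q ^ 5 + q ^ 4 + q ^ 3 + q ^ 2 + q + 1)%N.

Definition opp x y := [/\ PP x, PP y & ~~ dist2 L x y].

Lemma opp_sym x y : opp x y -> opp y x.
Proof. by case=> Px Py n; split=> //; apply: contra n; apply: (dist2_sym G Py (PP0 Px)). Qed.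

Lemma adj_add x y v : PP x -> PP y -> v != 0 -> (v <= pl x)%MS -> (v <= pl y)%MS ->
  x + y != 0 -> (v <= pl (x + y)%R)%MS.
Proof.
move=> Px Py v0 vx vy s0; have Pv := pl_PP G Px vx v0.
have h1 := pl_sym G Px vx v0; have h2 := pl_sym G Py vy v0.
by apply: (pl_sym G Pv _ s0); smx.
Qed.

Lemma opp_nz a b (a' : 'rV[F]_N) : opp a b -> (b <= pl a')%MS -> a' + a != 0.
Proof.
case=> Pa Pb n h; apply: contraNneq n => /eqP; rewrite addr_eq0 => /eqP e.
apply: (adj_dist2 G Pa); move: h; rewrite e -scaleN1r pl_scale //.
by rewrite oppr_eq0 oner_eq0.
Qed.

(** The indexing makes a_i a neighbour of b_j for i different from j and opposite to b_i, so
    permuting the indices or exchanging a and b gives an apartment again. *)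
Definition apt a1 a2 a3 b1 b2 b3 := [/\ opp a1 b1, opp a2 b2, opp a3 b3,
  [/\ (b2 <= pl a1)%MS, (b3 <= pl a2)%MS & (b1 <= pl a3)%MS] &
  [/\ (b3 <= pl a1)%MS, (b1 <= pl a2)%MS & (b2 <= pl a3)%MS]].

Lemma apt_rot a1 a2 a3 b1 b2 b3 : apt a1 a2 a3 b1 b2 b3 -> apt a2 a3 a1 b2 b3 b1.
Proof. by case=> o1 o2 o3 [h1 h2 h3] [h4 h5 h6]; split. Qed.

Lemma apt_swap a1 a2 a3 b1 b2 b3 : apt a1 a2 a3 b1 b2 b3 -> apt a1 a3 a2 b1 b3 b2.
Proof. by case=> o1 o2 o3 [h1 h2 h3] [h4 h5 h6]; split. Qed.

Lemma apt_dual a1 a2 a3 b1 b2 b3 : apt a1 a2 a3 b1 b2 b3 -> apt b1 b2 b3 a1 a2 a3.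
Proof.
case=> o1 o2 o3 [h1 h2 h3] [h4 h5 h6]; split; try exact: opp_sym.
- by case: o1 o2 o3 => P1 Q1 _ [P2 Q2 _] [P3 Q3 _]; split; apply: (pl_sym G) => //; apply: (@PP0 _ _ L).
- by case: o1 o2 o3 => P1 Q1 _ [P2 Q2 _] [P3 Q3 _]; split; apply: (pl_sym G) => //; apply: (@PP0 _ _ L).
Qed.

Lemma opp_scale (c : F) a b : c != 0 -> opp a b -> opp a (c *: b).
Proof.
move=> c0 [Pa Pb n]; split=> //; first by rewrite PP_scale.
apply: contra n => /existsP[w /and3P[w0 wa h]]; apply: (dist2P w0 wa).
by rewrite -(@scale_sub_eq _ _ c b) .
Qed.

Lemma apt_scale (c1 c2 c3 : F) a1 a2 a3 b1 b2 b3 : c1 != 0 -> c2 != 0 -> c3 != 0 ->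
  apt a1 a2 a3 b1 b2 b3 -> apt a1 a2 a3 (c1 *: b1) (c2 *: b2) (c3 *: b3).
Proof.
move=> n1 n2 n3 [o1 o2 o3 [h1 h2 h3] [h4 h5 h6]]; split; try exact: opp_scale.
  by split; smx.
by split; smx.
Qed.

(** From x go to two neighbours b2, b3 and on from b2 to a3; then a2 is the projection of a3 to a
    line through b3, and b1 is the middle point between a3 and a2. *)
Lemma apt_exists x : PP x -> exists a1 a2 a3 b1 b2 b3, apt a1 a2 a3 b1 b2 b3.
Proof.
move=> Px; have [b2 [b3 [b2x b3x n2 n3]]] := pl_plane G Px.
have b20 := notsub_nz n2; have b30 := notsub_nz n3.
have P2 := pl_PP G Px b2x b20; have P3 := pl_PP G Px b3x b30.
have xb2 := pl_sym G Px b2x b20; have xb3 := pl_sym G Px b3x b30; have x0 := PP0 Px.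
have n2' : ~~ (x <= b2)%MS by apply: contra n2; apply: sub_vec_sym.
have n3' : ~~ (b3 <= x)%MS by apply: contra n3 => h; smx.
have n3'' : ~~ (x <= b3)%MS by apply: contra n3'; apply: sub_vec_sym.
have n23 : ~~ (b2 <= b3 + x)%MS.
  apply: contra n3 => /sub_addvP[c [k [/sub_vecP[m ->] e]]]; have m0 : m != 0.
    by apply: contraNneq n2 => m0; rewrite e m0 scale0r add0r; smx.
  by apply: (@sub_lin _ _ m b3 (k *: x) b2); [exact: m0 | exact: e | smx | smx].
have [a3 [a3b2 na3]] : exists a, (a <= pl b2)%MS /\ ~~ (a <= x + b2)%MS.
  by apply: ex_outside; rewrite (rank_pl G P2) rank_span2.
have [v [vb3 nv]] : exists v, (v <= pl b3)%MS /\ ~~ (v <= b3 + x)%MS.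
  by apply: ex_outside; rewrite (rank_pl G P3) rank_span2.
have a30 := notsub_nz na3; have PA3 := pl_PP G P2 a3b2 a30.
have o3 : ~~ dist2 L b3 a3.
  by apply: (path3 G Hp To Px b3x n3' b2x n23 a3b2 na3).
have o3' : ~~ dist2 L a3 b3 by apply: contra o3; apply: (dist2_sym G PA3 b30).
have nv3 : ~~ (v <= b3)%MS by apply: contra nv => h; smx.
have [c dc] := proj_ex G Hp To PA3 P3 o3' vb3 nv3.
pose a2 := v + c *: b3; have mb3 := mem_pl G P3.
have a2b3 : (a2 <= pl b3)%MS by rewrite /a2; smx.
have na2 : ~~ (a2 <= b3 + x)%MS by rewrite /a2 addrC addv_sub_eq //; smx.
have a20 := notsub_nz na2; have PA2 := pl_PP G P3 a2b3 a20.
have o2 : ~~ dist2 L b2 a2.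
  apply: (path3 G Hp To Px b2x n2 b3x _ a2b3); last by rewrite addsmxC.
  by rewrite addsmxC.
case/existsP: dc => b1 /and3P[b10 b1a3 a2b1]; rewrite -/a2 in a2b1.
have P1 := pl_PP G PA3 b1a3 b10.
have b1a2 := pl_sym G P1 a2b1 a20; have a3b1 := pl_sym G PA3 b1a3 b10.
have b2a3 := pl_sym G P2 a3b2 a30; have b3a2 := pl_sym G P3 a2b3 a20.
have o1 : ~~ dist2 L x b1.
  apply: (path3 G Hp To P2 xb2 n2' a3b2 na3 b1a3).
  apply: contra o2 => h; apply: (dist2_sym G PA2 b20); apply: (dist2P b10 b1a2).
  apply: (pl_sym G P2 _ b10).
  by apply: submx_trans h _; have := mem_pl G P2 => ?; smx.
exists x, a2, a3, b1, b2, b3; split; split=> //.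
by apply: contra o2; apply: (dist2_sym G PA2 b20).
Qed.

Section OneApt.
Variables (a1 a2 a3 b1 b2 b3 : 'rV[F]_N).
Hypothesis ap : apt a1 a2 a3 b1 b2 b3.

Lemma apt_T : [/\ (a1 + a2 + a3 + b2 + b3 <= T a1)%MS & ~~ (b1 <= T a1)%MS].
Proof.
case: ap => -[P1 Q1 n1] [P2 Q2 n2] [P3 Q3 n3] [h1 h2 h3] [h4 h5 h6]; split; last by rewrite (T_iff G Hp To).
have m1 := mem_pl G P1; have mb2 := pl_sym G P3 h6 (PP0 Q2); have mb3 := pl_sym G P2 h2 (PP0 Q3).
smx; apply: dist2_T.
- exact: (adj_dist2 G P1 m1).
- exact: (dist2P (PP0 Q3) h4 mb3).
- exact: (dist2P (PP0 Q2) h1 mb2).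
- exact: (adj_dist2 G P1 h1).
- exact: (adj_dist2 G P1 h4).
Qed.

Lemma apt_indep : [/\ ~~ (b2 <= a1)%MS & ~~ (b3 <= a1 + b2)%MS].
Proof.
case: ap => -[P1 Q1 n1] [P2 Q2 n2] [P3 Q3 n3] [h1 h2 h3] [h4 h5 h6].
have nb3 : ~~ (b3 <= a1 + b2)%MS.
  apply: contra n3 => h; apply: (dist2P (PP0 Q2) h6).
  by apply: submx_trans h _; have := mem_pl G Q2; have := pl_sym G P1 h1 (PP0 Q2) => ? ?; smx.
split=> //; apply: contra n2 => h; apply: (dist2P (PP0 Q3) h2).
by apply: submx_trans h _; apply: (pl_sym G P1 h4 (PP0 Q3)).
Qed.

(** Modulo the hyperplane T a1 only the term of b1 survives. *)
Lemma apt_coef (x2 x3 y1 y2 y3 t x1 : F) e : (e <= T a1)%MS ->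
  x1 *: a1 + x2 *: a2 + x3 *: a3 + t *: e + y1 *: b1 + y2 *: b2 + y3 *: b3 = 0 -> y1 = 0.
Proof.
move=> eT e0; have [s nb] := apt_T; apply: contraNeq nb => n.
have : ((x1 *: a1 + x2 *: a2 + x3 *: a3 + t *: e + y2 *: b2 + y3 *: b3)%R <= T a1)%MS.
  by move: s; rewrite !addsmx_sub -!andbA => /and5P[? ? ? ? ?]; smx.
rewrite (_ : _ + _ = - (y1 *: b1)); first by rewrite opp_sub_eq scale_sub_eq.
by apply/eqP; rewrite -addr_eq0 -e0; apply/eqP; vec.
Qed.

End OneApt.

(** A point a3 + la a2 lies in T a1, so it has a common neighbour with a1; being in T b1 as well,
    this neighbour has the form b2 + r b3. The remaining point is that r depends linearly on la. *)
Lemma apt_nbr a1 a2 a3 b1 b2 b3 : apt a1 a2 a3 b1 b2 b3 ->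
  exists2 c : F, c != 0 & forall al be : F,
  al *: a3 + be *: a2 != 0 -> ((al *: b2 + (be * c) *: b3)%R <= pl (al *: a3 + be *: a2)%R)%MS.
Proof.
move=> ap; case: (ap) => -[P1 Q1 n1] [P2 Q2 n2] [P3 Q3 n3] [h1 h2 h3] [h4 h5 h6].
have [i1 i2] := apt_indep ap.
have [s _] := apt_T ap; move: s; rewrite !addsmx_sub -!andbA => /and5P[_ T2 T3 Tb2 Tb3].
have [s nT] := apt_T (apt_dual ap); move: s; rewrite !addsmx_sub -!andbA => /and5P[S1 S2 S3 _ _].
have a2b1 := pl_sym G P2 h5 (PP0 Q1); have a3b1 := pl_sym G P3 h3 (PP0 Q1).
have a2b3 := pl_sym G P2 h2 (PP0 Q3); have a3b2 := pl_sym G P3 h6 (PP0 Q2).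
have nb2 : ~~ (a2 <= pl b2)%MS by apply: contra n2 => h; apply: (adj_dist2 G P2); apply: (pl_sym G Q2 h (PP0 P2)).
have nb3 : ~~ (a3 <= pl b3)%MS by apply: contra n3 => h; apply: (adj_dist2 G P3); apply: (pl_sym G Q3 h (PP0 P3)).
have nz (la : F) : a3 + la *: a2 != 0.
  apply: contraNneq nb3 => e; rewrite -(addrK (la *: a2) a3) e add0r; smx.
have ex (la : F) : la != 0 -> exists2 r : F, r != 0 & ((b2 + r *: b3)%R <= pl (a3 + la *: a2)%R)%MS.
  move=> la0; set u := a3 + la *: a2.
  have ub1 : (u <= pl b1)%MS by rewrite /u; smx.
  have Pu : PP u := pl_PP G Q1 ub1 (nz la).
  have : dist2 L a1 u by rewrite -(T_iff G Hp To P1 Pu) /u; smx.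
  case/existsP => v /and3P[v0 va1 uv]; have Pv := pl_PP G P1 va1 v0.
  have vu := pl_sym G Pv uv (nz la).
  have : (v <= a1 + b2 + b3)%MS by apply: submx_trans va1 (pl3 G P1 h1 h4 i1 i2).
  case/sub_span3P => k [k2 [k3 ev]].
  have vT : (v <= T b1)%MS by apply: dist2_T; apply: (dist2P (nz la) ub1 vu).
  have k0 : k = 0.
    apply: contraNeq nT => k0.
    by apply: (@sub_lin _ _ k a1 (k2 *: b2 + k3 *: b3) v); [exact: k0 | rewrite addrA | exact: vT | smx].
  rewrite k0 scale0r add0r in ev.
  have k2n : k2 != 0.
    apply: contraNneq nb3 => e; have k3n : k3 != 0 by apply: contraNneq v0 => f; rewrite ev e f !scale0r addr0.
    rewrite -(addrK (la *: a2) a3) -/u; apply: addmx_sub; last by smx.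
    by move: uv; rewrite ev e scale0r add0r pl_scale.
  have k3n : k3 != 0.
    apply: contraNneq nb2 => e; rewrite -(@scale_sub_eq _ _ la a2) // -(addrK a3 (la *: a2)).
    rewrite [la *: a2 + a3]addrC -/u; apply: addmx_sub; last by smx.
    by move: uv; rewrite ev e scale0r addr0 pl_scale.
  exists (k3 / k2); first by rewrite mulf_neq0 ?invr_eq0.
  rewrite -(@scale_sub_eq _ _ k2) // scalerDr scalerA [k2 * _]mulrC divfK //; by rewrite -ev.
have Ll : <<(b3 + a2)%MS>>%MS \in L.
  apply: (pl_line G Q3 a2b3); apply: contra n2 => h; apply: (dist2_sym G Q2 (PP0 P2)).
  apply: (dist2P (PP0 P1) (pl_sym G P1 h1 (PP0 Q2))); apply: submx_trans h h4.
set l := <<(b3 + a2)%MS>>%MS in Ll.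
have ly (v : 'rV[F]_N) : (v <= l)%MS -> (v <= pl b3)%MS.
  by rewrite genmxE => h; apply: submx_trans h _; have := mem_pl G Q3 => ?; smx.
have nb23 : ~~ (b2 <= a3)%MS.
  apply: contra n2 => h; apply: (dist2P (PP0 Q1) h5); exact: submx_trans h a3b1.
have ya3 : ((a3 + b2)%R <= pl a3)%MS by have := mem_pl G P3 => ?; smx.
have yna3 : ~~ ((a3 + b2)%R <= a3)%MS by rewrite addv_sub_eq.
have Py := pl_PP G P3 ya3 (notsub_nz yna3).
have o33 : ~~ dist2 L b3 a3 by case: (opp_sym (And3 P3 Q3 n3)).
have db : dist2 L b3 b2 := dist2P (PP0 P1) (pl_sym G P1 h4 (PP0 Q3)) h1.
have ndy : ~~ dist2 L b3 (a3 + b2).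
  apply/negP => dy.
  have s1 : (b2 <= a3 + b2)%MS by smx.
  have s2 : ((a3 + b2)%R <= a3 + b2)%MS by smx.
  have := proj_uniq G Hp To Q3 P3 o33 h6 nb23 (PP0 Q2) (PP0 Py) s1 s2 db dy.
  by rewrite addrC addv_sub_eq // => h; case/negP: nb23; apply: sub_vec_sym h; apply: (PP0 P3).
have fy : far L l (a3 + b2).
  apply: farI => // z z0 /ly zb; apply/negP => h; case/negP: ndy.
  exact: (dist2P z0 zb (pl_sym G Py h z0)).
have [z [z0 zl dz]] := ex_dir G Hp To Ll fy.
have na2b3 : ~~ (a2 <= b3)%MS.
  apply: contra n2 => h; apply: (dist2_sym G Q2 (PP0 P2)).
  apply: (dist2P (PP0 P1) (pl_sym G P1 h1 (PP0 Q2))); exact: (submx_trans h h4).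
(* The sum of the collinear a3 + la a2 and b2 + r b3 is a point of the coset of a3 + b2 modulo l, so
   by [far_coset] the difference la a2 + r b3 is a multiple of the fixed z. *)
have inz (la r : F) : ((b2 + r *: b3)%R <= pl (a3 + la *: a2)%R)%MS -> ((la *: a2 + r *: b3)%R <= z)%MS.
  move=> h; have vl : ((la *: a2 + r *: b3)%R <= l)%MS by rewrite genmxE; smx.
  apply: (far_coset G Hp To Ll fy z0 zl dz vl).
  have Pu : PP (a3 + la *: a2) by apply: (pl_PP G Q1 _ (nz la)); smx.
  have e : a3 + b2 + (la *: a2 + r *: b3) = (a3 + la *: a2) + (b2 + r *: b3) by vec.
  rewrite e; apply: (pl_PP G Pu); first by have := mem_pl G Pu => ?; smx.
  rewrite -e; apply: (@notsub_nz _ _ _ _ l); rewrite addrC addv_sub_eq //; exact: (far_notin G fy).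
have [c c0 hc] := ex 1 (oner_neq0 _); exists c => //.
have zc : (z <= (a2 + c *: b3)%R)%MS.
  have := inz 1 c hc; rewrite scale1r => h; apply: sub_vec_sym h.
  by apply: (@notsub_nz _ _ _ _ b3); rewrite addrC addv_sub_eq //; smx.
have lin (la r : F) : ((b2 + r *: b3)%R <= pl (a3 + la *: a2)%R)%MS -> r = la * c.
  move/inz/submx_trans => /(_ _ _ zc)/sub_vecP[k e].
  have : (la - k) *: a2 + (r - k * c) *: b3 = 0.
    by rewrite -(subrr (k *: (a2 + c *: b3))) -{1}e; vec.
  move=> {}e; have ek : la = k.
    apply/eqP; rewrite -subr_eq0; apply: contraNT na2b3 => nk.
    rewrite -(@scale_sub_eq _ _ (la - k)) // (_ : _ *: a2 = - ((r - k * c) *: b3)); first by smx.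
    by apply/eqP; rewrite -addr_eq0 e.
  move/eqP: e; rewrite ek subrr scale0r add0r scaler_eq0 (negbTE (PP0 Q3)) orbF subr_eq0.
  by move/eqP.
move=> al be n0; have [al0|nal] := eqVneq al 0.
  have nbe : be != 0 by apply: contraNneq n0 => f; rewrite al0 f !scale0r addr0.
  by rewrite al0 !scale0r !add0r pl_scale //; smx.
have -> : al *: a3 + be *: a2 = al *: (a3 + (be / al) *: a2).
  by rewrite scalerDr scalerA [al * _]mulrC divfK.
rewrite pl_scale //; have [be0|nbe] := eqVneq be 0.
  by rewrite be0 !mul0r !scale0r !addr0; smx.
have la0 : be / al != 0 by rewrite mulf_neq0 ?invr_eq0.
have [r r0 hr] := ex _ la0; have er := lin _ _ hr.
rewrite (_ : _ + _ = al *: (b2 + r *: b3)); first by smx.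
by rewrite scalerDr scalerA er mulrA [al * _]mulrC divfK.
Qed.

(** Two of the three constants of [apt_nbr] are made -1 by rescaling the b_i. The third is then
    forced, by looking at the neighbours of a1 + a2 + a3. *)
Lemma apt_normal x : PP x -> exists a1 a2 a3 b1 b2 b3, apt a1 a2 a3 b1 b2 b3 /\
  forall al be : F,
    [/\ al *: a3 + be *: a2 != 0 -> ((al *: b2 - be *: b3)%R <= pl (al *: a3 + be *: a2)%R)%MS,
        al *: a3 + be *: a1 != 0 -> ((al *: b1 - be *: b3)%R <= pl (al *: a3 + be *: a1)%R)%MS &
        al *: a2 + be *: a1 != 0 -> ((al *: b1 - be *: b2)%R <= pl (al *: a2 + be *: a1)%R)%MS].
Proof.
move=> Px; have [a1 [a2 [a3 [b1 [b2 [b3 ap]]]]]] := apt_exists Px.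
have [c c0 hc] := apt_nbr ap.
have [d d0 hd] := apt_nbr (apt_swap (apt_rot ap)).
have nc0 : - c != 0 by rewrite oppr_eq0.
have cd0 : c / d != 0 by rewrite mulf_neq0 ?invr_eq0.
(* With b3 replaced by -c b3 the first constant c becomes -1, and the factor c / d on b1 does the
   same for d. *)
have ap' := apt_scale cd0 (oner_neq0 _) nc0 ap.
exists a1, a2, a3, ((c / d) *: b1), (1 *: b2), ((- c) *: b3); split=> //.
have [k k0 hk] := apt_nbr (apt_rot (apt_rot ap')).
have N1 (al be : F) : al *: a3 + be *: a2 != 0 ->
    ((al *: (1 *: b2) - be *: (- c *: b3))%R <= pl (al *: a3 + be *: a2)%R)%MS.
  by move=> /hc; rewrite (_ : _ + _ = al *: (1 *: b2) - be *: (- c *: b3)) //; vec.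
have N2 (al be : F) : al *: a3 + be *: a1 != 0 ->
    ((al *: ((c / d) *: b1) - be *: (- c *: b3))%R <= pl (al *: a3 + be *: a1)%R)%MS.
  move=> /hd; rewrite -(@scale_sub_eq _ _ (c / d)) //.
  rewrite (_ : _ *: (_ + _) = al *: ((c / d) *: b1) - be *: (- c *: b3)) //.
  by apply/rowP => i; rewrite !mxE; field.
suff ek : k = -1.
  move=> al be; split; [exact: N1 | exact: N2 | move=> /hk].
  by rewrite ek mulrN1 scaleNr.
clear hc hd; move: ap' hk N1 N2; move: (c / d *: b1) (1 *: b2) (- c *: b3) => {c d c0 d0 nc0 cd0 ap}c1 c2 c3 ap'.
case: (ap') => [][P1 Q1 n1] [P2 Q2 n2] [P3 Q3 n3] [h1 h2 h3] [h4 h5 h6] hk N1 N2.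
(* All of c2 - c3, c1 - c3 and c1 + k c2 are neighbours of u. If k were not -1, then c2 would be a
   neighbour too, hence c2 would be a neighbour of a2, its opposite. *)
pose u := a1 + a2 + a3.
have nb2 : ~~ (a2 <= pl c2)%MS by apply: contra n2 => h; apply: (adj_dist2 G P2); apply: (pl_sym G Q2 h (PP0 P2)).
have a1c2 := pl_sym G P1 h1 (PP0 Q2); have a3c2 := pl_sym G P3 h6 (PP0 Q2).
have u0 : u != 0.
  apply: contraNneq nb2 => e; rewrite -(addKr (a1 + a3) a2) addrAC -/u e addr0; smx.
have [i1 i2] := apt_indep ap'; have [i3 i4] := apt_indep (apt_rot ap').
have i5 : ~~ (c1 <= c2)%MS.
  apply: contra n1 => h; apply: (dist2P (PP0 Q2) h1); exact: submx_trans h (mem_pl G Q2).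
have v10 : c2 - c3 != 0.
  by apply: contraNneq i2 => /subr0_eq ->; smx.
have v20 : c1 - c3 != 0.
  by apply: contraNneq i4 => /subr0_eq ->; smx.
have v30 : c1 + k *: c2 != 0.
  apply: contraNneq i5 => e; rewrite -(addrK (k *: c2) c1) e add0r; smx.
have s1 : ((c2 - c3)%R <= pl u)%MS.
  have n0 := opp_nz (And3 P2 Q2 n2) h6.
  have := N1 1 1; rewrite !scale1r => /(_ n0) h.
  have Ps : PP (a3 + a2) by apply: (pl_PP G Q1 _ n0); have := pl_sym G P2 h5 (PP0 Q1); have := pl_sym G P3 h3 (PP0 Q1) => ? ?; smx.
  rewrite /u -addrA [a2 + a3]addrC; apply: adj_add => //; first by smx.
  by rewrite [a3 + a2]addrC addrA.
have s2 : ((c1 - c3)%R <= pl u)%MS.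
  have n0 := opp_nz (And3 P1 Q1 n1) h3.
  have := N2 1 1; rewrite !scale1r => /(_ n0) h.
  have Ps : PP (a3 + a1) by apply: (pl_PP G Q2 _ n0); smx.
  have e : u = a2 + (a3 + a1) by rewrite /u; vec.
  by rewrite e; apply: adj_add => //; [smx | rewrite -e].
have s3 : ((c1 + k *: c2)%R <= pl u)%MS.
  have n0 := opp_nz (And3 P1 Q1 n1) h5.
  have := hk 1 1; rewrite !scale1r mul1r => /(_ n0) h.
  have Ps : PP (a2 + a1) by apply: (pl_PP G Q3 _ n0); have := pl_sym G P2 h2 (PP0 Q3); have := pl_sym G P1 h4 (PP0 Q3) => ? ?; smx.
  have e : u = a3 + (a2 + a1) by rewrite /u; vec.
  by rewrite e; apply: adj_add => //; [smx | rewrite -e].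
have Pu : PP u.
  apply: (pl_PP G (pl_PP G P1 (_ : (c2 - c3)%R <= _)%MS v10) _ u0); first by smx.
  have n0 := opp_nz (And3 P2 Q2 n2) h6.
  have := N1 1 1; rewrite !scale1r => /(_ n0) h.
  have Ps : PP (a3 + a2) by apply: (pl_PP G Q1 _ n0); have := pl_sym G P2 h5 (PP0 Q1); have := pl_sym G P3 h3 (PP0 Q1) => ? ?; smx.
  have g1 := pl_sym G Ps h v10.
  have g2 : (a1 <= pl (c2 - c3)%R)%MS by apply: (pl_sym G P1 _ v10); smx.
  by rewrite /u (_ : _ + _ = a1 + (a3 + a2)); [smx | vec].
apply/eqP; rewrite -subr_eq0 opprK; apply: contraNT nb2 => nk.
have : (c2 <= pl u)%MS.
  rewrite -(@scale_sub_eq _ _ (k + 1)) //.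
  rewrite (_ : _ *: c2 = (c1 + k *: c2) - ((c1 - c3) - (c2 - c3))); first by smx.
  by vec.
move/(fun h => pl_sym G Pu h (PP0 Q2)) => h.
rewrite (_ : a2 = u - a1 - a3); first by smx.
by rewrite /u; vec.
Qed.

End Apartment.

(** * Dot and cross products *)

Section Vec3.
Local Open Scope ring_scope.
Variable F : fieldType.
Implicit Types (a b c d u v w : 'rV[F]_3) (k : F).

Definition j0 : 'I_3 := ord0.
Definition j1 : 'I_3 := @Ordinal 3 1 isT.
Definition j2 : 'I_3 := @Ordinal 3 2 isT.

Definition v3 (x y z : F) : 'rV[F]_3 := \row_i nth 0 [:: x; y; z] i.
Definition dot u v := u 0 j0 * v 0 j0 + u 0 j1 * v 0 j1 + u 0 j2 * v 0 j2.
Definition cross u v := v3 (u 0 j1 * v 0 j2 - u 0 j2 * v 0 j1)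
  (u 0 j2 * v 0 j0 - u 0 j0 * v 0 j2) (u 0 j0 * v 0 j1 - u 0 j1 * v 0 j0).

Lemma eq3 u v : u 0 j0 = v 0 j0 -> u 0 j1 = v 0 j1 -> u 0 j2 = v 0 j2 -> u = v.
Proof.
move=> h0 h1 h2; apply/rowP => -[[|[|[|//]]] p].
- by rewrite (_ : Ordinal p = j0) //; apply: val_inj.
- by rewrite (_ : Ordinal p = j1) //; apply: val_inj.
- by rewrite (_ : Ordinal p = j2) //; apply: val_inj.
Qed.

Lemma nz3 u : u != 0 -> [|| u 0 j0 != 0, u 0 j1 != 0 | u 0 j2 != 0].
Proof.
apply: contraNT; rewrite !negb_or !negbK => /and3P[/eqP h0 /eqP h1 /eqP h2].
by apply/eqP; apply: eq3; rewrite mxE.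
Qed.

End Vec3.

Ltac vec3 := apply: eq3; rewrite /cross /v3 /dot !mxE /=; ring.

Section Vec3Theory.
Local Open Scope ring_scope.
Variable F : fieldType.
Implicit Types (a b c d u v w : 'rV[F]_3) (k : F).

Lemma dotC u v : dot u v = dot v u. Proof. by rewrite /dot; ring. Qed.
Lemma dotDl u v w : dot (u + v) w = dot u w + dot v w. Proof. by rewrite /dot !mxE; ring. Qed.
Lemma dotDr u v w : dot w (u + v) = dot w u + dot w v. Proof. by rewrite /dot !mxE; ring. Qed.
Lemma dotZl k u w : dot (k *: u) w = k * dot u w. Proof. by rewrite /dot !mxE; ring. Qed.
Lemma dotZr k u w : dot w (k *: u) = k * dot w u. Proof. by rewrite /dot !mxE; ring. Qed.
Lemma dot0l w : dot 0 w = 0 :> F. Proof. by rewrite /dot !mxE; ring. Qed.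
Lemma dot0r w : dot w 0 = 0 :> F. Proof. by rewrite /dot !mxE; ring. Qed.
Lemma crossDl u v w : cross (u + v) w = cross u w + cross v w. Proof. by vec3. Qed.
Lemma crossDr u v w : cross w (u + v) = cross w u + cross w v. Proof. by vec3. Qed.
Lemma crossZl k u w : cross (k *: u) w = k *: cross u w. Proof. by vec3. Qed.
Lemma crossZr k u w : cross w (k *: u) = k *: cross w u. Proof. by vec3. Qed.
Lemma crossvv u : cross u u = 0. Proof. by vec3. Qed.
Lemma cross0l u : cross 0 u = 0. Proof. by vec3. Qed.
Lemma cross0r u : cross u 0 = 0. Proof. by vec3. Qed.
Lemma crossC u v : cross u v = - cross v u. Proof. by vec3. Qed.
Lemma dot_crossl u v : dot u (cross u v) = 0. Proof. by rewrite /dot /cross /v3 !mxE /=; ring. Qed.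
Lemma dot_crossr u v : dot v (cross u v) = 0. Proof. by rewrite /dot /cross /v3 !mxE /=; ring. Qed.
Lemma dot_cross_rot u v w : dot u (cross v w) = dot w (cross u v).
Proof. by rewrite /dot /cross /v3 !mxE /=; ring. Qed.
Lemma cross_cross a c d : cross (cross a c) d = dot a d *: c - dot c d *: a. Proof. by vec3. Qed.

Lemma perpP a b : a != 0 -> dot a b = 0 -> exists w, b = cross a w.
Proof.
move=> /nz3/or3P[] n; rewrite /dot => h.
- exists (v3 0 (b 0 j2 / a 0 j0) (- b 0 j1 / a 0 j0)).
  apply: eq3; rewrite !mxE /=; [|by field|by field].
  apply: (mulfI n); transitivity (- (a 0 j1 * b 0 j1 + a 0 j2 * b 0 j2)); last by field.
  by apply/eqP; rewrite -addr_eq0 addrA h.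
- exists (v3 (- b 0 j2 / a 0 j1) 0 (b 0 j0 / a 0 j1)).
  apply: eq3; rewrite !mxE /=; [by field| |by field].
  apply: (mulfI n); transitivity (- (a 0 j0 * b 0 j0 + a 0 j2 * b 0 j2)); last by field.
  by apply/eqP; rewrite -addr_eq0 addrA [X in X + _]addrC h.
- exists (v3 (b 0 j1 / a 0 j2) (- b 0 j0 / a 0 j2) 0).
  apply: eq3; rewrite !mxE /=; [by field|by field|].
  apply: (mulfI n); transitivity (- (a 0 j0 * b 0 j0 + a 0 j1 * b 0 j1)); last by field.
  by apply/eqP; rewrite -addr_eq0 addrC h.
Qed.

Lemma cross0P a c : a != 0 -> cross a c = 0 -> exists k, c = k *: a.
Proof.
move=> a0 h; move: (congr1 (fun u : 'rV_3 => u 0 j0) h) (congr1 (fun u : 'rV_3 => u 0 j1) h)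
  (congr1 (fun u : 'rV_3 => u 0 j2) h); rewrite !mxE /= => /subr0_eq h0 /subr0_eq h1 /subr0_eq h2.
case/or3P: (nz3 a0) => n.
- exists (c 0 j0 / a 0 j0); apply: eq3; rewrite !mxE; apply: (mulfI n); first by field.
  + by rewrite h2; field.
  + by rewrite -h1; field.
- exists (c 0 j1 / a 0 j1); apply: eq3; rewrite !mxE; apply: (mulfI n); [|by field|].
  + by rewrite -h2; field.
  + by rewrite h0; field.
- exists (c 0 j2 / a 0 j2); apply: eq3; rewrite !mxE; apply: (mulfI n); [| |by field].
  + by rewrite h1; field.
  + by rewrite -h0; field.
Qed.

Lemma cross_perp a b c : b != 0 -> dot a b = 0 -> dot c b = 0 -> exists k, cross a c = k *: b.
Proof.
move=> b0 ha hc; apply: cross0P => //; rewrite crossC cross_cross ha hc !scale0r subr0 oppr0 //.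
Qed.

Lemma dot_nz a : a != 0 -> exists b, dot a b != 0.
Proof.
case/nz3/or3P => n; [exists (v3 1 0 0)|exists (v3 0 1 0)|exists (v3 0 0 1)];
  by rewrite /dot !mxE /= !mulr0 ?mulr1 ?addr0 ?add0r.
Qed.

Lemma perp_ex b : exists2 a, a != 0 & dot a b = 0.
Proof.
have [h|n] := eqVneq (b 0 j0) 0.
  exists (v3 1 0 0); last by rewrite /dot !mxE /= h; ring.
  by apply/eqP => /rowP/(_ j0); rewrite !mxE /= => /eqP; rewrite oner_eq0.
exists (v3 (- b 0 j1) (b 0 j0) 0); last by rewrite /dot !mxE /=; ring.
by apply: contraNneq n => /rowP/(_ j1); rewrite !mxE /= => ->.
Qed.

End Vec3Theory.

(** * Frames *)

Section Mat3.
Local Open Scope ring_scope.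
Variables (F : fieldType) (N : nat).

Definition mat3 (x y z : 'rV[F]_N) : 'M[F]_(3, N) := \matrix_(i < 3) nth 0 [:: x; y; z] i.

Lemma mul_mat3 (a : 'rV[F]_3) x y z : a *m mat3 x y z = a 0 j0 *: x + a 0 j1 *: y + a 0 j2 *: z.
Proof.
rewrite mulmx_sum_row !big_ord_recl big_ord0 addr0 addrA /mat3 !rowK /=.
have -> : lift ord0 ord0 = j1 :> 'I_3 by apply: val_inj.
by have -> : lift ord0 (lift ord0 ord0) = j2 :> 'I_3 by apply: val_inj.
Qed.

Definition hcoord (A B : 'M[F]_(3, N)) (e : 'rV[F]_N) a t b := a *m A + t *: e + b *m B.

Variables (A B : 'M[F]_(3, N)) (e : 'rV[F]_N).
Local Notation P := (hcoord A B e).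

Lemma coordD a t b a' t' b' : P a t b + P a' t' b' = P (a + a') (t + t') (b + b').
Proof. by rewrite /hcoord !mulmxDl scalerDl addrACA [X in X + _]addrACA. Qed.

Lemma coordZ k a t b : k *: P a t b = P (k *: a) (k * t) (k *: b).
Proof. by rewrite /hcoord !scalerDr !scalemxAl scalerA. Qed.

Lemma coordA a : P a 0 0 = a *m A. Proof. by rewrite /hcoord scale0r mul0mx !addr0. Qed.
Lemma coordB b : P 0 0 b = b *m B. Proof. by rewrite /hcoord scale0r mul0mx !add0r. Qed.

Lemma coord_swap a t b : hcoord B A e b t a = P a t b.
Proof. by rewrite /hcoord addrC [b *m B + _]addrC addrA. Qed.

End Mat3.

Section Frame.
Local Open Scope ring_scope.
Variables (F : finFieldType) (N : nat) (L : {set 'M[F]_N}).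
Hypothesis G : flat L.
Local Notation q := #|F|.
Local Notation PP := (hpoint L).
Local Notation pl := (tplane L).
Local Notation T := (tspace L).
Implicit Types (x y z p u v w s r e : 'rV[F]_N) (l m n S E U H Gs V : 'M[F]_N).
Hypothesis Hp : forall H, \rank H = 6%N -> (nb_in L H <= q ^ 4 - q ^ 3 + 3 * q ^ 2 + 2 * q)%N.
Hypothesis To : (#|L| <= q ^ 5 + q ^ 4 + q ^ 3 + q ^ 2 + q + 1)%N.

(** The vector e is required in the hyperplanes of the six basis points only; [tau0] extends this to
    all points (a, 0, 0), and by [frame_swap] to all (0, 0, b). *)
Record frame (A B : 'M[F]_(3, N)) e : Prop := Frame {
  fr_inj : forall a t b, hcoord A B e a t b = 0 -> [/\ a = 0, t = 0 & b = 0];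
  fr_all : forall x, PP x -> exists a t b, x = hcoord A B e a t b;
  fr_A : forall a, a != 0 -> PP (a *m A);
  fr_B : forall b, b != 0 -> PP (b *m B);
  fr_adj : forall a b, a != 0 -> dot a b = 0 -> (b *m B <= pl (a *m A))%MS;
  fr_eA : forall i, (e <= T (row i A))%MS;
  fr_eB : forall i, (e <= T (row i B))%MS }.

Lemma frame_swap A B e : frame A B e -> frame B A e.
Proof.
case=> inj all fA fB adj eA eB; split=> //.
- by move=> a t b; rewrite coord_swap => /inj[].
- by move=> x /all[a [t [b ->]]]; exists b, t, a; rewrite coord_swap.
- move=> b a b0 d; have [->|a0] := eqVneq a 0; first by rewrite mul0mx sub0mx.
  apply: (pl_sym G (fA _ a0)); last exact: PP0 (fB _ b0).
  by apply: adj => //; rewrite dotC.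
Qed.

Lemma tspace_sub V w : (forall x, PP x -> (x <= V)%MS) -> (T w <= V)%MS.
Proof.
move=> h; apply/sumsmx_subP => p _; apply/sumsmx_subP => l; rewrite inE => /andP[Ll _].
exact: (all_sub h Ll).
Qed.

Lemma frame_exists x : PP x -> exists A B e, frame A B e.
Proof.
move=> Px; have [a1 [a2 [a3 [b1 [b2 [b3 [ap nb]]]]]]] := apt_normal G Hp To Px.
pose A := mat3 a1 a2 a3; pose B := mat3 b1 b2 b3.
case: (ap) => -[P1 Q1 n1] [P2 Q2 n2] [P3 Q3 n3] [h1 h2 h3] [h4 h5 h6].
pose V := <<(T a1 + b1)%MS>>%MS.
have rV : \rank V = 7%N.
  by rewrite mxrank_gen rank_addv ?(rank_T G Hp To P1) // (T_iff G Hp To P1 Q1).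
have inV y : PP y -> (y <= V)%MS by move=> Py; rewrite genmxE; apply: (T_all G Hp To P1 Q1 n1 Py).
have TV w : (T w <= V)%MS by apply: tspace_sub.
(* Inside rank seven each hyperplane lowers the rank by at most one, so six of them leave a nonzero
   e. *)
have step (X : 'M[F]_N) w : (X <= V)%MS -> PP w -> (\rank X <= (\rank (X :&: T w)%MS).+1)%N.
  move=> XV Pw; have := rank_cap_ge XV (TV w); rewrite (rank_T G Hp To Pw) rV.
  move: (\rank X) (\rank _) => i j; clear; lia.
have [e [e0 eT]] : exists e : 'rV[F]_N, e != 0 /\ (e <= T a1 :&: T a2 :&: T a3 :&: T b1 :&: T b2 :&: T b3)%MS.
  suff : (0 < \rank (T a1 :&: T a2 :&: T a3 :&: T b1 :&: T b2 :&: T b3)%MS)%N.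
    by rewrite lt0n mxrank_eq0 => /rowV0Pn[e eX e0]; exists e.
  have s1 := TV a1; have s2 := submx_trans (capmxSl _ (T a2)) s1.
  have s3 := submx_trans (capmxSl _ (T a3)) s2; have s4 := submx_trans (capmxSl _ (T b1)) s3.
  have s5 := submx_trans (capmxSl _ (T b2)) s4.
  have := step _ _ s1 P2; have := step _ _ s2 P3; have := step _ _ s3 Q1.
  have := step _ _ s4 Q2; have := step _ _ s5 Q3; rewrite (rank_T G Hp To P1).
  do 5!move: (\rank (_ :&: _)%MS) => ?; clear; lia.
move: eT; rewrite !sub_capmx -!andbA => /and5P[E1 E2 E3 E4 /andP[E5 E6]].
exists A, B, e.
have inj a t b : hcoord A B e a t b = 0 -> [/\ a = 0, t = 0 & b = 0].
  rewrite /hcoord !mul_mat3 => h.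
  have y1 : b 0 j0 = 0 by apply: (@apt_coef _ _ _ G Hp To _ _ _ _ _ _ ap (a 0 j1) (a 0 j2) (b 0 j0) (b 0 j1) (b 0 j2) t (a 0 j0) e E1); rewrite -h; vec.
  have y2 : b 0 j1 = 0 by apply: (@apt_coef _ _ _ G Hp To _ _ _ _ _ _ (apt_rot ap) (a 0 j2) (a 0 j0) (b 0 j1) (b 0 j2) (b 0 j0) t (a 0 j1) e E2); rewrite -h; vec.
  have y3 : b 0 j2 = 0 by apply: (@apt_coef _ _ _ G Hp To _ _ _ _ _ _ (apt_rot (apt_rot ap)) (a 0 j0) (a 0 j1) (b 0 j2) (b 0 j0) (b 0 j1) t (a 0 j2) e E3); rewrite -h; vec.
  have da := apt_dual G ap.
  have x1 : a 0 j0 = 0 by apply: (@apt_coef _ _ _ G Hp To _ _ _ _ _ _ da (b 0 j1) (b 0 j2) (a 0 j0) (a 0 j1) (a 0 j2) t (b 0 j0) e E4); rewrite -h; vec.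
  have x2 : a 0 j1 = 0 by apply: (@apt_coef _ _ _ G Hp To _ _ _ _ _ _ (apt_rot da) (b 0 j2) (b 0 j0) (a 0 j1) (a 0 j2) (a 0 j0) t (b 0 j1) e E5); rewrite -h; vec.
  have x3 : a 0 j2 = 0 by apply: (@apt_coef _ _ _ G Hp To _ _ _ _ _ _ (apt_rot (apt_rot da)) (b 0 j0) (b 0 j1) (a 0 j2) (a 0 j0) (a 0 j1) t (b 0 j2) e E6); rewrite -h; vec.
  split; try by apply: eq3; rewrite mxE.
  move: h; rewrite y1 y2 y3 x1 x2 x3 !scale0r !add0r !addr0 => /eqP.
  by rewrite scaler_eq0 (negbTE e0) orbF => /eqP.
have all y : PP y -> exists a t b, y = hcoord A B e a t b.
  move=> Py; pose M := col_mx A (col_mx e B).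
  have ME (v : 'rV[F]_(3 + (1 + 3))) : v *m M = hcoord A B e (lsubmx v) (lsubmx (rsubmx v) 0 0) (rsubmx (rsubmx v)).
    rewrite -{1}(hsubmxK v) -{1}(hsubmxK (rsubmx v)) !mul_row_col /hcoord -addrA; congr (_ + (_ + _)).
    by rewrite {1}[lsubmx (rsubmx v)]mx11_scalar mul_scalar_mx.
  have fM : row_free M.
    apply: inj_row_free => v; rewrite ME => /inj[z1 z2 z3].
    rewrite -(hsubmxK v) -(hsubmxK (rsubmx v)) z1 z3 [lsubmx (rsubmx v)]mx11_scalar z2.
    by rewrite raddf0 !row_mx0.
  have eV : (e <= V)%MS by apply: submx_trans E1 (TV a1).
  have MV : (M <= V)%MS.
    rewrite -addsmxE addsmx_sub -addsmxE addsmx_sub eV /=; apply/andP; split; apply/row_subP => -[[|[|[|//]]] i]; rewrite rowK; exact: inV.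
  have : (y <= M)%MS.
    apply: submx_trans (inV _ Py) _; apply: sub_rank_sup MV _; rewrite rV.
    by move/eqP: fM => ->.
  by case/submxP => v ->; rewrite ME; do 3!eexists.
have c0 (u : 'rV[F]_3) : u != 0 -> u *m A != 0.
  by apply: contraNneq => h; have [] := inj u 0 0; rewrite ?coordA // => ->.
have c1 (u : 'rV[F]_3) : u != 0 -> u *m B != 0.
  by apply: contraNneq => h; have [] := inj 0 0 u; rewrite ?coordB // => _ _ ->.
have sum y r v (k : F) : PP y -> v != 0 -> (v <= pl y)%MS -> (r = 0 \/ PP r /\ (v <= pl r)%MS) ->
    k *: y + r != 0 -> PP (k *: y + r) /\ (v <= pl (k *: y + r)%R)%MS.
  move=> Py v0 vy hr n0; have Pv := pl_PP G Py vy v0; have yv := pl_sym G Py vy v0.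
  have rv : (r <= pl v)%MS.
    by case: hr => [->|[Pr vr]]; [exact: sub0mx | apply: (pl_sym G Pr vr v0)].
  have s : ((k *: y + r)%R <= pl v)%MS by smx.
  by split; [apply: (pl_PP G Pv s n0) | apply: (pl_sym G Pv s n0)].
have a2b1 := pl_sym G P2 h5 (PP0 Q1); have a3b1 := pl_sym G P3 h3 (PP0 Q1).
have a2b3 := pl_sym G P2 h2 (PP0 Q3); have a3b2 := pl_sym G P3 h6 (PP0 Q2).
have a1b2 := pl_sym G P1 h1 (PP0 Q2); have a1b3 := pl_sym G P1 h4 (PP0 Q3).
have two y (y' b : 'rV[F]_N) (c d : F) : PP b -> (y <= pl b)%MS -> (y' <= pl b)%MS -> c *: y + d *: y' = 0 \/ PP (c *: y + d *: y').
  move=> Pb yb yb'; have [|n0] := eqVneq (c *: y + d *: y') 0; [by left | right].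
  by apply: (pl_PP G Pb _ n0); smx.
(* The three relations of [apt_normal], each extended by the missing a_i, make three combinations of
   the b_i neighbours of u; they span the products of u with all w. *)
have key (u : 'rV[F]_3) : u != 0 -> PP (u *m A) /\ forall w : 'rV[F]_3, (cross u w *m B <= pl (u *m A))%MS.
  move=> /c0; rewrite mul_mat3; set x1 := u 0 j0; set x2 := u 0 j1; set x3 := u 0 j2 => n0.
  have e1 : x1 *: a1 + x2 *: a2 + x3 *: a3 = x1 *: a1 + (x3 *: a3 + x2 *: a2) by vec.
  have e2 : x1 *: a1 + x2 *: a2 + x3 *: a3 = x2 *: a2 + (x3 *: a3 + x1 *: a1) by vec.
  have e3 : x1 *: a1 + x2 *: a2 + x3 *: a3 = x3 *: a3 + (x2 *: a2 + x1 *: a1) by vec.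
  have [N1 _ _] := nb x3 x2; have [_ N2 _] := nb x3 x1; have [_ _ N3] := nb x2 x1.
  have v1 : x3 *: b2 - x2 *: b3 != 0 -> PP (x1 *: a1 + x2 *: a2 + x3 *: a3) /\
      ((x3 *: b2 - x2 *: b3)%R <= pl (x1 *: a1 + x2 *: a2 + x3 *: a3)%R)%MS.
    move=> v0; rewrite e1; apply: sum; rewrite -?e1 //; first by smx.
    case: (two a3 a2 b1 x3 x2 Q1 a3b1 a2b1) => [->|h]; [by left | right; split=> //].
    by apply: N1; apply: PP0 h.
  have v2 : x3 *: b1 - x1 *: b3 != 0 -> PP (x1 *: a1 + x2 *: a2 + x3 *: a3) /\
      ((x3 *: b1 - x1 *: b3)%R <= pl (x1 *: a1 + x2 *: a2 + x3 *: a3)%R)%MS.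
    move=> v0; rewrite e2; apply: sum; rewrite -?e2 //; first by smx.
    case: (two a3 a1 b2 x3 x1 Q2 a3b2 a1b2) => [->|h]; [by left | right; split=> //].
    by apply: N2; apply: PP0 h.
  have v4 : x2 *: b1 - x1 *: b2 != 0 -> PP (x1 *: a1 + x2 *: a2 + x3 *: a3) /\
      ((x2 *: b1 - x1 *: b2)%R <= pl (x1 *: a1 + x2 *: a2 + x3 *: a3)%R)%MS.
    move=> v0; rewrite e3; apply: sum; rewrite -?e3 //; first by smx.
    case: (two a2 a1 b3 x2 x1 Q3 a2b3 a1b3) => [->|h]; [by left | right; split=> //].
    by apply: N3; apply: PP0 h.
  have s (v : 'rV[F]_N) : (v != 0 -> PP (x1 *: a1 + x2 *: a2 + x3 *: a3) /\
      (v <= pl (x1 *: a1 + x2 *: a2 + x3 *: a3)%R)%MS) -> (v <= pl (x1 *: a1 + x2 *: a2 + x3 *: a3)%R)%MS.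
    by have [-> _|n h] := eqVneq v 0; [exact: sub0mx | case: (h isT)].
  have [s1 s2 s3] := And3 (s _ v1) (s _ v2) (s _ v4).
  split.
    have [/eqP|/v1[]//] := eqVneq (x3 *: b2 - x2 *: b3) 0; rewrite subr_eq0 => /eqP e4.
    have [_ _ z] : [/\ 0 = 0 :> 'rV[F]_3, 0 = 0 :> F & v3 0 x3 (- x2) = 0].
      by apply: inj; rewrite coordB mul_mat3 !mxE /= e4; vec.
    have x20 : x2 = 0 by move/rowP/(_ j2): z; rewrite !mxE /= => /eqP; rewrite oppr_eq0 => /eqP.
    have x30 : x3 = 0 by move/rowP/(_ j1): z; rewrite !mxE.
    rewrite x20 x30 !scale0r !addr0 in n0 *; rewrite PP_scale //.
    by apply: contraNneq n0 => ->; rewrite scale0r.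
  move=> w; rewrite mul_mat3 !mxE /=.
  rewrite (_ : _ + _ = w 0 j0 *: (x3 *: b2 - x2 *: b3) - w 0 j1 *: (x3 *: b1 - x1 *: b3) + w 0 j2 *: (x2 *: b1 - x1 *: b2)); first by smx.
  by rewrite -/x1 -/x2 -/x3; vec.
split=> //.
- by move=> a /key[].
- move=> b b0; have [a a0 /(perpP a0)[w e1]] := perp_ex b; have [Pa h] := key a a0.
  by apply: (pl_PP G Pa _ (c1 _ b0)); rewrite e1.
- by move=> a b a0 /(perpP a0)[w ->]; have [_] := key a a0; apply.
- by case=> [[|[|[|//]]] i]; rewrite rowK.
- by case=> [[|[|[|//]]] i]; rewrite rowK.
Qed.

End Frame.

Lemma coordN (F : fieldType) N (A B : 'M[F]_(3, N)) e a t b :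
  (- hcoord A B e a t b = hcoord A B e (- a) (- t) (- b))%R.
Proof. by rewrite -scaleN1r coordZ !scaleN1r mulN1r. Qed.

Ltac crd := rewrite ?(coordZ, coordN, coordD); congr (hcoord _ _ _ _ _ _); first [vec | ring].

(** * Hyperplanes and planes in frame coordinates *)

Section FrameTheory.
Local Open Scope ring_scope.
Variables (F : finFieldType) (N : nat) (L : {set 'M[F]_N}).
Hypothesis G : flat L.
Local Notation q := #|F|.
Local Notation PP := (hpoint L).
Local Notation pl := (tplane L).
Local Notation T := (tspace L).
Implicit Types (x y z p u v w s r : 'rV[F]_N) (l m n S E U H Gs V : 'M[F]_N).
Hypothesis Hp : forall H, \rank H = 6%N -> (nb_in L H <= q ^ 4 - q ^ 3 + 3 * q ^ 2 + 2 * q)%N.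
Hypothesis To : (#|L| <= q ^ 5 + q ^ 4 + q ^ 3 + q ^ 2 + q + 1)%N.

Section OneFrame.
Variables (A B : 'M[F]_(3, N)) (e : 'rV[F]_N).
Hypothesis fr : frame L A B e.
Local Notation P := (hcoord A B e).
Implicit Types (a b c d : 'rV[F]_3) (t k : F).

Lemma coord_inj a t b a' t' b' : P a t b = P a' t' b' -> [/\ a = a', t = t' & b = b'].
Proof.
move/eqP; rewrite -subr_eq0 coordN coordD => /eqP/(fr_inj fr)[h1 h2 h3].
by split; apply/eqP; rewrite -subr_eq0; apply/eqP.
Qed.

Lemma hcoord0 : P 0 0 0 = 0. Proof. by rewrite coordA mul0mx. Qed.

Lemma coord_nz a t b : (P a t b != 0) = [|| a != 0, t != 0 | b != 0].
Proof.
have [h|n] := eqVneq (P a t b) 0; first by have [-> -> ->] := fr_inj fr h; rewrite !eqxx.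
symmetry; apply: contraNT n; rewrite !negb_or !negbK => /and3P[/eqP -> /eqP -> /eqP ->].
by rewrite hcoord0.
Qed.

Lemma PA a : a != 0 -> PP (P a 0 0). Proof. by rewrite coordA; apply: (fr_A fr). Qed.
Lemma PB b : b != 0 -> PP (P 0 0 b). Proof. by rewrite coordB; apply: (fr_B fr). Qed.

Lemma adjAB a b : a != 0 -> dot a b = 0 -> (P 0 0 b <= pl (P a 0 0))%MS.
Proof. by rewrite coordA coordB; apply: (fr_adj fr). Qed.

Lemma adjBA a b : b != 0 -> dot a b = 0 -> (P a 0 0 <= pl (P 0 0 b))%MS.
Proof. by rewrite coordA coordB dotC; apply: (fr_adj (frame_swap G fr)). Qed.

Lemma in_coord v p : PP p -> (v <= pl p)%MS -> exists a t b, v = P a t b.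
Proof.
move=> Pp vp; have [->|v0] := eqVneq v 0; first by exists 0, 0, 0; rewrite hcoord0.
exact: (fr_all fr (pl_PP G Pp vp v0)).
Qed.

(** With a' orthogonal to b and b' = a x a', the points (a, 0, 0), (0, 0, b'), (a', 0, 0), (0, 0, b)
    form a nondegenerate path, so [path3] applies. *)
Lemma far_AB a b : dot a b != 0 -> ~~ dist2 L (P a 0 0) (P 0 0 b).
Proof.
move=> n; have a0 : a != 0 by apply: contraNneq n => ->; rewrite dot0l.
have b0 : b != 0 by apply: contraNneq n => ->; rewrite dot0r.
have [a' a'0 h'] := perp_ex b; pose b' := cross a a'.
have nc k : a' != k *: a.
  apply: contraNneq a'0 => ek; rewrite ek dotZl in h'; move/eqP: h'.
  by rewrite mulf_eq0 (negbTE n) orbF ek => /eqP ->; rewrite scale0r.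
have b'0 : b' != 0.
  by apply/eqP => /(cross0P a0)[k ek]; case/eqP: (nc k).
have d1 : dot a b' = 0 by apply: dot_crossl.
have d2 : dot a' b' = 0 by apply: dot_crossr.
apply: (path3 G Hp To (PB b'0) (adjBA b'0 d1) _ (adjBA b'0 d2) _ (adjAB a'0 h')).
- apply/negP => /sub_vecP[k]; rewrite coordZ => /coord_inj[h _ _].
  by rewrite h scaler0 eqxx in a0.
- apply/negP => /sub_span2P[k [k' ]]; rewrite !coordZ coordD => /coord_inj[h _ _].
  by case/eqP: (nc k); rewrite h scaler0 addr0.
- apply/negP => /sub_span2P[k [k' ]]; rewrite !coordZ coordD => /coord_inj[_ _ h].
  by case/eqP: n; rewrite h scaler0 addr0 dotZr d1 mulr0.
Qed.

Lemma A_inT a c : a != 0 -> (P c 0 0 <= T (P a 0 0))%MS.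
Proof.
move=> a0; apply: dist2_T; have [h|n] := eqVneq (cross a c) 0.
  have [k ->] := cross0P a0 h; apply: (adj_dist2 G (PA a0)).
  have -> : P (k *: a) 0 0 = k *: P a 0 0 by crd.
  by apply: scalemx_sub; apply: (mem_pl G (PA a0)).
have d1 := dot_crossl a c; have d2 := dot_crossr a c.
by apply: (dist2P _ (adjAB a0 d1) (adjBA n d2)); apply: (PP0 (PB n)).
Qed.

(** The hyperplane T (a, 0, 0) has the equation a.d + k t = 0. The goal is k = 0, so that e lies in
    all these hyperplanes. *)
Definition tau a k := forall c t d, (P c t d <= T (P a 0 0))%MS = (dot a d + k * t == 0).

Lemma tau_ex a : a != 0 -> exists k, tau a k.
Proof.
move=> a0; have [b' n'] := dot_nz a0; pose b := (dot a b')^-1 *: b'.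
have ab : dot a b = 1 by rewrite dotZr mulVf.
have b0 : b != 0 by apply: contra_eq_neq ab => ->; rewrite dot0r eq_sym oner_neq0.
have nd : ~~ dist2 L (P a 0 0) (P 0 0 b) by apply: far_AB; rewrite ab oner_neq0.
have nT : ~~ (P 0 0 b <= T (P a 0 0))%MS by rewrite (T_iff G Hp To) ?PA ?PB.
have : (e <= T (P a 0 0) + P 0 0 b)%MS.
  rewrite -(genmxE (T (P a 0 0) + P 0 0 b)%MS); apply: submx_trans (fr_eA fr j0) _.
  by apply: tspace_sub => x Px; rewrite genmxE; apply: (T_all G Hp To) => //; [exact: PA | exact: PB].
case/sub_addvP => s [k [sT es]]; exists k => c t d.
have eP : e = P 0 1 0 by rewrite /hcoord !mul0mx scale1r add0r addr0.
have s1 : (P 0 1 (- k *: b) <= T (P a 0 0))%MS.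
  have -> : P 0 1 (- k *: b) = P 0 1 0 - k *: P 0 0 b by crd.
  by rewrite -eP [X in (X <= _)%MS](_ : _ = s) //; apply/eqP; rewrite subr_eq; apply/eqP.
have s2 : (P 0 0 (d - dot a d *: b) <= T (P a 0 0))%MS.
  apply: dist2_T; apply: (adj_dist2 G (PA a0)); apply: adjAB => //.
  by rewrite dotDr -scaleNr dotZr ab mulr1 subrr.
have s3 := A_inT c a0.
have -> : P c t d = P c 0 0 + t *: P 0 1 (- k *: b) + P 0 0 (d - dot a d *: b) + (dot a d + k * t) *: P 0 0 b.
  by crd.
have s4 : ((P c 0 0 + t *: P 0 1 (- k *: b) + P 0 0 (d - dot a d *: b))%R <= T (P a 0 0))%MS by smx.
rewrite addv_sub_eq //; have [->|h] := eqVneq (dot a d + k * t) 0; first by rewrite scale0r sub0mx.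
by rewrite scale_sub_eq // (negbTE nT).
Qed.

Lemma tau_scale a k (m : F) : m != 0 -> tau a k -> tau (m *: a) (m * k).
Proof.
move=> m0 h c t d; have -> : T (P (m *: a) 0 0) = T (P a 0 0).
  rewrite /tspace; have -> : P (m *: a) 0 0 = m *: P a 0 0 by crd.
  by rewrite pl_scale.
by rewrite h dotZl -mulrA -mulrDr mulf_eq0 (negbTE m0).
Qed.

Lemma T_sym x y : PP x -> PP y -> (x <= T y)%MS -> (y <= T x)%MS.
Proof.
move=> Px Py; rewrite !(T_iff G Hp To) //; exact: (dist2_sym G Py (PP0 Px)).
Qed.

Section Flag.
Variables a b : 'rV[F]_3.
Hypotheses (a0 : a != 0) (b0 : b != 0) (ab : dot a b = 0).

Lemma flag_PP : PP (P a 0 b).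
Proof.
apply: (pl_PP G (PA a0)); last by rewrite coord_nz a0.
have -> : P a 0 b = P a 0 0 + P 0 0 b by crd.
by have := mem_pl G (PA a0); have := adjAB a0 ab => ? ?; smx.
Qed.

Lemma flag_line : (P a 0 0 <= pl (P a 0 b))%MS /\ (P 0 0 b <= pl (P a 0 b))%MS.
Proof.
have Px := flag_PP; have mx := mem_pl G Px.
have h : (P a 0 0 <= pl (P a 0 b))%MS.
  apply: (pl_sym G (PA a0)); last exact: PP0 Px.
  have -> : P a 0 b = P a 0 0 + P 0 0 b by crd.
  by have := mem_pl G (PA a0); have := adjAB a0 ab => ? ?; smx.
split=> //; have -> : P 0 0 b = P a 0 b - P a 0 0 by crd.
by smx.
Qed.

(** Otherwise the plane at (a, 0, b) would lie in the solid spanned by the planes at (a, 0, 0) and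
    (0, 0, b), a third plane in one solid. *)
Lemma flag_notin c d : (P c 0 d <= pl (P a 0 b))%MS -> dot a d = 0 -> dot b c = 0 ->
  (P c 0 d <= P a 0 0 + P 0 0 b)%MS.
Proof.
move=> yx ad bc; apply: contraT => n; have Px := flag_PP; have [h1 h2] := flag_line.
have ny : ~~ (P 0 0 b <= P a 0 0)%MS.
  by apply/negP => /sub_vecP[k]; rewrite coordZ => /coord_inj[_ _ h]; move: b0; rewrite h scaler0 eqxx.
have rS := rank_pl2 G (PA a0) (adjAB a0 ab) ny.
have cd : dot c b = 0 by rewrite dotC.
have sx : (pl (P a 0 b) <= P a 0 0 + P 0 0 b + P c 0 d)%MS.
  apply: sub_rank_sup; first by smx.
  by rewrite (rank_pl G Px) rank_addv // rank_span2 // (PP0 (PA a0)).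
have sS : (pl (P a 0 b) <= pl (P a 0 0) + pl (P 0 0 b))%MS.
  apply: submx_trans sx _; have := mem_pl G (PA a0); have := mem_pl G (PB b0) => ? ?.
  have -> : P c 0 d = P c 0 0 + P 0 0 d by crd.
  by have := adjAB a0 ad; have := adjBA b0 cd => ? ?; smx.
have := solid3 G rS (PA a0) (PB b0) Px (addsmxSl _ _) (addsmxSr _ _) sS.
case/or3P => /sub_vecP[k]; rewrite coordZ => /coord_inj[g1 _ g2].
- by move: a0; rewrite g1 scaler0 eqxx.
- move/esym/eqP: g2; rewrite scaler_eq0 (negbTE b0) orbF => /eqP g2.
  by move: a0; rewrite g1 g2 scale0r eqxx.
- move/esym/eqP: g1; rewrite scaler_eq0 (negbTE a0) orbF => /eqP g1.
  by move: b0; rewrite g2 g1 scale0r eqxx.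
Qed.

(* By [flag_notin] the third generator of the plane leaves the hyperplane t = 0. *)
Lemma flag_ex0 : exists c t d, [/\ (P c t d <= pl (P a 0 b))%MS, ~~ (P c t d <= P a 0 0 + P 0 0 b)%MS,
  (P c t d <= T (P a 0 0))%MS & (P c t d <= T (P 0 0 b))%MS].
Proof.
have Px := flag_PP; have [h1 h2] := flag_line.
have [|y [yx ny]] := @ex_outside _ _ _ _ (P a 0 0 + P 0 0 b)%MS (pl (P a 0 b)).
  rewrite (rank_pl G Px); apply: leq_ltn_trans (rank_addv_le _ _) _; by rewrite (rank_vec (PP0 (PA a0))).
have [c [t [d ey]]] := in_coord Px yx; rewrite ey in yx ny; exists c, t, d; split=> //.
  by apply: dist2_T; apply: (dist2P (PP0 Px) _ yx); apply: (pl_sym G Px h1 (PP0 (PA a0))).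
by apply: dist2_T; apply: (dist2P (PP0 Px) _ yx); apply: (pl_sym G Px h2 (PP0 (PB b0))).
Qed.

End Flag.

End OneFrame.

Section TauZero.
Variables (A B : 'M[F]_(3, N)) (e : 'rV[F]_N).
Hypothesis fr : frame L A B e.
Local Notation P := (hcoord A B e).
Implicit Types (a b c d : 'rV[F]_3) (t k : F).
Let PA := PA fr.
Let PB := PB fr.
Let fr' := frame_swap G fr.

Lemma tauB_ex b : b != 0 -> exists k, forall c t d, (P c t d <= T (P 0 0 b))%MS = (dot b c + k * t == 0).
Proof. by move=> /(tau_ex fr')[k h]; exists k => c t d; rewrite -!(coord_swap A B e) h. Qed.

Lemma flag_ex a b : a != 0 -> b != 0 -> dot a b = 0 -> exists c d, (P c 1 d <= pl (P a 0 b))%MS.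
Proof.
move=> a0 b0 ab; have [c [t [d [yx ny yA yB]]]] := flag_ex0 fr a0 b0 ab.
have t0 : t != 0.
  apply/negP => /eqP t0; rewrite t0 in yx ny yA yB.
  have [k hk] := tau_ex fr a0; have [k' hk'] := tauB_ex b0.
  move: yA yB; rewrite hk hk' !mulr0 !addr0 => /eqP h1 /eqP h2.
  by case/negP: ny; apply: (flag_notin fr a0 b0 ab yx h1 h2).
exists (t^-1 *: c), (t^-1 *: d).
have -> : P (t^-1 *: c) 1 (t^-1 *: d) = t^-1 *: P c t d by rewrite coordZ mulVf.
by smx.
Qed.

(** A point y with middle coordinate 1 is found in both hyperplanes: take it in the plane at (a', 0,
    b) with b orthogonal to a' but not to a, and correct it by a multiple of (0, 0, b). By symmetry
    y also lies in the hyperplane of the sum, which kills its constant. *)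
Lemma tau_add a a' : cross a a' != 0 -> tau A B e a 0 -> tau A B e a' 0 -> tau A B e (a + a') 0.
Proof.
move=> ni h h'.
have a0 : a != 0 by apply: contraNneq ni => ->; rewrite cross0l.
have a'0 : a' != 0 by apply: contraNneq ni => ->; rewrite cross0r.
have s0 : a + a' != 0.
  by apply: contraNneq ni => /eqP; rewrite addr_eq0 => /eqP ->; rewrite -scaleN1r crossZl crossvv scaler0.
have [w nw] := dot_nz ni; pose b := cross a' w.
have ab : dot a b != 0 by rewrite /b dot_cross_rot dotC.
have b0 : b != 0 by apply: contraNneq ab => ->; rewrite dot0r.
have a'b : dot a' b = 0 by apply: dot_crossl.
have [c [d y0]] := flag_ex a'0 b0 a'b; have Px := flag_PP fr a'0 a'b.
have [l1 l2] := flag_line fr a'0 a'b.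
pose k := - dot a d / dot a b.
have yx : (P c 1 (d + k *: b) <= pl (P a' 0 b))%MS.
  have -> : P c 1 (d + k *: b) = P c 1 d + k *: P 0 0 b by crd.
  by smx.
have Py : PP (P c 1 (d + k *: b)) by apply: (pl_PP G Px yx); rewrite coord_nz // oner_neq0 orbT.
have yA : (P c 1 (d + k *: b) <= T (P a 0 0))%MS.
  by rewrite h mul0r addr0 dotDr dotZr /k divfK // subrr.
have yA' : (P c 1 (d + k *: b) <= T (P a' 0 0))%MS.
  apply: dist2_T; apply: (dist2P (PP0 Px) _ yx); apply: (pl_sym G Px l1 (PP0 (PA a'0))).
have yS : (P (a + a') 0 0 <= T (P c 1 (d + k *: b)))%MS.
  have -> : P (a + a') 0 0 = P a 0 0 + P a' 0 0 by crd.
  by have := T_sym Py (PA a0) yA; have := T_sym Py (PA a'0) yA' => ? ?; smx.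
have := T_sym (PA s0) Py yS; have [m hm] := tau_ex fr s0; rewrite hm dotDl.
move: yA; rewrite h mul0r addr0 => /eqP ->; move: yA'; rewrite h' mul0r addr0 => /eqP ->.
by rewrite !add0r mulr1 => /eqP m0; rewrite m0 in hm.
Qed.

(** The constant is zero for the three basis vectors by the choice of e, and this passes to
    multiples and sums. *)
Lemma tau0 a : a != 0 -> tau A B e a 0.
Proof.
pose good a := a != 0 -> tau A B e a 0.
have gZ k (u : 'rV[F]_3) : good u -> good (k *: u).
  move=> gu n; have k0 : k != 0 by apply: contraNneq n => ->; rewrite scale0r.
  rewrite -[0](mulr0 k); apply: (tau_scale k0); apply: gu; apply: contraNneq n => ->; by rewrite scaler0.
have gD (u v : 'rV[F]_3) : good u -> good v -> good (u + v).
  move=> gu gv; have [->|u0] := eqVneq u 0; first by rewrite add0r.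
  have [h|n] := eqVneq (cross u v) 0.
    by have [k ->] := cross0P u0 h; rewrite -{1}[u]scale1r -scalerDl; apply: gZ.
  have [->|v0] := eqVneq v 0; first by rewrite addr0.
  by move=> _; apply: tau_add => //; [apply: gu | apply: gv].
have g1 (i : 'I_3) : good (delta_mx 0 i).
  move=> n; have [k hk] := tau_ex fr n.
  have := fr_eA fr i; rewrite rowE -(coordA A B e).
  have {1}-> : e = P 0 1 0 by rewrite /hcoord !mul0mx scale1r add0r addr0.
  by rewrite hk dot0r add0r mulr1 => /eqP k0; rewrite k0 in hk.
rewrite (_ : a = a 0 j0 *: delta_mx 0 j0 + a 0 j1 *: delta_mx 0 j1 + a 0 j2 *: delta_mx 0 j2); last first.
  by apply: eq3; rewrite !mxE /=; ring.
by apply: (gD _ _ (gD _ _ _ _)); apply: gZ.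
Qed.

Lemma TA a c t d : a != 0 -> (P c t d <= T (P a 0 0))%MS = (dot a d == 0).
Proof. by move=> /tau0 ->; rewrite mul0r addr0. Qed.

End TauZero.

Section Kappa.
Variables (A B : 'M[F]_(3, N)) (e : 'rV[F]_N).
Hypothesis fr : frame L A B e.
Local Notation P := (hcoord A B e).
Implicit Types (a b c d : 'rV[F]_3) (t k : F).
Let PA := PA fr.
Let PB := PB fr.
Let fr' := frame_swap G fr.

Lemma TB b c t d : b != 0 -> (P c t d <= T (P 0 0 b))%MS = (dot b c == 0).
Proof. by move=> b0; rewrite -!(coord_swap A B e) (TA fr'). Qed.

(** For d orthogonal to a, the point (0, 0, b) is far from the line of (a, 0, 0) and (0, 0, d) with
    direction (0, 0, d). By [far_coset] adding (a, 0, 0) leaves the set of points. *)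
Lemma hyper_PP a b : a != 0 -> b != 0 -> PP (P a 0 b) -> dot a b = 0.
Proof.
move=> a0 b0 Px; apply/eqP; apply: contraT => n.
have nd := far_AB fr n.
have [d d0 h] := perp_ex a; rewrite dotC in h.
have Lm := pl_line G (PA a0) (adjAB fr a0 h).
have nda : ~~ (P 0 0 d <= P a 0 0)%MS.
  by apply/negP => /sub_vecP[k]; rewrite coordZ => /(coord_inj fr)[_ _ g]; rewrite g scaler0 eqxx in d0.
have {}Lm := Lm nda; set l := <<_>>%MS in Lm.
have nd' : ~~ dist2 L (P 0 0 b) (P a 0 0) by apply: contra nd; apply: (dist2_sym G (PB b0) (PP0 (PA a0))).
have fb : far L l (P 0 0 b) by apply: (opp_far G (PB b0) (PA a0) nd' (adjAB fr a0 h) nda).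
have dl : (P 0 0 d <= l)%MS by rewrite genmxE; smx.
have al : (P a 0 0 <= l)%MS by rewrite genmxE; smx.
have dd : dist2 L (P 0 0 d) (P 0 0 b).
  rewrite -(T_iff G Hp To (PB d0) (PB b0)) TB // dot0r //.
have : (P a 0 0 <= P 0 0 d)%MS.
  apply: (far_coset G Hp To Lm fb (PP0 (PB d0)) dl dd al).
  by have -> : P 0 0 b + P a 0 0 = P a 0 b by crd.
by case/sub_vecP => k; rewrite coordZ => /(coord_inj fr)[g _ _]; rewrite g scaler0 eqxx in a0.
Qed.

Lemma plA a c t d : a != 0 -> (P c t d <= pl (P a 0 0))%MS -> [/\ t = 0, dot a d = 0 & exists k, c = k *: a].
Proof.
move=> a0 h.
have [b' b'0 hb'] := perp_ex a; rewrite dotC in hb'.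
have [k nk] := dot_nz b'0; pose b := cross a k.
have ab : dot a b = 0 by apply: dot_crossl.
have ni : cross b' b != 0.
  rewrite /b crossC cross_cross hb' scale0r sub0r opprK scaler_eq0 negb_or a0 andbT dotC //.
have n1 : ~~ (P 0 0 b' <= P a 0 0)%MS.
  by apply/negP => /sub_vecP[m]; rewrite coordZ => /(coord_inj fr)[_ _ g]; rewrite g scaler0 eqxx in b'0.
have n2 : ~~ (P 0 0 b <= P a 0 0 + P 0 0 b')%MS.
  apply/negP => /sub_span2P[m [m']]; rewrite !coordZ coordD => /(coord_inj fr)[_ _ g].
  by case/eqP: ni; rewrite g scaler0 add0r crossZr crossvv scaler0.
have := submx_trans h (pl3 G (PA a0) (adjAB fr a0 hb') (adjAB fr a0 ab) n1 n2).
case/sub_span3P => m1 [m2 [m3]]; rewrite !coordZ !coordD => /(coord_inj fr)[-> -> ->].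
split; first by rewrite !mulr0 !addr0.
  by rewrite !dotDr !dotZr dot0r hb' ab !mulr0 !addr0.
by exists m1; rewrite !scaler0 !addr0.
Qed.

End Kappa.
End FrameTheory.

(** * The constant in a x c = k t b *)

Section KappaTheory.
Local Open Scope ring_scope.
Variables (F : finFieldType) (N : nat) (L : {set 'M[F]_N}).
Hypothesis G : flat L.
Local Notation q := #|F|.
Local Notation PP := (hpoint L).
Local Notation pl := (tplane L).
Local Notation T := (tspace L).
Implicit Types (x y z p : 'rV[F]_N) (H : 'M[F]_N).
Hypothesis Hp : forall H, \rank H = 6%N -> (nb_in L H <= q ^ 4 - q ^ 3 + 3 * q ^ 2 + 2 * q)%N.
Hypothesis To : (#|L| <= q ^ 5 + q ^ 4 + q ^ 3 + q ^ 2 + q + 1)%N.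

(** A priori the factor depends on a and b; it is shown not to depend on b by [kap_b] and not on a
    by [kap_a]. *)
Definition kap (A B : 'M[F]_(3, N)) e (a b : 'rV[F]_3) (k : F) := forall c (t : F) d,
  (hcoord A B e c t d <= pl (hcoord A B e a 0 b))%MS -> cross a c = (k * t) *: b.

Section OneFrame.
Variables (A B : 'M[F]_(3, N)) (e : 'rV[F]_N).
Hypothesis fr : frame L A B e.
Local Notation P := (hcoord A B e).
Local Notation kap := (kap A B e).
Implicit Types (a b c d : 'rV[F]_3) (t k : F).
Let PA := PA fr.
Let PB := PB fr.
Let fr' := frame_swap G fr.

Lemma plB b c t d : b != 0 -> (P c t d <= pl (P 0 0 b))%MS -> [/\ t = 0, dot b c = 0 & exists k, d = k *: b].
Proof. by move=> b0; rewrite -!(coord_swap A B e) => /(plA G fr' b0). Qed.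

Lemma flag_dots a b c t d : a != 0 -> b != 0 -> dot a b = 0 ->
  (P c t d <= pl (P a 0 b))%MS -> dot a d = 0 /\ dot b c = 0.
Proof.
move=> a0 b0 ab yx; have Px := flag_PP G fr a0 ab; have [h1 h2] := flag_line G fr a0 ab.
split; apply/eqP.
  rewrite -(TA G Hp To fr c t d a0); apply: dist2_T; apply: (dist2P (PP0 Px) _ yx).
  exact: (pl_sym G Px h1 (PP0 (PA a0))).
rewrite -(TB G Hp To fr c t d b0); apply: dist2_T; apply: (dist2P (PP0 Px) _ yx).
exact: (pl_sym G Px h2 (PP0 (PB b0))).
Qed.

Lemma flag_span a b c d : a != 0 -> b != 0 -> dot a b = 0 -> (P c 1 d <= pl (P a 0 b))%MS ->
  forall c' t d', (P c' t d' <= pl (P a 0 b))%MS ->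
  exists m m' : F, c' = m *: a + t *: c /\ d' = m' *: b + t *: d.
Proof.
move=> a0 b0 ab yx c' t d' h; have Px := flag_PP G fr a0 ab; have [h1 h2] := flag_line G fr a0 ab.
have ny : ~~ (P 0 0 b <= P a 0 0)%MS.
  by apply/negP => /sub_vecP[k]; rewrite coordZ => /(coord_inj fr)[_ _ g]; rewrite g scaler0 eqxx in b0.
have n1 : ~~ (P c 1 d <= P a 0 0 + P 0 0 b)%MS.
  apply/negP => /sub_span2P[k [k']]; rewrite !coordZ coordD => /(coord_inj fr)[_ /eqP g _].
  by rewrite !mulr0 addr0 oner_eq0 in g.
have sx : (pl (P a 0 b) <= P a 0 0 + P 0 0 b + P c 1 d)%MS.
  apply: sub_rank_sup; first by smx.
  by rewrite (rank_pl G Px) rank_addv // rank_span2 // (PP0 (PA a0)).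
have := submx_trans h sx; case/sub_span3P => m1 [m2 [m3]].
rewrite !coordZ !coordD !mulr0 !add0r mulr1 => /(coord_inj fr)[-> -> ->].
by exists m1, m2; rewrite !scaler0 add0r addr0.
Qed.

(** Both a and c are orthogonal to b, so a x c is a multiple of b; one neighbour with t = 1
    determines the others modulo (a, 0, 0) and (0, 0, b). *)
Lemma kap_ex a b : a != 0 -> b != 0 -> dot a b = 0 -> exists k, kap a b k.
Proof.
move=> a0 b0 ab; have [c [d yx]] := flag_ex G Hp To fr a0 b0 ab.
have [h1 h2] := flag_dots a0 b0 ab yx; rewrite dotC in h2.
have [k hk] := cross_perp b0 ab h2; exists k => c' t d' h.
have [m [m' [-> _]]] := flag_span a0 b0 ab yx h.
by rewrite crossDr !crossZr crossvv scaler0 add0r hk scalerA mulrC.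
Qed.

Lemma kap_uniq a b k k' : a != 0 -> b != 0 -> dot a b = 0 -> kap a b k -> kap a b k' -> k = k'.
Proof.
move=> a0 b0 ab h h'; have [c [d yx]] := flag_ex G Hp To fr a0 b0 ab.
have /eqP := h _ _ _ yx; rewrite (h' _ _ _ yx) !mulr1 -subr_eq0 -scalerBl scaler_eq0 (negbTE b0) orbF.
by rewrite subr_eq0 => /eqP.
Qed.

Lemma perp_other a b : a != 0 -> b != 0 -> dot a b = 0 -> exists2 d, dot a d = 0 & cross b d != 0.
Proof.
move=> a0 b0 ab; have [w nw] := dot_nz b0; exists (cross a w); first exact: dot_crossl.
rewrite crossC cross_cross ab scale0r sub0r opprK scaler_eq0 negb_or a0 andbT.
by rewrite dotC.
Qed.

(** If k = 0, then (0, 1, d) is a neighbour of (a, 0, b). It would have the two directions (a, 0, 0)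
    and (0, 0, b') on a line, a pentagon. *)
Lemma kap_nz a b k : a != 0 -> b != 0 -> dot a b = 0 -> kap a b k -> k != 0.
Proof.
move=> a0 b0 ab h; apply/eqP => k0; have [c [d yx]] := flag_ex G Hp To fr a0 b0 ab.
have := h _ _ _ yx; rewrite k0 mul0r scale0r => /(cross0P a0)[m em].
have Px := flag_PP G fr a0 ab; have [h1 h2] := flag_line G fr a0 ab.
have yx' : (P 0 1 d <= pl (P a 0 b))%MS.
  have -> : P 0 1 d = P c 1 d - m *: P a 0 0 by rewrite em; crd.
  by smx.
have [b' ab' ni] := perp_other a0 b0 ab.
have b'0 : b' != 0 by apply: contraNneq ni => ->; rewrite cross0r.
have nb' : ~~ (P 0 0 b' <= P a 0 0)%MS.
  by apply/negP => /sub_vecP[k']; rewrite coordZ => /(coord_inj fr)[_ _ g]; rewrite g scaler0 eqxx in b'0.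
have Ln := pl_line G (PA a0) (adjAB fr a0 ab') nb'.
set n := <<_>>%MS in Ln.
have an : (P a 0 0 <= n)%MS by rewrite genmxE; smx.
have bn : (P 0 0 b' <= n)%MS by rewrite genmxE; smx.
have ain : P a 0 0 \in lnz n by apply/lnzP; split=> //; apply: (PP0 (PA a0)).
have xa := pl_sym G Px h1 (PP0 (PA a0)).
have fy : far L n (P 0 1 d).
  apply: (far_path G Ln ain xa _ yx').
    rewrite genmxE; apply/negP => /sub_span2P[s [s']]; rewrite !coordZ coordD => /(coord_inj fr)[_ _ g].
    case/negP: ni; rewrite g scaler0 add0r crossZl crossvv scaler0 //.
  apply/negP => /sub_span2P[s [s']]; rewrite !coordZ coordD => /(coord_inj fr)[_ /eqP g _].
  by rewrite !mulr0 addr0 oner_eq0 in g.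
have Py := pl_PP G Px yx' (PP0 (far_PP fy)).
have d1 : dist2 L (P a 0 0) (P 0 1 d) := dist2P (PP0 Px) xa yx'.
have d2 : dist2 L (P 0 0 b') (P 0 1 d).
  by rewrite -(T_iff G Hp To (PB b'0) Py) (TB G Hp To fr) // dot0r.
by case/negP: nb'; apply: (no_pent G Hp To Ln fy (PP0 (PA a0)) (PP0 (PB b'0)) an bn d1 d2).
Qed.

Lemma cross_comb b b' k1 k2 k3 k4 : cross b b' != 0 -> k1 *: b + k2 *: b' = k3 *: b + k4 *: b' ->
  k1 = k3 /\ k2 = k4.
Proof.
move=> ni h; have h1 : k1 *: cross b b' = k3 *: cross b b'.
  by have := congr1 (fun u => cross u b') h; rewrite !crossDl !crossZl crossvv !scaler0 !addr0.
have h2 : k2 *: cross b b' = k4 *: cross b b'.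
  by have := congr1 (cross b) h; rewrite !crossDr !crossZr crossvv !scaler0 !add0r.
have key (k k' : F) : k *: cross b b' = k' *: cross b b' -> k = k'.
  by move/eqP; rewrite -subr_eq0 -scalerBl scaler_eq0 (negbTE ni) orbF subr_eq0 => /eqP.
by rewrite (key _ _ h1) (key _ _ h2).
Qed.

(** By [pl_comb] the plane at (a, 0, b + b') lies in the sum of the planes at (a, 0, b) and (0, 0,
    b'). The second contributes only multiples of b' to a x c, so the coefficient of b is k as well
    as k'. *)
Lemma kap_add a b b' k k' : a != 0 -> dot a b = 0 -> dot a b' = 0 -> cross b b' != 0 ->
  kap a b k -> kap a (b + b') k' -> k = k'.
Proof.
move=> a0 ab ab' ni h h'.
have b0 : b != 0 by apply: contraNneq ni => ->; rewrite cross0l.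
have b'0 : b' != 0 by apply: contraNneq ni => ->; rewrite cross0r.
have s0 : b + b' != 0.
  by apply: contraNneq ni => /eqP; rewrite addr_eq0 => /eqP ->; rewrite -scaleN1r crossZl crossvv scaler0.
have abs : dot a (b + b') = 0 by rewrite dotDr ab ab' addr0.
have [c [d yx]] := flag_ex G Hp To fr a0 s0 abs.
have xa : (P a 0 b <= pl (P a 0 0))%MS.
  have -> : P a 0 b = P a 0 0 + P 0 0 b by crd.
  by have := mem_pl G (PA a0); have := adjAB fr a0 ab => ? ?; smx.
have n1 : ~~ (P a 0 b <= P a 0 0)%MS.
  by apply/negP => /sub_vecP[s]; rewrite coordZ => /(coord_inj fr)[_ _ g]; rewrite g scaler0 eqxx in b0.
have n2 : ~~ (P 0 0 b' <= P a 0 0 + P a 0 b)%MS.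
  apply/negP => /sub_span2P[s [s']]; rewrite !coordZ coordD => /(coord_inj fr)[_ _ g].
  by case/negP: ni; rewrite g scaler0 add0r crossZr crossvv scaler0.
have := pl_comb G Hp To 1 (PA a0) xa (adjAB fr a0 ab') n1 n2.
have -> : P a 0 b + 1 *: P 0 0 b' = P a 0 (b + b') by crd.
move/(submx_trans yx)/sub_addsP => [u [v [ux vb]]].
have Px := flag_PP G fr a0 ab.
have [c1 [t1 [d1 eu]]] := in_coord G fr Px ux; have [c2 [t2 [d2 ev]]] := in_coord G fr (PB b'0) vb.
rewrite eu in ux; rewrite ev in vb; have [t20 bc2 _] := plB b'0 vb.
rewrite eu ev coordD t20 addr0 => /(coord_inj fr)[ec et _].
have := h' _ _ _ yx; rewrite ec crossDr (h _ _ _ ux) -et !mulr1.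
rewrite dotC in bc2; have [s ->] := cross_perp b'0 ab' bc2.
by rewrite scalerDr => /(cross_comb ni)[].
Qed.

(** Parallel b and b' are compared through a third vector d orthogonal to a. *)
Lemma kap_b a b b' k : a != 0 -> b != 0 -> b' != 0 -> dot a b = 0 -> dot a b' = 0 ->
  kap a b k -> kap a b' k.
Proof.
move=> a0 b0 b'0 ab ab' h.
have gen b1 b2 k1 : dot a b1 = 0 -> dot a b2 = 0 -> cross b1 b2 != 0 -> kap a b1 k1 -> kap a b2 k1.
  move=> h1 h2 ni hk.
  have b20 : b2 != 0 by apply: contraNneq ni => ->; rewrite cross0r.
  have [k2 hk2] := kap_ex a0 b20 h2.
  suff -> : k1 = k2 by [].
  apply: (@kap_add a b1 (b2 - b1) k1 k2) => //.
  - by rewrite dotDr -scaleN1r dotZr h1 h2 mulr0 addr0.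
  - by rewrite crossDr -scaleN1r crossZr crossvv scaler0 addr0.
  - by rewrite addrC subrK.
have [hc|n] := eqVneq (cross b b') 0; last exact: (gen b b').
have [m em] := cross0P b0 hc; have m0 : m != 0 by apply: contraNneq b'0 => m0; rewrite em m0 scale0r.
have [d ad ni] := perp_other a0 b0 ab.
apply: (gen d b') => //; last exact: (gen b d).
by rewrite crossC em crossZl oppr_eq0 scaler_eq0 negb_or m0.
Qed.

End OneFrame.

Section ChangeA.
Variables (A B : 'M[F]_(3, N)) (e : 'rV[F]_N).
Hypothesis fr : frame L A B e.
Local Notation P := (hcoord A B e).
Local Notation kap := (kap A B e).
Implicit Types (a b c d : 'rV[F]_3) (t k : F).
Let PA := PA fr.
Let PB := PB fr.
Let fr' := frame_swap G fr.

Lemma kap_dual a b : a != 0 -> b != 0 -> dot a b = 0 ->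
  exists2 k, k != 0 & forall c t d, (P c t d <= pl (P a 0 b))%MS -> cross b d = (k * t) *: a.
Proof.
move=> a0 b0 ab; have ba : dot b a = 0 by rewrite dotC.
have [k hk] := kap_ex fr' b0 a0 ba; exists k; first exact: (kap_nz fr' b0 a0 ba hk).
by move=> c t d; rewrite -!(coord_swap A B e); apply: hk.
Qed.

(* All the points of the line at infinity of pl y', where y' = (c, 1, xi dl), have their A-part in the plane dl^perp spanned by a and a'. *)
Lemma kap_a a a' b b' k : cross a a' != 0 -> b != 0 -> b' != 0 -> dot a b = 0 -> dot a' b' = 0 ->
  kap a b k -> kap a' b' k.
Proof.
move=> ni bn b'0 abn ab' hbn.
have a0 : a != 0 by apply: contraNneq ni => ->; rewrite cross0l.
have a'0 : a' != 0 by apply: contraNneq ni => ->; rewrite cross0r.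
set dl := cross a a' in ni; have adl : dot a dl = 0 := dot_crossl a a'.
have a'dl : dot a' dl = 0 := dot_crossr a a'.
have [b1 ab1 nb1] := perp_other a0 ni adl.
have b10 : b1 != 0 by apply: contraNneq nb1 => ->; rewrite cross0r.
have hk : kap a b1 k by apply: (kap_b fr a0 bn).
have [c [d yx]] := flag_ex G Hp To fr a0 b10 ab1.
have Px := flag_PP G fr a0 ab1; have [h1 h2] := flag_line G fr a0 ab1.
have [ad bc] := flag_dots fr a0 b10 ab1 yx.
have [k2 k20 hk2] := kap_dual a0 b10 ab1.
have := hk2 _ _ _ yx; rewrite mulr1 => e2.
have [mm em] : exists mm, cross b1 dl = mm *: a by apply: cross_perp => //; rewrite dotC.
have mm0 : mm != 0 by apply: contraNneq nb1 => m0; rewrite crossC em m0 scale0r oppr0.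
(* Since b1 x d and b1 x dl are both multiples of a, a multiple of dl can be subtracted from d to
   leave a multiple of b1, and (0, 0, b1) is a neighbour of (a, 0, b1). *)
have [la ela] : exists la, d - (k2 / mm) *: dl = la *: b1.
  by apply: (cross0P b10); rewrite crossDr -scaleNr crossZr e2 em scalerA mulNr divfK // scaleNr subrr.
set xi := k2 / mm in ela; have xi0 : xi != 0 by rewrite mulf_neq0 ?invr_eq0.
have {yx}yx : (P c 1 (xi *: dl) <= pl (P a 0 b1))%MS.
  have -> : P c 1 (xi *: dl) = P c 1 d - la *: P 0 0 b1.
    by rewrite -[d](subrK (xi *: dl)) ela; crd.
  by smx.
set y := P c 1 (xi *: dl) in yx.
have y0 : y != 0 by rewrite /y (coord_nz fr) oner_neq0 orbT.
have Py : PP y := pl_PP G Px yx y0; have xy := pl_sym G Px yx y0; have yy := mem_pl G Py.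
have noA u : u != 0 -> ~~ (P u 0 0 <= pl y)%MS.
  move=> u0; apply/negP => h; have := pl_sym G Py h (PP0 (PA u0)).
  by case/(plA G fr u0) => /eqP; rewrite oner_eq0.
have noB u : u != 0 -> ~~ (P 0 0 u <= pl y)%MS.
  move=> u0; apply/negP => h; have := pl_sym G Py h (PP0 (PB u0)).
  by case/(plB fr u0) => /eqP; rewrite oner_eq0.
have nyx : ~~ (P a 0 b1 <= y)%MS.
  apply/negP => /sub_vecP[s]; rewrite coordZ => /(coord_inj fr)[g1 /esym/eqP g2 _].
  by move: a0; rewrite g1; move: g2; rewrite mulr1 => /eqP ->; rewrite scale0r eqxx.
have [x2 [x2y nx2]] : exists x2 : 'rV[F]_N, (x2 <= pl y)%MS /\ ~~ (x2 <= y + P a 0 b1)%MS.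
  by apply: ex_outside; rewrite (rank_pl G Py) rank_span2.
(* Subtracting a multiple of y makes the middle coordinate zero. *)
have [a2 [b2 [{}x2y {}nx2]]] : exists a2 b2, (P a2 0 b2 <= pl y)%MS /\ ~~ (P a2 0 b2 <= y + P a 0 b1)%MS.
  have [u [t [v ex2]]] := in_coord G fr Py x2y; exists (u - t *: c), (v - t *: (xi *: dl)).
  have -> : P (u - t *: c) 0 (v - t *: (xi *: dl)) = x2 - t *: y by rewrite ex2 /y; crd.
  split; first by smx.
  apply: contra nx2 => h; rewrite -(subrK (t *: y) x2); smx.
have nsc s : P a2 0 b2 != s *: P a 0 b1 by apply: contraNneq nx2 => ->; smx.
have xs s : ((P a2 0 b2 - s *: P a 0 b1)%R <= pl y)%MS by smx.
have nb2 : cross b1 b2 != 0.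
  apply/eqP => /(cross0P b10)[s es].
  have n0 : a2 - s *: a != 0 by apply: contraNneq (nsc s) => /subr0_eq ->; rewrite es; apply/eqP; crd.
  by case/negP: (noA _ n0); have := xs s; rewrite (_ : _ - _ = P (a2 - s *: a) 0 0) // es; crd.
have na2 : cross a a2 != 0.
  apply/eqP => /(cross0P a0)[s es].
  have n0 : b2 - s *: b1 != 0 by apply: contraNneq (nsc s) => /subr0_eq ->; rewrite es; apply/eqP; crd.
  by case/negP: (noB _ n0); have := xs s; rewrite (_ : _ - _ = P 0 0 (b2 - s *: b1)) // es; crd.
have a20 : a2 != 0 by apply: contraNneq na2 => ->; rewrite cross0r.
have b20 : b2 != 0 by apply: contraNneq nb2 => ->; rewrite cross0r.
have all u v : u != 0 -> v != 0 -> (P u 0 v <= pl y)%MS ->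
    exists ku, [/\ kap u v ku, dot u v = 0, cross u c = ku *: v & dot u dl = 0].
  move=> u0 v0 h; have n0 : P u 0 v != 0 by rewrite (coord_nz fr) u0.
  have Pu := pl_PP G Py h n0; have uv := hyper_PP G Hp To fr u0 v0 Pu.
  have [ku hu] := kap_ex fr u0 v0 uv; have yu := pl_sym G Py h n0.
  exists ku; split=> //; first by rewrite (hu _ _ _ yu) mulr1.
  have [/eqP] := flag_dots fr u0 v0 uv yu; rewrite dotZr mulf_eq0 (negbTE xi0) /= => /eqP -> //.
have [k1' [hk1 _ e1 _]] := all a b1 a0 b10 xy.
have [ka [hka _ ea ada]] := all a2 b2 a20 b20 x2y.
have ek1 : k = k1' by apply: (kap_uniq fr a0 b10 ab1).
have a12 : a + a2 != 0.
  by apply: contraNneq na2 => /eqP; rewrite addr_eq0 => /eqP ->; rewrite -scaleN1r crossZl crossvv scaler0.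
have b12 : b1 + b2 != 0.
  by apply: contraNneq nb2 => /eqP; rewrite addr_eq0 => /eqP ->; rewrite -scaleN1r crossZl crossvv scaler0.
have s12 : (P (a + a2) 0 (b1 + b2) <= pl y)%MS.
  have -> : P (a + a2) 0 (b1 + b2) = P a 0 b1 + P a2 0 b2 by crd.
  by smx.
have [ks [_ _ es _]] := all _ _ a12 b12 s12.
(* The sum of the two points is again a neighbour of y with a factor of its own; comparing the
   coefficients of the independent b1 and b2 equates all three. *)
have eka : k = ka.
  move: es; rewrite crossDl e1 ea scalerDr => /(cross_comb nb2)[g1 g2].
  by rewrite ek1 g1 g2.
have [nn en] : exists nn, cross a a2 = nn *: dl by apply: cross_perp => //; rewrite dotC.
have nn0 : nn != 0 by apply: contraNneq na2 => n0; rewrite en n0 scale0r.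
have [r er] : exists r, a' - nn^-1 *: a2 = r *: a.
  apply: (cross0P a0); rewrite crossDr -scaleNr crossZr en scalerA mulNr mulVf //.
  by rewrite scaleN1r subrr.
have ea' : a' = r *: a + nn^-1 *: a2 by rewrite -er subrK.
pose b3 := r *: b1 + nn^-1 *: b2.
have s3 : (P a' 0 b3 <= pl y)%MS.
  have -> : P a' 0 b3 = r *: P a 0 b1 + nn^-1 *: P a2 0 b2 by rewrite ea' /b3; crd.
  by smx.
have b30 : b3 != 0.
  apply/eqP => h; have : r *: b1 + nn^-1 *: b2 = 0 *: b1 + 0 *: b2 by rewrite !scale0r addr0.
  by case/(cross_comb nb2) => _ /eqP; rewrite invr_eq0 (negbTE nn0).
have [k3 [hk3 ab3 e3 _]] := all _ _ a'0 b30 s3.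
have ek3 : k = k3.
  move: e3; rewrite {1}ea' crossDl !crossZl e1 ea /b3 scalerDr !scalerA => /(cross_comb nb2)[_ /eqP].
  by rewrite mulrC -subr_eq0 -mulrBl mulf_eq0 invr_eq0 (negbTE nn0) orbF subr_eq0 -eka => /eqP.
by rewrite ek3; apply: (kap_b fr a'0 b30).
Qed.

(** As [kap_a] needs non-parallel vectors, multiples of (1, 0, 0) are reached through (0, 1, 0). *)
Lemma kap_const : exists2 k, k != 0 & forall a b, a != 0 -> b != 0 -> dot a b = 0 -> kap a b k.
Proof.
have a0 : v3 1 0 0 != 0 :> 'rV[F]_3.
  by apply/eqP => /rowP/(_ j0); rewrite !mxE /= => /eqP; rewrite oner_eq0.
have b0 : v3 0 1 0 != 0 :> 'rV[F]_3.
  by apply/eqP => /rowP/(_ j1); rewrite !mxE /= => /eqP; rewrite oner_eq0.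
have ab : dot (v3 1 0 0) (v3 0 1 0) = 0 :> F by rewrite /dot !mxE /=; ring.
have [k hk] := kap_ex fr a0 b0 ab; exists k; first exact: (kap_nz fr a0 b0 ab hk).
move=> a b an bn abn; have [h|n] := eqVneq (cross (v3 1 0 0) a) 0; last first.
  exact: (kap_a n b0 bn ab abn hk).
have [m em] := cross0P a0 h; have m0 : m != 0 by apply: contraNneq an => m0; rewrite em m0 scale0r.
have ni : cross (v3 1 0 0) (v3 0 1 0) != 0 :> 'rV[F]_3.
  by apply/eqP => /rowP/(_ j2); rewrite !mxE /= => /eqP; rewrite mulr1 mulr0 subr0 oner_eq0.
have ni' : cross (v3 0 1 0) a != 0.
  by rewrite em crossZr scaler_eq0 negb_or m0 crossC oppr_eq0.
have [b' b'0 hb'] := perp_ex (v3 0 1 0 : 'rV[F]_3); rewrite dotC in hb'.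
exact: (kap_a ni' b'0 bn hb' abn (kap_a ni b0 b'0 ab hb' hk)).
Qed.

End ChangeA.
End KappaTheory.

(** * Coordinates of PG(6,q) and the Grassmann equations *)

Section Coord7.
Local Open Scope ring_scope.
Variable F : fieldType.
Implicit Types (a b c d : 'rV[F]_3) (t k : F) (v : 'rV[F]_7).

Definition mk7 a t b : 'rV[F]_7 :=
  \row_i nth 0 [:: a 0 j0; a 0 j1; a 0 j2; t; b 0 j0; b 0 j1; b 0 j2] i.
Definition pa v : 'rV[F]_3 := v3 (cd v 0%N) (cd v 1%N) (cd v 2%N).
Definition pb v : 'rV[F]_3 := v3 (cd v 4%N) (cd v 5%N) (cd v 6%N).

Lemma cd_mk7 a t b (k : nat) : (k < 7)%N ->
  cd (mk7 a t b) k = nth 0 [:: a 0 j0; a 0 j1; a 0 j2; t; b 0 j0; b 0 j1; b 0 j2] k.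
Proof. by move=> k7; rewrite /cd mxE inordK. Qed.

Lemma mk7K v : mk7 (pa v) (cd v 3%N) (pb v) = v.
Proof.
apply/rowP => i; rewrite mxE /pa /pb !mxE /= /cd.
by case: i => -[|[|[|[|[|[|[|//]]]]]]] p /=; congr (v 0 _); apply: val_inj; rewrite /= inordK.
Qed.

Lemma mk7D a t b a' t' b' : mk7 a t b + mk7 a' t' b' = mk7 (a + a') (t + t') (b + b').
Proof. by apply/rowP => -[[|[|[|[|[|[|[|//]]]]]]] p]; rewrite !mxE. Qed.

Lemma mk7Z k a t b : k *: mk7 a t b = mk7 (k *: a) (k * t) (k *: b).
Proof. by apply/rowP => -[[|[|[|[|[|[|[|//]]]]]]] p]; rewrite !mxE. Qed.

Lemma mk7_inj a t b a' t' b' : mk7 a t b = mk7 a' t' b' -> [/\ a = a', t = t' & b = b'].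
Proof.
move=> h; have g (k : nat) : (k < 7)%N -> cd (mk7 a t b) k = cd (mk7 a' t' b') k by rewrite h.
by split; [apply: eq3; [have := g 0%N isT|have := g 1%N isT|have := g 2%N isT]|have := g 3%N isT
  |apply: eq3; [have := g 4%N isT|have := g 5%N isT|have := g 6%N isT]]; rewrite !cd_mk7.
Qed.

Lemma Q6_mk7 a t b : Q6 (mk7 a t b) = dot a b - t ^+ 2.
Proof. by rewrite /Q6 !cd_mk7. Qed.

(** The form of the six Grassmann equations that both directions of the theorem use. *)
Lemma hex_mk7 a t b a' t' b' : hex_grassmann (mk7 a t b) (mk7 a' t' b') <->
  cross a a' = t *: b' - t' *: b /\ cross b b' = t' *: a - t *: a'.
Proof.
rewrite /hex_grassmann /pg !cd_mk7 //=; split.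
  move=> [h0 [h1 [h2 [h3 [h4 h5]]]]]; split; apply: eq3; rewrite !mxE /= ?h0 ?h2 ?h4; try ring.
  - by rewrite -[LHS]opprK -[RHS]opprK; congr (- _); rewrite opprB h3; ring.
  - by rewrite -[LHS]opprK -[RHS]opprK; congr (- _); rewrite opprB h5; ring.
  - by rewrite -[LHS]opprK -[RHS]opprK; congr (- _); rewrite opprB h1; ring.
case=> h h'.
have g0 := congr1 (fun u : 'rV[F]_3 => u 0 j0) h; have g1 := congr1 (fun u : 'rV[F]_3 => u 0 j1) h.
have g2 := congr1 (fun u : 'rV[F]_3 => u 0 j2) h; have g3 := congr1 (fun u : 'rV[F]_3 => u 0 j0) h'.
have g4 := congr1 (fun u : 'rV[F]_3 => u 0 j1) h'; have g5 := congr1 (fun u : 'rV[F]_3 => u 0 j2) h'.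
move: g0 g1 g2 g3 g4 g5; rewrite !mxE /= => g0 g1 g2 g3 g4 g5; repeat split.
- by rewrite g0; ring.
- by rewrite -[LHS]opprB g5; ring.
- by rewrite g1; ring.
- by rewrite -[LHS]opprB g3; ring.
- by rewrite g2; ring.
- by rewrite -[LHS]opprB g4; ring.
Qed.

Definition mat7 N (A B : 'M[F]_(3, N)) (e : 'rV[F]_N) : 'M[F]_(7, N) :=
  \matrix_(i < 7) nth 0 [:: row j0 A; row j1 A; row j2 A; e; row j0 B; row j1 B; row j2 B] i.

Lemma mul_row3 N (a : 'rV[F]_3) (A : 'M[F]_(3, N)) :
  a *m A = a 0 j0 *: row j0 A + a 0 j1 *: row j1 A + a 0 j2 *: row j2 A.
Proof.
have {1}-> : A = mat3 (row j0 A) (row j1 A) (row j2 A); last exact: mul_mat3.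
apply/row_matrixP => i; rewrite rowK; case: i => -[|[|[|//]]] p /=; congr (row _ A); exact: val_inj.
Qed.

Lemma mul_mat7 N (A B : 'M[F]_(3, N)) e a t b : mk7 a t b *m mat7 A B e = hcoord A B e a t b.
Proof.
rewrite mulmx_sum_row !big_ord_recl big_ord0 addr0 /mat7 !rowK !mxE /= /hcoord.
by rewrite !mul_row3 !addrA.
Qed.

End Coord7.

(** * Mapping L into H(q) *)

Section Embed.
Local Open Scope ring_scope.
Variables (F : finFieldType) (N : nat) (L : {set 'M[F]_N}).
Hypothesis G : flat L.
Local Notation q := #|F|.
Local Notation PP := (hpoint L).
Local Notation pl := (tplane L).
Local Notation T := (tspace L).
Implicit Types (x y z p : 'rV[F]_N) (l H : 'M[F]_N).
Hypothesis Hp : forall H, \rank H = 6%N -> (nb_in L H <= q ^ 4 - q ^ 3 + 3 * q ^ 2 + 2 * q)%N.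
Hypothesis To : (#|L| <= q ^ 5 + q ^ 4 + q ^ 3 + q ^ 2 + q + 1)%N.

Variables (A B : 'M[F]_(3, N)) (e : 'rV[F]_N).
Hypothesis fr : frame L A B e.
Local Notation P := (hcoord A B e).
Implicit Types (a b c d : 'rV[F]_3) (t k : F).

(** Every line has a point with middle coordinate zero, so it is spanned by (a, 0, b) and one of its
    neighbours. The two constants come from [kap_const] for the frame and for the swapped frame. *)
Lemma line_rel : exists k1 k2, [/\ k1 != 0, k2 != 0 & forall l, l \in L -> exists a b c t d,
  [/\ (l :=: P a 0 b + P c t d)%MS, [/\ dot a b = 0, dot a d = 0, dot b c = 0 & dot c d = - (k1 * k2) * t ^+ 2],
    cross a c = (k1 * t) *: b & cross b d = (k2 * t) *: a]].
Proof.
have fr' := frame_swap G fr.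
have [k1 k10 h1] := kap_const G Hp To fr; have [k2 k20 h2] := kap_const G Hp To fr'.
exists k1, k2; split=> // l Ll; have rl := fl_rank G Ll.
have inl u : (u <= l)%MS -> exists a t b, u = P a t b.
  have [->|u0 ul] := eqVneq u 0; first by exists 0, 0, 0; rewrite hcoord0.
  exact: (fr_all fr (l_PP Ll u0 ul)).
have [u [ul nu]] : exists u : 'rV[F]_N, (u <= l)%MS /\ ~~ (u <= (0 : 'rV[F]_N))%MS.
  by apply: ex_outside; rewrite mxrank0 rl.
have u0 := notsub_nz nu.
have [v [vl nv]] : exists v : 'rV[F]_N, (v <= l)%MS /\ ~~ (v <= u)%MS.
  by apply: ex_outside; rewrite rank_vec // rl.
have [a1 [t1 [b1 eu]]] := inl u ul; have [a2 [t2 [b2 ev]]] := inl v vl.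
have [a [b [x0 xl]]] : exists a b, P a 0 b != 0 /\ (P a 0 b <= l)%MS.
  have [t10|n1] := eqVneq t1 0; first by exists a1, b1; rewrite -t10 -eu.
  exists (a2 - (t2 / t1) *: a1), (b2 - (t2 / t1) *: b1).
  have -> : P (a2 - (t2 / t1) *: a1) 0 (b2 - (t2 / t1) *: b1) = v - (t2 / t1) *: u.
    rewrite ev eu coordZ coordN coordD divfK // subrr //.
  split; last by smx.
  by apply: contraNneq nv => /subr0_eq ->; smx.
have [y [yl ny]] : exists y : 'rV[F]_N, (y <= l)%MS /\ ~~ (y <= P a 0 b)%MS.
  by apply: ex_outside; rewrite rank_vec // rl.
have [c [t [d ey]]] := inl y yl; exists a, b, c, t, d.
have Px := l_PP Ll x0 xl; have lx := l_pl Ll x0 xl.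
have yx : (P c t d <= pl (P a 0 b))%MS by rewrite -ey; apply: submx_trans yl lx.
have el : (l :=: P a 0 b + P c t d)%MS.
  apply/eqmxP; rewrite -ey; apply/andP; split; last by smx.
  exact: (span_l G Ll x0 xl yl ny).
have [a0|na] := eqVneq a 0.
  have b0 : b != 0 by apply: contraNneq x0 => ->; rewrite a0 hcoord0.
  rewrite a0 in yx; have [t0 bc [m em]] := plB G fr b0 yx.
  split=> //; rewrite a0 t0 ?dot0l ?mulr0 ?scale0r ?cross0l ?scaler0 //.
    by split=> //; rewrite em dotZr dotC bc expr0n /= !mulr0.
  by rewrite em crossZr crossvv scaler0.
have [b0|nb] := eqVneq b 0.
  rewrite b0 in yx; have [t0 ad [m em]] := plA G fr na yx.
  split=> //; rewrite b0 t0 ?dot0l ?dot0r ?mulr0 ?scale0r ?cross0l ?scaler0 //.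
    by split=> //; rewrite em dotZl ad expr0n /= !mulr0.
  by rewrite em crossZr crossvv scaler0.
have ab := hyper_PP G Hp To fr na nb Px; have ba : dot b a = 0 by rewrite dotC.
have [ad bc] := flag_dots G Hp To fr na nb ab yx.
have e1 := h1 a b na nb ab _ _ _ yx.
have e2 : cross b d = (k2 * t) *: a.
  by apply: (h2 b a nb na ba _ _ c); rewrite !(coord_swap A B e).
split=> //; split=> //.
(* Expanding (a x c) x d in two ways gives the value of c.d. *)
have := cross_cross a c d; rewrite e1 crossZl e2 scalerA ad scale0r sub0r => /eqP.
rewrite -addr_eq0 -scalerDl scaler_eq0 (negbTE na) orbF addrC addr_eq0 => /eqP ->.
by rewrite expr2; ring.
Qed.

Lemma rank_frame : \rank (\sum_(l in L) l)%MS = 7%N.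
Proof.
pose M := mat7 A B e.
have fM : row_free M.
  apply: inj_row_free => v; rewrite -[v]mk7K mul_mat7 => /(fr_inj fr)[-> -> ->].
  by apply/rowP => -[[|[|[|[|[|[|[|//]]]]]]] p]; rewrite !mxE //= ?mxE.
have inM x : PP x -> (x <= M)%MS.
  by move=> /(fr_all fr)[a [t [b ->]]]; rewrite -mul_mat7 submxMl.
pose V := (\sum_(l in L) l)%MS.
have inV x : PP x -> (x <= V)%MS.
  case/andP => _ /set0Pn[l]; rewrite inE => /andP[Ll xl].
  by apply: submx_trans xl _; apply: (@sumsmx_sup _ _ l).
have rA i : (row i A <= V)%MS.
  apply: inV; rewrite rowE; apply: (fr_A fr); apply/eqP => /rowP/(_ i).
  by rewrite !mxE !eqxx /= => /eqP; rewrite oner_eq0.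
have rB i : (row i B <= V)%MS.
  apply: inV; rewrite rowE; apply: (fr_B fr); apply/eqP => /rowP/(_ i).
  by rewrite !mxE !eqxx /= => /eqP; rewrite oner_eq0.
have eV : (e <= V)%MS by apply: submx_trans (fr_eA fr j0) _; apply: tspace_sub.
move/eqP: fM => <-; apply: eqmx_rank; apply/andP; split.
  apply/sumsmx_subP => l Ll; apply/row_subP => i; have [->|n] := eqVneq (row i l) 0; first exact: sub0mx.
  by apply: inM; apply: (l_PP Ll n); apply: row_sub.
by apply/row_subP => -[[|[|[|[|[|[|[|//]]]]]]] p]; rewrite rowK /=.
Qed.

Lemma embed_hex : exists M : 'M[F]_(7, N), row_free M /\
  forall l, l \in L -> exists h, hex_line h /\ l = <<h *m M>>%MS.
Proof.
have [k1 [k2 [k10 k20 rel]]] := line_rel.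
(* The scale factors satisfy s r0 = r, so that all dot products are divided by r, and k1 r0 = -1, k1
   r = -s, k2 s = r^2, k2 = r r0, which turn both constants into signs. *)
pose s := k1 ^+ 2 * k2; pose r := - (k1 * k2); pose r0 := - k1^-1.
pose A' := mat3 (s *: row j0 A) (row j1 A) (row j2 A).
pose B' := mat3 (r0 *: row j0 B) (r *: row j1 B) (r *: row j2 B).
pose fa (a : 'rV[F]_3) := v3 (a 0 j0 / s) (a 0 j1) (a 0 j2).
pose fb (b : 'rV[F]_3) := v3 (b 0 j0 / r0) (b 0 j1 / r) (b 0 j2 / r).
have s0 : s != 0 by rewrite mulf_neq0 // expf_neq0.
have rn : r != 0 by rewrite oppr_eq0 mulf_neq0.
have r0n : r0 != 0 by rewrite oppr_eq0 invr_eq0.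
have eP a t b : P a t b = mk7 (fa a) t (fb b) *m mat7 A' B' e.
  rewrite mul_mat7 /hcoord !mul_mat3 !mul_row3 !mxE /= !scalerA !divfK //.
have fM : row_free (mat7 A' B' e).
  apply: inj_row_free => v; rewrite -[v]mk7K; move: (pa v) (cd v 3) (pb v) => a t b.
  have -> : mk7 a t b = mk7 (fa (v3 (s * a 0 j0) (a 0 j1) (a 0 j2))) t
      (fb (v3 (r0 * b 0 j0) (r * b 0 j1) (r * b 0 j2))).
    by congr mk7; apply: eq3; rewrite !mxE /= // mulrC mulKf.
  rewrite -eP => /(fr_inj fr)[h1 h2 h3]; rewrite h1 h2 h3.
  by apply/rowP => -[[|[|[|[|[|[|[|//]]]]]]] p]; rewrite !mxE //= ?mxE ?mul0r.
exists (mat7 A' B' e); split=> // l Ll; have [a [b [c [t [d [el [ab ad bc cd'] e1 e2]]]]]] := rel l Ll.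
pose x := mk7 (fa a) 0 (fb b); pose y := mk7 (fa c) t (fb d).
exists <<(x + y)%MS>>%MS.
have el' : (l :=: (x + y)%MS *m mat7 A' B' e)%MS.
  by apply: eqmx_trans el _; apply: eqmx_sym; rewrite !eP; apply: addsmxMr.
have dots u v : dot (fa u) (fb v) = dot u v / r.
  rewrite /dot !mxE /= /r /s /r0; field.
  by rewrite !oppr_eq0 mulf_neq0 // k10 k20 oner_eq0.
split; last first.
  rewrite -(fl_can G Ll); apply/eq_genmx; apply: eqmx_trans el' _.
  by apply: eqmxMr; apply: eqmx_sym; apply: genmxE.
have rxy : \rank (x + y)%MS = 2%N.
  by have := fl_rank G Ll; rewrite el' mxrankMfree.
split.
- by rewrite /proj_sub mxrank_gen rxy genmx_id !eqxx.
- move=> v; rewrite genmxE => /sub_span2P[m [n ->]].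
  rewrite !mk7Z mk7D Q6_mk7 !(dotDl, dotDr, dotZl, dotZr) !dots ab ad cd' [dot c b]dotC bc.
  by rewrite -/r; field.
- exists x, y; split; first by apply/andP; split; rewrite genmxE addsmxE.
  have g0 := congr1 (fun u : 'rV[F]_3 => u 0 j0) e1; have g1 := congr1 (fun u : 'rV[F]_3 => u 0 j1) e1.
  have g2 := congr1 (fun u : 'rV[F]_3 => u 0 j2) e1; have g3 := congr1 (fun u : 'rV[F]_3 => u 0 j0) e2.
  have g4 := congr1 (fun u : 'rV[F]_3 => u 0 j1) e2; have g5 := congr1 (fun u : 'rV[F]_3 => u 0 j2) e2.
  move: g0 g1 g2 g3 g4 g5; rewrite !mxE /= => g0 g1 g2 g3 g4 g5.
  have nzs := (oppr_eq0, invr_eq0, mulf_eq0, negbTE k10, negbTE k20, negbTE rn, negbTE r0n, oner_eq0 F).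
  apply/hex_mk7; split; apply: eq3; rewrite !mxE /=.
  + by rewrite g0 /r0; field; rewrite ?nzs.
  + transitivity ((a 0 j2 * c 0 j0 - a 0 j0 * c 0 j2) / s); first by field.
    by rewrite g1 /s /r; field; rewrite ?nzs.
  + transitivity ((a 0 j0 * c 0 j1 - a 0 j1 * c 0 j0) / s); first by field.
    by rewrite g2 /s /r; field; rewrite ?nzs.
  + transitivity ((b 0 j1 * d 0 j2 - b 0 j2 * d 0 j1) / r ^+ 2); first by field.
    by rewrite g3 /s /r; field; rewrite ?nzs.
  + transitivity ((b 0 j2 * d 0 j0 - b 0 j0 * d 0 j2) / (r * r0)); first by field; rewrite ?nzs.
    by rewrite g4 /r0 /r; field; rewrite ?nzs.
  + transitivity ((b 0 j0 * d 0 j1 - b 0 j1 * d 0 j0) / (r * r0)); first by field; rewrite ?nzs.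
    by rewrite g5 /r0 /r; field; rewrite ?nzs.
Qed.

End Embed.

(** * Collinearity in H(q) *)

Section Rel7.
Local Open Scope ring_scope.
Variable F : fieldType.
Implicit Types (a b c d u v w p : 'rV[F]_3) (t k s : F) (x y z : 'rV[F]_7).

Lemma cross_crossr a w b : cross a (cross w b) = dot a b *: w - dot a w *: b. Proof. by vec3. Qed.

Lemma dot_cross4 a b w p :
  dot w (cross b p) *: a = dot a w *: cross b p + dot a b *: cross p w + dot a p *: cross w b.
Proof. by vec3. Qed.

Lemma perp_cross u v (z : 'rV[F]_3) : cross u v != 0 -> dot z (cross u v) = 0 -> exists m n, z = m *: u + n *: v.
Proof.
move=> c0 h; have u0 : u != 0 by apply: contraNneq c0 => ->; rewrite cross0l.
have [k ek] := cross_perp c0 (dot_crossl u v) h.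
have [m em] : exists m, z - k *: v = m *: u.
  by apply: (cross0P u0); rewrite crossDr -scaleNr crossZr ek scaleNr subrr.
by exists m, k; rewrite -em subrK.
Qed.

Lemma pa_mk7 a t b : pa (mk7 a t b) = a.
Proof. by apply: eq3; rewrite mxE /= cd_mk7. Qed.
Lemma pb_mk7 a t b : pb (mk7 a t b) = b.
Proof. by apply: eq3; rewrite mxE /= cd_mk7. Qed.
Lemma cd3_mk7 a t b : cd (mk7 a t b) 3 = t.
Proof. by rewrite cd_mk7. Qed.

Lemma eq7 x y : pa x = pa y -> cd x 3 = cd y 3 -> pb x = pb y -> x = y.
Proof. by move=> h1 h2 h3; rewrite -(mk7K x) -(mk7K y) h1 h2 h3. Qed.

Lemma cdD x y i : cd (x + y) i = cd x i + cd y i. Proof. by rewrite /cd mxE. Qed.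
Lemma cdZ k x i : cd (k *: x) i = k * cd x i. Proof. by rewrite /cd mxE. Qed.
Lemma cd0 i : cd (0 : 'rV[F]_7) i = 0. Proof. by rewrite /cd mxE. Qed.
Lemma paD x y : pa (x + y) = pa x + pa y. Proof. by apply: eq3; rewrite !mxE /= cdD. Qed.
Lemma paZ k x : pa (k *: x) = k *: pa x. Proof. by apply: eq3; rewrite !mxE /= cdZ. Qed.
Lemma pbD x y : pb (x + y) = pb x + pb y. Proof. by apply: eq3; rewrite !mxE /= cdD. Qed.
Lemma pbZ k x : pb (k *: x) = k *: pb x. Proof. by apply: eq3; rewrite !mxE /= cdZ. Qed.
Lemma pa0 : pa 0 = 0 :> 'rV[F]_3. Proof. by apply: eq3; rewrite !mxE /= cd0. Qed.
Lemma pb0 : pb 0 = 0 :> 'rV[F]_3. Proof. by apply: eq3; rewrite !mxE /= cd0. Qed.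

(** The vector form of the Grassmann equations with two scalar equations added; the sum of the
    latter is orthogonality for the quadric. For singular independent vectors it is collinearity in
    H(q). *)
Definition hrel x y :=
  [&& dot (pa x) (pb y) == cd x 3 * cd y 3, dot (pa y) (pb x) == cd x 3 * cd y 3,
      cross (pa x) (pa y) == cd x 3 *: pb y - cd y 3 *: pb x &
      cross (pb x) (pb y) == cd y 3 *: pa x - cd x 3 *: pa y].

Lemma hrelP x y : reflect
  [/\ dot (pa x) (pb y) = cd x 3 * cd y 3, dot (pa y) (pb x) = cd x 3 * cd y 3,
      cross (pa x) (pa y) = cd x 3 *: pb y - cd y 3 *: pb x &
      cross (pb x) (pb y) = cd y 3 *: pa x - cd x 3 *: pa y] (hrel x y).
Proof. by apply: (iffP and4P) => -[/eqP h1 /eqP h2 /eqP h3 /eqP h4]; split=> //; apply/eqP. Qed.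

Lemma Q6E x : Q6 x = dot (pa x) (pb x) - cd x 3 ^+ 2.
Proof. by rewrite -{1}(mk7K x) Q6_mk7. Qed.

Lemma hrel_sym x y : hrel x y = hrel y x.
Proof.
suff h (u v : 'rV[F]_7) : hrel u v -> hrel v u by apply/idP/idP; apply: h.
case/hrelP => h1 h2 h3 h4; apply/hrelP; split; rewrite ?h1 ?h2 1?mulrC //.
  by rewrite crossC h3 opprB.
by rewrite crossC h4 opprB.
Qed.

Lemma hrelxx x : hrel x x = (Q6 x == 0).
Proof.
rewrite Q6E subr_eq0 expr2; apply/hrelP/eqP => [[]//|h]; split=> //; by rewrite crossvv subrr.
Qed.

Lemma hrelD x y z : hrel x y -> hrel x z -> hrel x (y + z).
Proof.
case/hrelP => h1 h2 h3 h4 /hrelP[g1 g2 g3 g4]; apply/hrelP.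
rewrite !(paD, pbD, cdD, dotDl, dotDr, crossDr) h1 h2 h3 h4 g1 g2 g3 g4; split.
- by ring.
- by ring.
- by vec.
- by vec.
Qed.

Lemma hrelZ k x y : hrel x y -> hrel x (k *: y).
Proof.
case/hrelP => h1 h2 h3 h4; apply/hrelP.
rewrite !(paZ, pbZ, cdZ, dotZl, dotZr, crossZr) h1 h2 h3 h4; split.
- by ring.
- by ring.
- by vec.
- by vec.
Qed.

Lemma hrelN x y : hrel x y -> hrel x (- y).
Proof. by move=> /(hrelZ (-1)); rewrite scaleN1r. Qed.

Lemma hrel0 x : hrel x 0.
Proof. by apply/hrelP; rewrite pa0 pb0 cd0 dot0l dot0r !cross0r !mulr0 !scaler0 !scale0r subrr. Qed.

Section Chart.
Variables (x : 'rV[F]_7) (w : 'rV[F]_3).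
Local Notation a := (pa x).
Local Notation b := (pb x).
Local Notation t := (cd x 3).
Hypotheses (aw : dot (pa x) w = 1) (Qx : dot (pa x) (pb x) = cd x 3 ^+ 2).

(** A chart of the plane at x: with w chosen so that w.(pa x) = 1, a related y is recovered from s =
    w.(pa y) and p = pb y. The multiple of w in the last block enforces the first scalar equation,
    so p matters only modulo w. *)
Definition ct s p := dot w (cross b p) + t * s.
Definition chart s p := mk7 (s *: a + ct s p *: cross w b - t *: cross w p) (ct s p)
  (p + (t * ct s p - dot a p) *: w).

Lemma chart_rel s p : hrel x (chart s p).
Proof.
apply/hrelP; rewrite /chart pa_mk7 pb_mk7 cd3_mk7; set t' := ct s p.
split.
- by rewrite dotDr dotZr aw; ring.
- rewrite !dotDl -scaleNr !dotZl Qx [dot (cross w b) _]dotC dot_crossr [dot (cross w p) b]dotC.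
  rewrite (dot_cross_rot b w p) (dot_cross_rot p b w).
  have -> : dot w (cross p b) = - dot w (cross b p) by rewrite crossC -scaleN1r dotZr mulN1r.
  by rewrite /t' /ct; ring.
- rewrite !crossDr -scaleNr !crossZr crossvv !cross_crossr aw Qx; vec.
- rewrite crossDr crossZr; have := dot_cross4 a b w p; rewrite aw Qx => h.
  have {h}-> : cross b p = dot w (cross b p) *: a - t ^+ 2 *: cross p w - dot a p *: cross w b.
    by rewrite h; vec.
  rewrite (crossC b w) (crossC p w) {2}/t' /ct; vec.
Qed.

Lemma chart_onto y : hrel x y -> y = chart (dot w (pa y)) (pb y).
Proof.
case/hrelP => h1 h2 h3 h4.
have et : ct (dot w (pa y)) (pb y) = cd y 3.
  by rewrite /ct h4 dotDr -scaleNr !dotZr [dot w a]dotC aw; ring.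
apply: eq7; rewrite /chart ?pa_mk7 ?pb_mk7 ?cd3_mk7 et //.
  have := cross_crossr w a (pa y); rewrite h3 [dot w a]dotC aw crossDr -scaleNr !crossZr => h.
  apply/eqP; rewrite eq_sym -subr_eq0; apply/eqP; transitivity (dot w (pa y) *: a - 1 *: pa y - (t *: cross w (pb y) + - cd y 3 *: cross w b)).
    by vec.
  by rewrite h subrr.
by rewrite h1; vec.
Qed.

Lemma chart_Q s p : Q6 (chart s p) = 0.
Proof.
rewrite Q6E /chart pa_mk7 pb_mk7 cd3_mk7; set t' := ct s p.
rewrite !(dotDl, dotDr) -scaleNr !(dotZl, dotZr) aw.
rewrite [dot (cross w b) w]dotC [dot (cross w p) w]dotC !dot_crossl [dot (cross w p) p]dotC dot_crossr.
rewrite [dot (cross w b) p]dotC (dot_cross_rot p w b) (dot_cross_rot b p w).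
have -> : dot w (cross b p) = t' - t * s by rewrite /t' /ct addrK.
ring.
Qed.

Lemma chart_zero y : hrel x y -> dot w (pa y) = 0 -> cross w (pb y) = 0 -> y = 0.
Proof.
move=> h h1 h2; have w0 : w != 0 by apply: contra_eq_neq aw => ->; rewrite dot0r eq_sym oner_neq0.
have [m em] := cross0P w0 h2.
have ey := chart_onto h; rewrite h1 em in ey.
have ct0 : ct 0 (m *: w) = 0 by rewrite /ct crossZr dotZr dot_crossr; ring.
rewrite ey; apply: eq7; rewrite /chart ?pa_mk7 ?pb_mk7 ?cd3_mk7 ct0 ?pa0 ?pb0 ?cd0 //.
  by rewrite crossZr crossvv; vec.
by rewrite dotZr aw; vec.
Qed.

Lemma chart_inj s p s' p' : dot a p = 0 -> dot a p' = 0 -> chart s p = chart s' p' -> s = s' /\ p = p'.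
Proof.
move=> ap ap' /mk7_inj[h1 h2 h3].
have e1 : p = p' by move: h3; rewrite ap ap' h2 => /addIr.
split=> //; move: h1; rewrite h2 e1 => /addIr/addIr/(congr1 (dot w)).
by rewrite !dotZr [dot w a]dotC aw !mulr1.
Qed.

End Chart.
End Rel7.

(** * Symmetry, triangles and totally singular subspaces *)

Section Swap.
Local Open Scope ring_scope.
Variable F : fieldType.
Implicit Types (x y z : 'rV[F]_7) (k : F).

(** The symmetry that reduces pa x = 0, where the chart does not exist, to pa x nonzero. *)
Definition sw x := mk7 (pb x) (- cd x 3) (pa x).

Lemma pa_sw x : pa (sw x) = pb x. Proof. exact: pa_mk7. Qed.
Lemma pb_sw x : pb (sw x) = pa x. Proof. exact: pb_mk7. Qed.
Lemma cd_sw x : cd (sw x) 3 = - cd x 3. Proof. exact: cd3_mk7. Qed.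
Lemma swK : involutive sw. Proof. by move=> x; apply: eq7; rewrite !(pa_sw, pb_sw, cd_sw) ?opprK. Qed.
Lemma swD x y : sw (x + y) = sw x + sw y.
Proof. by apply: eq7; rewrite !(pa_sw, pb_sw, cd_sw, paD, pbD, cdD) ?opprD. Qed.
Lemma swZ k x : sw (k *: x) = k *: sw x.
Proof. by apply: eq7; rewrite !(pa_sw, pb_sw, cd_sw, paZ, pbZ, cdZ) ?mulrN. Qed.
Lemma sw0 : sw 0 = 0 :> 'rV[F]_7. Proof. by have := swZ 0 0; rewrite !scale0r. Qed.

Lemma hrel_sw x y : hrel (sw x) (sw y) = hrel x y.
Proof.
suff h u v : hrel u v -> hrel (sw u) (sw v) by apply/idP/idP => [/h|/h]; rewrite ?swK.
case/hrelP => h1 h2 h3 h4; apply/hrelP; rewrite !(pa_sw, pb_sw, cd_sw); split.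
- by rewrite dotC h2; ring.
- by rewrite dotC h1; ring.
- by rewrite h4; vec.
- by rewrite h3; vec.
Qed.

Lemma Q6_sw x : Q6 (sw x) = Q6 x.
Proof. by rewrite !Q6E pa_sw pb_sw cd_sw dotC sqrrN. Qed.

Lemma sing_part x : x != 0 -> Q6 x = 0 -> (pa x != 0) || (pb x != 0).
Proof.
move=> x0; rewrite Q6E => Qx; apply: contraNT x0; rewrite negb_or !negbK => /andP[/eqP h1 /eqP h2].
move: Qx; rewrite h1 dot0l sub0r => /eqP; rewrite oppr_eq0 expf_eq0 /= => /eqP h3.
by apply/eqP; apply: eq7; rewrite ?h1 ?h2 ?h3 ?pa0 ?pb0 ?cd0.
Qed.

Lemma dot_unit (a : 'rV[F]_3) : a != 0 -> exists w, dot a w = 1.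
Proof. by move=> /dot_nz[b n]; exists ((dot a b)^-1 *: b); rewrite dotZr mulVf. Qed.

(* In the chart at x, the dot product with w of the second relation between y and z is the determinant of x, y, z. *)
Lemma hrel_notri x y z : x != 0 -> Q6 x = 0 -> hrel x y -> hrel x z -> hrel y z ->
  ~~ (y <= x)%MS -> (z <= x + y)%MS.
Proof.
move=> x0 Qx; wlog a0 : x y z x0 Qx / pa x != 0.
  move=> H xy xz yz ny; case/orP: (sing_part x0 Qx) => [a0|b0]; first exact: H.
  have : (sw z <= sw x + sw y)%MS.
    apply: H; rewrite ?hrel_sw ?Q6_sw ?pa_sw //.
      by apply: contraNneq x0 => h; rewrite -(swK x) h sw0.
    apply: contra ny => /sub_vecP[k]; rewrite -swZ => /(can_inj swK) ->; smx.
  case/sub_span2P => k [m]; rewrite -!swZ -swD => /(can_inj swK) ->; smx.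
move=> xy xz yz ny; have [w aw] := dot_unit a0.
have Q : dot (pa x) (pb x) = cd x 3 ^+ 2 by apply/eqP; rewrite -subr_eq0 -Q6E Qx.
have xx : hrel x x by rewrite hrelxx Qx.
pose y1 := y - dot w (pa y) *: x; pose z1 := z - dot w (pa z) *: x.
have hx1 (k : F) u : hrel x u -> hrel x (u - k *: x) by move=> h; apply: hrelD => //; apply: hrelN; apply: hrelZ.
have w1 u : dot w (pa (u - dot w (pa u) *: x)) = 0.
  by rewrite paD -scaleNr paZ dotDr dotZr [dot w (pa x)]dotC aw; ring.
have r1 : hrel y1 z1.
  rewrite hrel_sym; apply: hrelD.
    rewrite hrel_sym; apply: hrelD => //; apply: hrelN; apply: hrelZ; by rewrite hrel_sym.
  apply: hrelN; apply: hrelZ; rewrite hrel_sym; exact: hx1.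
have d0 : dot w (cross (pb y1) (pb z1)) = 0.
  by case/hrelP: r1 => _ _ _ ->; rewrite dotDr -scaleNr !dotZr !w1; ring.
have [c0|nc] := eqVneq (cross w (pb y1)) 0.
  have h := chart_zero aw (hx1 _ _ xy) (w1 y) c0.
  case/negP: ny; rewrite -(subrK (dot w (pa y) *: x) y) h add0r; smx.
have [|m [n ez]] := perp_cross nc (_ : dot (pb z1) _ = 0).
  by rewrite dot_cross_rot -dot_cross_rot dot_cross_rot dot_cross_rot.
have e : z1 - n *: y1 = 0.
  apply: (@chart_zero _ x w aw).
  - apply: hrelD; first exact: hx1.
    by apply: hrelN; apply: hrelZ; apply: hx1.
  - by rewrite paD -scaleNr paZ dotDr dotZr !w1; ring.
  - by rewrite pbD -scaleNr pbZ ez crossDr !crossZr crossDr !crossZr crossvv; vec.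
have -> : z = n *: y1 + dot w (pa z) *: x by rewrite -(subr0_eq e) /z1 subrK.
by rewrite /y1; smx.
Qed.

Lemma mul_lin7 m (g : 'rV[F]_7 -> 'rV[F]_m) : (forall x y, g (x + y) = g x + g y) ->
  (forall k x, g (k *: x) = k *: g x) -> forall v, v *m (\matrix_i g (delta_mx 0 i)) = g v.
Proof.
move=> gD gZ v; have g0 : g 0 = 0 by have := gZ 0 0; rewrite !scale0r.
rewrite [in RHS](row_sum_delta v) (big_morph g gD g0) mulmx_sum_row.
by apply: eq_bigr => i _; rewrite rowK gZ.
Qed.

Lemma Q6_polar x y : Q6 (x + y) = Q6 x + Q6 y +
  (dot (pa x) (pb y) + dot (pa y) (pb x) - cd x 3 * cd y 3 *+ 2).
Proof. by rewrite !Q6E paD pbD cdD !(dotDl, dotDr); ring. Qed.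

(** The kernel K of [pa] on W has middle coordinate zero and is determined by its [pb] part. The
    images pa(W) and pb(K) are orthogonal in a space of dimension three, and their ranks add up to
    the rank of W. *)
Lemma sing_rank m (W : 'M[F]_(m, 7)) : (forall v : 'rV[F]_7, (v <= W)%MS -> Q6 v = 0) -> (\rank W <= 3)%N.
Proof.
move=> sing; pose Pa := \matrix_i pa (delta_mx 0 i : 'rV[F]_7); pose Pb := \matrix_i pb (delta_mx 0 i : 'rV[F]_7).
have PaE v : v *m Pa = pa v by apply: mul_lin7; [exact: paD | exact: paZ].
have PbE v : v *m Pb = pb v by apply: mul_lin7; [exact: pbD | exact: pbZ].
pose K := (W :&: kermx Pa)%MS.
have inK v : (v <= K)%MS -> [/\ (v <= W)%MS, pa v = 0 & cd v 3 = 0].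
  rewrite sub_capmx => /andP[vW /sub_kermxP]; rewrite PaE => h; split=> //.
  by have := sing v vW; rewrite Q6E h dot0l sub0r => /eqP; rewrite oppr_eq0 expf_eq0 /= => /eqP.
rewrite -(mxrank_mul_ker W Pa) -/K -(mxrank_mul_ker K Pb).
have -> : \rank (K :&: kermx Pb)%MS = 0%N.
  apply/eqP; rewrite mxrank_eq0 -submx0; apply/row_subP => i.
  have := row_sub i (K :&: kermx Pb)%MS; rewrite sub_capmx => /andP[/inK[_ h1 h2] /sub_kermxP].
  by rewrite PbE => h3; rewrite submx0; apply/eqP; apply: eq7; rewrite ?h1 ?h2 ?h3 ?pa0 ?pb0 ?cd0.
rewrite addn0 -(mxrank_tr (K *m Pb)); apply: mulmx0_rank_max.
apply/matrixP => i j; rewrite [RHS]mxE.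
have [h1 h2 h3] := inK _ (row_sub j K); have ui := row_sub i W.
have := sing _ (addmx_sub ui h1); rewrite Q6_polar !sing // h2 h3 mulr0 mul0rn dot0l subr0 !addr0 add0r.
rewrite -PaE -PbE -!row_mul => <-; rewrite mxE /dot.
rewrite !big_ord_recl big_ord0 addr0 addrA !mxE.
have -> : lift ord0 ord0 = j1 :> 'I_3 by apply: val_inj.
by have -> : lift ord0 (lift ord0 ord0) = j2 :> 'I_3 by apply: val_inj.
Qed.

End Swap.

(** Turns a predicate closed under linear combinations into a matrix, as the sum over all its
    vectors; finiteness of F makes this sum exist. *)
Lemma sum_closed (F : finFieldType) N (K : pred 'rV[F]_N) v : K 0%R ->
  (forall x y, K x -> K y -> K (x + y)%R) -> (forall c x, K x -> K (c *: x)%R) ->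
  (v <= \sum_(y | K y) <<y>>)%MS = K v.
Proof.
move=> K0 KD KZ; apply/idP/idP => [/sub_sumsmxP[u ->]|Kv]; last first.
  by apply: (@sumsmx_sup _ _ v) => //; rewrite genmxE.
apply: (big_ind K) => // i Ki.
have : ((u i *m <<i>>%MS)%R <= i)%MS by apply: submx_trans (submxMl _ _) _; rewrite genmxE.
by case/sub_vecP => c ->; apply: KZ.
Qed.

(** * The plane of lines at a point of H(q) *)

Section Plane7.
Local Open Scope ring_scope.
Variable F : finFieldType.
Local Notation q := #|F|.
Implicit Types (x y z v : 'rV[F]_7).

Definition rplane x : 'M[F]_7 := (\sum_(y | hrel x y) <<y>>)%MS.

Lemma in_rplane x v : (v <= rplane x)%MS = hrel x v.
Proof. by apply: sum_closed => [|y z|c y]; [exact: hrel0 | exact: hrelD | exact: hrelZ]. Qed.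

Lemma rplane_sing x y : x != 0 -> Q6 x = 0 -> hrel x y -> Q6 y = 0.
Proof.
move=> x0 Qx; wlog a0 : x y x0 Qx / pa x != 0.
  move=> H xy; case/orP: (sing_part x0 Qx) => [a0|b0]; first exact: (H x y).
  rewrite -Q6_sw; apply: (H (sw x)); rewrite ?hrel_sw ?Q6_sw ?pa_sw //.
  by apply: contraNneq x0 => h; rewrite -(swK x) h sw0.
have [w aw] := dot_unit a0.
have Q : dot (pa x) (pb x) = cd x 3 ^+ 2 by apply/eqP; rewrite -subr_eq0 -Q6E Qx.
by move=> /(chart_onto aw) ->; apply: chart_Q.
Qed.

Lemma card_perp (a : 'rV[F]_3) : a != 0 -> #|[set p : 'rV[F]_3 | dot a p == 0]| = (q ^ 2)%N.
Proof.
move=> a0; have -> : [set p : 'rV[F]_3 | dot a p == 0] = vset (kermx a^T).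
  apply/setP => p; rewrite !inE; apply/eqP/sub_kermxP => [h|/matrixP/(_ 0 0)].
    apply/matrixP => i j; rewrite !ord1 [RHS]mxE -h mxE /dot !big_ord_recl big_ord0 addr0 addrA !mxE.
    have -> : lift ord0 ord0 = j1 :> 'I_3 by apply: val_inj.
    have -> : lift ord0 (lift ord0 ord0) = j2 :> 'I_3 by apply: val_inj.
    by rewrite -[ord0]/j0; ring.
  rewrite [RHS]mxE => <-; rewrite mxE /dot !big_ord_recl big_ord0 addr0 addrA !mxE.
  have -> : lift ord0 ord0 = j1 :> 'I_3 by apply: val_inj.
  have -> : lift ord0 (lift ord0 ord0) = j2 :> 'I_3 by apply: val_inj.
  by rewrite -[ord0]/j0; ring.
by rewrite card_vset mxrank_ker mxrank_tr rank_vec.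
Qed.

(** With p restricted to the vectors orthogonal to pa x the chart is a bijection: q values of s and
    q^2 values of p. *)
Lemma card_rplane x : x != 0 -> Q6 x = 0 -> #|[set y | hrel x y]| = (q ^ 3)%N.
Proof.
move=> x0 Qx; wlog a0 : x x0 Qx / pa x != 0.
  move=> H; case/orP: (sing_part x0 Qx) => [a0|b0]; first exact: (H x).
  rewrite -(H (sw x)) ?Q6_sw ?pa_sw //; last by apply: contraNneq x0 => h; rewrite -(swK x) h sw0.
  rewrite -(card_imset [set y | hrel (sw x) y] (can_inj (@swK F))); apply: eq_card => y; rewrite inE.
  apply/idP/imsetP => [h|[z]]; last by rewrite inE => h ->; rewrite -hrel_sw swK.
  by exists (sw y); rewrite ?swK // inE hrel_sw.
have [w aw] := dot_unit a0.
have Q : dot (pa x) (pb x) = cd x 3 ^+ 2 by apply/eqP; rewrite -subr_eq0 -Q6E Qx.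
pose D := setX [set: F] [set p : 'rV[F]_3 | dot (pa x) p == 0].
have -> : [set y | hrel x y] = [set chart x w sp.1 sp.2 | sp in D].
  apply/setP => y; rewrite inE; apply/idP/imsetP => [h|[[s p] _ ->]]; last exact: chart_rel.
  have [h1 _ _ _] := hrelP _ _ h.
  exists (dot w (pa y), pb y - (cd x 3 * cd y 3) *: w).
    by rewrite !inE /= dotDr -scaleNr dotZr aw h1 mulr1 subrr.
  have := chart_onto aw h; rewrite /chart /=; set t' := ct _ _ _ _ => e.
  have et : t' = cd y 3 by rewrite e cd3_mk7.
  rewrite {1}e; have ect : ct x w (dot w (pa y)) (pb y - (cd x 3 * cd y 3) *: w) = t'.
    by rewrite /t' /ct crossDr -scaleNr crossZr dotDr dotZr dot_crossr; ring.
  have ew : cross w (pb y - (cd x 3 * cd y 3) *: w) = cross w (pb y).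
    by rewrite crossDr -scaleNr crossZr crossvv scaler0 addr0.
  rewrite ect; congr mk7; first by rewrite ew.
  by rewrite et dotDr -scaleNr dotZr aw h1; vec.
rewrite card_in_imset ?cardsX ?cardsT ?card_perp // => -[s p] [s' p'].
rewrite !inE /= => /eqP h /eqP h' /(chart_inj aw h h')[-> ->] //.
Qed.

Lemma rank_rplane x : x != 0 -> Q6 x = 0 -> \rank (rplane x) = 3%N.
Proof.
move=> x0 Qx; have := card_rplane x0 Qx.
have -> : [set y | hrel x y] = vset (rplane x) by apply/setP => y; rewrite !inE in_rplane.
by rewrite card_vset => /eqP; rewrite eqn_exp2l ?q_gt1 // => /eqP.
Qed.

End Plane7.

(** * Split octonions *)

Section Zorn.
Local Open Scope ring_scope.
Variable F : fieldType.
Implicit Types (x y z u v w : 'rV[F]_7) (k : F).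
Local Notation zorn := ((F * 'rV[F]_3) * ('rV[F]_3 * F))%type.
Implicit Types (X Y Z : zorn).

(* The split octonions as Zorn vector matrices; the relation [hrel] says that a product of traceless octonions vanishes. *)
Definition zmul X Y : zorn :=
  ((X.1.1 * Y.1.1 + dot X.1.2 Y.2.1, X.1.1 *: Y.1.2 + Y.2.2 *: X.1.2 - cross X.2.1 Y.2.1),
   (Y.1.1 *: X.2.1 + X.2.2 *: Y.2.1 + cross X.1.2 Y.1.2, X.2.2 * Y.2.2 + dot X.2.1 Y.1.2)).
Definition zsc k X : zorn := ((k * X.1.1, k *: X.1.2), (k *: X.2.1, k * X.2.2)).
Definition zemb x : zorn := ((- cd x 3, pa x), (- pb x, cd x 3)).
Definition bet x y := dot (pa x) (pb y) + dot (pa y) (pb x) - cd x 3 * cd y 3 *+ 2.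

Lemma zorn_eq X Y : X.1.1 = Y.1.1 -> X.1.2 = Y.1.2 -> X.2.1 = Y.2.1 -> X.2.2 = Y.2.2 -> X = Y.
Proof. by case: X Y => [[s a] [b r]] [[s' a'] [b' r']] /= -> -> -> ->. Qed.

Ltac zor := apply: zorn_eq; rewrite /= ?/dot; [rewrite ?mxE /=; ring | vec3 | vec3 | rewrite ?mxE /=; ring].

Lemma zsc0 X : zsc 0 X = 0. Proof. by zor. Qed.
Lemma zscr0 k : zsc k 0 = 0. Proof. by zor. Qed.
Lemma zscD k X Y : zsc k (X + Y) = zsc k X + zsc k Y. Proof. by zor. Qed.
Lemma zmulDl X Y Z : zmul (X + Y) Z = zmul X Z + zmul Y Z. Proof. by zor. Qed.
Lemma zmulDr X Y Z : zmul Z (X + Y) = zmul Z X + zmul Z Y. Proof. by zor. Qed.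
Lemma zmulZl k X Y : zmul (zsc k X) Y = zsc k (zmul X Y). Proof. by zor. Qed.
Lemma zmulZr k X Y : zmul X (zsc k Y) = zsc k (zmul X Y). Proof. by zor. Qed.
Lemma zembD x y : zemb (x + y) = zemb x + zemb y.
Proof. by rewrite /zemb paD pbD cdD; zor. Qed.
Lemma zembZ k x : zemb (k *: x) = zsc k (zemb x).
Proof. by rewrite /zemb paZ pbZ cdZ; zor. Qed.

(** Left alternativity, as the square of a traceless octonion x is the scalar -Q6 x. *)
Lemma altl x Z : zmul (zemb x) (zmul (zemb x) Z) = zsc (- Q6 x) Z.
Proof. by rewrite /zemb Q6E; move: (pa x) (pb x) (cd x 3) => a b t; zor. Qed.

Lemma altr x Z : zmul (zmul Z (zemb x)) (zemb x) = zsc (- Q6 x) Z.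
Proof. by rewrite /zemb Q6E; move: (pa x) (pb x) (cd x 3) => a b t; zor. Qed.

Lemma zscDl k k' Z : zsc (k + k') Z = zsc k Z + zsc k' Z. Proof. by zor. Qed.

Lemma Q6D x y : Q6 (x + y) = Q6 x + Q6 y + bet x y. Proof. exact: Q6_polar. Qed.

(** Alternativity linearised by expanding it at x + y, which needs no division by 2. *)
Lemma altl2 x y Z : zmul (zemb x) (zmul (zemb y) Z) + zmul (zemb y) (zmul (zemb x) Z) = zsc (- bet x y) Z.
Proof.
have h := altl (x + y) Z.
have e : - Q6 (x + y) = - Q6 x + (- Q6 y + - bet x y) by rewrite Q6D; ring.
rewrite e zscDl zscDl zembD !(zmulDl, zmulDr) !altl -!addrA in h.
apply: (addrI (zsc (- Q6 x) Z)); apply: (addIr (zsc (- Q6 y) Z)).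
by rewrite -!addrA h [zsc (- Q6 y) _ + _]addrC.
Qed.

Lemma altr2 x y Z : zmul (zmul Z (zemb x)) (zemb y) + zmul (zmul Z (zemb y)) (zemb x) = zsc (- bet x y) Z.
Proof.
rewrite addrC; have h := altr (x + y) Z.
have e : - Q6 (x + y) = - Q6 x + (- Q6 y + - bet x y) by rewrite Q6D; ring.
rewrite e zscDl zscDl zembD !(zmulDl, zmulDr) !altr -!addrA in h.
apply: (addrI (zsc (- Q6 x) Z)); apply: (addIr (zsc (- Q6 y) Z)).
by rewrite -!addrA h [zsc (- Q6 y) _ + _]addrC.
Qed.

Lemma zmul_hrel x y : (zmul (zemb x) (zemb y) = 0) <-> hrel x y.
Proof.
split=> [h|/hrelP[h1 h2 h3 h4]].
  have g1 : cd x 3 * cd y 3 - dot (pa x) (pb y) = 0.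
    by rewrite -[RHS](congr1 (fun X : zorn => X.1.1) h) /= /dot !mxE; ring.
  have g2 : cd x 3 * cd y 3 - dot (pa y) (pb x) = 0.
    by rewrite -[RHS](congr1 (fun X : zorn => X.2.2) h) /= /dot !mxE; ring.
  have g3 : cd y 3 *: pa x - cd x 3 *: pa y - cross (pb x) (pb y) = 0.
    by rewrite -[RHS](congr1 (fun X : zorn => X.1.2) h) /=; vec3.
  have g4 : cross (pa x) (pa y) - (cd x 3 *: pb y - cd y 3 *: pb x) = 0.
    by rewrite -[RHS](congr1 (fun X : zorn => X.2.1) h) /=; vec3.
  by apply/hrelP; split; [move/subr0_eq: g1|move/subr0_eq: g2|move/subr0_eq: g4|move/subr0_eq: g3].
apply: zorn_eq => /=.
- transitivity (cd x 3 * cd y 3 - dot (pa x) (pb y)); first by rewrite /dot !mxE; ring.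
  by rewrite h1 subrr.
- transitivity (cd y 3 *: pa x - cd x 3 *: pa y - cross (pb x) (pb y)); first by vec3.
  by rewrite h4 subrr.
- transitivity (cross (pa x) (pa y) - (cd x 3 *: pb y - cd y 3 *: pb x)); first by vec3.
  by rewrite h3 subrr.
- transitivity (cd x 3 * cd y 3 - dot (pa y) (pb x)); first by rewrite /dot !mxE; ring.
  by rewrite h2 subrr.
Qed.

Lemma ztrace x y : (zmul (zemb x) (zemb y)).1.1 + (zmul (zemb x) (zemb y)).2.2 = - bet x y.
Proof. by rewrite /= /bet /dot !mxE; ring. Qed.

Lemma zemb_ex Z : Z.1.1 + Z.2.2 = 0 -> exists w, Z = zemb w.
Proof.
move=> h; exists (mk7 Z.1.2 Z.2.2 (- Z.2.1)).
by apply: zorn_eq; rewrite /= ?pa_mk7 ?pb_mk7 ?cd3_mk7 ?opprK //; apply/eqP; rewrite -addr_eq0 h.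
Qed.

Lemma zemb0 : zemb 0 = 0. Proof. by have := zembZ 0 0; rewrite scale0r zsc0. Qed.

Lemma betDl x y z : bet (x + y) z = bet x z + bet y z.
Proof. by rewrite /bet paD pbD cdD !(dotDl, dotDr); ring. Qed.
Lemma betZl k x z : bet (k *: x) z = k * bet x z.
Proof. by rewrite /bet paZ pbZ cdZ !(dotZl, dotZr); ring. Qed.
Lemma betC x y : bet x y = bet y x.
Proof. by rewrite /bet; ring. Qed.
Lemma betDr x y z : bet z (x + y) = bet z x + bet z y.
Proof. by rewrite !(betC z) betDl. Qed.
Lemma betZr k x z : bet z (k *: x) = k * bet z x.
Proof. by rewrite !(betC z) betZl. Qed.
Lemma Q6Z k x : Q6 (k *: x) = k ^+ 2 * Q6 x.
Proof. by rewrite !Q6E paZ pbZ cdZ dotZl dotZr; ring. Qed.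

Lemma hrel_bet x y : hrel x y -> bet x y = 0.
Proof. by case/hrelP => h1 h2 _ _; rewrite /bet h1 h2; ring. Qed.

(** The product xy is traceless, since its trace is -[bet] x y, and alternativity gives x (x y) = 0
    = (x y) y. *)
Lemma midpoint x y : Q6 x = 0 -> Q6 y = 0 -> bet x y = 0 -> ~~ hrel x y ->
  exists w, [/\ w != 0, hrel x w & hrel w y].
Proof.
move=> Qx Qy b0 n; have [w ew] : exists w, zmul (zemb x) (zemb y) = zemb w.
  by apply: zemb_ex; rewrite ztrace b0 oppr0.
exists w; split.
- by apply: contraNneq n => w0; apply/zmul_hrel; rewrite ew w0 zemb0.
- by apply/zmul_hrel; rewrite -ew altl Qx oppr0 zsc0.
- by apply/zmul_hrel; rewrite -ew altr Qy oppr0 zsc0.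
Qed.

(** The element D = u1 v2 + v1 u2 is traceless and, by linearised alternativity, is related to all
    four vectors. Hence it lies on both lines and is zero, and (u1 + k v1)(u2 + k v2) = k D. *)
Lemma regulus (u1 u2 v1 v2 : 'rV[F]_7) : u1 != 0 -> v1 != 0 ->
  Q6 u1 = 0 -> Q6 u2 = 0 -> Q6 v1 = 0 -> Q6 v2 = 0 -> hrel u1 u2 -> hrel v1 v2 ->
  ~~ (u2 <= u1)%MS -> ~~ (v2 <= v1)%MS -> ((u1 + u2) :&: (v1 + v2))%MS = 0 ->
  bet u1 v1 = 0 -> bet u2 v2 = 0 -> bet u1 v2 + bet v1 u2 = 0 ->
  forall k, hrel (u1 + k *: v1) (u2 + k *: v2).
Proof.
move=> u10 v10 Qu1 Qu2 Qv1 Qv2 hu hv nu nv dis b1 b2 b12 k.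
pose D := zmul (zemb u1) (zemb v2) + zmul (zemb v1) (zemb u2).
have [d ed] : exists d, D = zemb d.
  apply: zemb_ex; rewrite /D /= -[RHS]oppr0 -b12 opprD -!ztrace /=; ring.
have zu := (zmul_hrel _ _).2 hu; have zv := (zmul_hrel _ _).2 hv.
have z0r X : zmul X 0 = 0 by have := zmulZr 0 X 0; rewrite !zsc0.
have z0l X : zmul 0 X = 0 by have := zmulZl 0 0 X; rewrite !zsc0.
have r1 : hrel u1 d.
  apply/zmul_hrel; rewrite -ed /D zmulDr altl Qu1 oppr0 zsc0 add0r.
  by have := altl2 u1 v1 (zemb u2); rewrite zu z0r addr0 b1 oppr0 zsc0.
have r2 : hrel v1 d.
  apply/zmul_hrel; rewrite -ed /D zmulDr altl Qv1 oppr0 zsc0 addr0.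
  by have := altl2 v1 u1 (zemb v2); rewrite zv z0r addr0 betC b1 oppr0 zsc0.
have r3 : hrel u2 d.
  rewrite hrel_sym; apply/zmul_hrel; rewrite -ed /D zmulDl altr Qu2 oppr0 zsc0 addr0.
  by have := altr2 v2 u2 (zemb u1); rewrite zu z0l addr0 betC b2 oppr0 zsc0.
have r4 : hrel v2 d.
  rewrite hrel_sym; apply/zmul_hrel; rewrite -ed /D zmulDl altr Qv2 oppr0 zsc0 add0r.
  by have := altr2 u2 v2 (zemb v1); rewrite zv z0l addr0 b2 oppr0 zsc0.
have d0 : d = 0.
  apply/eqP; rewrite -submx0 -dis sub_capmx.
  by rewrite (hrel_notri u10 Qu1 hu r1 r3 nu) (hrel_notri v10 Qv1 hv r2 r4 nv).
have eD : D = 0 by rewrite ed d0 zemb0.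
apply/zmul_hrel; rewrite !zembD !zembZ !(zmulDl, zmulDr, zmulZl, zmulZr) zu zv !zscr0 addr0 add0r.
by rewrite -zscD -/D eD zscr0.
Qed.

End Zorn.

(** * Projection of a point to an orthogonal line *)

Section PerpLine.
Local Open Scope ring_scope.
Variable F : finFieldType.
Implicit Types (u v w x y z : 'rV[F]_7).

Lemma rplane_bet x y z : x != 0 -> Q6 x = 0 -> hrel x y -> hrel x z -> bet y z = 0.
Proof.
move=> x0 Qx hy hz; have := rplane_sing x0 Qx (hrelD hy hz).
by rewrite Q6D !(rplane_sing x0 Qx) // !add0r.
Qed.

(** The midpoint w of u and v1 is orthogonal to u and to the line. As a totally singular space has
    rank at most three, w lies in the span of u and the line, and its component on the line is the
    required point. *)
Lemma perp_line u (v1 v2 : 'rV[F]_7) : u != 0 -> v1 != 0 -> Q6 u = 0 -> Q6 v1 = 0 -> hrel v1 v2 ->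
  ~~ (v2 <= v1)%MS -> ~~ (u <= v1 + v2)%MS -> bet u v1 = 0 -> bet u v2 = 0 ->
  exists z, [/\ z != 0, (z <= v1 + v2)%MS & hrel u z].
Proof.
move=> u0 v10 Qu Qv1 h12 nv nu b1 b2.
have [h|n] := boolP (hrel u v1); first by exists v1; split=> //; smx.
have [w [w0 uw wv]] := midpoint Qu Qv1 b1 n.
have Qv2 := rplane_sing v10 Qv1 h12; have Qw := rplane_sing u0 Qu uw.
have b3 := hrel_bet h12; have b4 := hrel_bet uw; have b5 := hrel_bet wv.
have b6 : bet w v2 = 0 by apply: (rplane_bet v10 Qv1) => //; rewrite hrel_sym.
have r3 : \rank (v1 + v2 + u)%MS = 3%N by rewrite rank_addv // rank_span2.
have : (w <= v1 + v2 + u)%MS.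
  apply: contraT => nw; have := @sing_rank F _ (v1 + v2 + u + w)%MS; rewrite rank_addv // r3 => /(_ _).
  suff h v : (v <= v1 + v2 + u + w)%MS -> Q6 v = 0 by move/(_ h).
  case/sub_addvP => a [k [/sub_span3P[k1 [k2 [k3 ->]]] ->]].
  rewrite !Q6D !Q6Z !(betDl, betDr, betZl, betZr) Qu Qv1 Qv2 Qw b3.
  by rewrite [bet v1 u]betC [bet v2 u]betC [bet v1 w]betC [bet v2 w]betC b1 b2 b4 b5 b6; ring.
case/sub_addvP => a [k [al ew]].
have ua : hrel u a.
  by rewrite -[a](addrK (k *: u)) -ew; apply: hrelD => //; apply: hrelN; apply: hrelZ; rewrite hrelxx Qu.
have [a0|na] := eqVneq a 0; last by exists a.
have k0 : k != 0 by apply: contraNneq w0 => k0; rewrite ew a0 k0 scale0r addr0.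
case/negP: n; move: wv; rewrite ew a0 add0r hrel_sym => /(hrelZ k^-1).
by rewrite scalerA mulVf // scale1r hrel_sym.
Qed.

End PerpLine.

(** * Line counts in H(q) *)

Section HexLines.
Local Open Scope ring_scope.
Variable F : finFieldType.
Local Notation q := #|F|.
Implicit Types (u v w x y z : 'rV[F]_7) (l m n S : 'M[F]_7) (k : F).

(** Stated with the decidable [hrel], so that the lines form a finite set; [hlines_hex] identifies
    them with the given lines. The lock prevents accidental unfolding. *)
Definition hlines : {set 'M[F]_7} := locked [set l | proj_sub 1 l &
  [forall x : 'rV[F]_7, forall y : 'rV[F]_7, [==> (x <= l)%MS, (y <= l)%MS => hrel x y]]].

Lemma hlinesP l : reflect (proj_sub 1 l /\ forall x y, (x <= l)%MS -> (y <= l)%MS -> hrel x y) (l \in hlines).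
Proof.
rewrite /hlines -lock inE; apply: (iffP andP) => -[h1 h2]; split=> //.
  by move=> x y xl yl; move/forallP/(_ x)/forallP/(_ y): h2; rewrite xl yl.
by apply/forallP => x; apply/forallP => y; apply/implyP => xl; apply/implyP => yl; apply: h2.
Qed.

Lemma hl_rank l : l \in hlines -> \rank l = 2%N.
Proof. by case/hlinesP => /andP[/eqP]. Qed.

Lemma hl_can l : l \in hlines -> <<l>>%MS = l.
Proof. by case/hlinesP => /andP[_ /eqP]. Qed.

Lemma hl_rel l x y : l \in hlines -> (x <= l)%MS -> (y <= l)%MS -> hrel x y.
Proof. by case/hlinesP => _; apply. Qed.

Lemma hl_sing l x : l \in hlines -> (x <= l)%MS -> Q6 x = 0.
Proof. by move=> Ll xl; apply/eqP; rewrite -hrelxx; apply: (hl_rel Ll). Qed.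

Lemma hl_inj l m : l \in hlines -> m \in hlines -> (l <= m)%MS -> l = m.
Proof.
move=> Ll Lm lm; rewrite -(hl_can Ll) -(hl_can Lm); apply: eq_genmx; apply/eqmxP; rewrite lm /=.
by apply: sub_rank_sup lm _; rewrite !hl_rank.
Qed.

Lemma hl_basis l : l \in hlines -> exists x y, [/\ x != 0, ~~ (y <= x)%MS & (l :=: x + y)%MS].
Proof.
move=> Ll; have rl := hl_rank Ll.
have [x [xl nx]] : exists x, (x <= l)%MS /\ ~~ (x <= (0 : 'rV[F]_7))%MS.
  by apply: ex_outside; rewrite mxrank0 rl.
have x0 := notsub_nz nx.
have [y [yl ny]] : exists y, (y <= l)%MS /\ ~~ (y <= x)%MS.
  by apply: ex_outside; rewrite rank_vec // rl.
exists x, y; split=> //; apply/eqmx_sym/eqmxP; have s : (x + y <= l)%MS by smx.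
by rewrite s; apply: sub_rank_sup s _; rewrite rl rank_span2.
Qed.

Lemma hl_span l x y : l \in hlines -> x != 0 -> ~~ (y <= x)%MS -> (x <= l)%MS -> (y <= l)%MS ->
  l = <<(x + y)%MS>>%MS.
Proof.
move=> Ll x0 ny xl yl; rewrite -(hl_can Ll); apply: eq_genmx; apply/eqmx_sym/eqmxP.
have s : (x + y <= l)%MS by smx.
by rewrite s; apply: sub_rank_sup s _; rewrite (hl_rank Ll) rank_span2.
Qed.

Lemma hl_line x y : x != 0 -> ~~ (y <= x)%MS -> Q6 x = 0 -> Q6 y = 0 -> hrel x y ->
  <<(x + y)%MS>>%MS \in hlines.
Proof.
move=> x0 ny Qx Qy xy; apply/hlinesP; split.
  by rewrite /proj_sub mxrank_gen rank_span2 // genmx_id !eqxx.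
have h z (c d : F) : hrel z x -> hrel z y -> hrel z (c *: x + d *: y).
  by move=> h1 h2; apply: hrelD; apply: hrelZ.
move=> u v; rewrite !genmxE => /sub_span2P[c [d ->]] /sub_span2P[c' [d' ->]].
apply: (h); rewrite hrel_sym; apply: (h); rewrite ?hrelxx ?Qx ?Qy //; by rewrite hrel_sym.
Qed.

(** Orthogonality gives only the sum of the two scalar equations. If a middle coordinate is nonzero,
    the dot product of the first vector equation with pa x or pa y separates them; if both vanish,
    pa x and pa y are parallel. *)
Lemma grassmann_hrel x y : Q6 x = 0 -> Q6 y = 0 -> bet x y = 0 -> hex_grassmann x y -> hrel x y.
Proof.
move=> Qx Qy b0; rewrite -{1}(mk7K x) -{1}(mk7K y) => /hex_mk7[h3 h4].
move: Qx Qy b0; rewrite !Q6E /bet => /subr0_eq Qx /subr0_eq Qy /subr0_eq b0.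
have g1 := congr1 (dot (pa x)) h3; have g2 := congr1 (dot (pa y)) h3.
move: g1 g2; rewrite dot_crossl dot_crossr !dotDr -!scaleNr !dotZr Qx Qy => g1 g2.
suff d1 : dot (pa x) (pb y) = cd x 3 * cd y 3.
  apply/hrelP; split=> //; apply: (addrI (dot (pa x) (pb y))); rewrite b0 d1; ring.
have [t0|nt] := eqVneq (cd x 3) 0; last first.
  apply: (mulfI nt); apply/eqP; rewrite -subr_eq0 [X in _ == X]g1; apply/eqP; ring.
have [s0|ns] := eqVneq (cd y 3) 0; last first.
  have d2 : dot (pa y) (pb x) = 0.
    by apply: (mulfI ns); move: g2; rewrite t0 mul0r add0r mulNr mulr0 => /esym/eqP; rewrite oppr_eq0 => /eqP.
  by move: b0; rewrite d2 t0 mul0r addr0 mul0rn.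
rewrite t0 mul0r; move: h3; rewrite t0 s0 !scale0r subrr => h3.
have [->|na] := eqVneq (pa x) 0; first by rewrite dot0l.
have [k ek] := cross0P na h3.
by move: b0; rewrite ek dotZl Qx t0 mul0r mul0rn expr0n /= mulr0 addr0.
Qed.

Lemma hlines_hex l : l \in hlines <-> hex_line l.
Proof.
split=> [Ll|[pl Ql [x [y [/andP[h1 h2] gr]]]]].
  split; [by case/hlinesP: Ll | by move=> v; apply: hl_sing | ].
  have [x [y [x0 ny el]]] := hl_basis Ll; exists x, y.
  have xl : (x <= l)%MS by rewrite el; smx.
  have yl : (y <= l)%MS by rewrite el; smx.
  split; first by apply/andP; split; rewrite el addsmxE.
  by rewrite -(mk7K x) -(mk7K y); apply/hex_mk7; case/hrelP: (hl_rel Ll xl yl).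
apply/hlinesP; split=> //.
rewrite -addsmxE in h1; rewrite -addsmxE in h2.
have xl : (x <= l)%MS by apply: submx_trans h1; smx.
have yl : (y <= l)%MS by apply: submx_trans h1; smx.
have Qx := Ql _ xl; have Qy := Ql _ yl.
have b0 : bet x y = 0 by have := Ql _ (addmx_sub xl yl); rewrite Q6D Qx Qy !add0r.
have xy := grassmann_hrel Qx Qy b0 gr.
have h z (c d : F) : hrel z x -> hrel z y -> hrel z (c *: x + d *: y).
  by move=> g1 g2; apply: hrelD; apply: hrelZ.
move=> u v ul vl; have /sub_span2P[c [d ->]] := submx_trans ul h2.
have /sub_span2P[c' [d' ->]] := submx_trans vl h2.
apply: (h); rewrite hrel_sym; apply: (h); rewrite ?hrelxx ?Qx ?Qy //; by rewrite hrel_sym.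
Qed.

Lemma hl_rplane l x : l \in hlines -> (x <= l)%MS -> (l <= rplane x)%MS.
Proof. by move=> Ll xl; apply/row_subP => i; rewrite in_rplane (hl_rel Ll) // row_sub. Qed.

Lemma rplane_hl l x : x != 0 -> Q6 x = 0 -> l \in hlines -> (l <= rplane x)%MS -> (x <= l)%MS.
Proof.
move=> x0 Qx Ll lx; have [y [z [y0 nz el]]] := hl_basis Ll.
have yl : (y <= l)%MS by rewrite el; smx.
have zl : (z <= l)%MS by rewrite el; smx.
have hy : hrel x y by rewrite -in_rplane (submx_trans yl).
have hz : hrel x z by rewrite -in_rplane (submx_trans zl).
have [yx|ny] := boolP (y <= x)%MS; first by apply: submx_trans yl; apply: sub_vec_sym yx.
have h := hrel_notri x0 Qx hy hz (hl_rel Ll yl zl) ny.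
apply: (@submx_trans _ _ _ _ _ _ (x + y)%MS); first by smx.
have s : (l <= x + y)%MS by rewrite el; smx.
by apply: sub_rank_sup s _; rewrite (hl_rank Ll) rank_span2.
Qed.

(** Each of the q^3 - q vectors of the plane at x off <x> lies on one line through x, and each such
    line has q^2 - q of them. *)
Lemma hl_pt x : x != 0 -> Q6 x = 0 -> #|[set l in hlines | (x <= l)%MS]| = q.+1.
Proof.
move=> x0 Qx; have q1 := q_gt1 F.
pose W := [set l in hlines | (x <= l)%MS]; pose B := vset (rplane x) :\: vset x.
have xr : (x <= rplane x)%MS by rewrite in_rplane hrelxx Qx.
have cB : #|B| = (q ^ 3 - q)%N by rewrite card_vsetD // rank_rplane // rank_vec // expn1.
have := double_count W B (fun l y => (y <= l)%MS).
rewrite (eq_bigr (fun=> (q ^ 2 - q)%N)) => [|l]; last first.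
  rewrite inE => /andP[Ll xl]; have := card_vsetD xl; rewrite (hl_rank Ll) rank_vec // expn1 => <-.
  apply: eq_card => y; rewrite !inE; have [//|ny] := boolP (y <= x)%MS.
  have [yl|] := boolP (y <= l)%MS; rewrite ?andbF // andbT.
  exact: submx_trans yl (hl_rplane Ll xl).
rewrite [in RHS](eq_bigr (fun=> 1%N)) => [|y]; last first.
  rewrite !inE => /andP[ny yr]; rewrite in_rplane in yr.
  have Ly := hl_line x0 ny Qx (rplane_sing x0 Qx yr) yr.
  transitivity #|[set <<(x + y)%MS>>%MS]|; last exact: cards1.
  apply: eq_card => l; rewrite !inE.
  apply/andP/eqP => [[/andP[Ll xl] yl]|->]; first exact: hl_span.
  by rewrite Ly !genmxE; split=> /=; smx.
rewrite !sum_nat_const cB muln1 => e.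
have : (#|W| * (q ^ 2 - q) = q.+1 * (q ^ 2 - q))%N.
  rewrite e; move: q1; clear; case: #|F| => // k; rewrite !expnS expn0; nia.
have p : (0 < q ^ 2 - q)%N by rewrite subn_gt0 -{1}(expn1 q) ltn_exp2l.
by move/eqP; rewrite eqn_pmul2r // => /eqP.
Qed.

Lemma nb_rplane x S : x != 0 -> Q6 x = 0 -> (S :=: rplane x)%MS -> nb_in hlines S = q.+1.
Proof.
move=> x0 Qx eS; rewrite -(hl_pt x0 Qx) /nb_in; apply: eq_card => l; rewrite !inE.
have [Ll|//] := boolP (l \in hlines); rewrite /= eS.
by apply/idP/idP => h; [exact: rplane_hl | exact: hl_rplane].
Qed.

Lemma hl_meet l m x : l \in hlines -> m \in hlines -> l != m -> x != 0 -> (x <= l)%MS -> (x <= m)%MS ->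
  (rplane x <= l + m)%MS.
Proof.
move=> Ll Lm nlm x0 xl xm; have Qx := hl_sing Ll xl.
have s : (l + m <= rplane x)%MS by rewrite addsmx_sub !hl_rplane.
apply: sub_rank_sup s _; rewrite rank_rplane // ltnNge; apply: contra nlm => r.
apply/eqP; apply: (hl_inj Ll Lm); apply: submx_trans (addsmxSl l m) _.
by apply: sub_rank_sup; [exact: addsmxSr | rewrite (hl_rank Lm)].
Qed.

(** Two lines in S meet in a point x and span its plane. Smaller ranks are allowed because the
    preimage of a plane of PG(n,q) can be smaller than a plane. *)
Lemma hl_pl S : (\rank S <= 3)%N -> nb_in hlines S \in [:: 0%N; 1%N; q.+1].
Proof.
move=> rS; have [h|] := leqP (nb_in hlines S) 1.
  by move: h; rewrite !inE; case: (nb_in _ _) => [|[|//]].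
case/card_gt1P => l [m []]; rewrite !inE => /andP[Ll lS] /andP[Lm mS] nlm.
have [|x [x0 xl xm]] := ex_cap lS mS; first by rewrite (hl_rank Ll) (hl_rank Lm).
have Qx := hl_sing Ll xl; have s := hl_meet Ll Lm nlm x0 xl xm.
rewrite (@nb_rplane x) // ?eqxx ?orbT //; apply/eqmx_sym/eqmxP.
have sS : (rplane x <= S)%MS by apply: submx_trans s _; rewrite addsmx_sub lS.
by rewrite sS; apply: sub_rank_sup sS _; rewrite rank_rplane.
Qed.

(** The plane at x lies in S. If some line n in S misses x, it meets this plane in a point z whose
    plane then also lies in S. The quadric cuts S in exactly these two planes, so the lines of S are
    those through x or z, with one in common. *)
Lemma hl_sd_meet S x l m : \rank S = 4%N -> l \in hlines -> m \in hlines -> l != m ->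
  (l <= S)%MS -> (m <= S)%MS -> x != 0 -> (x <= l)%MS -> (x <= m)%MS ->
  nb_in hlines S \in [:: q.+1; (2 * q).+1].
Proof.
move=> rS Ll Lm nlm lS mS x0 xl xm; have Qx := hl_sing Ll xl.
have sx : (rplane x <= S)%MS.
  by apply: submx_trans (hl_meet Ll Lm nlm x0 xl xm) _; rewrite addsmx_sub lS.
have [/forall_inP all|] := boolP [forall (n | (n \in hlines) && (n <= S)%MS), (x <= n)%MS].
  rewrite inE; apply/orP; left; apply/eqP; rewrite -(hl_pt x0 Qx); apply: eq_card => n; rewrite !inE.
  have [Ln|//] := boolP (n \in hlines); rewrite /=.
  apply/idP/idP => h; first by apply: all; rewrite Ln.
  exact: submx_trans (hl_rplane Ln h) sx.
rewrite negb_forall_in => /exists_inP[n /andP[Ln nS] nxn].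
have [|z [z0 zr zn]] := ex_cap sx nS; first by rewrite rank_rplane // (hl_rank Ln) rS.
have Qz := hl_sing Ln zn; rewrite in_rplane in zr.
have nxz : ~~ (x <= z)%MS by apply: contra nxn => h; apply: submx_trans zn.
have nzx : ~~ (z <= x)%MS by apply: contra nxz; apply: sub_vec_sym.
have sz : (rplane z <= S)%MS.
  have s : (n + x <= rplane z)%MS by rewrite addsmx_sub (hl_rplane Ln zn) in_rplane hrel_sym.
  apply: submx_trans (sub_rank_sup s _) _; first by rewrite rank_rplane // rank_addv // (hl_rank Ln).
  by rewrite addsmx_sub nS (submx_trans xl lS).
have xS := submx_trans xl lS; have zS := submx_trans zn nS.
have r2 : \rank (x + z)%MS = 2%N by rewrite rank_span2.
have [u [ur nu]] : exists u, (u <= rplane x)%MS /\ ~~ (u <= x + z)%MS.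
  by apply: ex_outside; rewrite r2 rank_rplane.
have [v [vr nv]] : exists v, (v <= rplane z)%MS /\ ~~ (v <= x + z)%MS.
  by apply: ex_outside; rewrite r2 rank_rplane.
have xr : (x <= rplane x)%MS by rewrite in_rplane hrelxx Qx.
have zr' : (z <= rplane x)%MS by rewrite in_rplane.
have ex : (rplane x <= x + z + u)%MS.
  by apply: sub_rank_sup; [smx | rewrite rank_rplane // rank_addv // r2].
have nvx : ~~ (v <= rplane x)%MS.
  apply: contra nv; rewrite in_rplane => h; apply: (hrel_notri x0 Qx zr h _ nzx).
  by rewrite -in_rplane.
have nv4 : ~~ (v <= x + z + u)%MS by apply: contra nvx => h; apply: submx_trans h _; smx.
have eS : (S <= x + z + u + v)%MS.
  apply: sub_rank_sup; first by have := submx_trans ur sx; have := submx_trans vr sz => ? ?; smx.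
  by rewrite rS (rank_addv nv4) (rank_addv nu) r2.
have ur' := ur; have vr' := vr; rewrite !in_rplane in ur' vr'.
have Qu := rplane_sing x0 Qx ur'; have Qv := rplane_sing z0 Qz vr'.
have b1 := hrel_bet zr; have b2 := hrel_bet ur'; have b3 := rplane_bet x0 Qx zr ur'.
have b4 := hrel_bet vr'; have b5 : bet x v = 0 by apply: (rplane_bet z0 Qz) => //; rewrite hrel_sym.
have QS k1 k2 k3 k4 : Q6 (k1 *: x + k2 *: z + k3 *: u + k4 *: v) = k3 * k4 * bet u v.
  rewrite !Q6D !Q6Z !(betDl, betDr, betZl, betZr) Qu Qv Qx Qz b1 b2 b3 b4 b5; ring.
have nb : bet u v != 0.
  (* If u and v were orthogonal, all of S would be totally singular, although its rank is four. *)
  apply/eqP => b0; have := @sing_rank F _ S; rewrite rS => /(_ _).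
  suff h y : (y <= S)%MS -> Q6 y = 0 by move/(_ h).
  move=> yS; case/sub_addvP: (submx_trans yS eS) => a [k4 [/sub_span3P[k1 [k2 [k3 ->]]] ->]].
  by rewrite QS b0 mulr0.
have dich y : (y <= S)%MS -> Q6 y = 0 -> (y <= rplane x)%MS || (y <= rplane z)%MS.
  move=> yS; case/sub_addvP: (submx_trans yS eS) => a [k4 [/sub_span3P[k1 [k2 [k3 ->]]] ->]].
  rewrite QS => /eqP; rewrite !mulf_eq0 (negbTE nb) orbF => /orP[]/eqP ->.
    apply/orP; right; rewrite scale0r addr0.
    have : (x <= rplane z)%MS by rewrite in_rplane hrel_sym.
    have : (z <= rplane z)%MS by rewrite in_rplane hrelxx Qz.
    by move=> ? ?; smx.
  by apply/orP; left; rewrite scale0r addr0; smx.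
have key p : p \in hlines -> (p <= S)%MS -> (x <= p)%MS || (z <= p)%MS.
  move=> Lp pS; have [px|] := boolP (p <= rplane x)%MS; first by rewrite (rplane_hl x0 Qx Lp px).
  case/row_subPn => i ni; have [pz|] := boolP (p <= rplane z)%MS.
    by rewrite (rplane_hl z0 Qz Lp pz) orbT.
  case/row_subPn => j nj.
  have ip := row_sub i p; have jp := row_sub j p.
  have := dich _ (submx_trans ip pS) (hl_sing Lp ip); rewrite (negbTE ni) /= => iz.
  have := dich _ (submx_trans jp pS) (hl_sing Lp jp); rewrite (negbTE nj) orbF => jx.
  have sp := addmx_sub ip jp.
  have := dich _ (submx_trans sp pS) (hl_sing Lp sp) => /orP[] h.
    by case/negP: ni; move: h; rewrite addrC addv_sub_eq.
  by case/negP: nj; move: h; rewrite addv_sub_eq.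
pose X := [set p in hlines | (x <= p)%MS]; pose Z := [set p in hlines | (z <= p)%MS].
have eU : [set p in hlines | (p <= S)%MS] = X :|: Z.
  apply/setP => p; rewrite !inE; have [Lp|//] := boolP (p \in hlines); rewrite /=.
  apply/idP/orP => [/(key p Lp)/orP//|[] h].
    exact: submx_trans (hl_rplane Lp h) sx.
  exact: submx_trans (hl_rplane Lp h) sz.
have Lxz := hl_line x0 nzx Qx Qz zr.
have eI : X :&: Z = [set <<(x + z)%MS>>%MS].
  apply/setP => p; rewrite !inE; apply/idP/eqP => [/andP[/andP[Lp xp] /andP[_ zp]]|->].
    exact: hl_span.
  by rewrite Lxz !genmxE /=; apply/andP; split; smx.
rewrite /nb_in eU cardsU eI cards1 (hl_pt x0 Qx) (hl_pt z0 Qz) !inE; apply/orP; right.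
by apply/eqP; clear; lia.
Qed.

End HexLines.

(** * Solids with pairwise disjoint lines *)

Section HexSolids.
Local Open Scope ring_scope.
Variable F : finFieldType.
Local Notation q := #|F|.
Local Notation hlines := (hlines F).
Implicit Types (u v w x y z : 'rV[F]_7) (l m n S : 'M[F]_7) (k : F).

Lemma bet_perp_ex u n : n \in hlines -> exists v, [/\ v != 0, (v <= n)%MS & bet u v = 0].
Proof.
move=> Ln; have [x [y [x0 ny en]]] := hl_basis Ln.
have [b0|nb] := eqVneq (bet u x) 0; first by exists x; split=> //; rewrite en; smx.
exists (bet u x *: y - bet u y *: x); split; last 2 first.
- by rewrite en; smx.
- by rewrite betDr -scaleNr !betZr; ring.
apply: contraNneq ny => /subr0_eq e; rewrite -(@scale_sub_eq _ _ (bet u x)) // e; smx.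
Qed.

(** Bases of l and n adapted to the polar form satisfy the hypotheses of [regulus], which gives q
    lines besides n; the polar form shows that every other line of S is one of these. *)
Lemma hl_sd_disj S l n : \rank S = 4%N -> l \in hlines -> n \in hlines -> l != n ->
  (l <= S)%MS -> (n <= S)%MS ->
  (forall m m' x, m \in hlines -> m' \in hlines -> (m <= S)%MS -> (m' <= S)%MS ->
     x != 0 -> (x <= m)%MS -> (x <= m')%MS -> m = m') ->
  nb_in hlines S = q.+1.
Proof.
move=> rS Ll Ln nln lS nS dis.
have disj m m' : m \in hlines -> m' \in hlines -> (m <= S)%MS -> (m' <= S)%MS -> m != m' -> (m :&: m')%MS = 0.
  move=> Lm Lm' mS mS' nm; apply/eqP; rewrite -submx0; apply/row_subP => i; rewrite submx0.
  apply: contraNT nm => r0; apply/eqP; apply: (dis _ _ _ Lm Lm' mS mS' r0).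
    exact: submx_trans (row_sub i _) (capmxSl _ _).
  exact: submx_trans (row_sub i _) (capmxSr _ _).
have sum m m' : m \in hlines -> m' \in hlines -> (m <= S)%MS -> (m' <= S)%MS -> m != m' -> (S <= m + m')%MS.
  move=> Lm Lm' mS mS' nm; apply: sub_rank_sup; first by rewrite addsmx_sub mS.
  have := mxrank_sum_cap m m'; rewrite (disj _ _ Lm Lm' mS mS' nm) mxrank0 addn0 => ->.
  by rewrite rS (hl_rank Lm) (hl_rank Lm').
have norel m m' u v : m \in hlines -> m' \in hlines -> (m <= S)%MS -> (m' <= S)%MS -> m != m' ->
    u != 0 -> v != 0 -> (u <= m)%MS -> (v <= m')%MS -> ~~ hrel u v.
  move=> Lm Lm' mS mS' nm u0 v0 um vm; apply/negP => h.
  have nvu : ~~ (v <= u)%MS.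
    apply: contra nm => g; apply/eqP; apply: (dis _ _ v Lm Lm' mS mS' v0) => //; exact: submx_trans g um.
  have Luv := hl_line u0 nvu (hl_sing Lm um) (hl_sing Lm' vm) h.
  have sS : (<<(u + v)%MS>> <= S)%MS by rewrite genmxE addsmx_sub (submx_trans um mS) (submx_trans vm mS').
  have e1 := dis _ _ u Luv Lm sS mS u0; have e2 := dis _ _ v Luv Lm' sS mS' v0.
  have h1 : (u <= <<(u + v)%MS>>)%MS by rewrite genmxE; smx.
  have h2 : (v <= <<(u + v)%MS>>)%MS by rewrite genmxE; smx.
  by case/eqP: nm; apply: etrans (esym (e1 h1 um)) (e2 h2 vm).
have noperp m m' u : m \in hlines -> m' \in hlines -> (m <= S)%MS -> (m' <= S)%MS -> m != m' ->
    u != 0 -> (u <= m)%MS -> forall x y, (m' :=: x + y)%MS -> x != 0 -> ~~ (y <= x)%MS ->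
    ~~ ((bet u x == 0) && (bet u y == 0)).
  move=> Lm Lm' mS mS' nm u0 um x y em x0 ny; apply/negP => /andP[/eqP b1 /eqP b2].
  have xm : (x <= m')%MS by rewrite em; smx.
  have ym : (y <= m')%MS by rewrite em; smx.
  have nu : ~~ (u <= x + y)%MS.
    rewrite -em; apply: contra nm => h; apply/eqP; exact: (dis _ _ u Lm Lm' mS mS' u0).
  have [z [z0 zm uz]] := perp_line u0 x0 (hl_sing Lm um) (hl_sing Lm' xm) (hl_rel Lm' xm ym) ny nu b1 b2.
  rewrite -em in zm; by case/negP: (norel _ _ _ _ Lm Lm' mS mS' nm u0 z0 um zm).
have nnl : n != l by rewrite eq_sym.
have [u1 [u2 [u10 nu el]]] := hl_basis Ll.
have u1l : (u1 <= l)%MS by rewrite el; smx.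
have u2l : (u2 <= l)%MS by rewrite el; smx.
have u20 := notsub_nz nu.
have [v1 [v10 v1n b1]] := bet_perp_ex u1 Ln.
have [v2' [v2'0 v2'n b2']] := bet_perp_ex u2 Ln.
have nv' : ~~ (v2' <= v1)%MS.
  apply/negP => /sub_vecP[k ek]; have k0 : k != 0 by apply: contraNneq v2'0 => k0; rewrite ek k0 scale0r.
  have := noperp _ _ _ Ln Ll nS lS nnl v10 v1n _ _ el u10 nu; rewrite [bet v1 u1]betC b1 eqxx /=.
  move: b2'; rewrite ek betZr => /eqP; rewrite mulf_eq0 (negbTE k0) /= betC => ->; by [].
have en' : (n :=: v1 + v2')%MS.
  apply/eqmx_sym/eqmxP; have s : (v1 + v2' <= n)%MS by smx.
  by rewrite s; apply: sub_rank_sup s _; rewrite (hl_rank Ln) rank_span2.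
have c0 : bet u1 v2' != 0.
  by have := noperp _ _ _ Ll Ln lS nS nln u10 u1l _ _ en' v10 nv'; rewrite b1 eqxx.
have d0 : bet u2 v1 != 0.
  by have := noperp _ _ _ Ll Ln lS nS nln u20 u2l _ _ en' v10 nv'; rewrite b2' eqxx andbT.
(* This multiple makes the two mixed values of [bet] opposite, as [regulus] requires. *)
pose v2 := - (bet u2 v1 / bet u1 v2') *: v2'.
have k0 : - (bet u2 v1 / bet u1 v2') != 0 by rewrite oppr_eq0 mulf_neq0 ?invr_eq0.
have v2n : (v2 <= n)%MS by rewrite /v2; smx.
have nv : ~~ (v2 <= v1)%MS by rewrite /v2 scale_sub_eq.
have en : (n :=: v1 + v2)%MS.
  apply/eqmx_sym/eqmxP; have s : (v1 + v2 <= n)%MS by smx.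
  by rewrite s; apply: sub_rank_sup s _; rewrite (hl_rank Ln) rank_span2.
have b2 : bet u2 v2 = 0 by rewrite betZr b2' mulr0.
have b12 : bet u1 v2 + bet v1 u2 = 0.
  by rewrite betZr mulNr divfK // [bet v1 u2]betC addrC subrr.
have e0 : bet u1 v2 != 0 by rewrite betZr mulf_neq0.
clearbody v2.
have Qu1 := hl_sing Ll u1l; have Qu2 := hl_sing Ll u2l; have Qv1 := hl_sing Ln v1n; have Qv2 := hl_sing Ln v2n.
have hu := hl_rel Ll u1l u2l; have hv := hl_rel Ln v1n v2n.
have cap0 : ((u1 + u2) :&: (v1 + v2))%MS = 0.
  by apply/eqP; rewrite -submx0 -(disj _ _ Ll Ln lS nS nln); apply: capmxS; rewrite ?el ?en.
have reg := regulus u10 v10 Qu1 Qu2 Qv1 Qv2 hu hv nu nv cap0 b1 b2 b12.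
have nul (p : 'rV[F]_7) : (p <= l)%MS -> (p <= n)%MS -> p = 0.
  by move=> h1 h2; apply/eqP; rewrite -submx0 -(disj _ _ Ll Ln lS nS nln) sub_capmx h1.
pose mk (k : F) := <<((u1 + k *: v1)%R + (u2 + k *: v2)%R)%MS>>%MS.
have Qk (p r : 'rV[F]_7) k : Q6 p = 0 -> Q6 r = 0 -> bet p r = 0 -> Q6 (p + k *: r) = 0.
  by move=> h1 h2 h3; rewrite Q6D Q6Z betZr h1 h2 h3; ring.
have nz k : u1 + k *: v1 != 0.
  apply: contraNneq u10 => /eqP; rewrite addr_eq0 => /eqP h; apply/eqP; apply: nul => //; rewrite h; smx.
have nsub k : ~~ ((u2 + k *: v2)%R <= (u1 + k *: v1)%R)%MS.
  apply/negP => /sub_vecP[c e].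
  have h : u2 - c *: u1 = 0.
    apply: nul; first by smx.
    rewrite (_ : u2 - c *: u1 = c * k *: v1 - k *: v2); first by smx.
    by transitivity (u2 + k *: v2 - k *: v2 - c *: u1); [vec | rewrite e; vec].
  by case/negP: nu; rewrite (subr0_eq h); smx.
have Lk k : mk k \in hlines.
  by apply: hl_line => //; [exact: Qk | exact: Qk].
have u1S := submx_trans u1l lS; have u2S := submx_trans u2l lS.
have v1S := submx_trans v1n nS; have v2S := submx_trans v2n nS.
have kS k : (mk k <= S)%MS by rewrite genmxE; smx.
have nk k : mk k != n.
  apply/eqP => h; case/eqP: u10; apply: nul => //.
  have s : ((u1 + k *: v1)%R <= n)%MS by rewrite -h genmxE; smx.
  by rewrite -(addrK (k *: v1) u1); smx.
have inj : injective mk.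
  move=> k k' h; apply/eqP; apply: contraT => nkk; case/eqP: (nk k).
  apply: (dis _ _ v1 (Lk k) Ln (kS k) nS v10) => //.
  rewrite -(@scale_sub_eq _ _ (k - k')) ?subr_eq0 //.
  have s1 : ((u1 + k *: v1)%R <= mk k)%MS by rewrite genmxE; smx.
  have s2 : ((u1 + k' *: v1)%R <= mk k)%MS by rewrite h genmxE; smx.
  by rewrite (_ : _ *: v1 = (u1 + k *: v1) - (u1 + k' *: v1)); [smx | vec].
have eset : [set m in hlines | (m <= S)%MS] = n |: [set mk k | k in [set: F]].
  apply/setP => m; rewrite !inE; apply/andP/orP => [[Lm mS]|[/eqP ->|/imsetP[k _ ->]]]; last 2 first.
  - by [].
  - by rewrite Lk kS.
  have [->|nmn] := eqVneq m n; [by left | right].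
  (* The line m is a graph over l along n. Singularity of y1 and y2 kills one coefficient of p1 and
     one of p2, and their orthogonality equates the remaining two. *)
  have [y1 [p1 [y1m p1n e1]]] := sub_addsP (submx_trans u1S (sum _ _ Lm Ln mS nS nmn)).
  have [y2 [p2 [y2m p2n e2]]] := sub_addsP (submx_trans u2S (sum _ _ Lm Ln mS nS nmn)).
  have := p1n; rewrite en => /sub_span2P[al [be ep1]].
  have := p2n; rewrite en => /sub_span2P[ga [de ep2]].
  have ey1 : y1 = u1 - p1 by rewrite e1 addrK.
  have ey2 : y2 = u2 - p2 by rewrite e2 addrK.
  have b3 := hrel_bet hu; have b4 := hrel_bet hv.
  have Q1 : - be * bet u1 v2 = 0.
    rewrite -(hl_sing Lm y1m) ey1 ep1 -scaleN1r !Q6D !Q6Z !(betDr, betDl, betZr, betZl) !Q6D !Q6Z !(betDr, betDl, betZr, betZl).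
    by rewrite Qu1 Qv1 Qv2 b1 b4; ring.
  have be0 : be = 0 by apply/eqP; move/eqP: Q1; rewrite mulf_eq0 (negbTE e0) orbF oppr_eq0.
  have Q2 : - ga * bet u2 v1 = 0.
    rewrite -(hl_sing Lm y2m) ey2 ep2 -scaleN1r !Q6D !Q6Z !(betDr, betDl, betZr, betZl) !Q6D !Q6Z !(betDr, betDl, betZr, betZl).
    by rewrite Qu2 Qv1 Qv2 b2 b4; ring.
  have ga0 : ga = 0 by apply/eqP; move/eqP: Q2; rewrite mulf_eq0 (negbTE d0) orbF oppr_eq0.
  have B : (al - de) * bet u1 v2 = 0.
    have := hrel_bet (hl_rel Lm y1m y2m); rewrite ey1 ey2 ep1 ep2 be0 ga0.
    rewrite -!scaleN1r !(betDr, betDl, betZr, betZl) b3 b4 [bet v1 u2](_ : _ = - bet u1 v2).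
      by move=> <-; ring.
    by apply/eqP; rewrite -addr_eq0 addrC b12.
  have ead : al = de by apply/eqP; rewrite -subr_eq0; move/eqP: B; rewrite mulf_eq0 (negbTE e0) orbF.
  apply/imsetP; exists (- al) => //.
  have t1 : y1 = u1 + (- al) *: v1 by rewrite ey1 ep1 be0; vec.
  have t2 : y2 = u2 + (- al) *: v2 by rewrite ey2 ep2 ga0 -ead; vec.
  by apply: hl_span => //; rewrite -?t1 -?t2.
rewrite /nb_in eset cardsU1 card_imset // cardsT.
have -> : n \notin [set mk k | k in [set: F]]; last by rewrite add1n.
by apply/imsetP => -[k _ /esym/eqP]; rewrite (negbTE (nk k)).
Qed.

Lemma hl_sd S : (\rank S <= 4)%N -> nb_in hlines S \in [:: 0%N; 1%N; q.+1; (2 * q).+1].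
Proof.
rewrite leq_eqVlt => /orP[/eqP rS|rS]; last first.
  have := hl_pl rS; rewrite !inE => /or3P[]/eqP ->; rewrite eqxx ?orbT //.
have [h|] := leqP (nb_in hlines S) 1.
  by move: h; rewrite !inE; case: (nb_in _ _) => [|[|//]].
case/card_gt1P => l [m []]; rewrite !inE => /andP[Ll lS] /andP[Lm mS] nlm.
have [/existsP[l' /existsP[m' /existsP[x /and5P[/andP[Ll' Lm'] /andP[lS' mS'] nlm' x0 /andP[xl xm]]]]]|none] :=
    boolP [exists l' : 'M[F]_7, exists m' : 'M[F]_7, exists x : 'rV[F]_7,
      [&& (l' \in hlines) && (m' \in hlines), (l' <= S)%MS && (m' <= S)%MS, l' != m', x != 0 &
          (x <= l')%MS && (x <= m')%MS]].
  have := hl_sd_meet rS Ll' Lm' nlm' lS' mS' x0 xl xm.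
  by rewrite !inE => /orP[]/eqP ->; rewrite eqxx ?orbT.
rewrite (hl_sd_disj rS Ll Lm nlm lS mS) ?inE ?eqxx ?orbT // => l' m' x Ll' Lm' lS' mS' x0 xl xm.
apply/eqP; apply: contraNT none => nlm'; apply/existsP; exists l'; apply/existsP; exists m'; apply/existsP; exists x.
by rewrite Ll' Lm' lS' mS' nlm' x0 xl xm.
Qed.

End HexSolids.

(** * The number of lines, and planes contained in a hyperplane *)

Section HexCount.
Local Open Scope ring_scope.
Variable F : finFieldType.
Local Notation q := #|F|.
Local Notation hlines := (hlines F).
Implicit Types (u v w x y z : 'rV[F]_7) (l m n S : 'M[F]_7) (k : F).
Let q1 := q_gt1 F.

Lemma card_dot_eq (a : 'rV[F]_3) (c : F) : a != 0 -> #|[set b : 'rV[F]_3 | dot a b == c]| = (q ^ 2)%N.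
Proof.
move=> a0; rewrite -(card_perp a0); have [w aw] := dot_unit a0.
have inj : injective (fun b : 'rV[F]_3 => b + c *: w) by move=> b b' /addIr.
rewrite -(card_imset [set p | dot a p == 0] inj); apply: eq_card => b; rewrite inE.
apply/eqP/imsetP => [h|[p]]; last by rewrite inE => /eqP h ->; rewrite dotDr dotZr aw h add0r mulr1.
by exists (b - c *: w); rewrite ?subrK // inE dotDr -scaleNr dotZr aw h mulr1 subrr.
Qed.

(** For each (pa x, t) with pa x nonzero there are q^2 choices of pb x; for pa x = 0 only t = 0
    occurs, with q^3 choices. In total (q^3 - 1) q^3 + q^3. *)
Lemma card_sing : (#|[set x : 'rV[F]_7 | Q6 x == 0%R]| <= q ^ 6)%N.
Proof.
have := double_count [set x : 'rV[F]_7 | Q6 x == 0] [set: 'rV[F]_3 * F] (fun x p => (pa x, cd x 3) == p).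
rewrite (eq_bigr (fun=> 1%N)) => [|x _]; last first.
  transitivity #|[set (pa x, cd x 3)]|; last exact: cards1.
  by apply: eq_card => p; rewrite !inE eq_sym.
rewrite sum1_card => ->.
have le (p : 'rV[F]_3 * F) :
    (#|[set x in [set x : 'rV[F]_7 | Q6 x == 0%R] | (pa x, cd x 3) == p]| <= #|[set b : 'rV[F]_3 | dot p.1 b == (p.2 ^+ 2)%R]|)%N.
  have inj : {in [set x in [set x : 'rV[F]_7 | Q6 x == 0] | (pa x, cd x 3) == p] &, injective (@pb F)}.
    move=> x y; rewrite !inE => /andP[_ /eqP <-] /andP[_ /eqP[h1 h2]] h3; exact: eq7.
  rewrite -(card_in_imset inj); apply: subset_leq_card; apply/subsetP => b /imsetP[x].
  by rewrite !inE => /andP[Qx /eqP <-] -> /=; move: Qx; rewrite Q6E subr_eq0.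
apply: (@leq_trans (\sum_(p in [set: 'rV[F]_3 * F]) #|[set b : 'rV[F]_3 | dot p.1 b == (p.2 ^+ 2)%R]|)%N).
  by apply: leq_sum => p _; apply: le.
rewrite (bigID (fun p => p.1 == 0)) /= addnC.
rewrite (eq_bigr (fun=> (q ^ 2)%N)) => [|p /andP[_ n]]; last exact: card_dot_eq.
rewrite sum_nat_cond_const.
have -> : #|[set p : 'rV[F]_3 * F | (p \in setT) && (p.1 != 0)]| = ((q ^ 3 - 1) * q)%N.
  have -> : [set p : 'rV[F]_3 * F | (p \in setT) && (p.1 != 0)] = setX [set~ 0] setT.
    by apply/setP => p; rewrite !inE andbT.
  by rewrite cardsX cardsT cardsC1 card_mx mul1n subn1.
rewrite (bigD1 (0, 0)) /=; last by rewrite !inE eqxx.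
rewrite big1 ?addn0 => [|[a t] /= /andP[/andP[_ /eqP ->] n]]; last first.
  apply/eqP; rewrite cards_eq0; apply/eqP/setP => b; rewrite !inE dot0l eq_sym expf_eq0 /=.
  by apply: contraNF n => /eqP ->.
have -> : #|[set b : 'rV[F]_3 | dot 0 b == 0 ^+ 2]| = (q ^ 3)%N.
  have -> : [set b : 'rV[F]_3 | dot 0 b == 0 ^+ 2] = setT.
    by apply/setP => b; rewrite !inE dot0l expr0n eqxx.
  by rewrite cardsT card_mx mul1n.
move: q1; clear; case: #|F| => // j _; rewrite !expnS expn0; nia.
Qed.

Definition sing := [set x : 'rV[F]_7 | (x != 0) && (Q6 x == 0)].

(** Flags are counted twice: at most q^6 - 1 singular vectors with q + 1 lines each, and q^2 - 1
    vectors on each line. *)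
Lemma hl_To : (#|hlines| <= q ^ 5 + q ^ 4 + q ^ 3 + q ^ 2 + q + 1)%N.
Proof.
have := double_count sing hlines (fun x l => (x <= l)%MS).
rewrite (eq_bigr (fun=> q.+1)) => [|x]; last by rewrite inE => /andP[x0 /eqP Qx]; apply: hl_pt.
rewrite [in RHS](eq_bigr (fun=> (q ^ 2 - 1)%N)) => [|l Ll]; last first.
  have := card_nz l; rewrite (hl_rank Ll) => <-; apply: eq_card => x; rewrite !inE andbC.
  have [xl|//] := boolP (x <= l)%MS; by rewrite (hl_sing Ll xl) eqxx andbT.
rewrite !sum_nat_const; have : (#|sing| <= q ^ 6 - 1)%N.
  have : (#|sing| < #|[set x : 'rV[F]_7 | Q6 x == 0%R]|)%N.
    rewrite [X in (_ < X)%N](cardsD1 0) inE Q6E pa0 dot0l cd0 expr0n subrr eqxx add1n ltnS.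
    by apply: subset_leq_card; apply/subsetP => x; rewrite !inE.
  move/leq_trans => /(_ _ card_sing); case: (q ^ 6)%N => // k; by rewrite subn1.
move: q1; move: #|sing| #|hlines| => s h; clear; case: #|F| => // j; rewrite ltnS => j0 h1 h2.
have j20 : (0 < j.+1 ^ 2 - 1)%N by rewrite expnS expn1; nia.
rewrite -(leq_pmul2r j20) -h2.
have : (s * j.+2 <= (j.+1 ^ 6 - 1) * j.+2)%N by rewrite leq_mul.
move/leq_trans; apply; apply: eq_leq; rewrite !expnS expn0; nia.
Qed.

Lemma ex_functional S : (\rank S < 7)%N -> exists (xi : 'rV[F]_3) (eta : F) (ze : 'rV[F]_3),
  mk7 xi eta ze != 0 /\
  forall v, (v <= S)%MS -> dot xi (pa v) + eta * cd v 3 + dot ze (pb v) = 0.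
Proof.
move=> rS; have : (cokermx S)^T != 0.
  by rewrite -mxrank_eq0 mxrank_tr mxrank_coker subn_eq0 -ltnNge.
case/rowV0Pn => c cS c0.
exists (pa c), (cd c 3), (pb c); rewrite mk7K; split=> // v vS.
have h : v *m c^T = 0.
  move: cS => /submxP[D ->]; rewrite trmx_mul trmxK mulmxA.
  by move: vS; rewrite submxE => /eqP ->; rewrite mul0mx.
transitivity ((v *m c^T) 0 0); last by rewrite h mxE.
have e (a b a' b' : 'rV[F]_3) (t t' : F) :
    (mk7 a t b *m (mk7 a' t' b')^T) 0 0 = dot a' a + t' * t + dot b' b.
  by rewrite mxE !big_ord_recl big_ord0 !mxE /= /dot; ring.
by rewrite -[in RHS](mk7K v) -[in RHS](mk7K c) e.
Qed.

Local Notation zorn := ((F * 'rV[F]_3) * ('rV[F]_3 * F))%type.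

Section Functional.
Variables (xi : 'rV[F]_3) (eta : F) (ze : 'rV[F]_3).
Local Notation phi := (fun v => dot xi (pa v) + eta * cd v 3 + dot ze (pb v)).
(** The octonion encoding the functional phi; it has trace eta and norm xi.ze. *)
Definition zfun : zorn := ((0, - ze), (xi, eta)).

Lemma dot_all0 (a : 'rV[F]_3) : (forall p, dot a p = 0) -> a = 0.
Proof. by move=> h; apply/eqP; apply: contraT => /dot_nz[b]; rewrite h eqxx. Qed.

Lemma eigenE x k : cross xi (pb x) - cd x 3 *: ze = k *: pa x ->
  dot xi (pa x) + eta * cd x 3 = k * cd x 3 -> dot ze (pb x) = - (k * cd x 3) ->
  cd x 3 *: xi + eta *: pb x + cross ze (pa x) = k *: pb x ->
  zmul zfun (zemb x) = zsc k (zemb x).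
Proof.
move=> h1 h2 h3 h4; apply: zorn_eq => /=.
- transitivity (dot ze (pb x)); first by rewrite /dot !mxE; ring.
  by rewrite h3; ring.
- by rewrite -h1; vec3.
- transitivity (- (cd x 3 *: xi + eta *: pb x + cross ze (pa x))); first by vec3.
  by rewrite h4; vec.
- by rewrite -h2; ring.
Qed.

(** Vanishing of phi on the plane at x, tested on the chart, amounts to one scalar and one vector
    equation; these are rearranged into the four components of the eigenvector equation. *)
Lemma full_eigen x : x != 0 -> Q6 x = 0 -> (forall y, hrel x y -> phi y = 0) ->
  exists k, zmul zfun (zemb x) = zsc k (zemb x).
Proof.
move=> x0 Qx full; have Q : dot (pa x) (pb x) = cd x 3 ^+ 2 by apply/eqP; rewrite -subr_eq0 -Q6E Qx.
have [a0|na] := eqVneq (pa x) 0.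
  have t0 : cd x 3 = 0.
    by move/eqP: Q; rewrite a0 dot0l eq_sym expf_eq0 /= => /eqP.
  have b0 : pb x != 0 by have := sing_part x0 Qx; rewrite a0 eqxx.
  have c0 : cross xi (pb x) = 0.
    apply: dot_all0 => w; rewrite dotC -dot_cross_rot.
    have := full (mk7 (cross (pb x) w) 0 0); rewrite pa_mk7 pb_mk7 cd3_mk7 dot0r mulr0 !addr0; apply.
    apply/hrelP; rewrite pa_mk7 pb_mk7 cd3_mk7 t0 a0 !(dot0l, cross0l, cross0r, scale0r, scaler0, subrr, mulr0, mul0r).
    by split=> //; rewrite dotC dot_crossl.
  have z0 : dot ze (pb x) = 0.
    have := full x; rewrite a0 t0 dot0r mulr0 !add0r => -> //; by rewrite hrelxx Qx.
  exists eta; apply: eigenE; rewrite ?c0 ?a0 ?t0 ?z0 ?dot0r ?cross0r ?mulr0 ?scale0r ?scaler0 ?subrr ?oppr0 ?addr0 ?add0r //.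
have [w aw] := dot_unit na.
set a := pa x in Q aw na *; set b := pb x in Q *; set t := cd x 3 in Q *.
(* The coefficient of the middle coordinate [ct] in phi on the chart. E1 is phi at s = 1, p = 0, and
   E2 expresses phi at s = 0 for all p; the eigenvalue is eta - mu. *)
pose mu := dot xi (cross w b) + eta + t * dot ze w.
have E1 : dot xi a + t * mu = 0.
  have := full _ (chart_rel aw Q 1 0); rewrite /chart pa_mk7 pb_mk7 cd3_mk7 /ct -/a -/b -/t.
  rewrite !cross0r !dot0r mulr1 add0r subr0 add0r scale1r scaler0 subr0 dotDr !dotZr => h.
  by rewrite -h /mu; ring.
have E2 : mu *: cross w b - t *: cross xi w + ze - dot ze w *: a = 0.
  apply: dot_all0 => p; have := full _ (chart_rel aw Q 0 p); rewrite /chart pa_mk7 pb_mk7 cd3_mk7 /ct -/a -/b -/t.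
  have -> : dot (mu *: cross w b - t *: cross xi w + ze - dot ze w *: a) p =
      mu * dot (cross w b) p - t * dot (cross xi w) p + dot ze p - dot ze w * dot a p.
    by rewrite /dot !mxE; ring.
  rewrite (dot_cross_rot w b p) !mulr0 !addr0 scale0r add0r.
  have e (k1 k2 : F) (p1 p2 : 'rV[F]_3) : dot xi (k1 *: p1 - k2 *: p2) = k1 * dot xi p1 - k2 * dot xi p2.
    by rewrite /dot !mxE; ring.
  rewrite e dotDr dotZr (dot_cross_rot xi w p) (dotC (cross w b) p) (dotC (cross xi w) p) => <-.
  by rewrite /mu; ring.
exists (eta - mu); apply: eigenE; rewrite -/a -/b -/t.
- have := dot_cross4 a b w xi; rewrite aw Q => h.
  have e : cross xi b = - (dot w (cross b xi) *: a) + t ^+ 2 *: cross xi w + dot a xi *: cross w b.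
    by rewrite h (crossC xi b); vec.
  have -> : t *: ze = t *: (dot ze w *: a - mu *: cross w b + t *: cross xi w).
    congr (_ *: _); apply/eqP; rewrite -subr_eq0 -E2; apply/eqP; vec.
  have ex : dot a xi = - (t * mu) by apply/eqP; rewrite -addr_eq0 dotC E1.
  rewrite e ex /mu (dot_cross_rot w b xi) ; vec.
- by have -> : dot xi a = - (t * mu) by [apply/eqP; rewrite -addr_eq0 E1]; ring.
- have := congr1 (dot b) E2; rewrite dot0r !dotDr -!scaleNr !dotZr dot_crossr (dotC b a) Q (dotC b ze).
  rewrite (dot_cross_rot b xi w) (dot_cross_rot w b xi) => h.
  apply/eqP; rewrite -subr_eq0 -h /mu; apply/eqP; ring.
- have := congr1 (cross a) E2; rewrite cross0r !crossDr -!scaleNr !crossZr crossvv !cross_crossr aw Q => h.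
  have e1 : cross ze a = - cross a ze by rewrite crossC.
  have ex : dot a xi = - (t * mu) by apply/eqP; rewrite -addr_eq0 dotC E1.
  rewrite ex in h; apply/eqP; rewrite -subr_eq0 e1 -oppr_eq0 -h; apply/eqP; vec.
Qed.

End Functional.
End HexCount.

(** * Lines in a hyperplane of H(q) *)

Section HexHyper.
Local Open Scope ring_scope.
Variable F : finFieldType.
Local Notation q := #|F|.
Local Notation hlines := (hlines F).
Implicit Types (u v w x y z : 'rV[F]_7) (l m n S : 'M[F]_7) (k : F).
Local Notation zorn := ((F * 'rV[F]_3) * ('rV[F]_3 * F))%type.
Let q1 := q_gt1 F.

Lemma zsc_eq0 k (X : zorn) : zsc k X = 0 -> X != 0 -> k = 0.
Proof.
move=> h n; apply/eqP; apply: contraNT n => k0; apply/eqP; apply: zorn_eq => /=.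
- by apply: (mulfI k0); rewrite mulr0; have /= := congr1 (fun Y : zorn => Y.1.1) h.
- by apply: (scalerI k0); rewrite scaler0; have /= := congr1 (fun Y : zorn => Y.1.2) h.
- by apply: (scalerI k0); rewrite scaler0; have /= := congr1 (fun Y : zorn => Y.2.1) h.
- by apply: (mulfI k0); rewrite mulr0; have /= := congr1 (fun Y : zorn => Y.2.2) h.
Qed.

Lemma zemb_nz x : x != 0 -> zemb x != 0.
Proof.
apply: contraNneq => h.
have h1 := congr1 (fun Y : zorn => Y.1.2) h; have h2 := congr1 (fun Y : zorn => Y.2.1) h.
have h3 := congr1 (fun Y : zorn => Y.2.2) h; move: h1 h2 h3; rewrite /= => h1 h2 h3.
by apply/eqP; apply: eq7; rewrite ?h1 ?h3 ?pa0 ?pb0 ?cd0 //; apply/eqP; rewrite -oppr_eq0 h2.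
Qed.

Section Functional.
Variables (xi : 'rV[F]_3) (eta : F) (ze : 'rV[F]_3).
Hypothesis phi0 : mk7 xi eta ze != 0.
Local Notation C := (zfun xi eta ze).

(** Left multiplication by C satisfies the quadratic equation of C, with trace eta and norm
    xi.ze. *)
Lemma eigen_quad x k : x != 0 -> zmul C (zemb x) = zsc k (zemb x) -> k ^+ 2 - eta * k + dot xi ze = 0.
Proof.
move=> x0 h; apply: (@zsc_eq0 _ (zemb x)); last exact: zemb_nz.
have e : zmul C (zmul C (zemb x)) = zsc eta (zmul C (zemb x)) - zsc (dot xi ze) (zemb x).
  by apply: zorn_eq; rewrite /= /dot; [rewrite ?mxE /=; ring | vec3 | vec3 | rewrite ?mxE /=; ring].
move: e; rewrite h zmulZr h => /eqP; rewrite -subr_eq0 => /eqP <-.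
by apply: zorn_eq => /=; [ring | vec | vec | ring].
Qed.

Definition eigenv k x := zmul C (zemb x) == zsc k (zemb x).

(* (C - k) x = 0 forces the norm of x to vanish, since C - k is not zero. *)
Lemma card_eigen k : (#|[set x | (x != 0%R) && eigenv k x]| <= q ^ 3 - 1)%N.
Proof.
pose V := (\sum_(y | eigenv k y) <<y>>)%MS.
have inV v : (v <= V)%MS = eigenv k v.
  apply: sum_closed => [|x y /eqP h1 /eqP h2|c x /eqP h]; apply/eqP.
  - by rewrite zemb0 zscr0; have := zmulZr 0 C 0; rewrite !zsc0.
  - by rewrite zembD zmulDr h1 h2 zscD.
  - rewrite zembZ zmulZr h; apply: zorn_eq => /=; [ring | vec | vec | ring].
have sV v : (v <= V)%MS -> Q6 v = 0.
  rewrite inV => /eqP h; pose Z : zorn := ((- k, - ze), (xi, eta - k)).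
  have Z0 : Z != 0.
    apply: contraNneq phi0 => e.
    have /= g1 := congr1 (fun Y : zorn => Y.1.1) e; have /= g2 := congr1 (fun Y : zorn => Y.1.2) e.
    have /= g3 := congr1 (fun Y : zorn => Y.2.1) e; have /= g4 := congr1 (fun Y : zorn => Y.2.2) e.
    have k0 : k = 0 by apply/eqP; rewrite -oppr_eq0 g1.
    apply/eqP; apply: eq7; rewrite ?pa_mk7 ?pb_mk7 ?cd3_mk7 ?pa0 ?pb0 ?cd0 //.
      by rewrite -g4 k0 subr0.
    by apply/eqP; rewrite -oppr_eq0 g2.
  have e : zmul Z (zemb v) = 0.
    transitivity (zmul C (zemb v) - zsc k (zemb v)); last by rewrite h subrr.
    by apply: zorn_eq; rewrite /= /dot; [rewrite ?mxE /=; ring | vec3 | vec3 | rewrite ?mxE /=; ring].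
  apply/eqP; rewrite -oppr_eq0; apply/eqP; apply: (@zsc_eq0 _ Z) => //.
  by rewrite -altr e; have := zmulZl 0 0 (zemb v); rewrite !zsc0.
have rV := sing_rank sV.
apply: (@leq_trans (q ^ \rank V - 1)%N); last by rewrite leq_sub2r // leq_pexp2l // ltnW.
rewrite -card_nz; apply: subset_leq_card; apply/subsetP => x; rewrite !inE => /andP[-> h].
by rewrite inV h.
Qed.

End Functional.

(** If k is one root of the quadratic equation, the other is eta - k, so two eigenspaces contain all
    these points. *)
Lemma card_full7 S : (\rank S < 7)%N ->
  (#|[set x in sing F | (rplane x <= S)%MS]| <= 2 * (q ^ 3 - 1))%N.
Proof.
move=> rS; have [xi [eta [ze [phi0 hphi]]]] := ex_functional rS.
set Phi := [set x in sing F | (rplane x <= S)%MS].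
have ev x : x \in Phi -> exists k, eigenv xi eta ze k x.
  rewrite !inE => /andP[/andP[x0 /eqP Qx] rx].
  have [|k h] := @full_eigen F xi eta ze x x0 Qx; last by exists k; apply/eqP.
  by move=> y; rewrite -in_rplane => yx; apply: hphi; apply: submx_trans yx rx.
have [->|[x xP]] := set_0Vmem Phi; first by rewrite cards0.
have x0 y : y \in Phi -> y != 0 by rewrite !inE => /andP[/andP[]].
have [k hk] := ev x xP.
have s : Phi \subset [set x | (x != 0) && eigenv xi eta ze k x] :|: [set x | (x != 0) && eigenv xi eta ze (eta - k) x].
  apply/subsetP => y yP; have [k' hk'] := ev y yP; rewrite !inE (x0 y yP) /=.
  have e1 := eigen_quad (x0 x xP) (eqP hk); have e2 := eigen_quad (x0 y yP) (eqP hk').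
  have : (k' - k) * (k' - (eta - k)) == 0.
    by apply/eqP; rewrite -[RHS](subrr 0) -{1}e2 -e1; ring.
  by rewrite mulf_eq0 !subr_eq0 => /orP[]/eqP <-; rewrite hk' ?orbT.
apply: leq_trans (subset_leq_card s) _; apply: leq_trans (leq_card_setU _ _) _.
by rewrite mul2n -addnn leq_add // card_eigen.
Qed.

(** Two counts of flags: a point of S whose plane is not in S has at most one line in S, and a line
    not in S has at most one point in S. Eliminating the number of singular vectors of S bounds the
    lines by the number of points with plane in S. *)
Lemma hl_Hp S : (\rank S < 7)%N -> (nb_in hlines S <= q ^ 4 - q ^ 3 + 3 * q ^ 2 + 2 * q)%N.
Proof.
move=> rS; pose W := [set x in sing F | (x <= S)%MS]; pose Phi := [set x in sing F | (rplane x <= S)%MS].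
pose B := [set l in hlines | (l <= S)%MS].
have singP x : x \in sing F -> x != 0 /\ Q6 x = 0 by rewrite inE => /andP[h /eqP].
have c1 : (#|B| * (q ^ 2 - 1) <= #|W| + q * #|Phi|)%N.
  have := double_count B W (fun l x => (x <= l)%MS).
  rewrite (eq_bigr (fun=> (q ^ 2 - 1)%N)) => [|l]; last first.
    rewrite inE => /andP[Ll lS]; have := card_nz l; rewrite (hl_rank Ll) => <-; apply: eq_card => x.
    rewrite !inE; have [xl|] := boolP (x <= l)%MS; rewrite ?andbF // andbT /=.
    by rewrite (hl_sing Ll xl) eqxx (submx_trans xl lS) !andbT.
  rewrite sum_nat_const => ->.
  apply: (@leq_trans (\sum_(x in W) (1 + q * (x \in Phi)))%N).
    apply: leq_sum => x; rewrite [x \in W]inE => /andP[xs xS]; have [x0 Qx] := singP x xs.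
    have [h|] := leqP #|[set l in B | (x <= l)%MS]| 1.
      by apply: leq_trans h _; rewrite leq_addr.
    case/card_gt1P => l [m []]; rewrite !inE => /andP[/andP[Ll lS] xl] /andP[/andP[Lm mS] xm] nlm.
    have rx : (rplane x <= S)%MS by apply: submx_trans (hl_meet Ll Lm nlm x0 xl xm) _; rewrite addsmx_sub lS.
    rewrite x0 Qx eqxx rx /= muln1 add1n -(hl_pt x0 Qx); apply: subset_leq_card.
    by apply/subsetP => p; rewrite !inE => /andP[/andP[-> _] ->].
  rewrite big_split /= sum1_card leq_add2l -big_distrr /= leq_mul2l; apply/orP; right.
  rewrite -big_mkcondr /= sum1_card; apply: subset_leq_card; apply/subsetP => x.
  by rewrite unfold_in /= => /andP[].
have c2 : (#|W| * q.+1 <= #|B| * (q ^ 2 - 1) + (#|hlines| - #|B|) * q.-1)%N.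
  have := double_count W hlines (fun x l => (x <= l)%MS).
  rewrite (eq_bigr (fun=> q.+1)) => [|x]; last by rewrite inE => /andP[/singP[x0 Qx] _]; apply: hl_pt.
  rewrite sum_nat_const => ->.
  rewrite (bigID (fun l => (l <= S)%MS)) /=; apply: leq_add.
    rewrite -sum_nat_const (eq_bigl (fun l => l \in B)) => [|l]; last by rewrite inE.
    apply: leq_sum => l; rewrite inE => /andP[Ll _]; have := card_nz l; rewrite (hl_rank Ll) => <-.
    by apply: subset_leq_card; apply/subsetP => x; rewrite !inE => /andP[/andP[/andP[-> _] _] ->].
  have -> : (#|hlines| - #|B| = #|[set l in hlines | ~~ (l <= S)%MS]|)%N.
    rewrite -(cardsID [set l | (l <= S)%MS] hlines) (_ : B = hlines :&: [set l | (l <= S)%MS]); last by apply/setP => l; rewrite !inE.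
    by rewrite addKn; apply: eq_card => l; rewrite !inE andbC.
  rewrite -sum_nat_const (eq_bigl (fun l => l \in [set l in hlines | ~~ (l <= S)%MS])) => [|l]; last by rewrite inE.
  apply: leq_sum => l; rewrite inE => /andP[Ll nl].
  have rc : (\rank (l :&: S)%MS <= 1)%N.
    rewrite leqNgt; apply: contra nl => r; apply: submx_trans (capmxSr l S).
    by apply: sub_rank_sup (capmxSl _ _) _; rewrite (hl_rank Ll).
  apply: (@leq_trans (q ^ \rank (l :&: S)%MS - 1)%N).
    rewrite -card_nz; apply: subset_leq_card; apply/subsetP => x.
    by rewrite !inE sub_capmx => /andP[/andP[/andP[-> _] ->] ->].
  by rewrite -subn1 leq_sub2r // -[X in (_ <= X)%N]expn1 leq_pexp2l // ltnW.
have c3 := card_full7 rS; rewrite -/Phi in c3; have c4 := hl_To F.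
have c5 : (#|B| <= #|hlines|)%N by apply: subset_leq_card; apply/subsetP => l; rewrite inE => /andP[].
rewrite /nb_in -/B; move: c1 c2 c3 c4 c5 q1; move: #|W| #|Phi| #|hlines| #|B|; clear => s f h b.
case: #|F| => // j; rewrite /= ltnS => c1 c2 c3 c4 c5 j0.
have k1 : (b * (j * (j.+1 ^ 2 + j.+1 + 1)) <= h * j + j.+1 * j.+2 * f)%N.
  have e : (j.+1 ^ 2 - 1 = j * j.+2)%N by clear; rewrite expnS expn1; nia.
  rewrite e in c1 c2; have [d ed] : exists d, (h = b + d)%N by exists (h - b)%N; rewrite subnKC.
  have : (b * (j * j.+2) * j.+2 <= (s + j.+1 * f) * j.+2)%N by rewrite leq_mul.
  by move: c2; rewrite ed addKn mulnDl expnS expn1; clear; lia.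
(* Here q = j + 1. The common factor (q - 1)(q^2 + q + 1) divides both q^6 - 1, from the number of
   all lines, and 2 q (q + 1)(q^3 - 1), from [card_full7]. *)
have k2 : (b * (j * (j.+1 ^ 2 + j.+1 + 1)) <= (j.+1 ^ 3 + 1 + 2 * (j.+1 * j.+2)) * (j * (j.+1 ^ 2 + j.+1 + 1)))%N.
  apply: leq_trans k1 _; apply: leq_trans (leq_add (leq_mul c4 (leqnn j)) (leq_mul (leqnn (j.+1 * j.+2)) c3)) _.
  by apply: eq_leq; rewrite !expnS expn0; nia.
have {}k2 : (b <= j.+1 ^ 3 + 1 + 2 * (j.+1 * j.+2))%N.
  by move: k2; rewrite leq_pmul2r // muln_gt0 j0 addn1.
(* The bound q^3 + 2 q^2 + 2 q + 1 obtained here is below that of (Hp') by q^2 (q - 1)^2 - 1. *)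
apply: leq_trans k2 _; move: j0; clear; case: j => // j _.
have -> : (j.+2 ^ 4 - j.+2 ^ 3 = j.+2 ^ 3 * j.+1)%N by rewrite [(j.+2 ^ 4)%N]expnS; move: (j.+2 ^ 3)%N => i; nia.
rewrite !expnS expn0; nia.
Qed.

End HexHyper.

(** * The characterisation *)

Section Transfer.
Local Open Scope ring_scope.
Variables (F : finFieldType) (N : nat) (M : 'M[F]_(7, N)).
Hypothesis fM : row_free M.
Local Notation q := #|F|.

Definition himg (h : 'M[F]_7) : 'M[F]_N := <<h *m M>>%MS.

Lemma himg_inj : {in hlines F &, injective himg}.
Proof.
move=> h h' Lh Lh' e; apply: (hl_inj Lh Lh').
rewrite -(submxMfree _ _ fM) -(genmxE (h' *m M)) -/(himg h') -e /himg genmxE; exact: submx_refl.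
Qed.

(** The preimage of S in the seven-dimensional space, through which counts of image lines in S
    become counts in H(q). *)
Definition hpre (S : 'M[F]_N) : 'M[F]_7 := kermx (M *m cokermx S).

Lemma sub_hpre m (A : 'M[F]_(m, 7)) S : (A *m M <= S)%MS = (A <= hpre S)%MS.
Proof. by rewrite submxE -mulmxA; apply/eqP/sub_kermxP. Qed.

Lemma rank_hpre S : (\rank (hpre S) <= \rank S)%N.
Proof. by rewrite -(mxrankMfree _ fM) mxrankS // sub_hpre. Qed.

Variable L : {set 'M[F]_N}.
Hypothesis LE : L = [set himg h | h in hlines F].

Lemma nb_himg S : nb_in L S = nb_in (hlines F) (hpre S).
Proof.
rewrite /nb_in -(@card_in_imset _ _ himg [set h in hlines F | (h <= hpre S)%MS]); last first.
  by move=> h h'; rewrite !inE => /andP[Lh _] /andP[Lh' _]; apply: himg_inj.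
apply: eq_card => l; rewrite inE LE; apply/andP/imsetP => [[/imsetP[h Lh ->] hS]|[h]].
  by exists h => //; rewrite inE Lh -sub_hpre -(genmxE (h *m M)).
by rewrite inE => /andP[Lh hS] ->; rewrite imset_f // genmxE sub_hpre.
Qed.

Lemma pt_himg (p : 'M[F]_N) : \rank p = 1%N -> #|[set l in L | (p <= l)%MS]| \in [:: 0%N; q.+1].
Proof.
move=> rp; have [v [vp nv]] : exists v : 'rV[F]_N, (v <= p)%MS /\ ~~ (v <= (0 : 'rV[F]_N))%MS.
  by apply: ex_outside; rewrite mxrank0 rp.
have v0 := notsub_nz nv.
have pv : (p <= v)%MS by apply: sub_rank_sup vp _; rewrite rp rank_vec.
have ep (l : 'M[F]_N) : (p <= l)%MS = (v <= l)%MS by apply/idP/idP; apply: submx_trans.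
have [/existsP[x /andP[/eqP ev /eqP Qx]]|none] := boolP [exists x : 'rV[F]_7, (v == x *m M) && (Q6 x == 0)].
  have x0 : x != 0 by apply: contraNneq v0 => x0; rewrite ev x0 mul0mx.
  rewrite !inE; apply/orP; right; apply/eqP; rewrite -(hl_pt x0 Qx).
  rewrite -(@card_in_imset _ _ himg [set h in hlines F | (x <= h)%MS]); last first.
    by move=> h h'; rewrite !inE => /andP[Lh _] /andP[Lh' _]; apply: himg_inj.
  apply: eq_card => l; rewrite inE ep LE; apply/andP/imsetP => [[/imsetP[h Lh ->] vh]|[h]].
    exists h => //; rewrite inE Lh; move: vh; rewrite ev /himg genmxE submxMfree //.
  by rewrite inE => /andP[Lh xh] ->; rewrite imset_f // ev /himg genmxE submxMfree.
rewrite !inE cards_eq0; apply/orP; left; apply/eqP/setP => l; rewrite inE in_set0.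
apply/negP => /andP[]; rewrite LE => /imsetP[h Lh ->]; rewrite ep /himg genmxE => /submxP[D eD].
case/negP: none; apply/existsP; exists (D *m h); rewrite -mulmxA -eD eqxx /=.
by rewrite (hl_sing Lh) ?submxMl.
Qed.

End Transfer.

Lemma flatI (F : finFieldType) n (L : {set 'M[F]_n.+1}) :
  (forall l, l \in L -> proj_sub 1 l) ->
  (forall p : 'M[F]_n.+1, proj_sub 0 p -> #|[set l in L | (p <= l)%MS]| \in [:: 0; #|F|.+1]) ->
  (forall P : 'M[F]_n.+1, proj_sub 2 P -> nb_in L P \in [:: 0; 1; #|F|.+1]) ->
  (forall S : 'M[F]_n.+1, proj_sub 3 S -> nb_in L S \in [:: 0; 1; #|F|.+1; (2 * #|F|).+1]) ->
  flat L.
Proof.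
move=> lines Pt Pl Sd.
have nbg S : nb_in L <<S>>%MS = nb_in L S by apply: eq_card => l; rewrite !inE genmxE.
have pg k S : \rank S = k.+1 -> proj_sub k (<<S>>%MS : 'M[F]_n.+1).
  by move=> rS; rewrite /proj_sub mxrank_gen rS genmx_id !eqxx.
split.
- by move=> l /lines/andP[/eqP].
- by move=> l /lines/andP[_ /eqP].
- move=> x /andP[x0 nx]; have := Pt <<x>>%MS; rewrite /proj_sub mxrank_gen rank_vec // genmx_id !eqxx => /(_ isT).
  have -> : [set l in L | (<<x>> <= l)%MS] = lthru L x by apply/setP => l; rewrite !inE genmxE.
  by rewrite !inE cards_eq0 (negbTE nx) => /eqP.
- by move=> S rS; rewrite -nbg; apply: Pl; apply: pg.
- by move=> S rS; rewrite -nbg; apply: Sd; apply: pg.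
Qed.

Theorem theorem2 (F : finFieldType) (n : nat) (L : {set 'M[F]_n.+1}) :
  (2 <= n)%N ->
  (forall l, l \in L -> proj_sub 1 l) ->
  L != set0 ->
  is_hexagon_lineset L <->
  [/\ (* (Pt) *)
      (forall p : 'M[F]_n.+1, proj_sub 0 p ->
         #|[set l in L | (p <= l)%MS]| \in [:: 0%N; #|F|.+1]),
      (* (Pl) *)
      (forall P : 'M[F]_n.+1, proj_sub 2 P -> nb_in L P \in [:: 0%N; 1%N; #|F|.+1]),
      (* (Sd) *)
      (forall S : 'M[F]_n.+1, proj_sub 3 S ->
         nb_in L S \in [:: 0%N; 1%N; #|F|.+1; (2 * #|F|).+1]),
      (* (Hp') *)
      (forall H : 'M[F]_n.+1, proj_sub 5 H ->
         (nb_in L H <= #|F| ^ 4 - #|F| ^ 3 + 3 * #|F| ^ 2 + 2 * #|F|)%N)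
    & (* (To) *)
      (#|L| <= #|F| ^ 5 + #|F| ^ 4 + #|F| ^ 3 + #|F| ^ 2 + #|F| + 1)%N].
Proof.
move=> _ lines L0; split.
  case=> _ [M [fM LE]].
  have {}LE : L = [set himg M h | h in hlines F].
    apply/setP => l; apply/idP/imsetP => [/LE[h [Lh ->]]|[h Lh ->]].
      by exists h => //; apply/hlines_hex.
    by apply/LE; exists h; split=> //; apply/hlines_hex.
  split.
  - by move=> p /andP[/eqP rp _]; apply: (pt_himg fM LE).
  - by move=> P /andP[/eqP rP _]; rewrite (nb_himg fM LE); apply: hl_pl; have := rank_hpre fM P; rewrite rP.
  - by move=> S /andP[/eqP rS _]; rewrite (nb_himg fM LE); apply: hl_sd; have := rank_hpre fM S; rewrite rS.
  - by move=> H /andP[/eqP rH _]; rewrite (nb_himg fM LE); apply: hl_Hp; have := rank_hpre fM H; rewrite rH.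
  - by rewrite LE card_in_imset ?hl_To //; apply: himg_inj.
case=> Pt Pl Sd Hp To; have G := flatI lines Pt Pl Sd.
have {}Hp (H : 'M[F]_n.+1) : \rank H = 6 ->
    (nb_in L H <= #|F| ^ 4 - #|F| ^ 3 + 3 * #|F| ^ 2 + 2 * #|F|)%N.
  move=> rH; have -> : nb_in L H = nb_in L <<H>>%MS by apply: eq_card => l; rewrite !inE genmxE.
  by apply: Hp; rewrite /proj_sub mxrank_gen rH genmx_id !eqxx.
case/set0Pn: L0 => l Ll.
have [x [xl nx]] : exists x : 'rV[F]_n.+1, (x <= l)%MS /\ ~~ (x <= (0%R : 'rV[F]_n.+1))%MS.
  by apply: ex_outside; rewrite mxrank0 (fl_rank G Ll).
have Px : hpoint L x by apply: (l_PP Ll (notsub_nz nx) xl).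
have [A [B [e fr]]] := frame_exists G Hp To Px.
have [M [fM emb]] := embed_hex G Hp To fr.
split; first exact: (rank_frame fr).
exists M; split=> // m.
suff -> : L = [set himg M h | h in hlines F].
  split=> [/imsetP[h Lh ->]|[h [/hlines_hex Lh ->]]]; last by apply/imsetP; exists h.
  by exists h; split=> //; apply/hlines_hex.
apply/eqP; rewrite eqEcard; apply/andP; split.
  by apply/subsetP => p /emb[h [/hlines_hex Lh ->]]; apply/imsetP; exists h.
rewrite card_in_imset; last exact: himg_inj.
exact: leq_trans (hl_To F) (card_L_ge G Hp To Ll).
Qed.
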